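(* Let $X^1,X^2,X^3$ be operator-valued increments with $$\tilde\delta X^1=0,\qquad\tilde\delta X^2=X^1X^1,\qquad\tilde\delta X^3=X^1X^2+X^2X^1,$$ $$X^i\in\hat{\mathcal C}_2^{\gamma+(i-1)\kappa_0}\mathcal L^{\eta,-\rho}\cap\hat{\mathcal C}_2^{i\kappa_0}\mathcal L^{\eta,\eta},\qquad i=1,2,3,$$ where $\eta,\rho\ge0$, $\gamma=\kappa_0+\eta+\rho$, $\gamma+3\kappa_0>1$, and let $\kappa<\kappa_0$ be such that the space $\mathcal Q_{\kappa,\eta,\psi}$ of weakly controlled paths is defined ($0<\kappa<\kappa_0\wedge\eta$, $\gamma+3\kappa>1$). Let $\psi\in\mathcal B_\eta$. Then: (1) The equation $y_0=\psi$, $\hat\delta y=\mathcal J(\hat dx\,y)$ admits a unique solution $y\in\mathcal Q_{\kappa,\eta,\psi}$. (2) The map $(\psi,X^1,X^2,X^3)\mapsto y$ is continuous. (3) For $(t,s)\in\mathcal S_2$, the map $\Phi_{ts}:\mathcal B_\eta\to\mathcal B_\eta$ given by $\Phi_{ts}\psi=y_t$, where $y$ is the solution on $[s,T]$ of $y_s=\psi$, $\hat\delta y=\mathcal J(\hat dx\,y)$, is a bounded linear endomorphism of $\mathcal B_\eta$, and it satisfies the cocycle property $\Phi_{tu}\Phi_{us}=\Phi_{ts}$ for $s\le u\le t$.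
   Context: Fix $T>0$. $(\mathcal B,|\cdot|)$ is a separable Banach space and $A$ generates an analytic semigroup $(S_t)_{t\ge0}$ on $\mathcal B$ with $|S_t|\le Me^{-\lambda t}$ for some $M,\lambda>0$; $A_o=-A$; $\mathcal B_\alpha=\mathrm{Dom}(A_o^\alpha)$ for $\alpha\ge0$ and the completion of $\mathcal B$ for $\alpha<0$, with norm $|x|_{\mathcal B_\alpha}=|A_o^\alpha x|$. $S_{ts}=S_{t-s}$. $\mathcal S_n=\{T\ge t_1\ge\dots\ge t_n\ge0\}$; $\hat{\mathcal C}_n(V)$ is the space of continuous functions $\mathcal S_n\to V$. $(\hat\delta f)_{ts}=f_t-S_{ts}f_s$; $(\hat\delta h)_{tus}=h_{ts}-h_{tu}-S_{tu}h_{us}$; for operator-valued $R\in\hat{\mathcal C}_2$, $(\tilde\delta R)_{tus}=R_{ts}-R_{tu}S_{us}-S_{tu}R_{us}$. Products: $(gh)_{t_1\cdots t_{n+m-1}}=g_{t_1\cdots t_n}h_{t_n\cdots t_{n+m-1}}$ for $g\in\hat{\mathcal C}_n$, $h\in\hat{\mathcal C}_m$. $\hat{\mathcal C}_2^{\mu,\alpha}$: $g\in\hat{\mathcal C}_2(\mathcal B_\alpha)$ with $\sup|g_{ts}|_{\mathcal B_\alpha}/|t-s|^\mu<\infty$. $\hat{\mathcal C}_1^{\kappa,\alpha}$: $f\in\hat{\mathcal C}_1(\mathcal B_\alpha)$ with $\hat\delta f\in\hat{\mathcal C}_2^{\kappa,\alpha}$. $\hat{\mathcal C}_2^\mu\mathcal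 L^{\beta,\alpha}$: $R\in\hat{\mathcal C}_2(\mathcal L(\mathcal B_\beta,\mathcal B_\alpha))$ with $\sup\|R_{ts}\|_{\mathrm{op}}/|t-s|^\mu<\infty$. $\hat{\mathcal C}_3^{\mu,\alpha}$: $h\in\hat{\mathcal C}_3(\mathcal B_\alpha)$ that are sums $\sum_ih_i$ with $\sum_i\sup_{\mathcal S_3}\frac{|h_{i,tus}|_{\mathcal B_\alpha}}{|t-u|^{\rho_i}|u-s|^{\mu-\rho_i}}<\infty$, $0<\rho_i<\mu$. For $\mu>1$ and $h\in\hat{\mathcal C}_3^{\mu,\alpha}$ with $\hat\delta h=0$ (i.e. $h=\hat\delta B$ for some $B\in\hat{\mathcal C}_2(\mathcal B_\alpha)$), $\hat\Lambda h$ is the unique $M\in\hat{\mathcal C}_2^{\mu,\alpha}$ with $\hat\delta M=h$. Weakly controlled paths: for $0<\kappa<\kappa_0\wedge\eta$ with $\gamma+3\kappa>1$ and $\psi\in\mathcal B_\eta$, $\mathcal Q_{\kappa,\eta,\psi}$ is the set of $y\in\hat{\mathcal C}_1^{\kappa,\eta}$ (together with $(y^1,y^2,y^r,y^{1,r})$) with $y_0=\psi$, $\hat\delta y=X^1y^1+X^2y^2+y^r$, $\hat\delta y^1=X^1y^2+y^{1,r}$, where $y^1,y^2\in\hat{\mathcal C}_1^{\kappa,\eta}$, $y^r\in\hat{\mathcal C}_2^{3\kappa,\eta}$, $y^{1,r}\in\hat{\mathcal C}_2^{2\kappa,\eta}$. Integral: for $y\in\mathcal Q_{\kappa,\eta,\psi}$,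 $\mathcal J(\hat dx\,y)=X^1y+X^2y^1+X^3y^2+\hat\Lambda(X^1y^r+X^2y^{1,r}+X^3\hat\delta y^2)$. A solution of the equation is a fixed point of the map $\Gamma$ sending $y\in\mathcal Q_{\kappa,\eta,\psi}$ to the controlled path $z$ with $z_0=\psi$, $\hat\delta z=\mathcal J(\hat dx\,y)$, $z^1=y$, $z^2=y^1$, $z^{1,r}=X^2y^2+y^r$, and $z^r=X^3y^2+\hat\Lambda(X^1y^r+X^2y^{1,r}+X^3\hat\delta y^2)$. (This is a rough-path formulation of $y_t=S_t\psi+\int_0^tS_{tu}\,dx_u\,y_u$, with $X^i_{ts}$ representing $\int_s^tS_{tu}\,dx_u\,X^{i-1}_{us}$, $X^0=S$.) In (2), $X^i$ carries the norm of the space it is assumed to belong to and $y$ is considered in $\hat{\mathcal C}_1^{\kappa,\eta}$. *)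

(* Defs.v *)
From Stdlib Require Import Reals.
From Coquelicot Require Import Coquelicot.
Set Implicit Arguments.
Unset Strict Implicit.
Open Scope R_scope.

(* Stdlib has Rpower 0 mu = 1; here 0 ^ mu = 0, the value needed for mu > 0, so
   that [norm (g t s) <= C * rpow (t - s) mu] forces g t t = 0. *)
Definition rpow (x mu : R) : R := if Rlt_dec 0 x then Rpower x mu else 0.

Definition op_le (U V : NormedModule R_AbsRing) (L : U -> V) (C : R) : Prop :=
  forall x : U, norm (L x) <= C * norm x.

Definition separable (B : NormedModule R_AbsRing) : Prop :=
  exists u : nat -> B,
    forall (x : B) (eps : posreal), exists n, norm (minus x (u n)) < eps.

(** * Semigroups *)

Definition C0_semigroup (B : NormedModule R_AbsRing) (S : R -> B -> B) : Prop :=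
  (forall t, 0 <= t -> is_linear (S t)) /\
  (forall x, S 0 x = x) /\
  (forall t s x, 0 <= t -> 0 <= s -> S (t + s) x = S t (S s x)) /\
  (forall x, filterlim (fun t => S t x) (at_right 0) (locally x)).

(* The infinitesimal generator is unbounded: it is given by its graph. *)
Definition generates (B : NormedModule R_AbsRing) (A : B -> B -> Prop)
    (S : R -> B -> B) : Prop :=
  forall x z, A x z <->
    filterlim (fun h => scal (/ h) (minus (S h x) x)) (at_right 0) (locally z).

Definition sector (c : R) (z : C) : Prop := 0 < Re z /\ Rabs (Im z) < c * Re z.

(* B is a real Banach space: the holomorphic extension of S to a sector lives on
   the complexification of B, on which a complex-linear bounded operator is
   P + iQ with P, Q real-linear bounded operators on B.
   The last clause is complex differentiability in operator norm, the derivative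
   being D + iE:  (w - z) (D + iE)
     = (Re (w-z) D - Im (w-z) E) + i (Im (w-z) D + Re (w-z) E). *)
Definition analytic_semigroup (B : NormedModule R_AbsRing) (S : R -> B -> B)
    : Prop :=
  C0_semigroup S /\
  exists (c : R) (P Q : C -> B -> B),
    0 < c /\
    (forall z, sector c z -> is_linear (P z) /\ is_linear (Q z)) /\
    (forall t x, 0 < t -> P (RtoC t) x = S t x /\ Q (RtoC t) x = zero) /\
    (forall z w x, sector c z -> sector c w ->
       P (Cplus z w) x = minus (P z (P w x)) (Q z (Q w x)) /\
       Q (Cplus z w) x = plus (P z (Q w x)) (Q z (P w x))) /\
    (forall x,
       filterlim (fun z => P z x) (within (sector c) (locally (RtoC 0)))
         (locally x) /\
       filterlim (fun z => Q z x) (within (sector c) (locally (RtoC 0)))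
         (locally (@zero B))) /\
    (forall z, sector c z ->
       exists D E : B -> B, is_linear D /\ is_linear E /\
       forall eps : posreal, exists del : posreal, forall w : C,
         sector c w -> Cmod (Cminus w z) < del ->
         let a := Re (Cminus w z) in
         let b := Im (Cminus w z) in
         op_le (fun x => minus (minus (P w x) (P z x))
                               (minus (scal a (D x)) (scal b (E x))))
               (eps * Cmod (Cminus w z)) /\
         op_le (fun x => minus (minus (Q w x) (Q z x))
                               (plus (scal b (D x)) (scal a (E x))))
               (eps * Cmod (Cminus w z))).

(** * Fractional powers and the spaces B_alpha *)

Definition Euler_Gamma (a : R) : R :=
  RInt_gen (V := R_CompleteNormedModule)
    (fun t => Rpower t (a - 1) * exp (- t)) (at_right 0) (Rbar_locally p_infty).

(* [is_Aneg S a x z] : A_o^{-a} x = z for a > 0, where A_o = - A and A is the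
   generator of S:  A_o^{-a} = Euler_Gamma(a)^{-1} int_0^oo t^{a-1} S_t dt. *)
Definition is_Aneg (B : NormedModule R_AbsRing) (S : R -> B -> B) (a : R)
    (x z : B) : Prop :=
  is_RInt_gen (fun t => scal (Rpower t (a - 1) / Euler_Gamma a) (S t x))
    (at_right 0) (Rbar_locally p_infty) z.

(* [is_Apow S alpha x z] : x is in Dom(A_o^alpha) and A_o^alpha x = z. *)
Definition is_Apow (B : NormedModule R_AbsRing) (S : R -> B -> B) (alpha : R)
    (x z : B) : Prop :=
  (alpha < 0 /\ is_Aneg S (- alpha) x z) \/
  (alpha = 0 /\ z = x) \/
  (0 < alpha /\ is_Aneg S alpha z x).

(* B_alpha for alpha >= 0: the subspace Dom(A_o^alpha) of B, seen through its
   inclusion [dom_in], with norm |A_o^alpha x| and the restriction of S. *)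
Record dom_space (B : NormedModule R_AbsRing) (S : R -> B -> B) (alpha : R) := {
  dom_car :> CompleteNormedModule R_AbsRing;
  dom_in : dom_car -> B;
  dom_in_plus : forall v w, dom_in (plus v w) = plus (dom_in v) (dom_in w);
  dom_in_scal : forall (k : R) v, dom_in (scal k v) = scal k (dom_in v);
  dom_in_inj : forall v w, dom_in v = dom_in w -> v = w;
  dom_in_range : forall x,
    (exists v, dom_in v = x) <-> (exists z, is_Apow S alpha x z);
  dom_in_norm : forall v,
    exists z, is_Apow S alpha (dom_in v) z /\ norm v = norm z;
  dom_S : R -> dom_car -> dom_car;
  dom_SE : forall t v, 0 <= t -> dom_in (dom_S t v) = S t (dom_in v) }.
Arguments dom_S {B S alpha} d _ _.

(* B_alpha for alpha <= 0: a completion of B for the norm |A_o^alpha x| (unique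
   up to isometry), with the extension of S by density. *)
Record cpl_space (B : NormedModule R_AbsRing) (S : R -> B -> B) (alpha : R) := {
  cpl_car :> CompleteNormedModule R_AbsRing;
  cpl_in : B -> cpl_car;
  cpl_in_plus : forall x y, cpl_in (plus x y) = plus (cpl_in x) (cpl_in y);
  cpl_in_scal : forall (k : R) x, cpl_in (scal k x) = scal k (cpl_in x);
  cpl_in_norm : forall x,
    exists z, is_Apow S alpha x z /\ norm (cpl_in x) = norm z;
  cpl_in_dense : forall (v : cpl_car) (eps : posreal),
    exists x, norm (minus v (cpl_in x)) < eps;
  cpl_S : R -> cpl_car -> cpl_car;
  cpl_S_linear : forall t, 0 <= t -> is_linear (cpl_S t);
  cpl_SE : forall t x, 0 <= t -> cpl_S t (cpl_in x) = cpl_in (S t x) }.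
Arguments cpl_S {B S alpha} c _ _.

(** * Increments over an interval [a, b] *)

Definition S1 (a b : R) (t : R) : Prop := a <= t <= b.
Definition S2 (a b : R) (p : R * R) : Prop := a <= snd p <= fst p /\ fst p <= b.
Definition S3 (a b : R) (p : R * R * R) : Prop :=
  a <= snd p <= snd (fst p) /\ snd (fst p) <= fst (fst p) <= b.

Definition hdelta1 (V : NormedModule R_AbsRing) (SV : R -> V -> V)
    (f : R -> V) (t s : R) : V :=
  minus (f t) (SV (t - s) (f s)).

Definition hdelta2 (V : NormedModule R_AbsRing) (SV : R -> V -> V)
    (h : R -> R -> V) (t u s : R) : V :=
  minus (minus (h t s) (h t u)) (SV (t - u) (h u s)).

Definition tdelta (V : NormedModule R_AbsRing) (SV : R -> V -> V)
    (X : R -> R -> V -> V) (t u s : R) (x : V) : V :=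
  minus (minus (X t s x) (X t u (SV (u - s) x))) (SV (t - u) (X u s x)).

Definition C2 (V : NormedModule R_AbsRing) (a b mu : R) (g : R -> R -> V)
    : Prop :=
  continuous_on (S2 a b) (fun p => g (fst p) (snd p)) /\
  exists K, forall t s, S2 a b (t, s) -> norm (g t s) <= K * rpow (t - s) mu.

Definition C1 (V : NormedModule R_AbsRing) (SV : R -> V -> V) (a b kap : R)
    (f : R -> V) : Prop :=
  continuous_on (S1 a b) f /\ C2 a b kap (hdelta1 SV f).

(* Continuity is for the operator norm. *)
Definition C2L (U V : NormedModule R_AbsRing) (a b mu : R)
    (X : R -> R -> U -> V) : Prop :=
  (forall t s, S2 a b (t, s) -> is_linear (X t s)) /\
  (forall p, S2 a b p -> forall eps : posreal,
     within (S2 a b) (locally p) (fun q =>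
       op_le (fun x => minus (X (fst q) (snd q) x) (X (fst p) (snd p) x)) eps)) /\
  exists K, forall t s, S2 a b (t, s) -> op_le (X t s) (K * rpow (t - s) mu).

Definition C3 (V : NormedModule R_AbsRing) (a b mu : R) (h : R -> R -> R -> V)
    : Prop :=
  let cont (g : R -> R -> R -> V) :=
    continuous_on (S3 a b) (fun p => g (fst (fst p)) (snd (fst p)) (snd p)) in
  cont h /\
  exists (hi : nat -> R -> R -> R -> V) (rho K : nat -> R),
    (forall i, cont (hi i) /\ 0 < rho i < mu /\ 0 <= K i) /\
    (forall i t u s, S3 a b (t, u, s) ->
       norm (hi i t u s)
         <= K i * (rpow (t - u) (rho i) * rpow (u - s) (mu - rho i))) /\
    (forall t u s, S3 a b (t, u, s) ->
       is_series (fun i => hi i t u s) (h t u s)) /\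
    ex_series K.

(* [is_Lambda SV a b h M] : h is in the domain of the sewing map and M is its
   image (the existence of M makes h a hdelta-coboundary). *)
Definition is_Lambda (V : NormedModule R_AbsRing) (SV : R -> V -> V) (a b : R)
    (h : R -> R -> R -> V) (M : R -> R -> V) : Prop :=
  exists mu, 1 < mu /\ C3 a b mu h /\ C2 a b mu M /\
    forall t u s, S3 a b (t, u, s) -> hdelta2 SV M t u s = h t u s.

(** * The rough evolution equation *)

Record rough (V : Type) := Rough {
  X1 : R -> R -> V -> V;
  X2 : R -> R -> V -> V;
  X3 : R -> R -> V -> V }.

(* A path y together with (y^1, y^2, y^r, y^{1,r}). *)
Record cpath (V : Type) := CPath {
  cy : R -> V;
  cy1 : R -> V;
  cy2 : R -> V;
  cyr : R -> R -> V;
  cy1r : R -> R -> V }.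

Definition agree (V : Type) (a b : R) (p q : cpath V) : Prop :=
  (forall t, S1 a b t ->
     cy p t = cy q t /\ cy1 p t = cy1 q t /\ cy2 p t = cy2 q t) /\
  (forall t s, S2 a b (t, s) ->
     cyr p t s = cyr q t s /\ cy1r p t s = cy1r q t s).

(* Weakly controlled paths on [a, b] started from psi at time a. *)
Definition in_Q (V : NormedModule R_AbsRing) (SV : R -> V -> V)
    (X : rough V) (a b kap : R) (psi : V) (p : cpath V) : Prop :=
  cy p a = psi /\
  C1 SV a b kap (cy p) /\ C1 SV a b kap (cy1 p) /\ C1 SV a b kap (cy2 p) /\
  C2 a b (3 * kap) (cyr p) /\ C2 a b (2 * kap) (cy1r p) /\
  (forall t s, S2 a b (t, s) ->
     hdelta1 SV (cy p) t s
       = plus (plus (X1 X t s (cy1 p s)) (X2 X t s (cy2 p s))) (cyr p t s)) /\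
  (forall t s, S2 a b (t, s) ->
     hdelta1 SV (cy1 p) t s = plus (X1 X t s (cy2 p s)) (cy1r p t s)).

(* [E] is B_eta and [F] is B_{-rho}. *)
Definition emb (B : NormedModule R_AbsRing) (S : R -> B -> B) (alpha beta : R)
    (E : dom_space S alpha) (F : cpl_space S beta) (v : E) : F :=
  cpl_in F (dom_in v).

Definition admissible (B : NormedModule R_AbsRing) (S : R -> B -> B)
    (alpha beta : R) (E : dom_space S alpha) (F : cpl_space S beta)
    (T gam kap0 : R) (X : rough E) : Prop :=
  let C2L_both (i : R) (Y : R -> R -> E -> E) :=
    C2L 0 T (gam + (i - 1) * kap0) (fun t s v => emb F (Y t s v)) /\
    C2L 0 T (i * kap0) Y in
  C2L_both 1 (X1 X) /\ C2L_both 2 (X2 X) /\ C2L_both 3 (X3 X) /\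
  forall t u s x, S3 0 T (t, u, s) ->
    tdelta (dom_S E) (X1 X) t u s x = zero /\
    tdelta (dom_S E) (X2 X) t u s x = X1 X t u (X1 X u s x) /\
    tdelta (dom_S E) (X3 X) t u s x
      = plus (X1 X t u (X2 X u s x)) (X2 X t u (X1 X u s x)).

(* X^1 y^r + X^2 y^{1,r} + X^3 (hdelta y^2), in B_{-rho} *)
Definition sew_arg (B : NormedModule R_AbsRing) (S : R -> B -> B)
    (alpha beta : R) (E : dom_space S alpha) (F : cpl_space S beta)
    (X : rough E) (p : cpath E) (t u s : R) : F :=
  emb F (plus (plus (X1 X t u (cyr p u s)) (X2 X t u (cy1r p u s)))
              (X3 X t u (hdelta1 (dom_S E) (cy2 p) u s))).

(* J(dx y), where M stands for Lambda(sew_arg) *)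
Definition rough_int (B : NormedModule R_AbsRing) (S : R -> B -> B)
    (alpha beta : R) (E : dom_space S alpha) (F : cpl_space S beta)
    (X : rough E) (p : cpath E) (M : R -> R -> F) (t s : R) : F :=
  plus (emb F (plus (plus (X1 X t s (cy p s)) (X2 X t s (cy1 p s)))
                    (X3 X t s (cy2 p s))))
       (M t s).

(* q = Gamma(p) *)
Definition is_Gamma (B : NormedModule R_AbsRing) (S : R -> B -> B)
    (alpha beta : R) (E : dom_space S alpha) (F : cpl_space S beta)
    (X : rough E) (a b : R) (psi : E) (p q : cpath E) : Prop :=
  exists M : R -> R -> F,
    is_Lambda (cpl_S F) a b (sew_arg F X p) M /\
    cy q a = psi /\
    (forall t s, S2 a b (t, s) ->
       emb F (hdelta1 (dom_S E) (cy q) t s) = rough_int X p M t s) /\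
    (forall t, S1 a b t -> cy1 q t = cy p t /\ cy2 q t = cy1 p t) /\
    (forall t s, S2 a b (t, s) ->
       cy1r q t s = plus (X2 X t s (cy2 p s)) (cyr p t s) /\
       emb F (cyr q t s) = plus (emb F (X3 X t s (cy2 p s))) (M t s)).

Definition is_solution (B : NormedModule R_AbsRing) (S : R -> B -> B)
    (alpha beta : R) (E : dom_space S alpha) (F : cpl_space S beta)
    (X : rough E) (kap a b : R) (psi : E) (p : cpath E) : Prop :=
  in_Q (dom_S E) X a b kap psi p /\ is_Gamma F X a b psi p p.

Definition is_unique_solution (B : NormedModule R_AbsRing) (S : R -> B -> B)
    (alpha beta : R) (E : dom_space S alpha) (F : cpl_space S beta)
    (X : rough E) (kap a b : R) (psi : E) (p : cpath E) : Prop :=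
  is_solution F X kap a b psi p /\
  forall q, is_solution F X kap a b psi q -> agree a b p q.

(* Distance at most del, for each of the norms of the spaces in [admissible]. *)
Definition rough_dist_le (B : NormedModule R_AbsRing) (S : R -> B -> B)
    (alpha beta : R) (E : dom_space S alpha) (F : cpl_space S beta)
    (T gam kap0 : R) (X X' : rough E) (del : R) : Prop :=
  let close (i : R) (Y Y' : R -> R -> E -> E) :=
    forall t s, S2 0 T (t, s) ->
      op_le (fun v => minus (emb F (Y' t s v)) (emb F (Y t s v)))
            (del * rpow (t - s) (gam + (i - 1) * kap0)) /\
      op_le (fun v => minus (Y' t s v) (Y t s v))
            (del * rpow (t - s) (i * kap0)) in
  close 1 (X1 X) (X1 X') /\ close 2 (X2 X) (X2 X') /\ close 3 (X3 X) (X3 X').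

(* sup_t |y_t - y'_t| and the kap-Hoelder seminorm of hdelta (y' - y). *)
Definition C1_dist_le (V : NormedModule R_AbsRing) (SV : R -> V -> V)
    (a b kap : R) (y y' : R -> V) (eps : R) : Prop :=
  (forall t, S1 a b t -> norm (minus (y' t) (y t)) <= eps) /\
  (forall t s, S2 a b (t, s) ->
     norm (minus (hdelta1 SV y' t s) (hdelta1 SV y t s))
       <= eps * rpow (t - s) kap).

(* Main.v *)
(* Put e = eta + rho.  The semigroup satisfies |S_t v|_{B_eta} <= C t^{-e}
   |v|_{B_{-rho}}, so an increment whose hdelta is of order e + k > 1 in B_{-rho}
   and of order k in B_eta can be sewn in B_{-rho}, and the result has order k in
   B_eta: one half of each bisected interval is smoothed by S.  A path y is a
   solution exactly when its remainder R_ts = y_t - (S + X^1 + X^2 + X^3)_ts y_s has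
   these orders with k = kap0 + 3 kap.  By Chen's relations hdelta R is a linear
   expression in y and R of higher order, whence a linear a priori bound on short
   intervals, and on [0, T] by chaining them.  Applied to an Euler scheme it gives
   existence; applied to a difference of two solutions it gives uniqueness, the
   continuity of the solution in the data, and the linearity, boundedness and
   cocycle property of the flow.

   The smoothing estimate comes from |d/dt S_t| <= C / t, which is Cauchy's estimate
   for the holomorphic extension, bounded near 0 by Banach-Steinhaus.  With
   I_b z = int_0^oo t^{b-1} S_t z dt and D_r = d/dr S_r, integration by parts gives
   D_r I_{b+1} = - b S_r I_b, and Fubini gives I_p I_q = Beta(p, q) I_{p+q};
   hence S_{nr} z is up to a constant I_p D_r^{n-1} S_r I_b z with n = p + b + 1,
   which is bounded by C r^{-b} |I_b z|. *)

(* The a priori bound carries a cutoff d: below it the remainder is only known to be of size eps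
   d^(e+k) in B_{-rho} and eps d^k in B_eta, above it hdelta R is compared with its Chen expression.
   One statement thus serves an Euler scheme of mesh d and, as d tends to 0, a genuine path. The
   passage d -> 0 needs a remainder of slightly better order than the one propagated, hence two
   exponents k1 < k2 = kap0 + 3 kap, both with e + k > 1. There is room for k1 because gam + 3 kap >
   1 is strict; kap < kap0 places k2 below 4 kap0, the order of the products X^i X^j that Chen's
   relations do not absorb.

   The sewing map comes with some exponent mu > 1 that is not prescribed. A fixed point of Gamma
   therefore only shows a remainder of order mu in B_{-rho} and 3 kap in B_eta. Sewing it once more,
   with a cutoff that tends to 0, raises these orders to e + k2 and k2; only then does the a priori
   bound apply to it.

   No supremum is ever formed: a finite bound Z is improved to c + Z / 2 and the improvement is
   iterated. *)
Require Import Defs.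
From Stdlib Require Import Reals Lra Lia List ZArith Classical IndefiniteDescription.
From Coquelicot Require Import Coquelicot.
Open Scope R_scope.

(** * Linear identities in a normed module *)

(* The module operations occur through several convertible but syntactically
   different coercion paths, on which rewriting fails: both sides of an identity are
   reified and compared coefficient by coefficient. *)
Inductive mexp :=
| MVar (n : nat) | MZero | MPlus (a b : mexp) | MMinus (a b : mexp)
| MOpp (a : mexp) | MScal (k : R) (a : mexp).

Fixpoint mcoef (e : mexp) (i : nat) : R :=
  match e with
  | MVar n => if Nat.eqb n i then 1 else 0
  | MZero => 0
  | MPlus a b => mcoef a i + mcoef b i
  | MMinus a b => mcoef a i - mcoef b i
  | MOpp a => - mcoef a i
  | MScal k a => k * mcoef a i
  end.

Fixpoint meval {V : NormedModule R_AbsRing} (l : list V) (e : mexp) : V :=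
  match e with
  | MVar n => List.nth n l zero
  | MZero => zero
  | MPlus a b => plus (meval l a) (meval l b)
  | MMinus a b => minus (meval l a) (meval l b)
  | MOpp a => opp (meval l a)
  | MScal k a => scal k (meval l a)
  end.

Fixpoint mlin {V : NormedModule R_AbsRing} (c : nat -> R) (l : list V) : V :=
  match l with
  | nil => zero
  | x :: l' => plus (scal (c O) x) (mlin (fun i => c (S i)) l')
  end.

(** Recursion on the list of atoms lets [cbn] unfold this into finitely many equations between real
    numbers, one for each atom. *)
Fixpoint mcoef_eq {V : NormedModule R_AbsRing} (c d : nat -> R) (l : list V) : Prop :=
  match l with
  | nil => True
  | _ :: l' => c O = d O /\ mcoef_eq (fun i => c (S i)) (fun i => d (S i)) l'
  end.

Lemma mlin_ext {V : NormedModule R_AbsRing} (l : list V) :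
  forall c d, mcoef_eq c d l -> mlin c l = mlin d l.
Proof.
  induction l as [|x l IH]; simpl; [easy|].
  intros c d [H0 H]. now rewrite H0, (IH _ _ H).
Qed.

Lemma mlin_zero {V : NormedModule R_AbsRing} (l : list V) :
  mlin (fun _ => 0) l = zero.
Proof.
  induction l as [|x l IH]; simpl; [easy|].
  rewrite IH, plus_zero_r. apply (@scal_zero_l R_AbsRing V).
Qed.

Lemma mlin_plus {V : NormedModule R_AbsRing} (l : list V) :
  forall c d, mlin (fun i => c i + d i) l = plus (mlin c l) (mlin d l).
Proof.
  induction l as [|x l IH]; simpl; intros c d.
  - now rewrite plus_zero_l.
  - rewrite IH.
    replace (scal (c O + d O) x) with (plus (scal (c O) x) (scal (d O) x)).
    2: symmetry; apply (@scal_distr_r R_AbsRing V).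
    rewrite <- !plus_assoc. f_equal. rewrite !plus_assoc. f_equal.
    apply plus_comm.
Qed.

Lemma mlin_scal {V : NormedModule R_AbsRing} (l : list V) :
  forall k c, mlin (fun i => k * c i) l = scal k (mlin c l).
Proof.
  induction l as [|x l IH]; simpl; intros k c.
  - symmetry. apply (@scal_zero_r R_AbsRing V).
  - rewrite IH.
    replace (scal (k * c O) x) with (scal k (scal (c O) x)).
    2: apply (@scal_assoc R_AbsRing V).
    symmetry. apply (@scal_distr_l R_AbsRing V).
Qed.

Lemma mlin_var {V : NormedModule R_AbsRing} (l : list V) :
  forall n, mlin (fun i => if Nat.eqb n i then 1 else 0) l = List.nth n l zero.
Proof.
  induction l as [|x l IH]; simpl; intros n.
  - now destruct n.
  - destruct n as [|n]; simpl.
    + rewrite mlin_zero, plus_zero_r. apply (@scal_one R_AbsRing V).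
    + rewrite IH.
      replace (scal 0 x) with (@zero V).
      * apply plus_zero_l.
      * symmetry. apply (@scal_zero_l R_AbsRing V).
Qed.

Lemma meval_mlin {V : NormedModule R_AbsRing} (l : list V) (e : mexp) :
  meval l e = mlin (mcoef e) l.
Proof.
  induction e as [n| |a IHa b IHb|a IHa b IHb|a IHa|k a IHa]; simpl.
  - now rewrite mlin_var.
  - now rewrite mlin_zero.
  - now rewrite mlin_plus, IHa, IHb.
  - rewrite IHa, IHb.
    transitivity (plus (mlin (mcoef a) l) (mlin (fun i => (-1) * mcoef b i) l)).
    + rewrite mlin_scal. unfold minus. f_equal.
      symmetry. apply (@scal_opp_one R_AbsRing V).
    + rewrite <- mlin_plus. apply mlin_ext. generalize (mcoef a) (mcoef b). clear.
      induction l as [|x l IH]; simpl; intros c d; [easy|split; [ring|]].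
      apply (IH (fun i => c (S i)) (fun i => d (S i))).
  - rewrite IHa. transitivity (mlin (fun i => (-1) * mcoef a i) l).
    + rewrite mlin_scal. symmetry. apply (@scal_opp_one R_AbsRing V).
    + apply mlin_ext. generalize (mcoef a). clear.
      induction l as [|x l IH]; simpl; intros c; [easy|split; [ring|]].
      apply (IH (fun i => c (S i))).
  - now rewrite IHa, mlin_scal.
Qed.

Lemma meval_eq {V : NormedModule R_AbsRing} (l : list V) (e1 e2 : mexp) :
  mcoef_eq (mcoef e1) (mcoef e2) l -> meval l e1 = meval l e2.
Proof. intros H. rewrite !meval_mlin. now apply mlin_ext. Qed.

(** The [match goal] wrapper runs [constr_eq] while a term is being built; its failure makes the
    outer [match] try the next branch. Atoms are compared syntactically, so two spellings of one
    vector are two atoms. *)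
Ltac m_index x l :=
  match l with
  | (?y :: _)%list => let _ := match goal with _ => constr_eq x y end in constr:(O)
  | (_ :: ?l')%list => let n := m_index x l' in constr:(S n)
  end.
Ltac m_mem x l :=
  match l with
  | (?y :: _)%list => let _ := match goal with _ => constr_eq x y end in constr:(true)
  | (_ :: ?l')%list => m_mem x l'
  | _ => constr:(false)
  end.
Ltac m_atoms l e :=
  lazymatch e with
  | plus ?a ?b => let l1 := m_atoms l a in m_atoms l1 b
  | minus ?a ?b => let l1 := m_atoms l a in m_atoms l1 b
  | opp ?a => m_atoms l a
  | scal _ ?a => m_atoms l a
  | zero => l
  | _ => lazymatch m_mem e l with true => l | false => constr:((e :: l)%list) end
  end.
Ltac m_reify l e :=
  lazymatch e with
  | plus ?a ?b => let x := m_reify l a in let y := m_reify l b in constr:(MPlus x y)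
  | minus ?a ?b => let x := m_reify l a in let y := m_reify l b in constr:(MMinus x y)
  | opp ?a => let x := m_reify l a in constr:(MOpp x)
  | scal ?k ?a => let x := m_reify l a in constr:(MScal k x)
  | zero => constr:(MZero)
  | _ => let n := m_index e l in constr:(MVar n)
  end.
(** [V] is an argument because the goal may mention its carrier through several coercion paths;
    [change] then checks by conversion that the reified goal is the original one. *)
Ltac module_eq_in V :=
  lazymatch goal with
  | |- ?a = ?b =>
    let l0 := m_atoms (@nil (NormedModule.sort R_AbsRing V)) a in
    let l := m_atoms l0 b in
    let x := m_reify l a in
    let y := m_reify l b in
    change (@meval V l x = @meval V l y);
    apply meval_eq; cbn [mcoef_eq mcoef Nat.eqb]; repeat split;
    try ring; try field; try lra
  end.

(** * Powers extended by zero, and elementary estimates *)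

Lemma rpow_nonneg x m : 0 <= rpow x m.
Proof. unfold rpow. destruct (Rlt_dec 0 x); [left; apply exp_pos | lra]. Qed.

Lemma rpow_pos x m : 0 < x -> 0 < rpow x m.
Proof. unfold rpow. destruct (Rlt_dec 0 x); [intros; apply exp_pos | lra]. Qed.

Lemma rpow_Rpower x m : 0 < x -> rpow x m = Rpower x m.
Proof. unfold rpow. destruct (Rlt_dec 0 x); [easy | lra]. Qed.

Lemma rpow_nonpos x m : x <= 0 -> rpow x m = 0.
Proof. unfold rpow. destruct (Rlt_dec 0 x); [lra | easy]. Qed.

Lemma rpow_plus x a b : rpow x (a + b) = rpow x a * rpow x b.
Proof. unfold rpow. destruct (Rlt_dec 0 x); [apply Rpower_plus | ring]. Qed.

Lemma rpow_le x y m : 0 <= m -> x <= y -> rpow x m <= rpow y m.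
Proof.
  intros Hm H. destruct (Rlt_dec 0 x).
  - rewrite !rpow_Rpower by lra. apply Rle_Rpower_l; lra.
  - rewrite (rpow_nonpos x) by lra. apply rpow_nonneg.
Qed.

Lemma rpow_le_exp x a b : x <= 1 -> a <= b -> rpow x b <= rpow x a.
Proof.
  intros Hx H. destruct (Rlt_dec 0 x).
  - rewrite !rpow_Rpower by lra. unfold Rpower.
    assert (ln x <= 0) by (rewrite <- ln_1; apply ln_le; lra).
    destruct (Rle_lt_or_eq_dec (b * ln x) (a * ln x)) as [h|h]; [nra| |rewrite h; lra].
    left. now apply exp_increasing.
  - rewrite !rpow_nonpos by lra. lra.
Qed.

Lemma rpow_le_1 x m : 0 <= m -> x <= 1 -> rpow x m <= 1.
Proof.
  intros Hm H. apply Rle_trans with (rpow 1 m); [now apply rpow_le|].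
  rewrite rpow_Rpower by lra. unfold Rpower. rewrite ln_1, Rmult_0_r, exp_0. lra.
Qed.

Lemma rpow_mult c x m : 0 < c -> rpow (c * x) m = rpow c m * rpow x m.
Proof.
  intros Hc. destruct (Rlt_dec 0 x).
  - rewrite !rpow_Rpower by nra. symmetry. now apply Rpower_mult_distr.
  - rewrite (rpow_nonpos (c * x)), (rpow_nonpos x) by nra. ring.
Qed.

Lemma rpow_1 x : 0 <= x -> rpow x 1 = x.
Proof.
  intros [Hx|<-].
  - rewrite rpow_Rpower by easy. now apply Rpower_1.
  - apply rpow_nonpos; lra.
Qed.

Lemma rpow_small m eps : 0 < m -> 0 < eps ->
  exists d, 0 < d /\ forall x, x <= d -> rpow x m <= eps.
Proof.
  intros Hm He. exists (Rpower eps (/ m)). split; [apply exp_pos|].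
  intros x Hx. apply Rle_trans with (rpow (Rpower eps (/ m)) m); [apply rpow_le; lra|].
  rewrite rpow_Rpower by apply exp_pos.
  rewrite Rpower_mult, Rinv_l, Rpower_1 by lra. lra.
Qed.

Lemma rpow_half_lt m : 1 < m -> 0 < 2 * rpow (/ 2) m < 1.
Proof.
  intros Hm. split; [generalize (rpow_pos (/ 2) m ltac:(lra)); lra|].
  rewrite rpow_Rpower by lra.
  assert (H : Rpower (/ 2) m < / 2); [|lra].
  rewrite <- (Rpower_1 (/ 2)) at 2 by lra.
  unfold Rpower. apply exp_increasing.
  assert (ln (/ 2) < 0) by (rewrite <- ln_1; apply ln_increasing; lra). nra.
Qed.

Lemma rpow_half_lt_1 m : 0 < m -> 0 < rpow (/ 2) m < 1.
Proof.
  intros Hm. split; [apply rpow_pos; lra|].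
  rewrite rpow_Rpower by lra. rewrite <- exp_0. apply exp_increasing.
  assert (ln (/ 2) < 0) by (rewrite <- ln_1; apply ln_increasing; lra). nra.
Qed.

(** The map Z -> c + Z / 2 contracts to its fixed point 2 c, whatever the starting bound Z0. This
    replaces the absorption of half a supremum into the left-hand side, so Z0 does not enter the
    conclusion. *)
Lemma halving (P : R -> Prop) (c Z0 x A : R) :
  0 <= A -> P Z0 -> (forall Z, P Z -> P (c + Z / 2)) ->
  (forall Z, P Z -> x <= A * Z) -> x <= A * (2 * c).
Proof.
  intros HA H0 Hs Hx.
  assert (HP : forall n, P (2 * c + (Z0 - 2 * c) * (/ 2) ^ n)).
  { induction n as [|n IH].
    - simpl. now replace (2 * c + (Z0 - 2 * c) * 1) with Z0 by ring.
    - replace (2 * c + (Z0 - 2 * c) * (/ 2) ^ S n)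
        with (c + (2 * c + (Z0 - 2 * c) * (/ 2) ^ n) / 2) by (simpl; field).
      now apply Hs. }
  apply le_epsilon. intros eps Heps.
  set (D := A * Rabs (Z0 - 2 * c)).
  assert (HD : 0 <= D) by (apply Rmult_le_pos; [easy|apply Rabs_pos]).
  destruct (pow_lt_1_zero (/ 2)) with (y := eps / (D + 1)) as [N HN].
  { rewrite Rabs_right; lra. }
  { apply Rdiv_lt_0_compat; lra. }
  specialize (HN N (le_n _)). rewrite Rabs_right in HN.
  2: apply Rle_ge, pow_le; lra.
  assert (0 <= (/ 2) ^ N) by (apply pow_le; lra).
  apply Rle_trans with (1 := Hx _ (HP N)).
  rewrite Rmult_plus_distr_l.
  apply Rplus_le_compat_l.
  apply Rle_trans with (D * (/ 2) ^ N).
  - unfold D. rewrite Rmult_assoc. apply Rmult_le_compat_l; [easy|].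
    apply Rmult_le_compat_r; [easy|apply Rle_abs].
  - apply Rle_trans with ((D + 1) * (eps / (D + 1))).
    + apply Rmult_le_compat; lra.
    + right. field. lra.
Qed.

Lemma norm_minus_sym {V : NormedModule R_AbsRing} (x y : V) :
  norm (minus x y) = norm (minus y x).
Proof. rewrite <- (norm_opp (minus y x)), opp_minus. reflexivity. Qed.

Lemma norm_minus_le {V : NormedModule R_AbsRing} (x y : V) :
  norm (minus x y) <= norm x + norm y.
Proof. unfold minus. rewrite <- (norm_opp y). apply norm_triangle. Qed.

(** The axiom of normed modules is only an inequality; scaling back by / k gives the converse. *)
Lemma norm_scal_R {V : NormedModule R_AbsRing} (k : R) (x : V) :
  norm (scal k x) = Rabs k * norm x.
Proof.
  apply Rle_antisym; [exact (norm_scal k x)|].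
  destruct (Req_dec k 0) as [->|Hk].
  { rewrite Rabs_R0, Rmult_0_l. apply norm_ge_0. }
  assert (Hx : scal (/ k) (scal k x) = x).
  { transitivity (scal (/ k * k) x); [|rewrite Rinv_l by easy]; module_eq_in V. }
  assert (Hp := Rabs_pos_lt k Hk).
  apply Rmult_le_reg_l with (/ Rabs k); [now apply Rinv_0_lt_compat|].
  rewrite <- Rmult_assoc, Rinv_l, Rmult_1_l by lra.
  rewrite <- Hx at 1. rewrite <- Rabs_inv. exact (norm_scal (/ k) (scal k x)).
Qed.

Lemma filterlim_norm_eps {T : Type} {V : NormedModule R_AbsRing}
    (F : (T -> Prop) -> Prop) {FF : Filter F} (f : T -> V) (l : V) :
  filterlim f F (locally l) <->
  forall eps, 0 < eps -> F (fun x => norm (minus (f x) l) < eps).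
Proof.
  rewrite (filterlim_locally_ball_norm (F := F) f l). split.
  - intros H eps Heps. exact (H (mkposreal eps Heps)).
  - intros H eps. exact (H eps (cond_pos eps)).
Qed.

Set Implicit Arguments.
Unset Strict Implicit.

(** * Sewing in two norms *)

Section Rough.

Variables (E F : NormedModule R_AbsRing).
Variables (j : E -> F) (SE : R -> E -> E) (e CS CJ : R).

(* Every estimate is made in two norms at once: that of E ([f = false]) and the
   weaker one of F ([f = true]), the latter with [e] more powers of the time
   increment. *)
Definition graded_norm (f : bool) (v : E) : R := if f then norm (j v) else norm v.
Definition graded_exponent (f : bool) : R := if f then e else 0.

(** E, F and [j] stand for B_eta, B_{-rho} and the embedding. [sm_gain] is the smoothing estimate of
    order e = eta + rho, multiplied out so that no negative power occurs. *)
Record smoothing : Prop := {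
  sm_j : is_linear j;
  sm_jb : forall v, norm (j v) <= CJ * norm v;
  sm_lin : forall t, 0 <= t -> is_linear (SE t);
  sm_0 : forall v, SE 0 v = v;
  sm_add : forall t s v, 0 <= t -> 0 <= s -> SE (t + s) v = SE t (SE s v);
  sm_bd : forall f t v, 0 <= t -> graded_norm f (SE t v) <= CS * graded_norm f v;
  sm_gain : forall t v, 0 < t -> rpow t e * norm (SE t v) <= CS * norm (j v);
  sm_cont : forall v, filterlim (fun t => SE t v) (at_right 0) (locally v);
  sm_CS : 1 <= CS;
  sm_CJ : 0 <= CJ;
  sm_e : 0 < e }.

Hypothesis sm : smoothing.

Lemma nrm_plus f u v : graded_norm f (plus u v) <= graded_norm f u + graded_norm f v.
Proof.
  destruct f; simpl; [|apply norm_triangle].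
  rewrite (linear_plus _ (sm_j sm)). apply norm_triangle.
Qed.

Lemma nrm_minus f u v : graded_norm f (minus u v) <= graded_norm f u + graded_norm f v.
Proof.
  destruct f; simpl; [|apply norm_minus_le].
  rewrite (linear_minus _ _ _ (sm_j sm)). apply norm_minus_le.
Qed.

Lemma nrm_zero f : graded_norm f zero = 0.
Proof. destruct f; simpl; [rewrite (linear_zero _ (sm_j sm))|]; apply norm_zero. Qed.

Lemma nrm_le f v : graded_norm f v <= (1 + CJ) * norm v.
Proof.
  generalize (sm_jb sm v) (norm_ge_0 v) (sm_CJ sm); destruct f; simpl; nra.
Qed.

Lemma split_increment (Rm : R -> R -> E) t u s :
  Rm t s = plus (plus (hdelta2 SE Rm t u s) (Rm t u)) (SE (t - u) (Rm u s)).
Proof. unfold hdelta2. module_eq_in E. Qed.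

Section Sewing.

Variables (k H K d a b : R) (Rm : R -> R -> E).
Hypotheses (Hk : 0 < k) (Hek : 1 < e + k) (HH : 0 <= H) (HK : 0 <= K) (Hd : 0 < d).

Lemma dyadic_bound t s : exists n, t - s <= 2 ^ n * d.
Proof.
  destruct (INR_unbounded ((t - s) / d)) as [n Hn]. exists n.
  assert (INR n <= 2 ^ n).
  { clear Hn. induction n as [|n IH]; [simpl; lra|]. rewrite S_INR. simpl.
    assert (1 <= 2 ^ n) by (apply pow_R1_Rle; lra). lra. }
  replace (t - s) with ((t - s) / d * d) by (field; lra).
  apply Rmult_le_compat_r; lra.
Qed.

(** Bisection at midpoints down to pieces of length in (d/2, d]. Each level contributes q = 2
    (1/2)^(e+k) < 1 times the previous one, whence the factor H / (1 - q). The last pieces are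
    charged to 2 K (t - s) d^(e+k-1), which is additive under bisection and at least K d^(e+k) on a
    piece longer than d/2. *)
Lemma sewing_weak :
  (forall t s, a <= s -> s <= t -> t <= b -> t - s <= d ->
     norm (j (Rm t s)) <= K * rpow d (e + k)) ->
  (forall t s, a <= s -> t <= b -> d < t - s ->
     norm (j (hdelta2 SE Rm t ((t + s) / 2) s)) <= H * rpow (t - s) (e + k)) ->
  forall t s, a <= s -> t <= b -> d / 2 < t - s ->
  norm (j (Rm t s))
    <= CS * (2 * K * (t - s) * rpow d (e + k - 1)
             + H / (1 - 2 * rpow (/ 2) (e + k)) * rpow (t - s) (e + k)).
Proof.
  intros Hsmall Hlarge.
  assert (Hq := rpow_half_lt _ Hek).
  set (q := 2 * rpow (/ 2) (e + k)) in *.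
  assert (HC := sm_CS sm).
  assert (Hc : 0 <= H / (1 - q)).
  { apply Rmult_le_pos; [easy|]. left. apply Rinv_0_lt_compat. lra. }
  assert (base : forall t s r, a <= s -> t <= b -> 0 <= r -> d / 2 < t - s <= d ->
    graded_norm true (SE r (Rm t s))
    <= CS * (2 * K * (t - s) * rpow d (e + k - 1) + H / (1 - q) * rpow (t - s) (e + k))).
  { intros t s r Ha Hb Hr Ht.
    apply Rle_trans with (1 := sm_bd sm true (Rm t s) Hr).
    apply Rmult_le_compat_l; [lra|].
    apply Rle_trans with (1 := Hsmall t s Ha ltac:(lra) Hb ltac:(lra)).
    simpl. replace (e + k) with (e + k - 1 + 1) at 1 by ring.
    rewrite rpow_plus, (rpow_1 d) by lra.
    assert (0 <= rpow d (e + k - 1)) by apply rpow_nonneg.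
    assert (0 <= H / (1 - q) * rpow (t - s) (e + k))
      by (apply Rmult_le_pos; [easy|apply rpow_nonneg]).
    assert (0 <= K * rpow d (e + k - 1)) by nra. nra. }
  (* The operator [SE r] in front is carried through the induction: the semigroup law merges it with
     the [SE (t - u)] of the left half, so CS is paid once and not at every bisection. *)
  assert (main : forall n t s r,
    a <= s -> t <= b -> 0 <= r -> d / 2 < t - s <= 2 ^ n * d ->
    graded_norm true (SE r (Rm t s))
    <= CS * (2 * K * (t - s) * rpow d (e + k - 1) + H / (1 - q) * rpow (t - s) (e + k))).
  { induction n as [|n IH]; intros t s r Ha Hb Hr [Ht1 Ht2].
    { simpl in Ht2. apply base; lra. }
    destruct (Rle_lt_dec (t - s) d) as [Hsd|Hsd]; [apply base; lra|].
    set (u := (t + s) / 2).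
    assert (Hu : t - u = (t - s) / 2 /\ u - s = (t - s) / 2) by (unfold u; lra).
    assert (H2n : 2 ^ S n * d = 2 * (2 ^ n * d)) by (simpl; ring).
    rewrite (split_increment Rm t u s).
    rewrite !(linear_plus _ (sm_lin sm Hr)), <- (sm_add sm) by lra.
    eapply Rle_trans; [apply nrm_plus|].
    eapply Rle_trans; [apply Rplus_le_compat_r, nrm_plus|].
    assert (h1 := IH t u r ltac:(lra) Hb Hr ltac:(lra)).
    assert (h2 := IH u s (r + (t - u)) Ha ltac:(lra) ltac:(lra) ltac:(lra)).
    assert (h3 := sm_bd sm true (hdelta2 SE Rm t u s) Hr).
    assert (h4 := Hlarge t s Ha Hb Hsd). fold u in h4.
    replace (t - u) with (/ 2 * (t - s)) in h1 at 2 by lra.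
    replace (u - s) with (/ 2 * (t - s)) in h2 at 2 by lra.
    rewrite rpow_mult in h1, h2 by lra.
    replace (t - u) with ((t - s) / 2) in h1 by lra.
    replace (u - s) with ((t - s) / 2) in h2 by lra.
    replace (rpow (/ 2) (e + k)) with (q / 2) in h1, h2 by (unfold q; field).
    set (y := rpow (t - s) (e + k)) in *.
    set (z := rpow d (e + k - 1)) in *.
    assert (h5 : CS * graded_norm true (hdelta2 SE Rm t u s) <= CS * (H * y)).
    { apply Rmult_le_compat_l; [lra|exact h4]. }
    eapply Rle_trans.
    { apply Rplus_le_compat; [apply Rplus_le_compat|].
      - apply Rle_trans with (1 := h3) (2 := h5).
      - exact h1.
      - exact h2. }
    right. field. lra. }
  intros t s Ha Hb Ht. destruct (dyadic_bound t s) as [n Hn].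
  rewrite <- (sm_0 sm (Rm t s)).
  exact (main n t s 0 Ha Hb (Rle_refl 0) (conj Ht Hn)).
Qed.

(* In E the exponent [k] may be less than 1: bisection still converges because the
   increment over the left half is smoothed by the semigroup and bounded through F,
   so that only the right half is bisected further. *)
Lemma sewing_gain G Bd :
  0 <= G -> 0 <= Bd ->
  (forall t s, a <= s -> t <= b -> d < t - s ->
     norm (hdelta2 SE Rm t ((t + s) / 2) s) <= H * rpow (t - s) k) ->
  (forall t s, a <= s -> t <= b -> d / 2 < t - s ->
     norm (j (Rm t s)) <= G * rpow (t - s) (e + k)) ->
  (forall t s, a <= s -> t <= b -> d / 2 < t - s <= d -> norm (Rm t s) <= Bd) ->
  forall t s, a <= s -> t <= b -> d / 2 < t - s ->
  norm (Rm t s) <= Bd + (H + CS * G) / (1 - rpow (/ 2) k) * rpow (t - s) k.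
Proof.
  intros HG HB Hlarge Htrue Hsmall.
  assert (Hp := rpow_half_lt_1 _ Hk). set (p := rpow (/ 2) k) in *.
  assert (HC := sm_CS sm).
  assert (HCG : 0 <= CS * G) by (apply Rmult_le_pos; lra).
  assert (HDp : 0 <= (H + CS * G) / (1 - p)).
  { apply Rmult_le_pos; [lra|]. left. apply Rinv_0_lt_compat. lra. }
  assert (base : forall t s, a <= s -> t <= b -> d / 2 < t - s <= d ->
     norm (Rm t s) <= Bd + (H + CS * G) / (1 - p) * rpow (t - s) k).
  { intros t s Ha Hb Ht. apply Rle_trans with (1 := Hsmall t s Ha Hb Ht).
    assert (0 <= (H + CS * G) / (1 - p) * rpow (t - s) k)
      by (apply Rmult_le_pos; [easy|apply rpow_nonneg]). lra. }
  intros t s Ha Hb Ht. destruct (dyadic_bound t s) as [n Hn].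
  revert t s Ha Hb Ht Hn. induction n as [|n IH]; intros t s Ha Hb Ht1 Ht2.
  { simpl in Ht2. apply base; lra. }
  destruct (Rle_lt_dec (t - s) d) as [Hsd|Hsd]; [apply base; lra|].
  set (u := (t + s) / 2).
  assert (Hu : t - u = / 2 * (t - s) /\ u - s = / 2 * (t - s)) by (unfold u; lra).
  assert (H2n : 2 ^ S n * d = 2 * (2 ^ n * d)) by (simpl; ring).
  rewrite (split_increment Rm t u s).
  eapply Rle_trans; [apply norm_triangle|].
  eapply Rle_trans; [apply Rplus_le_compat_r, norm_triangle|].
  assert (h1 := IH t u ltac:(lra) Hb ltac:(lra) ltac:(lra)).
  assert (h2 := Htrue u s Ha ltac:(lra) ltac:(lra)).
  assert (h3 := sm_gain sm (t := t - u) (Rm u s) ltac:(lra)).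
  assert (h4 := Hlarge t s Ha Hb Hsd). fold u in h4.
  destruct Hu as [Hu1 Hu2]. rewrite Hu2 in h2.
  rewrite Hu1 in h1, h3. rewrite Hu1.
  rewrite rpow_mult in h1 by lra. fold p in h1.
  set (y := rpow (t - s) k) in *.
  assert (Hy : 0 <= y) by apply rpow_nonneg.
  (* Smoothing over the right half costs its length to the power e, which is the excess of the order
     in F over the order in E. *)
  assert (h5 : norm (SE (/ 2 * (t - s)) (Rm u s)) <= CS * G * y).
  { rewrite rpow_plus in h2.
    set (x := rpow (/ 2 * (t - s)) e) in *.
    assert (Hx : 0 < x) by (apply rpow_pos; lra).
    rewrite rpow_mult in h2 by lra. fold p y in h2.
    apply Rmult_le_reg_l with (1 := Hx).
    apply Rle_trans with (1 := h3).
    apply Rle_trans with (CS * (G * (x * (p * y)))).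
    - apply Rmult_le_compat_l; lra.
    - replace (CS * (G * (x * (p * y)))) with (x * (CS * G * (p * y))) by ring.
      apply Rmult_le_compat_l; [lra|]. apply Rmult_le_compat_l; [easy|]. nra. }
  apply Rle_trans with (H * y + (Bd + (H + CS * G) / (1 - p) * (p * y)) + CS * G * y).
  { apply Rplus_le_compat; [apply Rplus_le_compat|]; easy. }
  right. field. lra.
Qed.

Definition sew_cst : R :=
  CS * (4 * rpow 2 (e + k) + / (1 - 2 * rpow (/ 2) (e + k))).

Lemma sew_cst_pos : 1 <= sew_cst.
Proof.
  unfold sew_cst. assert (Hq := rpow_half_lt _ Hek). assert (HC := sm_CS sm).
  assert (0 < / (1 - 2 * rpow (/ 2) (e + k))) by (apply Rinv_0_lt_compat; lra).
  assert (1 <= rpow 2 (e + k)).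
  { rewrite rpow_Rpower by lra. rewrite <- (Rpower_O 2) by lra.
    apply Rle_Rpower; lra. }
  nra.
Qed.

Definition sew_cst2 : R := rpow 2 k + (1 + CS * sew_cst) / (1 - rpow (/ 2) k).

Hypothesis Hsmall : forall f t s, a <= s -> s <= t -> t <= b -> t - s <= d ->
  graded_norm f (Rm t s) <= K * rpow d (graded_exponent f + k).
Hypothesis Hlarge : forall f t s, a <= s -> t <= b -> d < t - s ->
  graded_norm f (hdelta2 SE Rm t ((t + s) / 2) s) <= H * rpow (t - s) (graded_exponent f + k).

Lemma sewing_true t s :
  a <= s -> t <= b -> d / 2 < t - s ->
  norm (j (Rm t s)) <= sew_cst * (H + K) * rpow (t - s) (e + k).
Proof.
  intros Ha Hb Ht.
  apply Rle_trans with (1 := sewing_weak (@Hsmall true) (@Hlarge true) Ha Hb Ht).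
  unfold sew_cst. rewrite !Rmult_assoc.
  apply Rmult_le_compat_l; [generalize (sm_CS sm); lra|].
  assert (Hq := rpow_half_lt _ Hek).
  set (q := 2 * rpow (/ 2) (e + k)) in *.
  assert (Hi : 0 < / (1 - q)) by (apply Rinv_0_lt_compat; lra).
  set (y := rpow (t - s) (e + k)).
  assert (Hy : 0 <= y) by apply rpow_nonneg.
  assert (h1 : (t - s) * rpow d (e + k - 1) <= rpow 2 (e + k) * y).
  { apply Rle_trans with ((t - s) * rpow (2 * (t - s)) (e + k - 1)).
    - apply Rmult_le_compat_l; [lra|]. apply rpow_le; lra.
    - rewrite rpow_mult by lra. unfold y.
      replace (e + k) with (e + k - 1 + 1) at 3 4 by ring.
      rewrite !rpow_plus, (rpow_1 2), (rpow_1 (t - s)) by lra.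
      assert (0 <= rpow 2 (e + k - 1) * rpow (t - s) (e + k - 1) * (t - s)).
      { apply Rmult_le_pos; [apply Rmult_le_pos; apply rpow_nonneg|lra]. }
      nra. }
  assert (0 <= rpow 2 (e + k) * y) by (apply Rmult_le_pos; [apply rpow_nonneg|easy]).
  apply Rle_trans with (2 * K * (rpow 2 (e + k) * y) + H * (/ (1 - q) * y)).
  - unfold Rdiv. rewrite <- !Rmult_assoc.
    apply Rplus_le_compat; [|lra].
    rewrite !(Rmult_assoc (2 * K)). apply Rmult_le_compat_l; [lra|].
    exact h1.
  - assert (0 <= / (1 - q) * y) by nra.
    set (z := rpow 2 (e + k) * y) in *. set (w := / (1 - q) * y) in *.
    replace ((4 * rpow 2 (e + k) + / (1 - q)) * ((H + K) * y))
      with ((H + K) * (4 * z + w)) by (unfold z, w; ring).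
    assert (0 <= K * w) by nra. assert (0 <= H * z) by nra.
    assert (0 <= K * z) by nra. nra.
Qed.

Lemma sewing_false t s :
  a <= s -> t <= b -> d / 2 < t - s ->
  norm (Rm t s) <= sew_cst2 * (H + K) * rpow (t - s) k.
Proof.
  intros Ha Hb Ht.
  assert (HC' := sew_cst_pos). assert (HC := sm_CS sm).
  assert (h := @sewing_gain (sew_cst * (H + K)) (K * rpow d k)
    ltac:(apply Rmult_le_pos; lra) ltac:(apply Rmult_le_pos; [easy|apply rpow_nonneg])).
  assert (hl := @Hlarge false). assert (hs := @Hsmall false).
  unfold graded_norm, graded_exponent in hl, hs. rewrite Rplus_0_l in hl, hs.
  specialize (h hl (@sewing_true)
    ltac:(intros t' s' h1 h2 h3; apply hs; lra) t s Ha Hb Ht).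
  apply Rle_trans with (1 := h).
  assert (h1 : rpow d k <= rpow 2 k * rpow (t - s) k).
  { rewrite <- rpow_mult by lra. apply rpow_le; lra. }
  assert (Hp := rpow_half_lt_1 _ Hk). set (p := rpow (/ 2) k) in *.
  set (y := rpow (t - s) k) in *.
  assert (Hy : 0 <= y) by apply rpow_nonneg.
  assert (h2 : K * rpow d k <= (H + K) * (rpow 2 k * y)).
  { apply Rmult_le_compat; [easy|apply rpow_nonneg|lra|easy]. }
  assert (Hi : 0 < / (1 - p)) by (apply Rinv_0_lt_compat; lra).
  assert (h3 : (H + CS * (sew_cst * (H + K))) / (1 - p) * y
     <= (1 + CS * sew_cst) / (1 - p) * (H + K) * y).
  { unfold Rdiv. apply Rmult_le_compat_r; [easy|].
    replace ((1 + CS * sew_cst) * / (1 - p) * (H + K))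
      with ((1 + CS * sew_cst) * (H + K) * / (1 - p)) by ring.
    apply Rmult_le_compat_r; lra. }
  unfold sew_cst2. fold p. lra.
Qed.

End Sewing.

End Rough.

(** * A priori bounds *)

Section Apriori.

Variables (E F : NormedModule R_AbsRing).
Variables (j : E -> F) (SE : R -> E -> E) (e CS CJ : R).
Hypothesis sm : smoothing j SE e CS CJ.
Variables (T k0 : R).
Hypothesis Hk0 : 0 < k0.

Let nrm := graded_norm j.
Let ex := graded_exponent e.

(** As gam = k0 + e, the exponent gam + (i - 1) k0 equals e + i k0; the assumptions on X^i in the
    two spaces take the common form [ex f + i * k0]. *)
Record rough_bounds (K : R) (X : rough E) : Prop := {
  ro_lin : forall t s, S2 0 T (t, s) ->
    is_linear (X1 X t s) /\ is_linear (X2 X t s) /\ is_linear (X3 X t s);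
  ro_1 : forall f t s v, S2 0 T (t, s) ->
    nrm f (X1 X t s v) <= K * rpow (t - s) (ex f + k0) * norm v;
  ro_2 : forall f t s v, S2 0 T (t, s) ->
    nrm f (X2 X t s v) <= K * rpow (t - s) (ex f + 2 * k0) * norm v;
  ro_3 : forall f t s v, S2 0 T (t, s) ->
    nrm f (X3 X t s v) <= K * rpow (t - s) (ex f + 3 * k0) * norm v }.

Definition Xs (X : rough E) t s v : E :=
  plus (plus (X1 X t s v) (X2 X t s v)) (X3 X t s v).

Definition one_step (X : rough E) t s v : E := plus (SE (t - s) v) (Xs X t s v).

(* By Chen's relations, [one_step t u (one_step u s v) - one_step t s v]. *)
Definition chi (X : rough E) t u s v : E :=
  plus (plus (X1 X t u (X3 X u s v)) (plus (X2 X t u (X2 X u s v)) (X2 X t u (X3 X u s v))))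
       (plus (X3 X t u (X1 X u s v)) (plus (X3 X t u (X2 X u s v)) (X3 X t u (X3 X u s v)))).

Lemma graded_exponent_nonneg f : 0 <= ex f.
Proof. unfold ex, graded_exponent. generalize (sm_e sm). destruct f; lra. Qed.

Lemma S2_intro a b t s : a <= s -> s <= t -> t <= b -> S2 a b (t, s).
Proof. unfold S2; simpl; lra. Qed.

(** Orders in time add under composition, and the excess over r is dropped because [t <= 1]. Only
    the outer operator has to land in the norm [f]; the inner value is measured in E. *)
Lemma prod_bd K L (A : E -> E) f p q r t1 t2 t (z : E) (x : R) :
  0 <= K -> 0 <= L -> 0 <= x ->
  (forall v, nrm f (A v) <= K * rpow t1 (ex f + p) * norm v) ->
  norm z <= L * rpow t2 q * x ->
  t1 <= t -> t2 <= t -> t <= 1 -> 0 <= p -> 0 <= q -> r <= p + q ->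
  nrm f (A z) <= K * L * rpow t (ex f + r) * x.
Proof.
  intros HK HL Hx HA Hz H1 H2 Ht Hp Hq Hr.
  assert (He := graded_exponent_nonneg f).
  apply Rle_trans with (1 := HA z).
  assert (h1 : rpow t1 (ex f + p) <= rpow t (ex f + p)) by (apply rpow_le; lra).
  assert (h2 : rpow t2 q <= rpow t q) by (apply rpow_le; lra).
  assert (h3 : rpow t (ex f + p) * rpow t q <= rpow t (ex f + r)).
  { rewrite <- rpow_plus. apply rpow_le_exp; lra. }
  assert (g1 := rpow_nonneg t1 (ex f + p)). assert (g2 := rpow_nonneg t2 q).
  assert (g3 := rpow_nonneg t (ex f + p)).
  apply Rle_trans with (K * rpow t (ex f + p) * (L * rpow t q * x)).
  - apply Rmult_le_compat; [now apply Rmult_le_pos|apply norm_ge_0| |].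
    + now apply Rmult_le_compat_l.
    + apply Rle_trans with (1 := Hz). apply Rmult_le_compat_r; [easy|].
      now apply Rmult_le_compat_l.
  - replace (K * rpow t (ex f + p) * (L * rpow t q * x))
      with (K * L * (rpow t (ex f + p) * rpow t q) * x) by ring.
    apply Rmult_le_compat_r; [easy|].
    apply Rmult_le_compat_l; [now apply Rmult_le_pos|easy].
Qed.

Section Bounds.
Variables (K : R) (X : rough E).
Hypothesis HK : 0 <= K.
Hypothesis HX : rough_bounds K X.

Lemma ro_false t s v : S2 0 T (t, s) ->
  norm (X1 X t s v) <= K * rpow (t - s) k0 * norm v /\
  norm (X2 X t s v) <= K * rpow (t - s) (2 * k0) * norm v /\
  norm (X3 X t s v) <= K * rpow (t - s) (3 * k0) * norm v.
Proof.
  intros H. rewrite <- (Rplus_0_l k0) at 1. rewrite <- (Rplus_0_l (2 * k0)).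
  rewrite <- (Rplus_0_l (3 * k0)).
  exact (conj (ro_1 HX false v H) (conj (ro_2 HX false v H) (ro_3 HX false v H))).
Qed.

Lemma Xs_bd f t s v : S2 0 T (t, s) -> t - s <= 1 ->
  nrm f (Xs X t s v) <= 3 * K * rpow (t - s) (ex f + k0) * norm v.
Proof.
  intros H Ht. unfold Xs.
  eapply Rle_trans; [apply (nrm_plus sm)|].
  eapply Rle_trans; [apply Rplus_le_compat_r, (nrm_plus sm)|].
  assert (h1 := ro_1 HX f v H). assert (h2 := ro_2 HX f v H).
  assert (h3 := ro_3 HX f v H).
  assert (g2 : rpow (t - s) (ex f + 2 * k0) <= rpow (t - s) (ex f + k0))
    by (apply rpow_le_exp; lra).
  assert (g3 : rpow (t - s) (ex f + 3 * k0) <= rpow (t - s) (ex f + k0))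
    by (apply rpow_le_exp; lra).
  assert (Hv := norm_ge_0 v).
  assert (g4 : K * rpow (t - s) (ex f + 2 * k0) * norm v
     <= K * rpow (t - s) (ex f + k0) * norm v)
    by (apply Rmult_le_compat_r; [easy|now apply Rmult_le_compat_l]).
  assert (g5 : K * rpow (t - s) (ex f + 3 * k0) * norm v
     <= K * rpow (t - s) (ex f + k0) * norm v)
    by (apply Rmult_le_compat_r; [easy|now apply Rmult_le_compat_l]).
  unfold nrm in *. lra.
Qed.

Lemma chi_bd f t u s v : S3 0 T (t, u, s) -> t - s <= 1 ->
  nrm f (chi X t u s v) <= 6 * (K * K) * rpow (t - s) (ex f + 4 * k0) * norm v.
Proof.
  unfold S3; simpl. intros H Ht.
  assert (H1 : S2 0 T (t, u)) by (unfold S2; simpl; lra).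
  assert (H2 : S2 0 T (u, s)) by (unfold S2; simpl; lra).
  destruct (ro_false v H2) as [f1 [f2 f3]].
  assert (Hv := norm_ge_0 v).
  assert (b13 := prod_bd (r := 4 * k0) HK HK Hv (fun v => ro_1 HX f v H1) f3
    (t := t - s) ltac:(lra) ltac:(lra) Ht ltac:(lra) ltac:(lra) ltac:(lra)).
  assert (b22 := prod_bd (r := 4 * k0) HK HK Hv (fun v => ro_2 HX f v H1) f2
    (t := t - s) ltac:(lra) ltac:(lra) Ht ltac:(lra) ltac:(lra) ltac:(lra)).
  assert (b23 := prod_bd (r := 4 * k0) HK HK Hv (fun v => ro_2 HX f v H1) f3
    (t := t - s) ltac:(lra) ltac:(lra) Ht ltac:(lra) ltac:(lra) ltac:(lra)).
  assert (b31 := prod_bd (r := 4 * k0) HK HK Hv (fun v => ro_3 HX f v H1) f1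
    (t := t - s) ltac:(lra) ltac:(lra) Ht ltac:(lra) ltac:(lra) ltac:(lra)).
  assert (b32 := prod_bd (r := 4 * k0) HK HK Hv (fun v => ro_3 HX f v H1) f2
    (t := t - s) ltac:(lra) ltac:(lra) Ht ltac:(lra) ltac:(lra) ltac:(lra)).
  assert (b33 := prod_bd (r := 4 * k0) HK HK Hv (fun v => ro_3 HX f v H1) f3
    (t := t - s) ltac:(lra) ltac:(lra) Ht ltac:(lra) ltac:(lra) ltac:(lra)).
  unfold chi.
  assert (p3 : forall x y z : E, nrm f (plus x (plus y z)) <= nrm f x + (nrm f y + nrm f z)).
  { intros. eapply Rle_trans; [apply (nrm_plus sm)|].
    apply Rplus_le_compat_l, (nrm_plus sm). }
  eapply Rle_trans; [apply (nrm_plus sm)|].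
  eapply Rle_trans; [apply Rplus_le_compat; apply p3|].
  lra.
Qed.

Lemma Xs_lin t s : S2 0 T (t, s) -> is_linear (Xs X t s).
Proof.
  intros H. destruct (ro_lin HX H) as [l1 [l2 l3]].
  apply (is_linear_comp (fun x => (plus (X1 X t s x) (X2 X t s x), X3 X t s x))
                        (fun p => plus (fst p) (snd p))); [|apply is_linear_plus].
  apply is_linear_prod; [|easy].
  apply (is_linear_comp (fun x => (X1 X t s x, X2 X t s x))
                        (fun p => plus (fst p) (snd p))); [|apply is_linear_plus].
  now apply is_linear_prod.
Qed.

Lemma Xi_lin t s : S2 0 T (t, s) -> is_linear (one_step X t s).
Proof.
  intros H.
  apply (is_linear_comp (fun x => (SE (t - s) x, Xs X t s x))
                        (fun p => plus (fst p) (snd p))); [|apply is_linear_plus].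
  apply is_linear_prod; [|now apply Xs_lin].
  apply (sm_lin sm). unfold S2 in H; simpl in H; lra.
Qed.

Lemma Xi_bd t s v : S2 0 T (t, s) -> t - s <= 1 ->
  norm (one_step X t s v) <= (CS + 3 * K) * norm v.
Proof.
  intros H Ht. unfold one_step. eapply Rle_trans; [apply norm_triangle|].
  assert (h1 := Xs_bd false v H Ht). unfold nrm, ex in h1; simpl in h1.
  assert (h2 := sm_bd sm false (t := t - s) v). simpl in h2.
  unfold S2 in H; simpl in H. specialize (h2 ltac:(lra)).
  assert (h3 : rpow (t - s) (0 + k0) <= 1) by (apply rpow_le_1; lra).
  assert (Hv := norm_ge_0 v). assert (0 <= K * norm v) by nra. nra.
Qed.

End Bounds.

Section Exponent.
Variables (k K : R).
Hypotheses (Hk : 0 < k) (Hk4 : k < 4 * k0) (Hek : 1 < e + k) (HK : 0 <= K).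

(** If Z bounds w and the remainder, then hdelta R, which is chi (w) + Xs (R) up to eps, has order
    exceeding k by at least [th]; sewing returns a bound of R by Z times a small power of tau, and w
    is recovered from its value at a by one step plus R. The last hypothesis is only qualitative:
    its Z starts the iteration and does not enter C. [Rmax (t - s) d] appears because nothing finer
    is known below the cutoff. *)
Lemma apriori_local : exists tau C, 0 < tau <= 1 /\ 1 <= C /\
  forall X, rough_bounds K X -> forall a b (w : R -> E) (Rm : R -> R -> E) eps d,
  0 <= a -> b <= T -> b - a <= tau -> 0 < d -> d <= tau -> 0 <= eps ->
  (forall t, a <= t <= b ->
     norm (minus (minus (w t) (one_step X t a (w a))) (Rm t a)) <= eps) ->
  (forall f t s, a <= s -> t <= b -> d < t - s ->
     nrm f (minus (hdelta2 SE Rm t ((t + s) / 2) s)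
              (plus (chi X t ((t + s) / 2) s (w s))
                    (Xs X t ((t + s) / 2) (Rm ((t + s) / 2) s))))
       <= eps * rpow (t - s) (ex f + k)) ->
  (forall f t s, a <= s -> s <= t -> t <= b -> t - s <= d ->
     nrm f (Rm t s) <= eps * rpow d (ex f + k)) ->
  (exists Z, (forall t, a <= t <= b -> norm (w t) <= Z) /\
     forall t s, a <= s -> s <= t -> t <= b -> norm (Rm t s) <= Z) ->
  (forall t, a <= t <= b -> norm (w t) <= C * (norm (w a) + eps)) /\
  forall f t s, a <= s -> s <= t -> t <= b ->
    nrm f (Rm t s) <= C * (norm (w a) + eps) * rpow (Rmax (t - s) d) (ex f + k).
Proof.
  (* The excess orders over k: [chi] has order 4 k0, and [Xs] applied to a remainder of order k has
     order k0 + k. *)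
  set (th := Rmin k0 (4 * k0 - k)).
  assert (Hth : 0 < th) by (apply Rmin_pos; lra).
  assert (Hth1 : th <= k0) by apply Rmin_l.
  assert (Hth2 : th <= 4 * k0 - k) by apply Rmin_r.
  set (Cs := sew_cst e CS k + sew_cst2 e CS k).
  assert (HCs1 := sew_cst_pos sm Hek).
  assert (HCS := sm_CS sm).
  assert (HCs2 : 0 <= sew_cst2 e CS k).
  { unfold sew_cst2. assert (Hp := rpow_half_lt_1 k Hk).
    assert (0 < / (1 - rpow (/ 2) k)) by (apply Rinv_0_lt_compat; lra).
    assert (0 <= rpow 2 e) by apply rpow_nonneg.
    assert (0 <= CS * sew_cst e CS k) by nra.
    assert (0 <= CS * sew_cst e CS k * rpow 2 e) by nra.
    assert (0 <= rpow 2 k) by apply rpow_nonneg.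
    unfold Rdiv. nra. }
  assert (HCs : 1 <= Cs) by (unfold Cs; lra).
  set (M1 := 6 * (K * K) + 3 * K).
  assert (HM1 : 0 <= M1) by (unfold M1; nra).
  assert (HCM : 0 <= Cs * M1) by (apply Rmult_le_pos; lra).
  destruct (rpow_small th (/ (2 * (Cs * M1 + 1))) Hth) as [tau0 [Ht0 Hsmall]].
  { apply Rinv_0_lt_compat. lra. }
  set (D := CS + 3 * K + 2 * Cs + 2).
  exists (Rmin tau0 1), (2 * D).
  assert (Htau : 0 < Rmin tau0 1 <= 1) by (split; [apply Rmin_pos; lra|apply Rmin_r]).
  split; [easy|]. split; [unfold D; nra|].
  set (tau := Rmin tau0 1) in *.
  (* The choice of tau: the sewing constant times the size of hdelta R is at most one half. *)
  assert (Htt : Cs * M1 * rpow tau th <= / 2).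
  { apply Rle_trans with (Cs * M1 * (/ (2 * (Cs * M1 + 1)))).
    - apply Rmult_le_compat_l; [easy|]. apply Hsmall, Rmin_l.
    - apply Rmult_le_reg_r with (2 * (Cs * M1 + 1)); [lra|].
      rewrite Rmult_assoc, Rinv_l; lra. }
  intros X HX a b w Rm eps d Ha HbT Hab Hd Hdt Heps H1 H2 H3 [Z0 [HZ1 HZ2]].
  set (P := fun Z => 0 <= Z /\ (forall t, a <= t <= b -> norm (w t) <= Z) /\
    forall f t s, a <= s -> s <= t -> t <= b ->
      nrm f (Rm t s) <= Z * rpow (Rmax (t - s) d) (ex f + k)).
  assert (Hmax : forall t s, a <= s -> s <= t -> t <= b ->
    0 < Rmax (t - s) d <= 1).
  { intros t s h1 h2 h3. split; [apply Rlt_le_trans with d; [easy|apply Rmax_r]|].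
    apply Rmax_lub; lra. }
  destruct (Rle_lt_dec a b) as [Hab'|Hab'].
  2:{ split; intros; lra. }
  set (c := D * (norm (w a) + eps)).
  assert (Hna := norm_ge_0 (w a)).
  assert (HD : 2 <= D) by (unfold D; lra).
  assert (Hc : 0 <= c) by (unfold c; nra).
  (* A plain bound of R is turned into a bound with the required powers by dividing by those of d;
     this starts the iteration and uses d > 0. *)
  assert (HP0 : P (Z0 + (1 + CJ) * Z0 * (/ rpow d k + / rpow d (e + k)))).
  { assert (HZ0 : 0 <= Z0).
    { apply Rle_trans with (norm (w a)); [easy|]. apply HZ1; lra. }
    assert (HJ := sm_CJ sm).
    assert (p1 : 0 < rpow d k) by now apply rpow_pos.
    assert (p2 : 0 < rpow d (e + k)) by now apply rpow_pos.
    assert (q1 := Rinv_0_lt_compat _ p1). assert (q2 := Rinv_0_lt_compat _ p2).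
    assert (HZJ : 0 <= (1 + CJ) * Z0) by nra.
    assert (HZs : 0 <= (1 + CJ) * Z0 * (/ rpow d k + / rpow d (e + k))) by nra.
    split; [lra|]. split.
    - intros t Ht. specialize (HZ1 t Ht). lra.
    - intros f t s h1 h2 h3.
      apply Rle_trans with (1 := nrm_le sm f (Rm t s)).
      apply Rle_trans with ((1 + CJ) * Z0).
      { apply Rmult_le_compat_l; [lra|]. now apply HZ2. }
      apply Rle_trans with ((1 + CJ) * Z0 * (/ rpow d k + / rpow d (e + k))
                            * rpow d (ex f + k)).
      + rewrite Rmult_assoc. rewrite <- (Rmult_1_r ((1 + CJ) * Z0)) at 1.
        apply Rmult_le_compat_l; [easy|].
        unfold ex, graded_exponent. destruct f.
        * rewrite Rmult_plus_distr_r, Rinv_l by lra. nra.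
        * rewrite Rplus_0_l, Rmult_plus_distr_r, Rinv_l by lra. nra.
      + apply Rmult_le_compat; [easy|apply rpow_nonneg|lra|].
        apply rpow_le; [generalize (graded_exponent_nonneg f); lra|apply Rmax_r]. }
  assert (Hstep : forall Z, P Z -> P (c + Z / 2)).
  { intros Z [HZ [PZ1 PZ2]].
    set (x := rpow tau th) in *. assert (Hx : 0 <= x) by apply rpow_nonneg.
    set (H := M1 * Z * x + eps).
    assert (HH : 0 <= H) by (unfold H; assert (0 <= M1 * Z) by nra; nra).
    assert (Hl : forall f t s, a <= s -> t <= b -> d < t - s ->
      nrm f (hdelta2 SE Rm t ((t + s) / 2) s) <= H * rpow (t - s) (ex f + k)).
    { intros f t s h1 h2 h3. set (u := (t + s) / 2).
      assert (Hu : t - u = (t - s) / 2 /\ u - s = (t - s) / 2) by (unfold u; lra).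
      assert (S2tu : S2 0 T (t, u)) by (apply S2_intro; lra).
      assert (S3u : S3 0 T (t, u, s)) by (unfold S3; simpl; lra).
      assert (g1 := chi_bd HK HX f (w s) S3u ltac:(lra)).
      assert (g0 := Hmax u s h1 ltac:(lra) ltac:(lra)).
      assert (g2 : nrm f (Xs X t u (Rm u s))
                <= 3 * K * 1 * rpow (t - s) (ex f + (k0 + k)) * Z).
      { apply (prod_bd (p := k0) (q := k) (t1 := t - u) (t2 := t - s)); try lra.
        - intros v. apply (Xs_bd HK HX f v S2tu). lra.
        - rewrite Rmult_1_l.
          assert (g3 := PZ2 false u s h1 ltac:(lra) ltac:(lra)).
          unfold ex in g3; simpl in g3. rewrite Rplus_0_l in g3.
          apply Rle_trans with (1 := g3). rewrite Rmult_comm.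
          apply Rmult_le_compat_r; [easy|]. apply rpow_le; [lra|].
          apply Rmax_lub; lra. }
      assert (ext : forall r, th <= r ->
         rpow (t - s) (ex f + k + r) <= x * rpow (t - s) (ex f + k)).
      { intros r Hr. rewrite rpow_plus, Rmult_comm.
        apply Rmult_le_compat_r; [apply rpow_nonneg|].
        apply Rle_trans with (rpow (t - s) th); [apply rpow_le_exp; lra|].
        apply rpow_le; lra. }
      assert (g4 := ext (4 * k0 - k) Hth2). assert (g5 := ext k0 Hth1).
      replace (ex f + k + (4 * k0 - k)) with (ex f + 4 * k0) in g4 by ring.
      replace (ex f + k + k0) with (ex f + (k0 + k)) in g5 by ring.
      specialize (H2 f t s h1 h2 h3). fold u in H2.
      assert (g6 : norm (w s) <= Z) by (apply PZ1; lra).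
      set (y := rpow (t - s) (ex f + k)) in *.
      assert (Hy : 0 <= y) by apply rpow_nonneg.
      set (hd := hdelta2 SE Rm t u s) in *.
      replace hd with (plus (minus hd (plus (chi X t u s (w s)) (Xs X t u (Rm u s))))
                 (plus (chi X t u s (w s)) (Xs X t u (Rm u s)))).
      2: { module_eq_in E. }
      eapply Rle_trans; [apply (nrm_plus sm)|].
      eapply Rle_trans; [apply Rplus_le_compat_l, (nrm_plus sm)|].
      fold nrm.
      assert (g7 : nrm f (chi X t u s (w s)) <= 6 * (K * K) * (x * y) * Z).
      { apply Rle_trans with (1 := g1). apply Rmult_le_compat; [|apply norm_ge_0| |easy].
        - apply Rmult_le_pos; [nra|apply rpow_nonneg].
        - apply Rmult_le_compat_l; [nra|easy]. }
      assert (g8 : nrm f (Xs X t u (Rm u s)) <= 3 * K * (x * y) * Z).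
      { apply Rle_trans with (1 := g2). apply Rmult_le_compat_r; [easy|].
        rewrite Rmult_1_r. apply Rmult_le_compat_l; [lra|easy]. }
      unfold H, M1. lra. }
    assert (Hs1 := fun t s => sewing_true sm Hek HH Heps Hd H3 Hl (t := t) (s := s)).
    assert (Hs2 := fun t s => sewing_false sm Hk Hek HH Heps Hd H3 Hl (t := t) (s := s)).
    assert (Hsew : forall f t s, a <= s -> s <= t -> t <= b ->
       nrm f (Rm t s) <= (Cs * (H + eps) + eps) * rpow (Rmax (t - s) d) (ex f + k)).
    { intros f t s h1 h2 h3.
      assert (Hex := graded_exponent_nonneg f).
      assert (Hy := rpow_nonneg (Rmax (t - s) d) (ex f + k)).
      assert (HCH : 0 <= Cs * (H + eps)) by (apply Rmult_le_pos; lra).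
      destruct (Rle_lt_dec (t - s) d) as [hd|hd].
      - apply Rle_trans with (1 := H3 f t s h1 h2 h3 hd).
        rewrite Rmax_right by easy. rewrite Rmax_right in Hy by easy. nra.
      - rewrite Rmax_left by lra. rewrite Rmax_left in Hy by lra.
        apply Rle_trans with (Cs * (H + eps) * rpow (t - s) (ex f + k)); [|nra].
        apply Rle_trans with ((if f then sew_cst e CS k else sew_cst2 e CS k)
           * (H + eps) * rpow (t - s) (ex f + k)).
        + destruct f; unfold nrm, ex; simpl; [apply Hs1; lra|].
          rewrite Rplus_0_l. apply Hs2; lra.
        + apply Rmult_le_compat_r; [easy|]. apply Rmult_le_compat_r; [lra|].
          unfold Cs; destruct f; lra. }
    assert (HZx : Cs * (H + eps) + eps <= (2 * Cs + 1) * eps + Z / 2).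
    { unfold H. assert (Cs * M1 * x * Z <= / 2 * Z) by (apply Rmult_le_compat_r; lra).
      lra. }
    assert (HcD : (CS + 3 * K) * norm (w a) + (2 * Cs + 2) * eps <= c).
    { unfold c, D.
      assert (0 <= (2 * Cs + 2) * norm (w a)) by (apply Rmult_le_pos; lra).
      assert (0 <= (CS + 3 * K) * eps) by (apply Rmult_le_pos; lra). lra. }
    assert (Hpa : 0 <= (CS + 3 * K) * norm (w a)) by (apply Rmult_le_pos; lra).
    split; [lra|]. split.
    - intros t Ht. specialize (H1 t Ht).
      assert (S2ta : S2 0 T (t, a)) by (apply S2_intro; lra).
      assert (g1 := Xi_bd HK HX (w a) S2ta ltac:(lra)).
      assert (g2 := Hsew false t a ltac:(lra) ltac:(lra) ltac:(lra)).
      destruct (Hmax t a ltac:(lra) ltac:(lra) ltac:(lra)) as [m1 m2].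
      assert (g3 : rpow (Rmax (t - a) d) (ex false + k) <= 1).
      { apply rpow_le_1; [generalize (graded_exponent_nonneg false); lra|easy]. }
      assert (g4 := rpow_nonneg (Rmax (t - a) d) (ex false + k)).
      unfold nrm in g2; simpl in g2.
      replace (w t) with (plus (minus (minus (w t) (one_step X t a (w a))) (Rm t a))
                               (plus (one_step X t a (w a)) (Rm t a))).
      2: { module_eq_in E. }
      eapply Rle_trans; [apply norm_triangle|].
      eapply Rle_trans; [apply Rplus_le_compat_l, norm_triangle|].
      assert (HCH : 0 <= Cs * (H + eps) + eps)
        by (apply Rplus_le_le_0_compat; [apply Rmult_le_pos; lra|easy]).
      assert (g5 := Rmult_le_compat_l _ _ _ HCH g3). unfold ex, graded_exponent in g5. lra.
    - intros f t s h1 h2 h3. apply Rle_trans with (1 := Hsew f t s h1 h2 h3).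
      apply Rmult_le_compat_r; [apply rpow_nonneg|]. lra. }
  split.
  - intros t Ht.
    replace (2 * D * (norm (w a) + eps)) with (2 * c) by (unfold c; ring).
    rewrite <- (Rmult_1_l (2 * c)).
    refine (halving P c _ _ _ Rle_0_1 HP0 Hstep _).
    intros Z [_ [HZ _]]. rewrite Rmult_1_l. now apply HZ.
  - intros f t s h1 h2 h3.
    replace (2 * D * (norm (w a) + eps) * rpow (Rmax (t - s) d) (ex f + k))
      with (rpow (Rmax (t - s) d) (ex f + k) * (2 * c)) by (unfold c; ring).
    refine (halving P c _ _ _ (rpow_nonneg _ _) HP0 Hstep _).
    intros Z [_ [_ HZ]]. rewrite Rmult_comm. now apply HZ.
Qed.

End Exponent.
End Apriori.

(** * The a priori bound on the whole interval, and the defect in Chen's relations *)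

Section Global.

Variables (E F : NormedModule R_AbsRing).
Variables (j : E -> F) (SE : R -> E -> E) (e CS CJ : R).
Hypothesis sm : smoothing j SE e CS CJ.
Variables (T k0 : R).
Hypothesis Hk0 : 0 < k0.

Let nrm := graded_norm j.
Let ex := graded_exponent e.
Let rough_ok := rough_bounds j e T k0.
Let Xi := one_step SE.

(** A predicate, so that later sections can assume it for two exponents k side by side; tau and C
    are uniform over all rough data with the same constant K. *)
Definition apriori_prop (k K tau C : R) : Prop :=
  forall X, rough_ok K X -> forall a b (w : R -> E) (Rm : R -> R -> E) eps d,
  0 <= a -> b <= T -> 0 < d -> d <= tau -> 0 <= eps ->
  (forall t s, a <= s -> s <= t -> t <= b -> t - s <= tau ->
     norm (minus (minus (w t) (Xi X t s (w s))) (Rm t s)) <= eps) ->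
  (forall f t u s, a <= s -> s <= u -> u <= t -> t <= b -> d < t - s -> t - s <= tau ->
     nrm f (minus (hdelta2 SE Rm t u s)
              (plus (chi X t u s (w s)) (Xs X t u (Rm u s))))
       <= eps * rpow (t - s) (ex f + k)) ->
  (forall f t s, a <= s -> s <= t -> t <= b -> t - s <= d ->
     nrm f (Rm t s) <= eps * rpow d (ex f + k)) ->
  (exists Z, (forall t, a <= t <= b -> norm (w t) <= Z) /\
     forall t s, a <= s -> s <= t -> t <= b -> norm (Rm t s) <= Z) ->
  (forall t, a <= t <= b -> norm (w t) <= C * (norm (w a) + eps)) /\
  forall f t s, a <= s -> s <= t -> t <= b -> t - s <= tau ->
    nrm f (Rm t s) <= C * (norm (w a) + eps) * rpow (Rmax (t - s) d) (ex f + k).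

Lemma apriori_global (k K : R) :
  0 < k -> k < 4 * k0 -> 1 < e + k -> 0 <= K ->
  exists tau C, 0 < tau <= 1 /\ 1 <= C /\ apriori_prop k K tau C.
Proof.
  intros Hk Hk4 Hek HK.
  destruct (apriori_local sm T Hk0 Hk Hk4 Hek HK) as [tau [C0 [Ht [HC H]]]].
  destruct (INR_unbounded (T / tau)) as [N HN].
  (* Over each interval of length tau the quantity norm w + eps grows at most by the factor C0 + 1,
     and N such intervals cover [0, T]; the remaining C0 is that of the local bound on the
     remainder. *)
  exists tau, (C0 * (C0 + 1) ^ N).
  assert (Hpow : forall n, 1 <= (C0 + 1) ^ n) by (intros; apply pow_R1_Rle; lra).
  split; [easy|]. split; [generalize (Hpow N); nra|].
  intros X HX a b w Rm eps d Ha Hb Hd Hdt Heps H1 H2 H3 [Z [HZ1 HZ2]].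
  assert (loc : forall s t, a <= s -> s <= t -> t <= b -> t - s <= tau ->
     norm (w t) <= C0 * (norm (w s) + eps) /\
     forall f, nrm f (Rm t s)
       <= C0 * (norm (w s) + eps) * rpow (Rmax (t - s) d) (ex f + k)).
  { intros s t h1 h2 h3 h4.
    destruct (H X HX s t w Rm eps d) as [g1 g2]; try lra.
    - intros r Hr. apply H1; lra.
    - intros f t' s' i1 i2 i3. apply H2; lra.
    - intros f t' s' i1 i2 i3 i4. apply H3; lra.
    - exists Z. split; [intros; apply HZ1; lra|intros; apply HZ2; lra].
    - split; [apply g1; lra|]. intros f. apply g2; lra. }
  assert (Hna := norm_ge_0 (w a)).
  assert (Hn : forall n t, a <= t -> t <= b -> t <= a + INR n * tau ->
    norm (w t) + eps <= (C0 + 1) ^ n * (norm (w a) + eps)).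
  { induction n as [|n IH]; intros t h1 h2 h3.
    - simpl in h3. replace t with a by lra. simpl. lra.
    - rewrite S_INR in h3.
      destruct (Rle_lt_dec t (a + INR n * tau)) as [h|h].
      + apply Rle_trans with (1 := IH t h1 h2 h). simpl.
        assert (0 <= (C0 + 1) ^ n * (norm (w a) + eps)).
        { apply Rmult_le_pos; [generalize (Hpow n)|]; lra. }
        nra.
      + set (s := a + INR n * tau) in *.
        assert (a <= s) by (unfold s; generalize (pos_INR n); nra).
        assert (t - s <= tau) by (unfold s; lra).
        destruct (loc s t) as [g _]; try lra.
        specialize (IH s ltac:(lra) ltac:(lra) (Rle_refl _)).
        assert (hs := norm_ge_0 (w s)).
        apply Rle_trans with ((C0 + 1) * (norm (w s) + eps)); [lra|].
        rewrite <- tech_pow_Rmult, Rmult_assoc. apply Rmult_le_compat_l; lra. }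
  assert (Hall : forall t, a <= t -> t <= b ->
    norm (w t) + eps <= (C0 + 1) ^ N * (norm (w a) + eps)).
  { intros t h1 h2. apply Hn; try lra.
    assert (T <= INR N * tau); [|lra].
    replace T with (T / tau * tau) by (field; lra).
    apply Rmult_le_compat_r; lra. }
  split.
  - intros t [h1 h2]. generalize (Hall t h1 h2). intros g.
    assert (0 <= (C0 + 1) ^ N * (norm (w a) + eps)).
    { apply Rmult_le_pos; [generalize (Hpow N)|]; lra. }
    nra.
  - intros f t s h1 h2 h3 h4. destruct (loc s t h1 h2 h3 h4) as [_ g].
    apply Rle_trans with (1 := g f). apply Rmult_le_compat_r; [apply rpow_nonneg|].
    rewrite Rmult_assoc. apply Rmult_le_compat_l; [lra|]. apply Hall; lra.
Qed.

Definition chen_relations (X : rough E) : Prop :=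
  forall t u s x, S3 0 T (t, u, s) ->
    tdelta SE (X1 X) t u s x = zero /\
    tdelta SE (X2 X) t u s x = X1 X t u (X1 X u s x) /\
    tdelta SE (X3 X) t u s x
      = plus (X1 X t u (X2 X u s x)) (X2 X t u (X1 X u s x)).

Section Path.
Variables (K : R) (X : rough E).
Hypotheses (HK : 0 <= K) (HX : rough_ok K X) (HC : chen_relations X).

Definition remainder (y : R -> E) t s : E := minus (y t) (Xi X t s (y s)).

Lemma chen_X t u s v : S3 0 T (t, u, s) ->
  X1 X t s v = plus (X1 X t u (SE (u - s) v)) (SE (t - u) (X1 X u s v)) /\
  X2 X t s v = plus (plus (X2 X t u (SE (u - s) v)) (SE (t - u) (X2 X u s v)))
                 (X1 X t u (X1 X u s v)) /\
  X3 X t s v = plus (plus (X3 X t u (SE (u - s) v)) (SE (t - u) (X3 X u s v)))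
                 (plus (X1 X t u (X2 X u s v)) (X2 X t u (X1 X u s v))).
Proof.
  intros H. destruct (HC v H) as [h1 [h2 h3]]. unfold tdelta in *.
  repeat split.
  - transitivity (plus (plus (X1 X t u (SE (u - s) v)) (SE (t - u) (X1 X u s v))) zero);
      [rewrite <- h1|]; module_eq_in E.
  - rewrite <- h2. module_eq_in E.
  - rewrite <- h3. module_eq_in E.
Qed.

(** The products X^i X^j with i + j <= 3 are those that Chen's relations produce when X^{i+j} is
    split at u; [chi] collects the products with i + j >= 4. *)
Lemma Xi_Xi t u s v : S3 0 T (t, u, s) ->
  Xi X t u (Xi X u s v) = plus (Xi X t s v) (chi X t u s v).
Proof.
  intros H. destruct (chen_X v H) as [h1 [h2 h3]].
  assert (S2 0 T (t, u)) as Htu by (unfold S3, S2 in *; simpl in *; lra).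
  destruct (ro_lin HX Htu) as [l1 [l2 l3]].
  assert (H' := H). unfold S3 in H'; simpl in H'.
  assert (l0 := sm_lin sm (t := t - u) ltac:(lra)).
  unfold Xi, one_step, Xs, chi. rewrite h1, h2, h3.
  rewrite (linear_plus _ l0), (linear_plus _ l1), (linear_plus _ l2), (linear_plus _ l3).
  rewrite !(linear_plus _ l0), !(linear_plus _ l1), !(linear_plus _ l2), !(linear_plus _ l3).
  rewrite <- (sm_add sm) by lra. replace (t - u + (u - s)) with (t - s) by ring.
  module_eq_in E.
Qed.

(** Starting the second step from y_u instead of the approximation [Xi X u s (y s)] changes it by
    the remainder over (u, s), so R reappears under [Xs], and [Xi_Xi] supplies the rest. *)
Lemma rem_delta y t u s : S3 0 T (t, u, s) ->
  hdelta2 SE (remainder y) t u s = plus (chi X t u s (y s)) (Xs X t u (remainder y u s)).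
Proof.
  intros H.
  assert (S2 0 T (t, u)) as Htu by (unfold S3, S2 in *; simpl in *; lra).
  assert (H' := H). unfold S3 in H'; simpl in H'.
  assert (l0 := sm_lin sm (t := t - u) ltac:(lra)).
  assert (ls := Xs_lin HX Htu).
  assert (h := Xi_Xi (y s) H).
  change (Xi X t u (Xi X u s (y s)))
    with (plus (SE (t - u) (Xi X u s (y s))) (Xs X t u (Xi X u s (y s)))) in h.
  unfold hdelta2, remainder.
  rewrite (linear_minus _ _ _ l0), (linear_minus _ _ _ ls).
  change (Xi X t u (y u)) with (plus (SE (t - u) (y u)) (Xs X t u (y u))).
  set (A := Xi X t s (y s)) in *.
  replace (chi X t u s (y s)) with (minus (plus A (chi X t u s (y s))) A)
    by module_eq_in E.
  rewrite <- h. module_eq_in E.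
Qed.

End Path.
End Global.

(** * Uniqueness, linearity and stability of solutions *)

Section Stability.

Variables (E F : NormedModule R_AbsRing).
Variables (j : E -> F) (SE : R -> E -> E) (e CS CJ : R).
Hypothesis sm : smoothing j SE e CS CJ.
Variables (T k0 k1 k2 K tau C : R).
Hypotheses (Hk0 : 0 < k0) (Hk1 : 0 < k1) (Hk12 : k1 < k2) (Hk2 : k2 < 4 * k0).
Hypotheses (HK : 0 <= K) (Htau : 0 < tau <= 1) (HC1 : 1 <= C).

Let nrm := graded_norm j.
Let ex := graded_exponent e.
Let rough_ok := rough_bounds j e T k0.
Let Xi := one_step SE.
Let ex_nonneg f : 0 <= ex f := graded_exponent_nonneg sm f.
Let rem := remainder SE.
Let chen := chen_relations SE T.

Hypothesis Hap : apriori_prop j SE e T k0 k1 K tau C.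

(* Solutions of the rough equation, characterised by the order of their remainder
   with respect to [S + X1 + X2 + X3]; no sewing map is involved. *)
Definition asol (X : rough E) (a b : R) (psi : E) (y : R -> E) : Prop :=
  y a = psi /\
  exists L, (forall t, a <= t <= b -> norm (y t) <= L) /\
    forall f t s, a <= s -> s <= t -> t <= b ->
      nrm f (rem X y t s) <= L * rpow (t - s) (ex f + k2).

(** A remainder of the better order k2 satisfies the small-scale hypothesis for k1 with any eta > 0,
    once L d^(k2-k1) <= eta. Both d and eta then tend to 0, and L disappears from the result. *)
Lemma apriori_limit X a b (w : R -> E) (Rm : R -> R -> E) eps L :
  rough_ok K X -> 0 <= a -> b <= T -> 0 <= eps ->
  (forall t s, a <= s -> s <= t -> t <= b -> t - s <= tau ->
     norm (minus (minus (w t) (Xi X t s (w s))) (Rm t s)) <= eps) ->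
  (forall f t u s, a <= s -> s <= u -> u <= t -> t <= b -> t - s <= tau ->
     nrm f (minus (hdelta2 SE Rm t u s)
              (plus (chi X t u s (w s)) (Xs X t u (Rm u s))))
       <= eps * rpow (t - s) (ex f + k1)) ->
  (forall t, a <= t <= b -> norm (w t) <= L) ->
  (forall f t s, a <= s -> s <= t -> t <= b ->
     nrm f (Rm t s) <= L * rpow (t - s) (ex f + k2)) ->
  (forall t, a <= t <= b -> norm (w t) <= C * (norm (w a) + eps)) /\
  forall f t s, a <= s -> s <= t -> t <= b -> t - s <= tau ->
    nrm f (Rm t s) <= C * (norm (w a) + eps) * rpow (t - s) (ex f + k1).
Proof.
  intros HX Ha Hb Heps H1 H2 H3 H4.
  destruct (Rle_lt_dec a b) as [Hab|Hab]; [|split; intros; lra].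
  assert (HL : 0 <= L) by (apply Rle_trans with (norm (w a)); [apply norm_ge_0|apply H3; lra]).
  assert (main : forall eta m, 0 < eta -> 0 < m -> exists d, 0 < d /\ d <= m /\
    (forall t, a <= t <= b -> norm (w t) <= C * (norm (w a) + (eps + eta))) /\
    forall f t s, a <= s -> s <= t -> t <= b -> t - s <= tau ->
    nrm f (Rm t s) <= C * (norm (w a) + (eps + eta)) * rpow (Rmax (t - s) d) (ex f + k1)).
  { intros eta m Heta Hm.
    destruct (rpow_small (k2 - k1) (eta / (L + 1)) ltac:(lra)) as [d0 [Hd0 Hd0s]].
    { apply Rdiv_lt_0_compat; lra. }
    set (d := Rmin d0 (Rmin tau m)).
    assert (Hd : 0 < d) by (repeat apply Rmin_pos; lra).
    assert (Hdd0 : d <= d0) by apply Rmin_l.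
    assert (Hdm : d <= Rmin tau m) by apply Rmin_r.
    assert (Hdt : d <= tau) by (apply Rle_trans with (1 := Hdm), Rmin_l).
    exists d. split; [easy|]. split; [apply Rle_trans with (1 := Hdm), Rmin_r|].
    apply (Hap HX (d := d)); try lra.
    - intros t s h1 h2 h3 h4. apply Rle_trans with (1 := H1 t s h1 h2 h3 h4). lra.
    - intros f t u s h1 h2 h3 h4 h5 h6.
      apply Rle_trans with (1 := H2 f t u s h1 h2 h3 h4 h6).
      apply Rmult_le_compat_r; [apply rpow_nonneg|lra].
    - intros f t s h1 h2 h3 h4. apply Rle_trans with (1 := H4 f t s h1 h2 h3).
      apply Rle_trans with (L * rpow d (ex f + k2)).
      { apply Rmult_le_compat_l; [easy|]. apply rpow_le; [|easy].
        generalize (ex_nonneg f); lra. }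
      replace (ex f + k2) with ((k2 - k1) + (ex f + k1)) by ring.
      rewrite rpow_plus, <- Rmult_assoc.
      apply Rmult_le_compat_r; [apply rpow_nonneg|].
      specialize (Hd0s d Hdd0).
      assert (h := rpow_nonneg d (k2 - k1)).
      apply Rle_trans with ((L + 1) * (eta / (L + 1))).
      + apply Rmult_le_compat; lra.
      + replace ((L + 1) * (eta / (L + 1))) with eta by (field; lra). lra.
    - exists (L + L * rpow (b - a) k2). split.
      + intros t Ht. specialize (H3 t Ht).
        assert (h := rpow_nonneg (b - a) k2). nra.
      + intros t s h1 h2 h3. assert (h := H4 false t s h1 h2 h3).
        unfold nrm, ex in h; simpl in h. rewrite Rplus_0_l in h.
        assert (h' : rpow (t - s) k2 <= rpow (b - a) k2) by (apply rpow_le; lra).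
        apply Rle_trans with (1 := h).
        assert (L * rpow (t - s) k2 <= L * rpow (b - a) k2) by (apply Rmult_le_compat_l; lra).
        lra. }
  assert (Hna := norm_ge_0 (w a)).
  split.
  - intros t Ht. apply le_epsilon. intros eta Heta.
    destruct (main (eta / C) 1) as [d [_ [_ [h _]]]]; [|lra|].
    { apply Rdiv_lt_0_compat; lra. }
    apply Rle_trans with (1 := h t Ht). right. field. lra.
  - intros f t s h1 h2 h3 h4.
    destruct (Rle_lt_dec t s) as [h5|h5].
    { replace t with s by lra.
      apply Rle_trans with (1 := H4 f s s h1 (Rle_refl s) ltac:(lra)).
      rewrite !(rpow_nonpos (s - s)) by lra. lra. }
    apply le_epsilon. intros eta Heta.
    set (y := rpow (t - s) (ex f + k1)).
    assert (Hy : 0 < y) by (apply rpow_pos; lra).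
    assert (HCy : 0 < C * y) by nra.
    (* Asking for d <= t - s makes [Rmax (t - s) d] equal to t - s. *)
    destruct (main (eta / (C * y)) (t - s)) as [d [_ [Hd [_ h]]]]; [|lra|].
    { now apply Rdiv_lt_0_compat. }
    specialize (h f t s h1 h2 h3 h4). rewrite Rmax_left in h by easy. fold y in h.
    apply Rle_trans with (1 := h). right. field. split; lra.
Qed.

Section Fixed.
Variable X : rough E.
Hypotheses (HX : rough_ok K X) (HC : chen X).

Lemma asol_bound a b psi y :
  0 <= a -> b <= T -> asol X a b psi y ->
  (forall t, a <= t <= b -> norm (y t) <= C * norm psi) /\
  forall f t s, a <= s -> s <= t -> t <= b -> t - s <= tau ->
    nrm f (rem X y t s) <= C * norm psi * rpow (t - s) (ex f + k1).
Proof.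
  intros Ha Hb [H0 [L [H1 H2]]].
  rewrite <- H0. rewrite <- (Rplus_0_r (norm (y a))).
  apply (apriori_limit (Rm := rem X y) (L := L) HX Ha Hb (Rle_refl 0)); try easy.
  - intros t s h1 h2 h3 h4. right.
    replace (minus (minus (y t) (Xi X t s (y s))) (rem X y t s)) with (@zero E).
    + apply norm_zero.
    + unfold rem, remainder, Xi. module_eq_in E.
  - intros f t u s h1 h2 h3 h4 h5. right.
    rewrite Rmult_0_l.
    assert (H3 : S3 0 T (t, u, s)) by (unfold S3; simpl; lra).
    replace (hdelta2 SE (rem X y) t u s)
      with (plus (chi X t u s (y s)) (Xs X t u (rem X y u s))).
    + match goal with |- nrm f ?v = 0 => replace v with (@zero E) end.
      * apply (nrm_zero sm).
      * module_eq_in E.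
    + symmetry. exact (rem_delta sm HX HC y H3).
Qed.

Lemma asol_lin a b p q al be y z :
  0 <= a -> b <= T -> asol X a b p y -> asol X a b q z ->
  asol X a b (plus (scal al p) (scal be q))
    (fun t => plus (scal al (y t)) (scal be (z t))).
Proof.
  intros Ha Hb [<- [L [H1 H2]]] [<- [L' [H1' H2']]].
  split; [easy|]. exists (Rabs al * L + Rabs be * L').
  split.
  - intros t Ht. specialize (H1 t Ht). specialize (H1' t Ht).
    eapply Rle_trans; [apply norm_triangle|].
    rewrite (norm_scal_R al), (norm_scal_R be).
    assert (ha := Rabs_pos al). assert (hb := Rabs_pos be). nra.
  - intros f t s h1 h2 h3.
    specialize (H2 f t s h1 h2 h3). specialize (H2' f t s h1 h2 h3).
    assert (S2 0 T (t, s)) as Hts by (unfold S2; simpl; lra).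
    assert (l := Xi_lin sm HX Hts).
    unfold rem, remainder in *.
    rewrite (linear_plus _ l), !(linear_scal _ l).
    match goal with |- nrm f ?v <= _ => replace v with
      (plus (scal al (minus (y t) (one_step SE X t s (y s)))) (scal be (minus (z t) (one_step SE X t s (z s)))))
    end.
    2: module_eq_in E.
    eapply Rle_trans; [apply (nrm_plus sm)|]. fold nrm.
    assert (sc : forall c v, nrm f (scal c v) = Rabs c * nrm f v).
    { intros c v. unfold nrm; destruct f; simpl.
      - rewrite (linear_scal _ (sm_j sm)). apply (norm_scal_R c).
      - apply (norm_scal_R c). }
    rewrite !sc.
    assert (ha := Rabs_pos al). assert (hb := Rabs_pos be).
    assert (Rabs al * nrm f (minus (y t) (one_step SE X t s (y s)))
      <= Rabs al * (L * rpow (t - s) (ex f + k2))) by (apply Rmult_le_compat_l; easy).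
    assert (Rabs be * nrm f (minus (z t) (one_step SE X t s (z s)))
      <= Rabs be * (L' * rpow (t - s) (ex f + k2))) by (apply Rmult_le_compat_l; easy).
    lra.
Qed.

(** The difference is a solution started from 0, which [asol_bound] forces to vanish. *)
Lemma asol_unique a b psi y z :
  0 <= a -> b <= T -> asol X a b psi y -> asol X a b psi z ->
  forall t, a <= t <= b -> y t = z t.
Proof.
  intros Ha Hb Hy Hz t Ht.
  destruct (asol_bound Ha Hb (asol_lin 1 (-1) Ha Hb Hy Hz)) as [h _].
  specialize (h t Ht).
  assert (h0 : norm (plus (scal 1 psi) (scal (-1) psi)) = 0).
  { replace (plus (scal 1 psi) (scal (-1) psi)) with (@zero E) by module_eq_in E.
    apply norm_zero. }
  assert (h1 : plus (scal 1 (y t)) (scal (-1) (z t)) = zero).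
  { apply (@norm_eq_zero R_AbsRing E). apply Rle_antisym; [|apply norm_ge_0].
    rewrite <- (Rmult_0_r C), <- h0. exact h. }
  transitivity (plus (plus (scal 1 (y t)) (scal (-1) (z t))) (z t)); [module_eq_in E|].
  rewrite h1. apply plus_zero_l.
Qed.

Lemma asol_restrict a a' b psi y :
  a <= a' -> asol X a b psi y -> asol X a' b (y a') y.
Proof.
  intros Ha [H0 [L [H1 H2]]]. split; [easy|]. exists L. split.
  - intros t Ht. apply H1; lra.
  - intros f t s h1 h2 h3. apply H2; lra.
Qed.

End Fixed.

Definition rough_close (D : R) (X X' : rough E) : Prop :=
  forall f t s v, S2 0 T (t, s) ->
    nrm f (minus (X1 X' t s v) (X1 X t s v)) <= D * rpow (t - s) (ex f + k0) * norm v /\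
    nrm f (minus (X2 X' t s v) (X2 X t s v)) <= D * rpow (t - s) (ex f + 2 * k0) * norm v /\
    nrm f (minus (X3 X' t s v) (X3 X t s v)) <= D * rpow (t - s) (ex f + 3 * k0) * norm v.

Lemma Xs_close D X X' f t s v : 0 <= D -> rough_close D X X' ->
  S2 0 T (t, s) -> t - s <= 1 ->
  nrm f (minus (Xs X' t s v) (Xs X t s v)) <= 3 * D * rpow (t - s) (ex f + k0) * norm v.
Proof.
  intros HD HX H Ht. destruct (HX f t s v H) as [h1 [h2 h3]].
  replace (minus (Xs X' t s v) (Xs X t s v)) with
    (plus (minus (X1 X' t s v) (X1 X t s v))
      (plus (minus (X2 X' t s v) (X2 X t s v)) (minus (X3 X' t s v) (X3 X t s v))))
    by (unfold Xs; module_eq_in E).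
  eapply Rle_trans; [apply (nrm_plus sm)|].
  eapply Rle_trans; [apply Rplus_le_compat_l, (nrm_plus sm)|].
  assert (Hv := norm_ge_0 v).
  assert (g : forall i, 1 <= i ->
     D * rpow (t - s) (ex f + i * k0) * norm v <= D * rpow (t - s) (ex f + k0) * norm v).
  { intros i Hi. apply Rmult_le_compat_r; [easy|]. apply Rmult_le_compat_l; [easy|].
    apply rpow_le_exp; [easy|nra]. }
  assert (g2 := g 2 ltac:(lra)). assert (g3 := g 3 ltac:(lra)).
  fold nrm. lra.
Qed.

Lemma prod_close D f p q (A A' B B' : E -> E) t1 t2 t (z : E) :
  0 <= D -> is_linear A ->
  (forall v, nrm f (A v) <= K * rpow t1 (ex f + p) * norm v) ->
  (forall v, nrm f (minus (A' v) (A v)) <= D * rpow t1 (ex f + p) * norm v) ->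
  norm (B' z) <= K * rpow t2 q * norm z ->
  norm (minus (B' z) (B z)) <= D * rpow t2 q * norm z ->
  t1 <= t -> t2 <= t -> t <= 1 -> 0 <= p -> 0 <= q -> 4 * k0 <= p + q ->
  nrm f (minus (A' (B' z)) (A (B z))) <= 2 * K * D * rpow t (ex f + 4 * k0) * norm z.
Proof.
  intros HD HA h1 h2 h3 h4 i1 i2 i3 i4 i5 i6.
  replace (minus (A' (B' z)) (A (B z))) with
    (plus (minus (A' (B' z)) (A (B' z))) (A (minus (B' z) (B z)))).
  2: { rewrite (linear_minus _ _ _ HA). module_eq_in E. }
  eapply Rle_trans; [apply (nrm_plus sm)|].
  assert (Hz := norm_ge_0 z).
  assert (g1 := prod_bd sm (A := fun v => minus (A' v) (A v)) HD HK Hz h2 h3 i1 i2 i3 i4 i5 i6).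
  assert (g2 := prod_bd sm HK HD Hz h1 h4 i1 i2 i3 i4 i5 i6).
  simpl in g1. fold ex nrm in g1, g2. fold nrm. lra.
Qed.

Lemma chi_close D X X' f t u s v : 0 <= D ->
  rough_ok K X -> rough_ok K X' -> rough_close D X X' ->
  S3 0 T (t, u, s) -> t - s <= 1 ->
  nrm f (minus (chi X' t u s v) (chi X t u s v))
    <= 12 * K * D * rpow (t - s) (ex f + 4 * k0) * norm v.
Proof.
  intros HD HX HX' HXX H Ht.
  assert (H' := H). unfold S3 in H'; simpl in H'.
  assert (Htu : S2 0 T (t, u)) by (unfold S2; simpl; lra).
  assert (Hus : S2 0 T (u, s)) by (unfold S2; simpl; lra).
  destruct (ro_lin HX Htu) as [l1 [l2 l3]].
  destruct (ro_false HX' v Hus) as [b1 [b2 b3]].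
  destruct (HXX false u s v Hus) as [d1 [d2 d3]].
  unfold nrm, ex, graded_exponent in d1, d2, d3; simpl in d1, d2, d3. rewrite Rplus_0_l in d1, d2, d3.
  assert (c1 := fun v => proj1 (HXX f t u v Htu)).
  assert (c2 := fun v => proj1 (proj2 (HXX f t u v Htu))).
  assert (c3 := fun v => proj2 (proj2 (HXX f t u v Htu))).
  assert (e1 := fun v => ro_1 HX f v Htu).
  assert (e2 := fun v => ro_2 HX f v Htu).
  assert (e3 := fun v => ro_3 HX f v Htu).
  assert (g13 := prod_close HD l1 e1 c1 b3 d3 (t := t - s)
    ltac:(lra) ltac:(lra) Ht ltac:(lra) ltac:(lra) ltac:(lra)).
  assert (g22 := prod_close HD l2 e2 c2 b2 d2 (t := t - s)
    ltac:(lra) ltac:(lra) Ht ltac:(lra) ltac:(lra) ltac:(lra)).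
  assert (g23 := prod_close HD l2 e2 c2 b3 d3 (t := t - s)
    ltac:(lra) ltac:(lra) Ht ltac:(lra) ltac:(lra) ltac:(lra)).
  assert (g31 := prod_close HD l3 e3 c3 b1 d1 (t := t - s)
    ltac:(lra) ltac:(lra) Ht ltac:(lra) ltac:(lra) ltac:(lra)).
  assert (g32 := prod_close HD l3 e3 c3 b2 d2 (t := t - s)
    ltac:(lra) ltac:(lra) Ht ltac:(lra) ltac:(lra) ltac:(lra)).
  assert (g33 := prod_close HD l3 e3 c3 b3 d3 (t := t - s)
    ltac:(lra) ltac:(lra) Ht ltac:(lra) ltac:(lra) ltac:(lra)).
  replace (minus (chi X' t u s v) (chi X t u s v)) with
    (plus (plus (minus (X1 X' t u (X3 X' u s v)) (X1 X t u (X3 X u s v)))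
          (plus (minus (X2 X' t u (X2 X' u s v)) (X2 X t u (X2 X u s v)))
                (minus (X2 X' t u (X3 X' u s v)) (X2 X t u (X3 X u s v)))))
          (plus (minus (X3 X' t u (X1 X' u s v)) (X3 X t u (X1 X u s v)))
          (plus (minus (X3 X' t u (X2 X' u s v)) (X3 X t u (X2 X u s v)))
                (minus (X3 X' t u (X3 X' u s v)) (X3 X t u (X3 X u s v))))))
    by (unfold chi; module_eq_in E).
  assert (p3 : forall x y z : E, nrm f (plus x (plus y z)) <= nrm f x + (nrm f y + nrm f z)).
  { intros. eapply Rle_trans; [apply (nrm_plus sm)|].
    apply Rplus_le_compat_l, (nrm_plus sm). }
  eapply Rle_trans; [apply (nrm_plus sm)|].
  eapply Rle_trans; [apply Rplus_le_compat; apply p3|].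
  lra.
Qed.

Lemma chi_minus X t u s v w : rough_ok K X -> S3 0 T (t, u, s) ->
  chi X t u s (minus v w) = minus (chi X t u s v) (chi X t u s w).
Proof.
  intros HX H. unfold S3 in H; simpl in H.
  assert (Htu : S2 0 T (t, u)) by (unfold S2; simpl; lra).
  assert (Hus : S2 0 T (u, s)) by (unfold S2; simpl; lra).
  destruct (ro_lin HX Htu) as [l1 [l2 l3]].
  destruct (ro_lin HX Hus) as [m1 [m2 m3]].
  unfold chi.
  rewrite (linear_minus _ _ _ m1), (linear_minus _ _ _ m2), (linear_minus _ _ _ m3).
  rewrite (linear_minus _ _ _ l1), !(linear_minus _ _ _ l2), !(linear_minus _ _ _ l3).
  module_eq_in E.
Qed.

(** The difference y' - y solves the equation driven by X up to a defect: X' - X applied to y' and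
    to its remainder. In [eps] the part 12 K D comes from [chi_close], the part 3 D from [Xs_close],
    and C norm psi' bounds y' and its remainder. The a priori bound for X with this [eps] does the
    rest. *)
Lemma asol_stable X X' D a b psi psi' y y' kap :
  rough_ok K X -> rough_ok K X' -> chen X -> chen X' ->
  0 <= D -> rough_close D X X' -> 0 <= a -> b <= T ->
  asol X a b psi y -> asol X' a b psi' y' -> kap <= k0 -> kap <= k1 ->
  let eps := (12 * K + 3) * D * C * norm psi' in
  let A := C * (norm (minus psi' psi) + eps) in
  (forall t, a <= t <= b -> norm (minus (y' t) (y t)) <= A) /\
  forall t s, a <= s -> s <= t -> t <= b -> t - s <= tau ->
    norm (minus (hdelta1 SE y' t s) (hdelta1 SE y t s))
      <= (eps + (3 * K + 1) * A) * rpow (t - s) kap.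
Proof.
  intros HX HX' HC HC' HD HXX Ha Hb Hy Hy' Hka Hkb eps A.
  destruct (asol_bound HX HC Ha Hb Hy) as [b1 b2].
  destruct (asol_bound HX' HC' Ha Hb Hy') as [b1' b2'].
  assert (HQ : 0 <= C * norm psi') by (generalize (norm_ge_0 psi'); nra).
  set (Q := C * norm psi') in *.
  assert (HDQ : 0 <= D * Q) by now apply Rmult_le_pos.
  assert (HKDQ : 0 <= K * (D * Q)) by now apply Rmult_le_pos.
  assert (Heps' : eps = 12 * (K * (D * Q)) + 3 * (D * Q)) by (unfold eps, Q; ring).
  assert (Heps : 0 <= eps) by lra.
  assert (dXs : forall t s, a <= s -> s <= t -> t <= b -> t - s <= tau ->
     norm (minus (Xs X' t s (y' s)) (Xs X t s (y' s))) <= 3 * (D * Q) * rpow (t - s) k0).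
  { intros t s h1 h2 h3 h4.
    assert (g := Xs_close false (y' s) HD HXX (t := t) (s := s)
      ltac:(unfold S2; simpl; lra) ltac:(lra)).
    unfold nrm, ex, graded_exponent in g; simpl in g. rewrite Rplus_0_l in g.
    apply Rle_trans with (1 := g).
    replace (3 * (D * Q) * rpow (t - s) k0) with (3 * D * rpow (t - s) k0 * Q) by ring.
    apply Rmult_le_compat_l; [|apply b1'; lra].
    apply Rmult_le_pos; [lra|apply rpow_nonneg]. }
  assert (main : (forall t, a <= t <= b -> norm (minus (y' t) (y t)) <= A) /\
    forall f t s, a <= s -> s <= t -> t <= b -> t - s <= tau ->
      nrm f (minus (rem X' y' t s) (rem X y t s)) <= A * rpow (t - s) (ex f + k1)).
  { destruct Hy as [y0 [L [L1 L2]]]. destruct Hy' as [y0' [L' [L1' L2']]].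
    unfold A. rewrite <- y0, <- y0'.
    apply (apriori_limit (X := X) (w := fun t => minus (y' t) (y t))
      (Rm := fun t s => minus (rem X' y' t s) (rem X y t s)) (L := L' + L)); try easy.
    - intros t s h1 h2 h3 h4.
      assert (lX := Xi_lin sm HX (t := t) (s := s) ltac:(unfold S2; simpl; lra)).
      replace (minus (minus (minus (y' t) (y t)) (Xi X t s (minus (y' s) (y s))))
                (minus (rem X' y' t s) (rem X y t s)))
        with (minus (Xs X' t s (y' s)) (Xs X t s (y' s))).
      2: { unfold Xi. rewrite (linear_minus _ _ _ lX).
           unfold rem, remainder, one_step. module_eq_in E. }
      apply Rle_trans with (1 := dXs t s h1 h2 h3 h4).
      assert (rpow (t - s) k0 <= 1) by (apply rpow_le_1; lra).
      assert (0 <= rpow (t - s) k0) by apply rpow_nonneg. nra.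
    - intros f t u s h1 h2 h3 h4 h5.
      assert (H3 : S3 0 T (t, u, s)) by (unfold S3; simpl; lra).
      assert (Htu : S2 0 T (t, u)) by (unfold S2; simpl; lra).
      assert (lX := Xs_lin HX Htu). assert (l0 := sm_lin sm (t := t - u) ltac:(lra)).
      assert (r1 := rem_delta sm HX HC y H3). assert (r2 := rem_delta sm HX' HC' y' H3).
      fold rem in r1, r2.
      match goal with |- nrm f ?v <= _ => replace v with
       (plus (minus (chi X' t u s (y' s)) (chi X t u s (y' s)))
          (minus (Xs X' t u (rem X' y' u s)) (Xs X t u (rem X' y' u s)))) end.
      2: { rewrite (chi_minus _ _ HX H3), (linear_minus _ _ _ lX).
           transitivity (minus (minus (plus (chi X' t u s (y' s)) (Xs X' t u (rem X' y' u s)))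
             (plus (chi X t u s (y s)) (Xs X t u (rem X y u s))))
             (plus (minus (chi X t u s (y' s)) (chi X t u s (y s)))
               (minus (Xs X t u (rem X' y' u s)) (Xs X t u (rem X y u s))))).
           - module_eq_in E.
           - rewrite <- r1, <- r2. unfold hdelta2. rewrite (linear_minus _ _ _ l0).
             module_eq_in E. }
      eapply Rle_trans; [apply (nrm_plus sm)|]. fold nrm.
      assert (g1 := chi_close f (y' s) HD HX HX' HXX H3 ltac:(lra)).
      assert (Hex := ex_nonneg f).
      assert (g2 : nrm f (minus (Xs X' t u (rem X' y' u s)) (Xs X t u (rem X' y' u s)))
          <= 3 * D * 1 * rpow (t - s) (ex f + k1) * Q).
      { apply (prod_bd sm (A := fun v => minus (Xs X' t u v) (Xs X t u v))
          (p := k0) (q := k1) (t1 := t - u) (t2 := u - s)); try lra.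
        - intros v. apply (Xs_close f v HD HXX Htu). lra.
        - rewrite Rmult_1_l.
          assert (g3 := b2' false u s h1 h2 ltac:(lra) ltac:(lra)).
          unfold nrm, ex, graded_exponent in g3; simpl in g3. rewrite Rplus_0_l in g3.
          apply Rle_trans with (1 := g3). right. unfold Q. ring. }
      assert (g4 : rpow (t - s) (ex f + 4 * k0) <= rpow (t - s) (ex f + k1))
        by (apply rpow_le_exp; lra).
      assert (g5 : norm (y' s) <= Q) by (apply b1'; lra).
      set (z := rpow (t - s) (ex f + k1)) in *.
      assert (g6 : 12 * K * D * rpow (t - s) (ex f + 4 * k0) * norm (y' s) <= 12 * K * D * z * Q).
      { assert (hKD : 0 <= K * D) by now apply Rmult_le_pos.
        assert (0 <= 12 * K * D) by lra.
        apply Rmult_le_compat; [|apply norm_ge_0| |easy].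
        - apply Rmult_le_pos; [easy|apply rpow_nonneg].
        - now apply Rmult_le_compat_l. }
      rewrite Heps'. lra.
    - intros t Ht. eapply Rle_trans; [apply norm_minus_le|].
      generalize (L1 t Ht) (L1' t Ht). lra.
    - intros f t s h1 h2 h3. eapply Rle_trans; [apply (nrm_minus sm)|].
      generalize (L2 f t s h1 h2 h3) (L2' f t s h1 h2 h3). fold nrm. lra. }
  destruct main as [m1 m2]. split; [exact m1|].
  intros t s h1 h2 h3 h4.
  assert (Hts : S2 0 T (t, s)) by (unfold S2; simpl; lra).
  assert (lX := Xs_lin HX Hts).
  (* Each hdelta y is Xs (y) plus the remainder; the change of operator is separated from the change
     of path. *)
  replace (minus (hdelta1 SE y' t s) (hdelta1 SE y t s)) with
    (plus (minus (Xs X' t s (y' s)) (Xs X t s (y' s)))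
       (plus (Xs X t s (minus (y' s) (y s))) (minus (rem X' y' t s) (rem X y t s)))).
  2: { rewrite (linear_minus _ _ _ lX). unfold hdelta1, rem, remainder, one_step.
       module_eq_in E. }
  eapply Rle_trans; [apply norm_triangle|].
  eapply Rle_trans; [apply Rplus_le_compat_l, norm_triangle|].
  assert (g1 := dXs t s h1 h2 h3 h4).
  assert (g2 := Xs_bd sm Hk0 HK HX false (minus (y' s) (y s)) Hts ltac:(lra)).
  assert (g3 := m2 false t s h1 h2 h3 h4).
  unfold nrm, ex, graded_exponent in g2, g3; simpl in g2, g3. rewrite Rplus_0_l in g2, g3.
  assert (i0 : rpow (t - s) k0 <= rpow (t - s) kap) by (apply rpow_le_exp; lra).
  assert (i1 : rpow (t - s) k1 <= rpow (t - s) kap) by (apply rpow_le_exp; lra).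
  assert (p0 := rpow_nonneg (t - s) k0). assert (p1 := rpow_nonneg (t - s) k1).
  assert (g5 : norm (minus (y' s) (y s)) <= A) by (apply m1; lra).
  assert (HA : 0 <= A) by (apply Rle_trans with (2 := g5), norm_ge_0).
  set (z := rpow (t - s) kap) in *.
  assert (g6 : 3 * K * rpow (t - s) k0 * norm (minus (y' s) (y s)) <= 3 * K * z * A).
  { apply Rmult_le_compat; [|apply norm_ge_0| |easy].
    - apply Rmult_le_pos; lra.
    - apply Rmult_le_compat_l; lra. }
  assert (g7 : A * rpow (t - s) k1 <= A * z) by now apply Rmult_le_compat_l.
  assert (g8 : 3 * (D * Q) * rpow (t - s) k0 <= eps * z).
  { apply Rmult_le_compat; lra. }
  lra.
Qed.

End Stability.

(** * Existence by the Euler scheme *)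

Section Euler.

Variables (E F : NormedModule R_AbsRing).
Variables (j : E -> F) (SE : R -> E -> E) (e CS CJ : R).
Hypothesis sm : smoothing j SE e CS CJ.
Hypothesis complete : forall u : nat -> E,
  (forall eps, 0 < eps -> exists N, forall n m, (N <= n)%nat -> (N <= m)%nat ->
     norm (minus (u n) (u m)) < eps) ->
  exists l : E, forall eps, 0 < eps -> exists N, forall n, (N <= n)%nat ->
     norm (minus (u n) l) < eps.
Variables (T k0 k1 k2 K tau1 C1 tau2 C2 : R).
Hypotheses (Hk0 : 0 < k0) (Hk1 : 0 < k1) (Hk12 : k1 < k2) (Hk2 : k2 < 4 * k0).
Hypotheses (HK : 0 <= K).
Hypotheses (Htau1 : 0 < tau1 <= 1) (HC1 : 1 <= C1).
Hypotheses (Htau2 : 0 < tau2 <= 1) (HC2 : 1 <= C2).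

Let nrm := graded_norm j.
Let ex := graded_exponent e.
Let rough_ok := rough_bounds j e T k0.
Let Xi := one_step SE.
Let ex_nonneg f : 0 <= ex f := graded_exponent_nonneg sm f.
Let rem := remainder SE.
Let chen := chen_relations SE T.

(** The exponent k2 bounds every scheme uniformly in its mesh. The weaker k1 is for differences of
    schemes, which then decay like a power k2 - k1 of the mesh. *)
Hypothesis Hap1 : apriori_prop j SE e T k0 k1 K tau1 C1.
Hypothesis Hap2 : apriori_prop j SE e T k0 k2 K tau2 C2.

Variable X : rough E.
Hypotheses (HX : rough_ok K X) (HC : chen X).

(** The order bounds at t = s force each X^i to vanish there, because [rpow] is 0 at 0. *)
Lemma Xi_diag t v : 0 <= t -> t <= T -> Xi X t t v = v.
Proof.
  intros h1 h2. assert (H : S2 0 T (t, t)) by (unfold S2; simpl; lra).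
  destruct (ro_false HX v H) as [f1 [f2 f3]].
  rewrite Rminus_diag, !rpow_nonpos, Rmult_0_r, Rmult_0_l in f1, f2, f3 by lra.
  assert (z : forall w : E, norm w <= 0 -> w = zero).
  { intros w Hw. apply norm_eq_zero. apply Rle_antisym; [easy|apply norm_ge_0]. }
  unfold Xi, one_step, Xs. rewrite (z _ f1), (z _ f2), (z _ f3), Rminus_diag, (sm_0 sm).
  module_eq_in E.
Qed.

Lemma Xi_bd_T : exists CX, 0 <= CX /\ forall t s v, S2 0 T (t, s) ->
  norm (Xi X t s v) <= CX * norm v.
Proof.
  set (c := rpow (1 + T) (3 * k0)). assert (Hc : 0 <= c) by apply rpow_nonneg.
  assert (HCS := sm_CS sm).
  exists (CS + 3 * K * c). split; [apply Rplus_le_le_0_compat; [lra|apply Rmult_le_pos; lra]|].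
  intros t s v H. destruct (ro_false HX v H) as [f1 [f2 f3]].
  unfold S2 in H; simpl in H.
  assert (b : forall i, 1 <= i -> i <= 3 ->
     K * rpow (t - s) (i * k0) * norm v <= K * c * norm v).
  { intros i hi1 hi2. apply Rmult_le_compat_r; [apply norm_ge_0|].
    apply Rmult_le_compat_l; [easy|].
    apply Rle_trans with (rpow (1 + T) (i * k0)); [apply rpow_le; nra|].
    unfold c. rewrite !rpow_Rpower by lra. apply Rle_Rpower; nra. }
  assert (b1 := b 1 ltac:(lra) ltac:(lra)). rewrite Rmult_1_l in b1.
  assert (b2 := b 2 ltac:(lra) ltac:(lra)). assert (b3 := b 3 ltac:(lra) ltac:(lra)).
  assert (f0 := sm_bd sm false v (t := t - s) ltac:(lra)). simpl in f0.
  unfold Xi, one_step, Xs.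
  eapply Rle_trans; [apply norm_triangle|].
  eapply Rle_trans; [apply Rplus_le_compat_l, norm_triangle|].
  eapply Rle_trans; [apply Rplus_le_compat_l, Rplus_le_compat_r, norm_triangle|].
  lra.
Qed.

Section Scheme.

Variables (a b d : R) (psi : E).
Hypotheses (Ha : 0 <= a) (Hb : b <= T) (Hd : 0 < d <= 1).

Fixpoint grid_value (n : nat) : E :=
  match n with
  | O => psi
  | S m => Xi X (a + INR (S m) * d) (a + INR m * d) (grid_value m)
  end.

Definition cell (t : R) : nat := Z.to_nat (Int_part ((t - a) / d)).

Definition euler (t : R) : E :=
  Xi X t (a + INR (cell t) * d) (grid_value (cell t)).

Lemma cell_spec t : a <= t ->
  a + INR (cell t) * d <= t < a + INR (S (cell t)) * d.
Proof.
  intros Ht. destruct (base_Int_part ((t - a) / d)) as [h1 h2].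
  assert (h0 : 0 <= (t - a) / d).
  { apply Rmult_le_pos; [lra|]. left. apply Rinv_0_lt_compat. lra. }
  assert (hz : (0 <= Int_part ((t - a) / d))%Z).
  { apply Z.lt_succ_r, lt_IZR. rewrite succ_IZR. lra. }
  assert (hI : INR (cell t) = IZR (Int_part ((t - a) / d))).
  { unfold cell. rewrite INR_IZR_INZ, Z2Nat.id; easy. }
  rewrite S_INR, hI. set (z := IZR (Int_part ((t - a) / d))) in *.
  assert (hd : (t - a) / d * d = t - a) by (field; lra).
  split; nra.
Qed.

(** The cell may be taken closed: at its right end [cell] is already n + 1, but a step of length
    zero is the identity, so both formulas agree. *)
Lemma euler_cell n t :
  a + INR n * d <= t -> t <= a + INR (S n) * d -> t <= T ->
  euler t = Xi X t (a + INR n * d) (grid_value n).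
Proof.
  intros h1 h2 h3. assert (hn := pos_INR n).
  assert (h0 : a <= t) by nra.
  destruct (cell_spec h0) as [h4 h5].
  assert (hlo : (n <= cell t)%nat).
  { apply Nat.lt_succ_r, INR_lt. apply Rmult_lt_reg_r with d; lra. }
  assert (hhi : (cell t <= S n)%nat).
  { apply INR_le. apply Rmult_le_reg_r with d; lra. }
  unfold euler.
  destruct (Nat.eq_dec (cell t) n) as [->|hne]; [easy|].
  replace (cell t) with (S n) in * by lia.
  replace t with (a + INR (S n) * d) by lra.
  rewrite Xi_diag; [easy| |lra]. generalize (pos_INR (S n)); nra.
Qed.

Lemma euler_grid n : a + INR n * d <= T -> euler (a + INR n * d) = grid_value n.
Proof.
  intros h. rewrite (euler_cell (n := n)); [|lra|rewrite S_INR; lra|easy].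
  apply Xi_diag; [|easy]. generalize (pos_INR n); nra.
Qed.

Lemma euler_start : a <= T -> euler a = psi.
Proof.
  intros h. replace a with (a + INR 0 * d) at 1 by (simpl; ring).
  apply euler_grid. simpl. lra.
Qed.

Lemma euler_step n t :
  a + INR n * d <= t -> t <= a + INR (S n) * d -> t <= T ->
  euler t = Xi X t (a + INR n * d) (euler (a + INR n * d)).
Proof.
  intros h1 h2 h3. rewrite (euler_cell h1 h2 h3), euler_grid by lra. easy.
Qed.

(** This bound depends on the mesh; it serves only as the start of the iteration in
    [euler_uniform]. *)
Lemma euler_bounded : exists W, forall t, a <= t <= b -> norm (euler t) <= W.
Proof.
  assert (HCS := sm_CS sm).
  assert (H : forall n, exists W, forall t, a <= t <= b -> t <= a + INR n * d ->
    norm (euler t) <= W).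
  { induction n as [|n [W IH]].
    - exists (norm psi). intros t h1 h2. simpl in h2.
      replace t with a by lra. rewrite euler_start by lra. lra.
    - exists (Rmax W ((CS + 3 * K) * W)). intros t h1 h2.
      destruct (Rle_lt_dec t (a + INR n * d)) as [h3|h3].
      + apply Rle_trans with (1 := IH t h1 h3), Rmax_l.
      + assert (hn := pos_INR n).
        rewrite (euler_step (n := n)); try lra. rewrite S_INR in h2.
        eapply Rle_trans; [|apply Rmax_r].
        apply Rle_trans with ((CS + 3 * K) * norm (euler (a + INR n * d))).
        * apply (Xi_bd sm Hk0 HK HX); [unfold S2; simpl; nra|lra].
        * apply Rmult_le_compat_l; [lra|]. apply IH; nra. }
  destruct (INR_unbounded ((b - a) / d)) as [N HN].
  destruct (H N) as [W HW]. exists W. intros t Ht. apply HW; [easy|].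
  assert (b - a <= INR N * d); [|lra].
  replace (b - a) with ((b - a) / d * d) by (field; lra).
  apply Rmult_le_compat_r; lra.
Qed.

(** Splitting at the grid point between two adjacent cells gives 6 K^2 for [chi], 6 K^2 for the
    right-hand remainder, CS times 6 K^2 for the left-hand one carried by the semigroup, and 3 K
    times 6 K^2 for [Xs] applied to it. *)
Definition defect_cst : R := 6 * (K * K) * (2 + CS) + 18 * (K * (K * K)).

(** Both values are single steps from the same grid point r, so by [Xi_Xi] the remainder is exactly
    minus [chi] at r. *)
Lemma euler_same_cell W f n t s :
  (forall t, a <= t <= b -> norm (euler t) <= W) ->
  a + INR n * d <= s -> s <= t -> t <= a + INR (S n) * d -> t <= b ->
  nrm f (rem X euler t s) <= 6 * (K * K) * rpow d (ex f + 4 * k0) * W.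
Proof.
  intros HW h1 h2 h3 h4. assert (hn := pos_INR n).
  assert (hnd : 0 <= INR n * d) by nra. assert (hS := S_INR n).
  set (r := a + INR n * d) in *.
  assert (H3 : S3 0 T (t, s, r)) by (unfold S3; simpl; unfold r in *; lra).
  assert (Hr : rem X euler t s = opp (chi X t s r (euler r))).
  { unfold rem, remainder. unfold r in *.
    rewrite (euler_step (n := n) (t := t)), (euler_step (n := n) (t := s)) by lra.
    fold r in H3 |- *.
    change (minus (Xi X t r (euler r)) (Xi X t s (Xi X s r (euler r)))
      = opp (chi X t s r (euler r))).
    assert (g : Xi X t s (Xi X s r (euler r)) = plus (Xi X t r (euler r)) (chi X t s r (euler r)))
      by exact (Xi_Xi sm HX HC (euler r) H3).
    rewrite g.
    module_eq_in E. }
  assert (Ho : nrm f (rem X euler t s) = nrm f (chi X t s r (euler r))).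
  { rewrite Hr. unfold nrm. destruct f; simpl.
    - rewrite (linear_opp _ _ (sm_j sm)). apply norm_opp.
    - apply norm_opp. }
  rewrite Ho.
  assert (hr : t - r <= d) by (unfold r; rewrite hS in h3; lra).
  assert (hr' : a <= r) by (unfold r; lra).
  apply Rle_trans with (1 := chi_bd sm Hk0 HK HX f (euler r) H3 ltac:(lra)).
  assert (g1 : rpow (t - r) (ex f + 4 * k0) <= rpow d (ex f + 4 * k0)).
  { apply rpow_le; [generalize (ex_nonneg f); lra|lra]. }
  assert (g2 := rpow_nonneg (t - r) (ex f + 4 * k0)).
  assert (0 <= 6 * (K * K)) by (assert (0 <= K * K) by (now apply Rmult_le_pos); lra).
  apply Rmult_le_compat; [now apply Rmult_le_pos|apply norm_ge_0| |apply HW; lra].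
  apply Rmult_le_compat_l; easy.
Qed.

(** Two times at distance at most d lie in one cell or in two adjacent ones; in the second case the
    increment is split at the common grid point. *)
Lemma euler_defect W f t s :
  (forall t, a <= t <= b -> norm (euler t) <= W) ->
  a <= s -> s <= t -> t <= b -> t - s <= d ->
  nrm f (rem X euler t s) <= defect_cst * rpow d (ex f + 4 * k0) * W.
Proof.
  intros HW h1 h2 h3 h4.
  assert (HW0 : 0 <= W) by (apply Rle_trans with (norm (euler s)); [apply norm_ge_0|apply HW; lra]).
  assert (HCS := sm_CS sm).
  assert (HKK : 0 <= K * K) by now apply Rmult_le_pos.
  assert (HKKK : 0 <= K * (K * K)) by now apply Rmult_le_pos.
  assert (HKC : 0 <= K * K * CS) by (apply Rmult_le_pos; lra).
  destruct (cell_spec h1) as [c1 c2]. set (n := cell s) in *.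
  set (p := rpow d (ex f + 4 * k0)). assert (Hp : 0 <= p) by apply rpow_nonneg.
  assert (HpW : 0 <= p * W) by now apply Rmult_le_pos.
  destruct (Rle_lt_dec t (a + INR (S n) * d)) as [h5|h5].
  { apply Rle_trans with (1 := euler_same_cell f HW c1 h2 h5 h3). fold p.
    rewrite !Rmult_assoc, (Rmult_comm p W). rewrite (Rmult_comm W p).
    unfold defect_cst. apply Rle_trans with ((6 * (K * K)) * (p * W)); [lra|].
    apply Rmult_le_compat_r; [easy|]. lra. }
  set (u := a + INR (S n) * d) in *.
  assert (hnn : 0 <= INR (S n) * d) by (generalize (pos_INR (S n)); nra).
  assert (hu : a <= u) by (unfold u; lra).
  assert (hu' : t <= a + INR (S (S n)) * d) by (rewrite (S_INR (S n)); unfold u in *; lra).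
  assert (H3 : S3 0 T (t, u, s)) by (unfold S3; simpl; lra).
  assert (Htu : S2 0 T (t, u)) by (unfold S2; simpl; lra).
  rewrite (split_increment SE (rem X euler) t u s).
  replace (hdelta2 SE (rem X euler) t u s)
    with (plus (chi X t u s (euler s)) (Xs X t u (rem X euler u s)))
    by (symmetry; exact (rem_delta sm HX HC euler H3)).
  eapply Rle_trans; [apply (nrm_plus sm)|].
  eapply Rle_trans; [apply Rplus_le_compat_r, (nrm_plus sm)|].
  eapply Rle_trans; [apply Rplus_le_compat_r, Rplus_le_compat_r, (nrm_plus sm)|].
  fold nrm.
  assert (g1 := chi_bd sm Hk0 HK HX f (euler s) H3 ltac:(lra)).
  assert (g2 := euler_same_cell f HW (Rle_refl _) (Rlt_le _ _ h5) hu' h3). fold p u in g2.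
  assert (g3 : forall f, nrm f (rem X euler u s) <= 6 * (K * K) * rpow d (ex f + 4 * k0) * W).
  { intros f'. apply (@euler_same_cell W f' n u s); [exact HW|easy|lra|apply Rle_refl|lra]. }
  assert (g4 := sm_bd sm f (rem X euler u s) (t := t - u) ltac:(lra)).
  assert (g5 : nrm f (Xs X t u (rem X euler u s))
     <= 3 * K * (6 * (K * K)) * rpow d (ex f + 4 * k0) * W).
  { apply (prod_bd sm (p := k0) (q := 4 * k0) (t1 := t - u) (t2 := d)); try lra.
    - intros v. apply (Xs_bd sm Hk0 HK HX f v Htu). lra.
    - assert (g6 := g3 false). unfold nrm, ex, graded_exponent in g6; simpl in g6.
      rewrite Rplus_0_l in g6. exact g6. }
  fold p in g5.
  assert (g7 : nrm f (chi X t u s (euler s)) <= 6 * (K * K) * p * W).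
  { apply Rle_trans with (1 := g1).
    apply Rmult_le_compat; [|apply norm_ge_0| |apply HW; lra].
    - apply Rmult_le_pos; [lra|apply rpow_nonneg].
    - apply Rmult_le_compat_l; [lra|]. apply rpow_le; [|lra].
      generalize (ex_nonneg f); lra. }
  assert (g8 : CS * nrm f (rem X euler u s) <= CS * (6 * (K * K) * p * W)).
  { apply Rmult_le_compat_l; [lra|]. apply g3. }
  unfold defect_cst. fold nrm in g4. lra.
Qed.

End Scheme.

Lemma rem_fits y t s :
  norm (minus (minus (y t) (Xi X t s (y s))) (rem X y t s)) = 0.
Proof.
  replace (minus (minus (y t) (Xi X t s (y s))) (rem X y t s)) with (@zero E).
  - apply norm_zero.
  - unfold rem, remainder, Xi. module_eq_in E.
Qed.

Lemma rem_delta_fits f y t u s : S3 0 T (t, u, s) ->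
  nrm f (minus (hdelta2 SE (rem X y) t u s)
     (plus (chi X t u s (y s)) (Xs X t u (rem X y u s)))) = 0.
Proof.
  intros H.
  replace (hdelta2 SE (rem X y) t u s)
    with (plus (chi X t u s (y s)) (Xs X t u (rem X y u s))).
  - match goal with |- nrm f ?v = 0 => replace v with (@zero E) end.
    + apply (nrm_zero sm).
    + module_eq_in E.
  - symmetry. exact (rem_delta sm HX HC y H).
Qed.

Lemma defect_cst_nonneg : 0 <= defect_cst.
Proof.
  unfold defect_cst. assert (HCS := sm_CS sm).
  assert (HKK : 0 <= K * K) by now apply Rmult_le_pos.
  assert (HKKK : 0 <= K * (K * K)) by now apply Rmult_le_pos.
  assert (HKC : 0 <= K * K * CS) by (apply Rmult_le_pos; lra).
  lra.
Qed.

(** Below the mesh the defect is M d^(4 k0 - k2) W times the admissible power of d, where W is a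
    bound of the scheme itself. For small d this is a small multiple of W, which the iteration
    absorbs; d0 depends neither on psi nor on the interval. *)
Lemma euler_uniform : exists d0, 0 < d0 /\ d0 <= tau2 /\
  forall a b d psi, 0 <= a -> b <= T -> 0 < d -> d <= d0 ->
  (forall t, a <= t <= b -> norm (euler a d psi t) <= 2 * C2 * norm psi) /\
  forall f t s, a <= s -> s <= t -> t <= b -> t - s <= tau2 ->
    nrm f (rem X (euler a d psi) t s)
      <= 2 * C2 * norm psi * rpow (Rmax (t - s) d) (ex f + k2).
Proof.
  assert (HM := defect_cst_nonneg). set (M := defect_cst) in *.
  assert (HCM : 0 <= C2 * M) by (apply Rmult_le_pos; lra).
  destruct (rpow_small (4 * k0 - k2) (/ (2 * (C2 * M + 1))) ltac:(lra)) as [d1 [Hd1 Hsm]].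
  { apply Rinv_0_lt_compat. lra. }
  exists (Rmin d1 tau2). split; [apply Rmin_pos; lra|]. split; [apply Rmin_r|].
  intros a b d psi Ha Hb Hd Hdd.
  assert (Hdd1 := Rle_trans _ _ _ Hdd (Rmin_l _ _)).
  assert (Hdt := Rle_trans _ _ _ Hdd (Rmin_r _ _)).
  assert (Hd' : 0 < d <= 1) by lra.
  destruct (Rle_lt_dec a b) as [Hab|Hab]; [|split; intros; lra].
  set (y := euler a d psi).
  assert (Hy0 : y a = psi) by (apply euler_start; lra).
  set (th := rpow d (4 * k0 - k2)). assert (Hth : 0 <= th) by apply rpow_nonneg.
  assert (Hhalf : C2 * M * th <= / 2).
  { apply Rle_trans with (C2 * M * (/ (2 * (C2 * M + 1)))).
    - apply Rmult_le_compat_l; [easy|]. now apply Hsm.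
    - apply Rmult_le_reg_r with (2 * (C2 * M + 1)); [lra|].
      rewrite Rmult_assoc, Rinv_l; lra. }
  destruct (euler_bounded psi Ha Hb Hd') as [W0 HW0]. fold y in HW0.
  assert (HMth : 0 <= M * th) by now apply Rmult_le_pos.
  assert (main : forall W, (forall t, a <= t <= b -> norm (y t) <= W) ->
    (forall t, a <= t <= b -> norm (y t) <= C2 * (norm psi + M * th * W)) /\
    forall f t s, a <= s -> s <= t -> t <= b -> t - s <= tau2 ->
    nrm f (rem X y t s)
      <= C2 * (norm psi + M * th * W) * rpow (Rmax (t - s) d) (ex f + k2)).
  { intros W HW. rewrite <- Hy0.
    assert (HWp : 0 <= W) by (apply Rle_trans with (norm (y a)); [apply norm_ge_0|apply HW; lra]).
    assert (Hepsp : 0 <= M * th * W) by now apply Rmult_le_pos.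
    apply (Hap2 HX (d := d)); try lra.
    - intros t s h1 h2 h3 h4.
      apply Rle_trans with 0; [right; apply rem_fits|exact Hepsp].
    - intros f t u s h1 h2 h3 h4 h5 h6.
      eapply Rle_trans; [right; apply rem_delta_fits; unfold S3; simpl; lra|].
      apply Rmult_le_pos; [easy|apply rpow_nonneg].
    - intros f t s h1 h2 h3 h4.
      eapply Rle_trans; [exact (euler_defect Ha Hb Hd' f HW h1 h2 h3 h4)|].
      fold M. right. unfold th. change (graded_exponent e f) with (ex f).
      replace (ex f + 4 * k0) with (4 * k0 - k2 + (ex f + k2)) by ring.
      rewrite rpow_plus. ring.
    - destruct Xi_bd_T as [CX [HCX HX']].
      exists (W0 + CX * W0).
      assert (HW0p : 0 <= W0) by (apply Rle_trans with (norm (y a)); [apply norm_ge_0|apply HW0; lra]).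
      assert (0 <= CX * W0) by now apply Rmult_le_pos.
      split; [intros t Ht; specialize (HW0 t Ht); lra|].
      intros t s h1 h2 h3. eapply Rle_trans; [apply norm_minus_le|].
      assert (g1 := HW0 t ltac:(lra)). assert (g2 := HW0 s ltac:(lra)).
      assert (g3 := HX' t s (y s) ltac:(unfold S2; simpl; lra)).
      assert (CX * norm (y s) <= CX * W0) by now apply Rmult_le_compat_l.
      unfold Xi in g3. lra. }
  assert (Hbd : forall t, a <= t <= b -> norm (y t) <= 2 * C2 * norm psi).
  { intros t Ht. rewrite <- (Rmult_1_l (2 * C2 * norm psi)), (Rmult_assoc 2).
    refine (halving (fun W => forall t, a <= t <= b -> norm (y t) <= W)
      (C2 * norm psi) W0 _ 1 Rle_0_1 HW0 _ _).
    - intros W HW r Hr. destruct (main W HW) as [g _].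
      assert (HWp : 0 <= W) by (apply Rle_trans with (norm (y a)); [apply norm_ge_0|apply HW; lra]).
      apply Rle_trans with (1 := g r Hr).
      assert (C2 * M * th * W <= / 2 * W) by now apply Rmult_le_compat_r.
      lra.
    - intros W HW. rewrite Rmult_1_l. now apply HW. }
  split; [exact Hbd|].
  intros f t s h1 h2 h3 h4. destruct (main _ Hbd) as [_ g].
  apply Rle_trans with (1 := g f t s h1 h2 h3 h4).
  apply Rmult_le_compat_r; [apply rpow_nonneg|].
  assert (Hn := norm_ge_0 psi).
  assert (C2 * M * th * norm psi <= / 2 * norm psi) by now apply Rmult_le_compat_r.
  assert (0 <= C2 * norm psi) by (apply Rmult_le_pos; lra).
  assert (C2 * (C2 * M * th * norm psi) <= C2 * (/ 2 * norm psi))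
    by (apply Rmult_le_compat_l; lra).
  lra.
Qed.

(** The difference of two schemes satisfies the linear remainder relation exactly, by [rem_delta],
    and starts from 0. The only error is the size of the two remainders below scale m, which is 2 L
    m^(k2 - k1) in units of order k1. *)
Lemma euler_cauchy d0 L a b psi :
  0 <= a -> a <= b -> b <= T -> 0 < d0 -> d0 <= tau2 ->
  (forall d, 0 < d -> d <= d0 ->
    (forall t, a <= t <= b -> norm (euler a d psi t) <= L) /\
    forall f t s, a <= s -> s <= t -> t <= b -> t - s <= tau2 ->
      nrm f (rem X (euler a d psi) t s) <= L * rpow (Rmax (t - s) d) (ex f + k2)) ->
  forall m d d', 0 < d -> d <= m -> 0 < d' -> d' <= m -> m <= d0 -> m <= tau1 ->
  forall t, a <= t <= b ->
    norm (minus (euler a d psi t) (euler a d' psi t)) <= 2 * C1 * L * rpow m (k2 - k1).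
Proof.
  intros Ha Hab Hb Hd0 Hd02 H m d d' h1 h2 h3 h4 h5 h6.
  destruct (H d h1 ltac:(lra)) as [A1 A2]. destruct (H d' h3 ltac:(lra)) as [B1 B2].
  set (y := euler a d psi) in *. set (z := euler a d' psi) in *.
  assert (Hy0 : y a = psi) by (apply euler_start; lra).
  assert (Hz0 : z a = psi) by (apply euler_start; lra).
  assert (HL : 0 <= L) by (apply Rle_trans with (norm (y a)); [apply norm_ge_0|apply A1; lra]).
  assert (Hw : norm (minus (y a) (z a)) = 0).
  { rewrite Hy0, Hz0. replace (minus psi psi) with (@zero E) by module_eq_in E.
    apply norm_zero. }
  set (eps := 2 * L * rpow m (k2 - k1)).
  assert (Heps : 0 <= eps) by (apply Rmult_le_pos; [lra|apply rpow_nonneg]).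
  intros t Ht.
  replace (2 * C1 * L * rpow m (k2 - k1)) with (C1 * (norm (minus (y a) (z a)) + eps))
    by (rewrite Hw; unfold eps; ring).
  revert t Ht.
  apply (Hap1 HX (w := fun t => minus (y t) (z t))
    (Rm := fun t s => minus (rem X y t s) (rem X z t s)) (d := m)); try lra.
  - intros t s i1 i2 i3 i4. apply Rle_trans with 0; [|easy].
    assert (lX := Xi_lin sm HX (t := t) (s := s) ltac:(unfold S2; simpl; lra)).
    rewrite (linear_minus _ _ _ lX). unfold rem, remainder. right.
    match goal with |- norm ?v = 0 => replace v with (@zero E) by module_eq_in E end.
    apply norm_zero.
  - intros f t u s i1 i2 i3 i4 i5 i6.
    assert (H3 : S3 0 T (t, u, s)) by (unfold S3; simpl; lra).
    assert (Htu : S2 0 T (t, u)) by (unfold S2; simpl; lra).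
    assert (lX := Xs_lin HX Htu). assert (l0 := sm_lin sm (t := t - u) ltac:(lra)).
    match goal with |- graded_norm _ f ?v <= _ => replace v with
     (minus (minus (hdelta2 SE (rem X y) t u s)
              (plus (chi X t u s (y s)) (Xs X t u (rem X y u s))))
            (minus (hdelta2 SE (rem X z) t u s)
              (plus (chi X t u s (z s)) (Xs X t u (rem X z u s))))) end.
    2: { rewrite (chi_minus _ _ HX H3), (linear_minus _ _ _ lX).
         unfold hdelta2. rewrite (linear_minus _ _ _ l0). module_eq_in E. }
    eapply Rle_trans; [apply (nrm_minus sm)|]. fold nrm.
    rewrite !rem_delta_fits by easy. rewrite Rplus_0_l.
    apply Rmult_le_pos; [easy|apply rpow_nonneg].
  - intros f t s i1 i2 i3 i4.
    eapply Rle_trans; [apply (nrm_minus sm)|].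
    assert (Hex := ex_nonneg f).
    assert (g : forall r, 0 < r -> r <= m ->
      L * rpow (Rmax (t - s) r) (ex f + k2) <= L * (rpow m (k2 - k1) * rpow m (ex f + k1))).
    { intros r hr1 hr2. rewrite <- rpow_plus. apply Rmult_le_compat_l; [easy|].
      replace (k2 - k1 + (ex f + k1)) with (ex f + k2) by ring.
      apply rpow_le; [lra|]. apply Rmax_lub; lra. }
    assert (g1 := A2 f t s i1 i2 i3 ltac:(lra)). assert (g2 := B2 f t s i1 i2 i3 ltac:(lra)).
    assert (g3 := g d h1 h2). assert (g4 := g d' h3 h4).
    fold nrm ex. unfold eps. lra.
  - destruct Xi_bd_T as [CX [HCX HX']].
    assert (0 <= CX * L) by now apply Rmult_le_pos.
    assert (bd : forall x : R -> E, (forall t, a <= t <= b -> norm (x t) <= L) ->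
      forall t s, a <= s -> s <= t -> t <= b -> norm (rem X x t s) <= L + CX * L).
    { intros x hx t s i1 i2 i3. eapply Rle_trans; [apply norm_minus_le|].
      assert (g1 := hx t ltac:(lra)). assert (g2 := hx s ltac:(lra)).
      assert (g3 := HX' t s (x s) ltac:(unfold S2; simpl; lra)).
      assert (CX * norm (x s) <= CX * L) by now apply Rmult_le_compat_l.
      unfold Xi in g3. lra. }
    exists (2 * (L + CX * L)). split.
    + intros t Ht. eapply Rle_trans; [apply norm_minus_le|].
      assert (g1 := A1 t Ht). assert (g2 := B1 t Ht). lra.
    + intros t s i1 i2 i3. eapply Rle_trans; [apply norm_minus_le|].
      assert (g1 := bd y A1 t s i1 i2 i3). assert (g2 := bd z B1 t s i1 i2 i3). lra.
Qed.

(** Schemes of mesh d1 / (n + 1) converge uniformly. For fixed s < t the mesh is eventually below t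
    - s, so the bound by [Rmax (t - s) d] passes to the limit as the full order k2. *)
Lemma asol_exists a b psi :
  0 <= a -> a <= b -> b <= T -> exists y, asol j SE e k2 X a b psi y.
Proof.
  intros Ha Hab Hb.
  destruct euler_uniform as [d0 [Hd0 [Hd02 Hunif]]].
  set (L := 2 * C2 * norm psi).
  assert (HL : 0 <= L) by (unfold L; generalize (norm_ge_0 psi); nra).
  assert (Hc := euler_cauchy (L := L) Ha Hab Hb Hd0 Hd02
    (fun d h1 h2 => Hunif a b d psi Ha Hb h1 h2)).
  set (d1 := Rmin d0 tau1).
  assert (Hd1 : 0 < d1) by (apply Rmin_pos; lra).
  assert (Hd1' : d1 <= d0 /\ d1 <= tau1) by (split; [apply Rmin_l|apply Rmin_r]).
  set (dn := fun n => d1 / INR (S n)).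
  assert (Hdn : forall n, 0 < dn n).
  { intros n. apply Rdiv_lt_0_compat; [easy|]. apply lt_0_INR. lia. }
  assert (Hdle : forall n m, (n <= m)%nat -> dn m <= dn n).
  { intros n m Hnm. apply Rmult_le_compat_l; [lra|]. apply Rinv_le_contravar.
    - apply lt_0_INR; lia.
    - apply le_INR; lia. }
  assert (Hd1n : forall n, dn n <= d1).
  { intros n. apply Rle_trans with (dn O); [apply Hdle; lia|]. unfold dn. simpl. lra. }
  assert (Hsmall : forall r, 0 < r -> exists N, forall n, (N <= n)%nat -> dn n <= r).
  { intros r Hr. destruct (INR_unbounded (d1 / r)) as [N HN].
    exists N. intros n Hn. unfold dn.
    assert (hS : 0 < INR (S n)) by (apply lt_0_INR; lia).
    assert (hN : INR N <= INR (S n)) by (apply le_INR; lia).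
    apply Rmult_le_reg_r with (INR (S n)); [easy|].
    replace (d1 / INR (S n) * INR (S n)) with (d1 / r * r) by (field; lra).
    rewrite (Rmult_comm r). apply Rmult_le_compat_r; lra. }
  assert (Hcau : forall eps, 0 < eps -> exists N, forall n m, (N <= n)%nat -> (N <= m)%nat ->
    forall t, a <= t <= b ->
      norm (minus (euler a (dn n) psi t) (euler a (dn m) psi t)) < eps).
  { intros eps Heps.
    assert (HC1L : 0 <= 2 * C1 * L) by (assert (0 <= C1 * L) by (apply Rmult_le_pos; lra); lra).
    destruct (rpow_small (k2 - k1) (eps / (2 * C1 * L + 1)) ltac:(lra)) as [r [Hr Hrs]].
    { apply Rdiv_lt_0_compat; lra. }
    destruct (Hsmall r Hr) as [N HN]. exists N. intros n m Hn Hm t Ht.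
    assert (g := Hc (dn N) (dn n) (dn m) (Hdn n) (Hdle N n Hn) (Hdn m) (Hdle N m Hm)
      ltac:(generalize (Hd1n N); lra) ltac:(generalize (Hd1n N); lra) t Ht).
    apply Rle_lt_trans with (1 := g).
    apply Rle_lt_trans with (2 * C1 * L * (eps / (2 * C1 * L + 1))).
    - apply Rmult_le_compat_l; [easy|]. apply Hrs, HN. lia.
    - apply Rlt_le_trans with ((2 * C1 * L + 1) * (eps / (2 * C1 * L + 1))).
      + apply Rmult_lt_compat_r; [|lra]. apply Rdiv_lt_0_compat; lra.
      + right. field. lra. }
  (* The range of t is a premise inside the existential, so that choice yields a function on all of
     R. *)
  assert (Hlim : forall t, exists l, a <= t <= b -> forall eps, 0 < eps ->
    exists N, forall n, (N <= n)%nat -> norm (minus (euler a (dn n) psi t) l) < eps).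
  { intros t. destruct (Rle_dec a t) as [h1|h1]; [|exists zero; lra].
    destruct (Rle_dec t b) as [h2|h2]; [|exists zero; lra].
    destruct (complete (u := fun n => euler a (dn n) psi t)) as [l Hl].
    - intros eps Heps. destruct (Hcau eps Heps) as [N HN]. exists N.
      intros n m Hn Hm. apply HN; lra || easy.
    - exists l. intros _. exact Hl. }
  set (y := fun t => proj1_sig (constructive_indefinite_description _ (Hlim t))).
  assert (Hy : forall t, a <= t <= b -> forall eps, 0 < eps ->
    exists N, forall n, (N <= n)%nat -> norm (minus (euler a (dn n) psi t) (y t)) < eps).
  { intros t. unfold y. destruct (constructive_indefinite_description _ _). easy. }
  clearbody y. clear Hlim.
  destruct Xi_bd_T as [CX [HCX HX']].
  assert (Hunif' := fun n => Hunif a b (dn n) psi Ha Hb (Hdn n)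
    ltac:(generalize (Hd1n n); lra)).
  assert (Hby : forall t, a <= t <= b -> norm (y t) <= L).
  { intros t Ht. apply le_epsilon. intros eps Heps.
    destruct (Hy t Ht eps Heps) as [N HN].
    replace (y t) with (minus (euler a (dn N) psi t) (minus (euler a (dn N) psi t) (y t)))
      by module_eq_in E.
    eapply Rle_trans; [apply norm_minus_le|].
    specialize (HN N (le_n N)). destruct (Hunif' N) as [g _]. specialize (g t Ht).
    fold L in g. lra. }
  assert (Hrem : forall t s eps, a <= s -> s <= t -> t <= b -> 0 < eps -> exists N,
    forall n, (N <= n)%nat ->
      norm (minus (rem X y t s) (rem X (euler a (dn n) psi) t s)) <= eps).
  { intros t s eps h1 h2 h3 Heps.
    assert (He : 0 < eps / (1 + CX)) by (apply Rdiv_lt_0_compat; lra).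
    destruct (Hy t ltac:(lra) _ He) as [N1 HN1]. destruct (Hy s ltac:(lra) _ He) as [N2 HN2].
    exists (max N1 N2). intros n Hn.
    specialize (HN1 n ltac:(lia)). specialize (HN2 n ltac:(lia)).
    set (z := euler a (dn n) psi) in *.
    assert (Hts : S2 0 T (t, s)) by (unfold S2; simpl; lra).
    assert (lX := Xi_lin sm HX Hts).
    replace (minus (rem X y t s) (rem X z t s))
      with (minus (Xi X t s (minus (z s) (y s))) (minus (z t) (y t))).
    2: { unfold rem, remainder, Xi. rewrite (linear_minus _ _ _ lX). module_eq_in E. }
    eapply Rle_trans; [apply norm_minus_le|].
    assert (g := HX' t s (minus (z s) (y s)) Hts).
    assert (CX * norm (minus (z s) (y s)) <= CX * (eps / (1 + CX)))
      by (apply Rmult_le_compat_l; lra).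
    replace eps with (CX * (eps / (1 + CX)) + eps / (1 + CX)) by (field; lra). lra. }
  assert (Hloc : forall f t s, a <= s -> s <= t -> t <= b -> t - s <= tau2 ->
    nrm f (rem X y t s) <= L * rpow (t - s) (ex f + k2)).
  { intros f t s h1 h2 h3 h4. assert (HJ := sm_CJ sm).
    destruct (Rle_lt_dec t s) as [h5|h5].
    { replace t with s by lra. rewrite rpow_nonpos by lra.
      replace (rem X y s s) with (@zero E).
      2: { change (zero = minus (y s) (Xi X s s (y s))). rewrite Xi_diag by lra.
           module_eq_in E. }
      right. rewrite Rmult_0_r. apply (nrm_zero sm). }
    apply le_epsilon. intros eps Heps.
    assert (He : 0 < eps / (1 + CJ)) by (apply Rdiv_lt_0_compat; lra).
    destruct (Hrem t s _ h1 h2 h3 He) as [N1 HN1].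
    destruct (Hsmall (t - s) ltac:(lra)) as [N2 HN2].
    set (n := max N1 N2). specialize (HN1 n ltac:(lia)). specialize (HN2 n ltac:(lia)).
    set (z := euler a (dn n) psi) in *.
    destruct (Hunif' n) as [_ g]. specialize (g f t s h1 h2 h3 h4).
    rewrite Rmax_left in g by easy. fold z L in g.
    replace (rem X y t s) with (plus (rem X z t s) (minus (rem X y t s) (rem X z t s)))
      by module_eq_in E.
    eapply Rle_trans; [apply (nrm_plus sm)|]. fold nrm.
    assert (g2 := nrm_le sm f (minus (rem X y t s) (rem X z t s))). fold nrm in g2.
    assert (g3 : (1 + CJ) * norm (minus (rem X y t s) (rem X z t s)) <= (1 + CJ) * (eps / (1 + CJ)))
      by (apply Rmult_le_compat_l; lra).
    replace ((1 + CJ) * (eps / (1 + CJ))) with eps in g3 by (field; lra). lra. }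
  exists y. split.
  - assert (h : norm (minus psi (y a)) <= 0).
    { apply le_epsilon. intros eps Heps. destruct (Hy a ltac:(lra) eps Heps) as [N HN].
      specialize (HN N (le_n N)).
      assert (hN : 0 < dn N <= 1) by (generalize (Hdn N) (Hd1n N); lra).
      rewrite euler_start in HN by lra. rewrite Rplus_0_l. left. exact HN. }
    assert (h0 : minus psi (y a) = zero).
    { apply norm_eq_zero. apply Rle_antisym; [easy|apply norm_ge_0]. }
    transitivity (minus psi (minus psi (y a))); [module_eq_in E|].
    rewrite h0. module_eq_in E.
  - assert (HJ := sm_CJ sm).
    assert (Hp : forall f, 0 < rpow tau2 (ex f + k2)) by (intros; apply rpow_pos; lra).
    assert (HLX : 0 <= (1 + CJ) * (L + CX * L)).
    { assert (0 <= CX * L) by now apply Rmult_le_pos. apply Rmult_le_pos; lra. }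
    (* For t - s > tau2 the trivial bound on the remainder suffices, at the price of dividing by the
       power of tau2. *)
    set (Lf := fun f => (1 + CJ) * (L + CX * L) / rpow tau2 (ex f + k2)).
    assert (HLf : forall f, 0 <= Lf f).
    { intros f. apply Rmult_le_pos; [easy|]. left. now apply Rinv_0_lt_compat. }
    assert (HLt := HLf true). assert (HLff := HLf false).
    exists (L + Lf true + Lf false). split.
    + intros t Ht. specialize (Hby t Ht). lra.
    + intros f t s h1 h2 h3. fold rem nrm ex.
      assert (Hr := rpow_nonneg (t - s) (ex f + k2)).
      destruct (Rle_lt_dec (t - s) tau2) as [h4|h4].
      * apply Rle_trans with (1 := Hloc f t s h1 h2 h3 h4).
        apply Rmult_le_compat_r; lra.
      * apply Rle_trans with (Lf f * rpow (t - s) (ex f + k2)).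
        2: { apply Rmult_le_compat_r; [easy|]. destruct f; lra. }
        apply Rle_trans with ((1 + CJ) * (L + CX * L)).
        -- eapply Rle_trans; [apply (nrm_le sm)|]. apply Rmult_le_compat_l; [lra|].
           eapply Rle_trans; [apply norm_minus_le|].
           assert (g1 := Hby t ltac:(lra)). assert (g2 := Hby s ltac:(lra)).
           assert (g3 := HX' t s (y s) ltac:(unfold S2; simpl; lra)).
           assert (CX * norm (y s) <= CX * L) by now apply Rmult_le_compat_l.
           unfold Xi in g3. lra.
        -- replace ((1 + CJ) * (L + CX * L)) with (Lf f * rpow tau2 (ex f + k2)).
           2: { unfold Lf. field. apply Rgt_not_eq, Hp. }
           apply Rmult_le_compat_l; [apply HLf|].
           apply rpow_le; [generalize (ex_nonneg f)|]; lra.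
Qed.

End Euler.

(** * Raising the order of a remainder *)

Lemma rpow_trade c x a b : a <= b -> x <= c -> rpow x b <= rpow c (b - a) * rpow x a.
Proof.
  intros Hab Hx. replace b with (b - a + a) at 1 by ring. rewrite rpow_plus.
  apply Rmult_le_compat_r; [apply rpow_nonneg|]. apply rpow_le; lra.
Qed.

Lemma is_series_3 {V : NormedModule R_AbsRing} (a : nat -> V) :
  (forall n, a (S (S (S n))) = zero) -> is_series a (plus (plus (a O) (a 1%nat)) (a 2%nat)).
Proof.
  intros H. unfold is_series.
  apply (filterlim_ext_loc (fun _ => plus (plus (a O) (a 1%nat)) (a 2%nat)));
    [|apply filterlim_const].
  exists 2%nat. intros n Hn. destruct n as [|[|n]]; [lia|lia|].
  clear Hn. induction n as [|n IH].
  - now rewrite !sum_Sn, sum_O.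
  - rewrite sum_Sn, <- IH, H, plus_zero_r. reflexivity.
Qed.

Lemma filterlim_minus {T : Type} {V : NormedModule R_AbsRing} (G : (T -> Prop) -> Prop)
    {FG : Filter G} (f g : T -> V) (l m : V) :
  filterlim f G (locally l) -> filterlim g G (locally m) ->
  filterlim (fun q => minus (f q) (g q)) G (locally (minus l m)).
Proof.
  intros Hf Hg. unfold minus.
  apply (filterlim_comp_2 (G := locally l) (H := locally (opp m))
    f (fun q => opp (g q)) plus Hf).
  - exact (filterlim_comp _ _ _ g opp G (locally m) (locally (opp m)) Hg (filterlim_opp m)).
  - apply filterlim_plus.
Qed.

Section Bridge.

Variables (E F : NormedModule R_AbsRing).
Variables (j : E -> F) (SE : R -> E -> E) (e CS CJ : R).
Hypothesis sm : smoothing j SE e CS CJ.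
Variables (T k0 : R).
Hypothesis Hk0 : 0 < k0.

Let nrm := graded_norm j.
Let ex := graded_exponent e.
Let rough_ok := rough_bounds j e T k0.
Let ex_nonneg f : 0 <= ex f := graded_exponent_nonneg sm f.
Let rem := remainder SE.
Let chen := chen_relations SE T.

Variables (K : R) (X : rough E).
Hypotheses (HK : 0 <= K) (HX : rough_ok K X) (HC : chen X).

Section Remainder.
Variables (k2 q mu : R).
Hypotheses (Hk2 : 0 < k2) (Hk24 : k2 <= 4 * k0) (Hek : 1 < e + k2).
Hypotheses (Hq : 0 < q) (Hkq : k2 <= k0 + q) (Hmu : 1 < mu).

(** By [rem_delta] the increment hdelta R already has the orders e + k2 and k2, since 4 k0 and k0 +
    q are at least k2. Sewing with cutoff d adds a small-scale term of size d^(mu - 1) in F and d^q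
    in E; both vanish as d tends to 0, and only the order of hdelta R is left. F is treated before E
    because the smoothing argument in E consumes the bound in F. *)
Lemma remainder_bound a b y L :
  0 <= a -> b <= T ->
  (forall t, a <= t <= b -> norm (y t) <= L) ->
  (forall t s, a <= s -> s <= t -> t <= b -> norm (rem X y t s) <= L * rpow (t - s) q) ->
  (forall t s, a <= s -> s <= t -> t <= b -> norm (j (rem X y t s)) <= L * rpow (t - s) mu) ->
  exists L', forall f t s, a <= s -> s <= t -> t <= b ->
    nrm f (rem X y t s) <= L' * rpow (t - s) (ex f + k2).
Proof.
  intros Ha Hb HL Hf Ht.
  destruct (Rle_lt_dec a b) as [Hab|Hab]; [|exists 0; intros; lra].
  assert (HL0 : 0 <= L) by (apply Rle_trans with (norm (y a)); [apply norm_ge_0|apply HL; lra]).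
  set (H := (6 * (K * K) + 3 * K) * L).
  assert (HKK : 0 <= K * K) by now apply Rmult_le_pos.
  assert (HH : 0 <= H) by (apply Rmult_le_pos; lra).
  assert (Hl : forall f t s, a <= s -> s <= t -> t <= b -> t - s <= 1 ->
      nrm f (hdelta2 SE (rem X y) t ((t + s) / 2) s) <= H * rpow (t - s) (ex f + k2)).
  { intros f t s h1 h2 h3 h4. set (u := (t + s) / 2).
    assert (Hu : s <= u <= t) by (unfold u; lra).
    assert (H3 : S3 0 T (t, u, s)) by (unfold S3; simpl; lra).
    assert (Htu : S2 0 T (t, u)) by (unfold S2; simpl; lra).
    replace (hdelta2 SE (rem X y) t u s)
      with (plus (chi X t u s (y s)) (Xs X t u (rem X y u s)))
      by (symmetry; exact (rem_delta sm HX HC y H3)).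
    eapply Rle_trans; [apply (nrm_plus sm)|]. fold nrm.
    assert (g1 := chi_bd sm Hk0 HK HX f (y s) H3 h4).
    assert (g2 : nrm f (Xs X t u (rem X y u s)) <= 3 * K * L * rpow (t - s) (ex f + k2) * 1).
    { apply (prod_bd sm (p := k0) (q := q) (t1 := t - u) (t2 := u - s)); try lra.
      - intros v. apply (Xs_bd sm Hk0 HK HX f v Htu). lra.
      - rewrite Rmult_1_r. apply Hf; lra. }
    assert (g3 : rpow (t - s) (ex f + 4 * k0) <= rpow (t - s) (ex f + k2))
      by (apply rpow_le_exp; lra).
    set (z := rpow (t - s) (ex f + k2)) in *.
    assert (g4 : 6 * (K * K) * rpow (t - s) (ex f + 4 * k0) * norm (y s) <= 6 * (K * K) * z * L).
    { apply Rmult_le_compat; [|apply norm_ge_0| |apply HL; lra].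
      - apply Rmult_le_pos; [lra|apply rpow_nonneg].
      - apply Rmult_le_compat_l; lra. }
    unfold H. fold ex nrm in g1. lra. }
  assert (Hq2 := rpow_half_lt _ Hek). set (q2 := 2 * rpow (/ 2) (e + k2)) in *.
  set (G := CS * (H / (1 - q2))).
  assert (HCS := sm_CS sm).
  assert (HG : 0 <= G).
  { apply Rmult_le_pos; [lra|]. apply Rmult_le_pos; [easy|]. left. apply Rinv_0_lt_compat. lra. }
  assert (Htrue : forall t s, a <= s -> s < t -> t <= b -> t - s <= 1 ->
     norm (j (rem X y t s)) <= G * rpow (t - s) (e + k2)).
  { intros t s h1 h2 h3 h4. apply le_epsilon. intros eps Heps.
    set (c := CS * 2 * L * (t - s)).
    assert (Hc : 0 <= c) by (repeat apply Rmult_le_pos; lra).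
    destruct (rpow_small (mu - 1) (eps / (c + 1)) ltac:(lra)) as [d0 [Hd0 Hd0s]].
    { apply Rdiv_lt_0_compat; lra. }
    set (d := Rmin d0 (t - s)).
    assert (Hd : 0 < d) by (apply Rmin_pos; lra).
    assert (Hdd : d <= t - s) by apply Rmin_r.
    (* This K puts the bound of order mu below scale d into the form K d^(e + k2) that [sewing_weak]
       expects; the exponent mu - e - k2 may be negative. *)
    assert (HKd : 0 <= L * rpow d (mu - e - k2)) by (apply Rmult_le_pos; [easy|apply rpow_nonneg]).
    assert (g := sewing_weak sm (a := s) (b := t) (Rm := rem X y) Hek HH HKd Hd).
    specialize (g ltac:(
      intros t' s' i1 i2 i3 i4;
      apply Rle_trans with (1 := Ht t' s' ltac:(lra) i2 ltac:(lra));
      rewrite Rmult_assoc, <- rpow_plus; apply Rmult_le_compat_l; [easy|];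
      replace (mu - e - k2 + (e + k2)) with mu by ring; apply rpow_le; lra)).
    specialize (g ltac:(intros t' s' i1 i2 i3; apply (Hl true t' s'); lra)).
    specialize (g t s ltac:(lra) ltac:(lra) ltac:(lra)). fold q2 in g.
    apply Rle_trans with (1 := g).
    replace (CS * (2 * (L * rpow d (mu - e - k2)) * (t - s) * rpow d (e + k2 - 1) +
             H / (1 - q2) * rpow (t - s) (e + k2)))
      with (c * (rpow d (mu - e - k2) * rpow d (e + k2 - 1)) + G * rpow (t - s) (e + k2))
      by (unfold c, G; ring).
    rewrite <- rpow_plus. replace (mu - e - k2 + (e + k2 - 1)) with (mu - 1) by ring.
    assert (g1 : c * rpow d (mu - 1) <= (c + 1) * (eps / (c + 1))).
    { apply Rmult_le_compat; [easy|apply rpow_nonneg|lra|]. apply Hd0s, Rmin_l. }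
    replace ((c + 1) * (eps / (c + 1))) with eps in g1 by (field; lra). lra. }
  set (D := (H + CS * G) / (1 - rpow (/ 2) k2)).
  assert (Hp := rpow_half_lt_1 _ Hk2).
  assert (HD : 0 <= D).
  { apply Rmult_le_pos; [apply Rplus_le_le_0_compat; [easy|apply Rmult_le_pos; lra]|].
    left. apply Rinv_0_lt_compat. lra. }
  assert (Hfalse : forall t s, a <= s -> s < t -> t <= b -> t - s <= 1 ->
     norm (rem X y t s) <= D * rpow (t - s) k2).
  { intros t s h1 h2 h3 h4. apply le_epsilon. intros eps Heps.
    destruct (rpow_small q (eps / (L + 1)) ltac:(lra)) as [d0 [Hd0 Hd0s]].
    { apply Rdiv_lt_0_compat; lra. }
    set (d := Rmin d0 (t - s)).
    assert (Hd : 0 < d) by (apply Rmin_pos; lra).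
    assert (Hdd : d <= t - s) by apply Rmin_r.
    assert (HB : 0 <= L * rpow d q) by (apply Rmult_le_pos; [easy|apply rpow_nonneg]).
    assert (g := sewing_gain sm (a := s) (b := t) (Rm := rem X y) Hk2 HH Hd HG HB).
    specialize (g ltac:(
      intros t' s' i1 i2 i3; assert (i4 := Hl false t' s' ltac:(lra) ltac:(lra) ltac:(lra) ltac:(lra));
      unfold nrm, ex in i4; simpl in i4; rewrite Rplus_0_l in i4; exact i4)).
    specialize (g ltac:(intros t' s' i1 i2 i3; apply Htrue; lra)).
    specialize (g ltac:(intros t' s' i1 i2 i3;
      apply Rle_trans with (1 := Hf t' s' ltac:(lra) ltac:(lra) ltac:(lra));
      apply Rmult_le_compat_l; [easy|apply rpow_le; lra])).
    specialize (g t s ltac:(lra) ltac:(lra) ltac:(lra)). fold D in g.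
    assert (g1 : L * rpow d q <= (L + 1) * (eps / (L + 1))).
    { apply Rmult_le_compat; [easy|apply rpow_nonneg|lra|]. apply Hd0s, Rmin_l. }
    replace ((L + 1) * (eps / (L + 1))) with eps in g1 by (field; lra). lra. }
  (* Covers t - s > 1, where the wanted powers are at least 1 and the given bounds are enough. *)
  set (M := L * rpow (1 + T) mu + L * rpow (1 + T) q).
  assert (HM1 : 0 <= L * rpow (1 + T) mu) by (apply Rmult_le_pos; [easy|apply rpow_nonneg]).
  assert (HM2 : 0 <= L * rpow (1 + T) q) by (apply Rmult_le_pos; [easy|apply rpow_nonneg]).
  exists (G + D + M). intros f t s h1 h2 h3.
  assert (Hz := rpow_nonneg (t - s) (ex f + k2)).
  destruct (Rle_lt_dec (t - s) 1) as [h4|h4].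
  - destruct (Rle_lt_dec t s) as [h5|h5].
    { apply Rle_trans with 0; [|apply Rmult_le_pos; [unfold M|]; lra].
      destruct f; unfold nrm; simpl.
      - apply Rle_trans with (1 := Ht t s h1 h2 h3). rewrite rpow_nonpos by lra. lra.
      - apply Rle_trans with (1 := Hf t s h1 h2 h3). rewrite rpow_nonpos by lra. lra. }
    apply Rle_trans with ((G + D) * rpow (t - s) (ex f + k2)).
    2: { apply Rmult_le_compat_r; [easy|unfold M; lra]. }
    assert (g1 := Htrue t s h1 h5 h3 h4). assert (g2 := Hfalse t s h1 h5 h3 h4).
    destruct f; unfold nrm, ex in *; simpl in *; [|rewrite Rplus_0_l in *].
    + apply Rle_trans with (1 := g1). apply Rmult_le_compat_r; lra.
    + apply Rle_trans with (1 := g2). apply Rmult_le_compat_r; lra.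
  - apply Rle_trans with (M * 1).
    + rewrite Rmult_1_r. unfold M, nrm. destruct f; simpl.
      * apply Rle_trans with (1 := Ht t s h1 h2 h3).
        assert (L * rpow (t - s) mu <= L * rpow (1 + T) mu)
          by (apply Rmult_le_compat_l; [easy|apply rpow_le; lra]). lra.
      * apply Rle_trans with (1 := Hf t s h1 h2 h3).
        assert (L * rpow (t - s) q <= L * rpow (1 + T) q)
          by (apply Rmult_le_compat_l; [easy|apply rpow_le; lra]). lra.
    + assert (1 <= rpow (t - s) (ex f + k2)).
      { rewrite rpow_Rpower by lra. rewrite <- (Rpower_O (t - s)) by lra.
        apply Rle_Rpower; [lra|]. generalize (ex_nonneg f); lra. }
      apply Rmult_le_compat; unfold M; lra.
Qed.

End Remainder.

End Bridge.

(** * Continuity of paths and remainders *)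

Section Regularity.

Variables (E F : NormedModule R_AbsRing).
Variables (j : E -> F) (SE : R -> E -> E) (e CS CJ : R).
Hypothesis sm : smoothing j SE e CS CJ.

(** Strong continuity is only given at 0 from the right. Factoring out the smaller of the two times,
    with its uniform bound CS, transports it to every time and to both sides. *)
Lemma SE_continuous v r0 eps : 0 <= r0 -> 0 < eps -> exists h, 0 < h /\
  forall r, 0 <= r -> Rabs (r - r0) < h -> norm (minus (SE r v) (SE r0 v)) < eps.
Proof.
  intros Hr0 Heps. assert (HCS := sm_CS sm).
  assert (He : 0 < eps / CS) by (apply Rdiv_lt_0_compat; lra).
  destruct (proj1 (filterlim_norm_eps _ _ _) (sm_cont sm (v := v)) (eps / CS) He) as [h Hh].
  exists h. split; [apply cond_pos|].
  assert (key : forall r r', 0 <= r -> r < r' -> r' - r < h ->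
    norm (minus (SE r' v) (SE r v)) < eps).
  { intros r r' h1 h2 h3.
    replace (SE r' v) with (SE r (SE (r' - r) v))
      by (rewrite <- (sm_add sm) by lra; f_equal; ring).
    rewrite <- (linear_minus _ _ _ (sm_lin sm h1)).
    apply Rle_lt_trans with (1 := sm_bd sm false _ h1). simpl.
    replace eps with (CS * (eps / CS)) by (field; lra).
    apply Rmult_lt_compat_l; [lra|]. apply Hh; [|lra].
    change (Rabs (r' - r - 0) < h). rewrite Rabs_right; lra. }
  intros r h1 h2. apply Rabs_lt_between in h2.
  destruct (Rtotal_order r r0) as [h3|[h3|h3]].
  - rewrite norm_minus_sym. apply key; lra.
  - subst r. replace (minus (SE r0 v) (SE r0 v)) with (@zero E) by module_eq_in E.
    rewrite norm_zero. easy.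
  - apply key; lra.
Qed.

Lemma SE_lim {P : Type} (G : (P -> Prop) -> Prop) {FG : Filter G} (r : P -> R) (v : P -> E) r0 v0 :
  0 <= r0 -> G (fun q => 0 <= r q) -> filterlim r G (locally r0) ->
  filterlim v G (locally v0) ->
  filterlim (fun q => SE (r q) (v q)) G (locally (SE r0 v0)).
Proof.
  intros Hr0 Hpos Hr Hv. apply filterlim_norm_eps; [easy|]. intros eps Heps.
  assert (HCS := sm_CS sm).
  destruct (SE_continuous v0 Hr0 (eps := eps / 2) ltac:(lra)) as [h [Hh Hc]].
  assert (He : 0 < eps / (2 * CS)) by (apply Rdiv_lt_0_compat; lra).
  assert (G1 := proj1 (filterlim_norm_eps G v v0) Hv _ He).
  assert (G2 : G (fun q => Rabs (r q - r0) < h)).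
  { apply (Hr (fun x => Rabs (x - r0) < h)).
    exists (mkposreal h Hh). intros x Hx. exact Hx. }
  generalize (filter_and _ _ Hpos (filter_and _ _ G1 G2)). apply filter_imp.
  intros q [p1 [p2 p3]].
  replace (minus (SE (r q) (v q)) (SE r0 v0)) with
    (plus (SE (r q) (minus (v q) v0)) (minus (SE (r q) v0) (SE r0 v0))).
  2: { rewrite (linear_minus _ _ _ (sm_lin sm p1)). module_eq_in E. }
  eapply Rle_lt_trans; [apply norm_triangle|].
  assert (g1 := Hc _ p1 p3).
  assert (g2 := sm_bd sm false (minus (v q) v0) p1). simpl in g2.
  assert (g3 : CS * norm (minus (v q) v0) < CS * (eps / (2 * CS)))
    by (apply Rmult_lt_compat_l; lra).
  replace (CS * (eps / (2 * CS))) with (eps / 2) in g3 by (field; lra). lra.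
Qed.

(* The increments of [y] twisted by the semigroup control its modulus of
   continuity only together with [r -> SE r (y r0)] for a base point [r0]
   slightly to the left. *)
Lemma path_continuous a b (y : R -> E) C k : 0 < k ->
  (forall t s, a <= s -> s <= t -> t <= b ->
     norm (minus (y t) (SE (t - s) (y s))) <= C * rpow (t - s) k) ->
  continuous_on (S1 a b) y.
Proof.
  intros Hk Hy t0 Ht0. unfold S1 in Ht0. apply filterlim_norm_eps; [apply within_filter, locally_filter|].
  intros eps Heps.
  assert (HC := Rabs_pos C).
  destruct (rpow_small k (eps / (4 * (Rabs C + 1))) Hk) as [d [Hd Hds]].
  { apply Rdiv_lt_0_compat; lra. }
  set (r := Rmax a (t0 - d / 2)).
  assert (Hr1 : a <= r) by apply Rmax_l.
  assert (Hr2 : t0 - d / 2 <= r) by apply Rmax_r.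
  assert (Hr3 : r <= t0) by (apply Rmax_lub; lra).
  destruct (SE_continuous (y r) (r0 := t0 - r) (eps := eps / 2)) as [h [Hh Hc]]; [lra|lra|].
  assert (Hm : 0 < Rmin h (d / 2)) by (apply Rmin_pos; lra).
  exists (mkposreal _ Hm). intros t Ht [Ht1 Ht2].
  change (Rabs (t - t0) < Rmin h (d / 2)) in Ht.
  assert (Hth := Rlt_le_trans _ _ _ Ht (Rmin_l _ _)).
  assert (Htd := Rlt_le_trans _ _ _ Ht (Rmin_r _ _)).
  apply Rabs_lt_between in Htd.
  assert (Hrt : r <= t) by (apply Rmax_lub; lra).
  assert (small : forall x, r <= x -> x <= b -> x - r <= d ->
     norm (minus (y x) (SE (x - r) (y r))) <= eps / 4).
  { intros x h1 h2 h3. apply Rle_trans with (1 := Hy x r Hr1 h1 h2).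
    apply Rle_trans with ((Rabs C + 1) * (eps / (4 * (Rabs C + 1)))).
    - apply Rle_trans with (Rabs C * rpow (x - r) k).
      + apply Rmult_le_compat_r; [apply rpow_nonneg|apply Rle_abs].
      + apply Rmult_le_compat; [easy|apply rpow_nonneg|lra|]. apply Hds. lra.
    - right. field. lra. }
  assert (g1 := small t Hrt Ht2 ltac:(lra)).
  assert (g2 := small t0 Hr3 ltac:(lra) ltac:(lra)).
  assert (g3 := Hc (t - r) ltac:(lra)).
  replace (t - r - (t0 - r)) with (t - t0) in g3 by ring. specialize (g3 Hth).
  replace (minus (y t) (y t0)) with
    (plus (minus (minus (y t) (SE (t - r) (y r))) (minus (y t0) (SE (t0 - r) (y r))))
      (minus (SE (t - r) (y r)) (SE (t0 - r) (y r)))) by module_eq_in E.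
  eapply Rle_lt_trans; [apply norm_triangle|].
  eapply Rle_lt_trans; [apply Rplus_le_compat_r, norm_minus_le|]. lra.
Qed.

Definition op_continuous (T : R) (Y : R -> R -> E -> E) : Prop :=
  forall p, S2 0 T p -> forall eps : posreal,
    within (S2 0 T) (locally p) (fun q =>
      op_le (fun x => minus (Y (fst q) (snd q) x) (Y (fst p) (snd p) x)) eps).

(** Convergence of a pair of times inside the simplex, along an arbitrary filter: the same lemmas
    then serve S2 and the two pairs of consecutive times of a point of S3. *)
Definition S2lim {P : Type} (G : (P -> Prop) -> Prop) (a b : R) (t s : P -> R) t0 s0 : Prop :=
  filterlim (fun q => (t q, s q)) G (within (S2 a b) (locally (t0, s0))).

Section Lim.
Variables (P : Type) (G : (P -> Prop) -> Prop).
Context {FG : Filter G}.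
Variables (a b T : R) (t s : P -> R) (t0 s0 : R).
Hypotheses (Ha : 0 <= a) (Hb : b <= T) (H0 : S2 a b (t0, s0)).
Hypothesis HS : S2lim G a b t s t0 s0.

Lemma S2lim_in : G (fun q => S2 a b (t q, s q)).
Proof.
  apply (HS (P := S2 a b)). unfold within. apply filter_forall. easy.
Qed.

Lemma S2lim_fst : filterlim t G (within (S1 a b) (locally t0)).
Proof.
  intros Q HQ. destruct HQ as [h Hh].
  apply (HS (P := fun p => Q (fst p))). exists h. intros [x y] [Hx Hy] Hxy.
  apply Hh; [exact Hx|]. unfold S2, S1 in *; simpl in *; lra.
Qed.

Lemma S2lim_snd : filterlim s G (within (S1 a b) (locally s0)).
Proof.
  intros Q HQ. destruct HQ as [h Hh].
  apply (HS (P := fun p => Q (snd p))). exists h. intros [x y] [Hx Hy] Hxy.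
  apply Hh; [exact Hy|]. unfold S2, S1 in *; simpl in *; lra.
Qed.

Lemma S2lim_op (Y : R -> R -> E -> E) (v : P -> E) v0 :
  op_continuous T Y -> is_linear (Y t0 s0) -> filterlim v G (locally v0) ->
  filterlim (fun q => Y (t q) (s q) (v q)) G (locally (Y t0 s0 v0)).
Proof.
  intros HY Hlin Hv. apply filterlim_norm_eps; [easy|]. intros eps Heps.
  destruct (linear_norm _ Hlin) as [M [HM HMb]].
  assert (Hn := norm_ge_0 v0).
  set (c := norm v0 + 1).
  assert (Hc : 0 < eps / (2 * c)) by (apply Rdiv_lt_0_compat; unfold c; lra).
  assert (He : 0 < Rmin 1 (eps / (2 * M)))
    by (apply Rmin_pos; [lra|apply Rdiv_lt_0_compat; lra]).
  assert (G1 := proj1 (filterlim_norm_eps G v v0) Hv _ He).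
  assert (H0T : S2 0 T (t0, s0)) by (unfold S2 in *; simpl in *; lra).
  assert (G2 : G (fun q => op_le (fun x => minus (Y (t q) (s q) x) (Y t0 s0 x)) (eps / (2 * c)))).
  { apply (HS (P := fun p => op_le (fun x => minus (Y (fst p) (snd p) x) (Y t0 s0 x)) (eps / (2 * c)))).
    generalize (HY (t0, s0) H0T (mkposreal _ Hc)). unfold within. apply filter_imp.
    intros p Hp Hp'. apply Hp. unfold S2 in *; lra. }
  generalize (filter_and _ _ G1 G2). apply filter_imp. intros q [p1 p2].
  assert (p3 := Rlt_le_trans _ _ _ p1 (Rmin_l _ _)).
  assert (p4 := Rlt_le_trans _ _ _ p1 (Rmin_r _ _)).
  replace (minus (Y (t q) (s q) (v q)) (Y t0 s0 v0)) with
    (plus (minus (Y (t q) (s q) (v q)) (Y t0 s0 (v q))) (Y t0 s0 (minus (v q) v0))).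
  2: { rewrite (linear_minus _ _ _ Hlin). module_eq_in E. }
  eapply Rle_lt_trans; [apply norm_triangle|].
  assert (g1 := p2 (v q)). simpl in g1. assert (g2 := HMb (minus (v q) v0)).
  assert (g3 : norm (v q) < c).
  { unfold c. replace (v q) with (plus v0 (minus (v q) v0)) by module_eq_in E.
    eapply Rle_lt_trans; [apply norm_triangle|]. lra. }
  assert (g4 : eps / (2 * c) * norm (v q) <= eps / 2).
  { replace (eps / 2) with (eps / (2 * c) * c) by (field; unfold c; lra).
    apply Rmult_le_compat_l; lra. }
  assert (g5 : M * norm (minus (v q) v0) < M * (eps / (2 * M))) by (apply Rmult_lt_compat_l; lra).
  replace (M * (eps / (2 * M))) with (eps / 2) in g5 by (field; lra). lra.
Qed.

Section Path.
Variable y : R -> E.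
Hypothesis Hy : continuous_on (S1 a b) y.

Lemma S2lim_y_fst : filterlim (fun q => y (t q)) G (locally (y t0)).
Proof.
  apply (filterlim_comp _ _ _ t y G _ _ S2lim_fst). apply Hy.
  unfold S1, S2 in *; simpl in *; lra.
Qed.

Lemma S2lim_y_snd : filterlim (fun q => y (s q)) G (locally (y s0)).
Proof.
  apply (filterlim_comp _ _ _ s y G _ _ S2lim_snd). apply Hy.
  unfold S1, S2 in *; simpl in *; lra.
Qed.

Lemma S2lim_hdelta1 :
  filterlim (fun q => hdelta1 SE y (t q) (s q)) G (locally (hdelta1 SE y t0 s0)).
Proof.
  apply filterlim_minus; [easy|apply S2lim_y_fst|].
  apply SE_lim; [easy| | | |apply S2lim_y_snd].
  - unfold S2 in H0; simpl in H0; lra.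
  - generalize S2lim_in. apply filter_imp. unfold S2; simpl. intros; lra.
  - apply (filterlim_minus (V := R_NormedModule)); [easy| |].
    + intros Q HQ. apply S2lim_fst. unfold within. revert HQ. apply filter_imp. easy.
    + intros Q HQ. apply S2lim_snd. unfold within. revert HQ. apply filter_imp. easy.
Qed.

End Path.
End Lim.

Lemma S2lim_id a b p : S2lim (within (S2 a b) (locally p)) a b fst snd (fst p) (snd p).
Proof.
  destruct p as [x y]. unfold S2lim. simpl.
  apply (filterlim_ext (fun q => q)); [now intros []|]. apply filterlim_id.
Qed.

Lemma S3lim_1 a b p : S2lim (within (S3 a b) (locally p)) a b
  (fun q => fst (fst q)) (fun q => snd (fst q)) (fst (fst p)) (snd (fst p)).
Proof.
  destruct p as [[x y] z]. unfold S2lim. simpl. intros Q [h Hh].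
  exists h. intros [[x' y'] z'] [[h1 h2] h3] H. apply Hh; [split; easy|].
  unfold S2, S3 in *; simpl in *; lra.
Qed.

Lemma S3lim_2 a b p : S2lim (within (S3 a b) (locally p)) a b
  (fun q => snd (fst q)) (fun q => snd q) (snd (fst p)) (snd p).
Proof.
  destruct p as [[x y] z]. unfold S2lim. simpl. intros Q [h Hh].
  exists h. intros [[x' y'] z'] [[h1 h2] h3] H. apply Hh; [split; easy|].
  unfold S2, S3 in *; simpl in *; lra.
Qed.

End Regularity.

(** * Solutions as weakly controlled paths *)

Section Solution.

Variables (E F : NormedModule R_AbsRing).
Variables (j : E -> F) (SE : R -> E -> E) (SF : R -> F -> F) (e CS CJ : R).
Hypothesis sm : smoothing j SE e CS CJ.
Hypothesis HSF : forall r v, 0 <= r -> SF r (j v) = j (SE r v).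
Variables (T k0 kap : R).
Hypotheses (Hkap : 0 < kap) (Hkap0 : kap < k0).
Let k2 := k0 + 3 * kap.
Hypothesis Hek : 1 < e + k2.

Let ex := graded_exponent e.
Let rough_ok := rough_bounds j e T k0.
Let rem := remainder SE.
Let chen := chen_relations SE T.

Variables (K : R) (X : rough E).
Hypotheses (HK : 0 <= K) (HX : rough_ok K X) (HC : chen X).

(** A fixed point of Gamma has y^1 = y^2 = y, so the decomposition of hdelta y determines y^r, and
    the formula for z^{1,r} then determines y^{1,r}. *)
Definition path_r (y : R -> E) t s : E :=
  minus (minus (hdelta1 SE y t s) (X1 X t s (y s))) (X2 X t s (y s)).

Definition path_1r (y : R -> E) t s : E := plus (X2 X t s (y s)) (path_r y t s).

Definition path_sew (y : R -> E) t u s : E :=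
  plus (plus (X1 X t u (path_r y u s)) (X2 X t u (path_1r y u s)))
       (X3 X t u (hdelta1 SE y u s)).

Definition solution_path (y : R -> E) : cpath E :=
  CPath y y y (path_r y) (path_1r y).

Lemma path_r_rem y t s : path_r y t s = plus (X3 X t s (y s)) (rem X y t s).
Proof. unfold path_r, hdelta1, rem, remainder, one_step, Xs. module_eq_in E. Qed.

Section Sol.
Variables (a b : R) (psi : E) (y : R -> E).
Hypotheses (Ha : 0 <= a) (Hb : b <= T).
Hypothesis Hy : asol j SE e k2 X a b psi y.

Lemma path_bounds : exists L, 0 <= L /\ forall t s, S2 a b (t, s) ->
  norm (hdelta1 SE y t s) <= L * rpow (t - s) kap /\
  norm (path_1r y t s) <= L * rpow (t - s) (2 * kap) /\
  norm (path_r y t s) <= L * rpow (t - s) (3 * kap).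
Proof.
  destruct Hy as [H0 [L [H1 H2]]].
  destruct (Rle_lt_dec a b) as [Hab|Hab].
  2:{ exists 0. split; [lra|]. unfold S2; simpl; intros; lra. }
  assert (HL : 0 <= L) by (apply Rle_trans with (norm (y a)); [apply norm_ge_0|apply H1; lra]).
  set (c := 1 + T).
  assert (HKL : 0 <= K * L) by now apply Rmult_le_pos.
  assert (tr : forall x i q, 0 <= x -> q <= i -> exists C, 0 <= C /\
     forall t s, S2 a b (t, s) -> x * rpow (t - s) i <= C * rpow (t - s) q).
  { intros x i q hx hq. exists (x * rpow c (i - q)). split.
    - apply Rmult_le_pos; [easy|apply rpow_nonneg].
    - intros t s Hts. rewrite Rmult_assoc. apply Rmult_le_compat_l; [easy|].
      apply rpow_trade; [easy|]. unfold S2, c in *; simpl in *; lra. }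
  destruct (tr (K * L) (3 * k0) (3 * kap) HKL ltac:(lra)) as [A3 [HA3 B3]].
  destruct (tr L k2 (3 * kap) HL ltac:(unfold k2; lra)) as [A4 [HA4 B4]].
  destruct (tr (K * L) (2 * k0) (2 * kap) HKL ltac:(lra)) as [A2 [HA2 B2]].
  destruct (tr (A3 + A4) (3 * kap) (2 * kap) ltac:(lra) ltac:(lra)) as [A5 [HA5 B5]].
  destruct (tr (K * L) k0 kap HKL ltac:(lra)) as [A1 [HA1 B1]].
  destruct (tr (A2 + A5) (2 * kap) kap ltac:(lra) ltac:(lra)) as [A6 [HA6 B6]].
  exists (A1 + A2 + A3 + A4 + A5 + A6). split; [lra|]. intros t s Hts.
  assert (Hts' := Hts). unfold S2 in Hts'; simpl in Hts'.
  assert (HT : S2 0 T (t, s)) by (unfold S2; simpl; lra).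
  specialize (B1 t s Hts). specialize (B2 t s Hts). specialize (B3 t s Hts).
  specialize (B4 t s Hts). specialize (B5 t s Hts). specialize (B6 t s Hts).
  destruct (ro_false HX (y s) HT) as [f1 [f2 f3]].
  assert (f4 := H2 false t s ltac:(lra) ltac:(lra) ltac:(lra)).
  unfold graded_norm, graded_exponent in f4. rewrite Rplus_0_l in f4. fold rem in f4.
  assert (HyL := H1 s ltac:(lra)).
  assert (up : forall i, K * rpow (t - s) i * norm (y s) <= K * L * rpow (t - s) i).
  { intros i. rewrite Rmult_assoc, Rmult_assoc. apply Rmult_le_compat_l; [easy|].
    rewrite Rmult_comm. apply Rmult_le_compat_r; [apply rpow_nonneg|easy]. }
  assert (u1 := up k0). assert (u2 := up (2 * k0)). assert (u3 := up (3 * k0)).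
  assert (hr : norm (path_r y t s) <= (A3 + A4) * rpow (t - s) (3 * kap)).
  { rewrite path_r_rem. eapply Rle_trans; [apply norm_triangle|]. lra. }
  assert (h1r : norm (path_1r y t s) <= (A2 + A5) * rpow (t - s) (2 * kap)).
  { unfold path_1r. eapply Rle_trans; [apply norm_triangle|]. lra. }
  assert (hd : norm (hdelta1 SE y t s) <= (A1 + A6) * rpow (t - s) kap).
  { replace (hdelta1 SE y t s) with (plus (X1 X t s (y s)) (path_1r y t s))
      by (unfold path_1r, path_r; module_eq_in E).
    eapply Rle_trans; [apply norm_triangle|]. lra. }
  assert (pk : forall q z B, z <= B * rpow (t - s) q -> B <= A1 + A2 + A3 + A4 + A5 + A6 ->
    z <= (A1 + A2 + A3 + A4 + A5 + A6) * rpow (t - s) q).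
  { intros q z B hz hB. apply Rle_trans with (1 := hz).
    apply Rmult_le_compat_r; [apply rpow_nonneg|easy]. }
  repeat split; eapply pk; eauto; lra.
Qed.

Lemma asol_continuous : continuous_on (S1 a b) y.
Proof.
  destruct path_bounds as [L [HL H]].
  apply (path_continuous sm (C := L) Hkap).
  intros t s h1 h2 h3. apply H. unfold S2; simpl; lra.
Qed.

Hypotheses (Hc1 : op_continuous T (X1 X)) (Hc2 : op_continuous T (X2 X))
  (Hc3 : op_continuous T (X3 X)).

Section Lim.
Variables (P : Type) (G : (P -> Prop) -> Prop).
Context {FG : Filter G}.
Variables (t s : P -> R) (t0 s0 : R).
Hypotheses (H0 : S2 a b (t0, s0)).
Hypothesis HS : S2lim G a b t s t0 s0.

Let H0T : S2 0 T (t0, s0).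
Proof. unfold S2 in *; simpl in *; lra. Qed.

Lemma lim_X1 (v : P -> E) v0 : filterlim v G (locally v0) ->
  filterlim (fun q => X1 X (t q) (s q) (v q)) G (locally (X1 X t0 s0 v0)).
Proof. intros Hv. apply (S2lim_op Ha Hb H0 HS Hc1); [apply (ro_lin HX H0T)|easy]. Qed.

Lemma lim_X2 (v : P -> E) v0 : filterlim v G (locally v0) ->
  filterlim (fun q => X2 X (t q) (s q) (v q)) G (locally (X2 X t0 s0 v0)).
Proof. intros Hv. apply (S2lim_op Ha Hb H0 HS Hc2); [apply (ro_lin HX H0T)|easy]. Qed.

Lemma lim_X3 (v : P -> E) v0 : filterlim v G (locally v0) ->
  filterlim (fun q => X3 X (t q) (s q) (v q)) G (locally (X3 X t0 s0 v0)).
Proof. intros Hv. apply (S2lim_op Ha Hb H0 HS Hc3); [apply (ro_lin HX H0T)|easy]. Qed.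

Lemma lim_hdelta1 :
  filterlim (fun q => hdelta1 SE y (t q) (s q)) G (locally (hdelta1 SE y t0 s0)).
Proof. exact (S2lim_hdelta1 sm H0 HS asol_continuous). Qed.

Lemma lim_path_r :
  filterlim (fun q => path_r y (t q) (s q)) G (locally (path_r y t0 s0)).
Proof.
  assert (Hs := S2lim_y_snd H0 HS asol_continuous).
  apply filterlim_minus; [easy|apply filterlim_minus; [easy|apply lim_hdelta1|]|].
  - now apply lim_X1.
  - now apply lim_X2.
Qed.

Lemma filterlim_plus_at (f g : P -> E) l m :
  filterlim f G (locally l) -> filterlim g G (locally m) ->
  filterlim (fun q => plus (f q) (g q)) G (locally (plus l m)).
Proof.
  intros Hf Hg.
  exact (filterlim_comp_2 (G := locally l) (H := locally m) f g plus Hf Hg (filterlim_plus l m)).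
Qed.

Lemma lim_path_1r :
  filterlim (fun q => path_1r y (t q) (s q)) G (locally (path_1r y t0 s0)).
Proof.
  assert (Hs := S2lim_y_snd H0 HS asol_continuous).
  apply filterlim_plus_at; [now apply lim_X2|apply lim_path_r].
Qed.

Lemma lim_rem : filterlim (fun q => rem X y (t q) (s q)) G (locally (rem X y t0 s0)).
Proof.
  assert (Hs := S2lim_y_snd H0 HS asol_continuous).
  assert (h := filterlim_minus lim_path_r (lim_X3 Hs)).
  replace (rem X y t0 s0) with (minus (path_r y t0 s0) (X3 X t0 s0 (y s0)))
    by (rewrite path_r_rem; module_eq_in E).
  apply (filterlim_ext (fun q => minus (path_r y (t q) (s q)) (X3 X (t q) (s q) (y (s q))))).
  - intros q. rewrite path_r_rem. module_eq_in E.
  - exact h.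
Qed.

End Lim.

Lemma j_lim {P : Type} (G : (P -> Prop) -> Prop) {FG : Filter G} (v : P -> E) v0 :
  filterlim v G (locally v0) -> filterlim (fun q => j (v q)) G (locally (j v0)).
Proof.
  intros Hv. apply (filterlim_comp _ _ _ v j G (locally v0) (locally (j v0)) Hv).
  exact (linear_cont j v0 (sm_j sm)).
Qed.

Lemma C2_of (mu L : R) (g : R -> R -> E) :
  (forall p, S2 a b p -> filterlim (fun q => g (fst q) (snd q)) (within (S2 a b) (locally p))
     (locally (g (fst p) (snd p)))) ->
  (forall t s, S2 a b (t, s) -> norm (g t s) <= L * rpow (t - s) mu) -> C2 a b mu g.
Proof. intros H1 H2. split; [exact H1|]. now exists L. Qed.

Lemma asol_in_Q : in_Q SE X a b kap psi (solution_path y).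
Proof.
  destruct path_bounds as [L [HL H]].
  assert (Hcy : Defs.C1 SE a b kap y).
  { split; [exact asol_continuous|]. apply (@C2_of kap L).
    - intros p Hp. apply lim_hdelta1; [apply within_filter, locally_filter|exact Hp|apply S2lim_id].
    - intros t s Hts. apply (H t s Hts). }
  split; [exact (proj1 Hy)|]. split; [exact Hcy|]. split; [exact Hcy|]. split; [exact Hcy|].
  split; [|split; [|split]].
  - apply (@C2_of (3 * kap) L).
    + intros p Hp. apply lim_path_r; [apply within_filter, locally_filter|exact Hp|apply S2lim_id].
    + intros t s Hts. apply (H t s Hts).
  - apply (@C2_of (2 * kap) L).
    + intros p Hp. apply lim_path_1r; [apply within_filter, locally_filter|exact Hp|apply S2lim_id].
    + intros t s Hts. apply (H t s Hts).
  - intros t s Hts. simpl. unfold path_r. module_eq_in E.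
  - intros t s Hts. simpl. unfold path_1r, path_r. module_eq_in E.
Qed.

(** The remainder is itself the image under the sewing map: it has order e + k2 > 1 in F, and its
    hdelta from [rem_delta] coincides with the argument of Lambda once y^r is written as X^3 y plus
    the remainder. *)
Lemma asol_is_Lambda :
  is_Lambda SF a b (fun t u s => j (path_sew y t u s)) (fun t s => j (rem X y t s)).
Proof.
  destruct path_bounds as [L [HL H]].
  destruct Hy as [_ [L' [_ H2]]].
  exists (e + k2). split; [easy|]. split; [|split].
  - assert (c1 : forall p, S3 a b p -> filterlim
      (fun q => X1 X (fst (fst q)) (snd (fst q)) (path_r y (snd (fst q)) (snd q)))
      (within (S3 a b) (locally p))
      (locally (X1 X (fst (fst p)) (snd (fst p)) (path_r y (snd (fst p)) (snd p))))).
    { intros p Hp. apply lim_X1; [apply within_filter, locally_filter|unfold S2, S3 in *; simpl; lra|apply S3lim_1|].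
      apply lim_path_r; [apply within_filter, locally_filter|unfold S2, S3 in *; simpl; lra|apply S3lim_2]. }
    assert (c2 : forall p, S3 a b p -> filterlim
      (fun q => X2 X (fst (fst q)) (snd (fst q)) (path_1r y (snd (fst q)) (snd q)))
      (within (S3 a b) (locally p))
      (locally (X2 X (fst (fst p)) (snd (fst p)) (path_1r y (snd (fst p)) (snd p))))).
    { intros p Hp. apply lim_X2; [apply within_filter, locally_filter|unfold S2, S3 in *; simpl; lra|apply S3lim_1|].
      apply lim_path_1r; [apply within_filter, locally_filter|unfold S2, S3 in *; simpl; lra|apply S3lim_2]. }
    assert (c3 : forall p, S3 a b p -> filterlim
      (fun q => X3 X (fst (fst q)) (snd (fst q)) (hdelta1 SE y (snd (fst q)) (snd q)))
      (within (S3 a b) (locally p))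
      (locally (X3 X (fst (fst p)) (snd (fst p)) (hdelta1 SE y (snd (fst p)) (snd p))))).
    { intros p Hp. apply lim_X3; [apply within_filter, locally_filter|unfold S2, S3 in *; simpl; lra|apply S3lim_1|].
      apply lim_hdelta1; [apply within_filter, locally_filter|unfold S2, S3 in *; simpl; lra|apply S3lim_2]. }
    split.
    { intros p Hp. apply j_lim; [apply within_filter, locally_filter|].
      apply filterlim_plus_at; [apply within_filter, locally_filter| |now apply c3].
      apply filterlim_plus_at; [apply within_filter, locally_filter|now apply c1|now apply c2]. }
    set (c := 1 + T).
    (* The three summands, followed by zeros. The exponents at t - u are e + k0 + i kap, so that
       those at u - s, which complete them to e + k2, are 3 kap, 2 kap and kap; the orders e + 2 k0
       and e + 3 k0 of X^2 and X^3 are lowered to fit, at the cost of powers of 1 + T. The default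
       exponent must still lie strictly between 0 and e + k2. *)
    exists (fun i t u s => match i with
       | O => j (X1 X t u (path_r y u s))
       | 1%nat => j (X2 X t u (path_1r y u s))
       | 2%nat => j (X3 X t u (hdelta1 SE y u s))
       | _ => zero end),
     (fun i => match i with
       | O => e + k0 | 1%nat => e + k0 + kap | 2%nat => e + k0 + 2 * kap
       | _ => e + k0 end),
     (fun i => match i with
       | O => K * L | 1%nat => K * L * rpow c (k0 - kap)
       | 2%nat => K * L * rpow c (2 * (k0 - kap))
       | _ => 0 end).
    assert (HKL : 0 <= K * L) by now apply Rmult_le_pos.
    assert (He := sm_e sm).
    split; [|split; [|split]].
    + intros i. split; [|split].
      * destruct i as [|[|[|i]]].
        -- intros p Hp. apply j_lim; [apply within_filter, locally_filter|now apply c1].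
        -- intros p Hp. apply j_lim; [apply within_filter, locally_filter|now apply c2].
        -- intros p Hp. apply j_lim; [apply within_filter, locally_filter|now apply c3].
        -- intros p Hp. apply filterlim_const.
      * unfold k2; destruct i as [|[|[|i]]]; lra.
      * destruct i as [|[|[|i]]]; try lra; apply Rmult_le_pos; try easy; apply rpow_nonneg.
    + intros i t u s H3. unfold S3 in H3; simpl in H3.
      assert (Htu : S2 0 T (t, u)) by (unfold S2; simpl; lra).
      destruct (H u s ltac:(unfold S2; simpl; lra)) as [b1 [b2 b3]].
      assert (pr : forall p p' q z (A : E -> E),
        (forall v, norm (j (A v)) <= K * rpow (t - u) (e + p) * norm v) -> p' <= p ->
        norm z <= L * rpow (u - s) q ->
        norm (j (A z)) <= K * L * rpow c (p - p') * (rpow (t - u) (e + p') * rpow (u - s) q)).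
      { intros p p' q z A hA hp hz. apply Rle_trans with (1 := hA z).
        assert (g1 : rpow (t - u) (e + p) <= rpow c (p - p') * rpow (t - u) (e + p')).
        { replace (p - p') with (e + p - (e + p')) by ring. apply rpow_trade; [lra|].
          unfold c; lra. }
        replace (K * L * rpow c (p - p') * (rpow (t - u) (e + p') * rpow (u - s) q))
          with (K * (rpow c (p - p') * rpow (t - u) (e + p')) * (L * rpow (u - s) q)) by ring.
        apply Rmult_le_compat; [apply Rmult_le_pos; [easy|apply rpow_nonneg]|apply norm_ge_0| |easy].
        now apply Rmult_le_compat_l. }
      destruct i as [|[|[|i]]].
      * assert (g := pr k0 k0 (3 * kap) (path_r y u s) (X1 X t u)
          (fun v => ro_1 HX true v Htu) (Rle_refl _) b3).
        replace (e + k2 - (e + k0)) with (3 * kap) by (unfold k2; ring).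
        apply Rle_trans with (1 := g). apply Rmult_le_compat_r.
        { apply Rmult_le_pos; apply rpow_nonneg. }
        rewrite Rminus_diag. rewrite <- (Rmult_1_r (K * L)) at 2.
        apply Rmult_le_compat_l; [easy|]. right. rewrite rpow_Rpower.
        -- apply Rpower_O. unfold c; lra.
        -- unfold c; lra.
      * assert (g := pr (2 * k0) (k0 + kap) (2 * kap) (path_1r y u s) (X2 X t u)
          (fun v => ro_2 HX true v Htu) ltac:(lra) b2).
        replace (e + k2 - (e + k0 + kap)) with (2 * kap) by (unfold k2; ring).
        replace (2 * k0 - (k0 + kap)) with (k0 - kap) in g by ring.
        rewrite <- Rplus_assoc in g. exact g.
      * assert (g := pr (3 * k0) (k0 + 2 * kap) kap (hdelta1 SE y u s) (X3 X t u)
          (fun v => ro_3 HX true v Htu) ltac:(lra) b1).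
        replace (e + k2 - (e + k0 + 2 * kap)) with kap by (unfold k2; ring).
        replace (3 * k0 - (k0 + 2 * kap)) with (2 * (k0 - kap)) in g by ring.
        rewrite <- Rplus_assoc in g. exact g.
      * rewrite norm_zero, Rmult_0_l. lra.
    + intros t u s H3. unfold path_sew.
      rewrite !(linear_plus _ (sm_j sm)).
      match goal with |- is_series ?f _ => exact (is_series_3 (a := f) (fun n => eq_refl)) end.
    + match goal with |- ex_series ?f =>
        exact (ex_intro _ _ (is_series_3 (V := R_NormedModule) (a := f) (fun n => eq_refl))) end.
  - split.
    + intros p Hp. apply j_lim; [apply within_filter, locally_filter|].
      apply lim_rem; [apply within_filter, locally_filter|exact Hp|apply S2lim_id].
    + exists L'. intros t s Hts. unfold S2 in Hts; simpl in Hts.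
      exact (H2 true t s ltac:(lra) ltac:(lra) ltac:(lra)).
  - intros t u s H3. assert (H3' := H3). unfold S3 in H3'; simpl in H3'.
    assert (H3T : S3 0 T (t, u, s)) by (unfold S3; simpl; lra).
    assert (Htu : S2 0 T (t, u)) by (unfold S2; simpl; lra).
    destruct (ro_lin HX Htu) as [l1 [l2 l3]].
    unfold hdelta2. rewrite HSF by lra.
    rewrite <- !(linear_minus _ _ _ (sm_j sm)). f_equal.
    transitivity (plus (chi X t u s (y s)) (Xs X t u (rem X y u s))).
    + exact (rem_delta sm HX HC y H3T).
    + unfold path_sew.
      replace (hdelta1 SE y u s) with (plus (X1 X u s (y s)) (plus (X2 X u s (y s)) (path_r y u s)))
        by (unfold path_r; module_eq_in E).
      unfold path_1r. rewrite path_r_rem.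
      rewrite !(linear_plus _ l1), !(linear_plus _ l2), !(linear_plus _ l3).
      unfold chi, Xs. module_eq_in E.
Qed.

End Sol.
End Solution.

(** * Fubini's theorem and uniform boundedness *)

Lemma continuous_norm_eps {V : NormedModule R_AbsRing} (f : R -> V) x :
  continuous f x <-> forall eps, 0 < eps -> exists d, 0 < d /\
    forall y, Rabs (y - x) < d -> norm (minus (f y) (f x)) < eps.
Proof.
  apply (iff_trans (filterlim_norm_eps (locally x) f (f x))). split; intros H eps Heps.
  - destruct (H eps Heps) as [d Hd]. exists d. split; [apply cond_pos|].
    intros y Hy. apply Hd. exact Hy.
  - destruct (H eps Heps) as [d [Hd Hy]]. exists (mkposreal d Hd).
    intros y h. apply Hy. exact h.
Qed.

Lemma continuous_2d_norm_eps {V : NormedModule R_AbsRing} (f : R -> R -> V) x y :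
  continuous (fun p : R * R => f (fst p) (snd p)) (x, y) <->
  forall eps, 0 < eps -> exists d, 0 < d /\
    forall x' y', Rabs (x' - x) < d -> Rabs (y' - y) < d ->
      norm (minus (f x' y') (f x y)) < eps.
Proof.
  apply (iff_trans (filterlim_norm_eps (locally (x, y))
    (fun p : R * R => f (fst p) (snd p)) (f x y))). split; intros H eps Heps.
  - destruct (H eps Heps) as [d Hd]. exists d. split; [apply cond_pos|].
    intros x' y' Hx Hy. apply (Hd (x', y')). split; [exact Hx|exact Hy].
  - destruct (H eps Heps) as [d [Hd Hy]]. exists (mkposreal d Hd).
    intros [x' y'] [h1 h2]. apply Hy; [exact h1|exact h2].
Qed.

(** The Heine-Cantor theorem through a Lebesgue number. Continuity is used on radius 2 h about a
    centre: a point within h of the centre has its whole h-neighbourhood there. *)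
Lemma uniform_2d {V : NormedModule R_AbsRing} (f : R -> R -> V) a b c d :
  (forall u t, a <= u <= b -> c <= t <= d ->
     continuous (fun p : R * R => f (fst p) (snd p)) (u, t)) ->
  forall eps, 0 < eps -> exists h, 0 < h /\ forall u u' t t',
    a <= u <= b -> a <= u' <= b -> c <= t <= d -> c <= t' <= d ->
    Rabs (u' - u) < h -> Rabs (t' - t) < h -> norm (minus (f u' t') (f u t)) < eps.
Proof.
  intros H eps Heps.
  assert (Hd : forall u t, exists h : posreal, a <= u <= b -> c <= t <= d ->
    forall u' t', Rabs (u' - u) < 2 * h -> Rabs (t' - t) < 2 * h ->
      norm (minus (f u' t') (f u t)) < eps / 2).
  { intros u t. destruct (classic (a <= u <= b /\ c <= t <= d)) as [[h1 h2]|h1].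
    - destruct (proj1 (continuous_2d_norm_eps f u t) (H u t h1 h2) (eps / 2) ltac:(lra))
        as [h [Hh Hf]].
      assert (Hh' : 0 < h / 2) by lra. exists (mkposreal _ Hh'). simpl.
      intros _ _ u' t' i1 i2. apply Hf; lra.
    - exists (mkposreal 1 Rlt_0_1). tauto. }
  set (del := fun u t => proj1_sig (constructive_indefinite_description _ (Hd u t))).
  destruct (compactness_value_2d a b c d del) as [h Hh].
  exists h. split; [apply cond_pos|]. intros u u' t t' h1 h2 h3 h4 h5 h6.
  apply NNPP. intros Hn. apply (Hh u t h1 h3). intros [x [y [i1 [i2 [i3 [i4 i5]]]]]].
  apply Hn. clear Hn Hh. unfold del in *.
  destruct (constructive_indefinite_description _ (Hd x y)) as [r Hr]; simpl in *.
  specialize (Hr i1 i2).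
  assert (hr := cond_pos r).
  assert (g1 := Hr u t ltac:(lra) ltac:(lra)).
  assert (g2 : Rabs (u' - x) < 2 * r).
  { replace (u' - x) with ((u' - u) + (u - x)) by ring.
    eapply Rle_lt_trans; [apply Rabs_triang|]. lra. }
  assert (g3 : Rabs (t' - y) < 2 * r).
  { replace (t' - y) with ((t' - t) + (t - y)) by ring.
    eapply Rle_lt_trans; [apply Rabs_triang|]. lra. }
  specialize (Hr u' t' g2 g3).
  replace (minus (f u' t') (f u t)) with
    (minus (minus (f u' t') (f x y)) (minus (f u t) (f x y))) by module_eq_in V.
  eapply Rle_lt_trans; [apply norm_minus_le|]. lra.
Qed.

(** A vanishing derivative in uniform, derivative-free form: summing over a fine equal partition
    leaves at most eps times the length. *)
Lemma null_increments {V : NormedModule R_AbsRing} (D : R -> V) a b : a <= b ->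
  (forall eps, 0 < eps -> exists h, 0 < h /\ forall x x', a <= x -> x <= x' -> x' <= b ->
     x' - x < h -> norm (minus (D x') (D x)) <= eps * (x' - x)) ->
  D b = D a.
Proof.
  intros Hab H.
  assert (Hz : norm (minus (D b) (D a)) <= 0).
  { apply le_epsilon. intros eps Heps.
    destruct (H (eps / (b - a + 1))) as [h [Hh Hd]].
    { apply Rdiv_lt_0_compat; lra. }
    set (ep := eps / (b - a + 1)) in *.
    assert (Hep : 0 < ep) by (apply Rdiv_lt_0_compat; lra).
    destruct (INR_unbounded ((b - a) / h)) as [N HN].
    assert (HS : 0 < INR (S N)) by (apply lt_0_INR; lia).
    set (w := (b - a) / INR (S N)).
    assert (Hw : 0 <= w) by (apply Rmult_le_pos; [lra|left; now apply Rinv_0_lt_compat]).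
    assert (Hwh : w < h).
    { apply Rmult_lt_reg_r with (INR (S N)); [easy|].
      replace (w * INR (S N)) with ((b - a) / h * h) by (unfold w; field; lra).
      rewrite S_INR in *. rewrite (Rmult_comm h). apply Rmult_lt_compat_r; lra. }
    assert (Hi : forall i, (i <= S N)%nat ->
       norm (minus (D (a + INR i * w)) (D a)) <= ep * (INR i * w)).
    { induction i as [|i IH]; intros Hi.
      - simpl. rewrite Rmult_0_l, Rplus_0_r.
        replace (minus (D a) (D a)) with (@zero V) by module_eq_in V.
        rewrite norm_zero. lra.
      - specialize (IH ltac:(lia)).
        assert (hb : INR (S i) * w <= b - a).
        { replace (b - a) with (INR (S N) * w) by (unfold w; field; lra).
          apply Rmult_le_compat_r; [easy|]. now apply le_INR. }
        assert (hi := pos_INR i). assert (0 <= INR i * w) by now apply Rmult_le_pos.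
        rewrite S_INR in hb |- *.
        assert (g := Hd (a + INR i * w) (a + (INR i + 1) * w) ltac:(lra) ltac:(lra)
          ltac:(lra) ltac:(lra)).
        replace (minus (D (a + (INR i + 1) * w)) (D a)) with
          (plus (minus (D (a + (INR i + 1) * w)) (D (a + INR i * w)))
                (minus (D (a + INR i * w)) (D a))) by module_eq_in V.
        eapply Rle_trans; [apply norm_triangle|]. lra. }
    specialize (Hi (S N) (le_n _)).
    replace (INR (S N) * w) with (b - a) in Hi by (unfold w; field; lra).
    replace (a + (b - a)) with b in Hi by ring.
    apply Rle_trans with (1 := Hi).
    replace eps with (ep * (b - a + 1)) at 1 by (unfold ep; field; lra).
    rewrite Rplus_0_l. apply Rmult_le_compat_l; lra. }
  assert (h0 : minus (D b) (D a) = zero).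
  { apply norm_eq_zero. apply Rle_antisym; [easy|apply norm_ge_0]. }
  transitivity (plus (minus (D b) (D a)) (D a)); [module_eq_in V|].
  rewrite h0. apply plus_zero_l.
Qed.

Lemma continuous_slices {V : NormedModule R_AbsRing} (f : R -> R -> V) u t :
  continuous (fun p : R * R => f (fst p) (snd p)) (u, t) ->
  continuous (fun x => f x t) u /\ continuous (f u) t.
Proof.
  intros H. rewrite continuous_2d_norm_eps in H.
  split; apply continuous_norm_eps; intros eps Heps; destruct (H eps Heps) as [d [Hd Hf]];
    exists d; (split; [easy|]); intros x Hx; apply Hf; try easy;
    rewrite Rminus_diag, Rabs_R0; easy.
Qed.

Section Fubini.

Context {V : CompleteNormedModule R_AbsRing}.
Variables (f : R -> R -> V) (a b c d r : R).
Hypotheses (Hab : a <= b) (Hcd : c <= d) (Hr : 0 < r).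
(** The rectangle is enlarged by r because continuity at an end point is two-sided here. *)
Hypothesis Hf : forall u t, a - r <= u <= b + r -> c - r <= t <= d + r ->
  continuous (fun p : R * R => f (fst p) (snd p)) (u, t).

Lemma ex_RInt_snd u x y : a - r <= u <= b + r -> c - r <= x <= d + r -> c - r <= y <= d + r ->
  ex_RInt (f u) x y.
Proof.
  intros Hu Hx Hy. apply ex_RInt_continuous. intros t Ht.
  apply (fun H => proj2 (continuous_slices (f := f) (u := u) (t := t) H)), Hf; [easy|].
  unfold Rmin, Rmax in Ht; destruct (Rle_dec x y); lra.
Qed.

Lemma ex_RInt_fst t x y : c - r <= t <= d + r -> a - r <= x <= b + r -> a - r <= y <= b + r ->
  ex_RInt (fun u => f u t) x y.
Proof.
  intros Ht Hx Hy. apply ex_RInt_continuous. intros u Hu.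
  apply (fun H => proj1 (continuous_slices (f := f) (u := u) (t := t) H)), Hf; [|easy].
  unfold Rmin, Rmax in Hu; destruct (Rle_dec x y); lra.
Qed.

Lemma norm_RInt_diff (g h : R -> V) x y M : x <= y ->
  ex_RInt g x y -> ex_RInt h x y ->
  (forall t, x <= t <= y -> norm (minus (g t) (h t)) <= M) ->
  norm (minus (RInt g x y) (RInt h x y)) <= (y - x) * M.
Proof.
  intros Hxy Hg Hh HM.
  apply (norm_RInt_le_const (fun t => minus (g t) (h t)) x y); [easy|exact HM|].
  apply (is_RInt_minus g h); now apply RInt_correct.
Qed.

Lemma RInt_snd_continuous u : a - r < u < b + r -> continuous (fun x => RInt (f x) c d) u.
Proof.
  intros Hu. apply (proj2 (continuous_norm_eps (V := V) _ _)). intros eps Heps.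
  destruct (uniform_2d Hf (eps := eps / (d - c + 1))) as [h [Hh Hd]].
  { apply Rdiv_lt_0_compat; lra. }
  set (m := Rmin h (Rmin (u - (a - r)) (b + r - u))).
  assert (Hm : 0 < m) by (repeat apply Rmin_pos; lra).
  assert (Hm1 : m <= h) by apply Rmin_l.
  assert (Hm2 : m <= u - (a - r)) by (eapply Rle_trans; [apply Rmin_r|apply Rmin_l]).
  assert (Hm3 : m <= b + r - u) by (eapply Rle_trans; [apply Rmin_r|apply Rmin_r]).
  exists m. split; [easy|]. intros y Hy.
  assert (Hy' := Hy). apply Rabs_lt_between in Hy'.
  apply Rle_lt_trans with ((d - c) * (eps / (d - c + 1))).
  - apply norm_RInt_diff; [easy|apply ex_RInt_snd; lra|apply ex_RInt_snd; lra|].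
    intros t Ht. left. apply Hd; try lra. rewrite Rminus_diag, Rabs_R0. easy.
  - apply Rlt_le_trans with ((d - c + 1) * (eps / (d - c + 1))).
    + apply Rmult_lt_compat_r; [apply Rdiv_lt_0_compat|]; lra.
    + right. field. lra.
Qed.

Lemma RInt_fst_continuous x y t : a <= x -> x <= y -> y <= b ->
  c - r < t < d + r -> continuous (fun t => RInt (fun u => f u t) x y) t.
Proof.
  intros Hx Hxy Hy Ht. apply (proj2 (continuous_norm_eps (V := V) _ _)). intros eps Heps.
  destruct (uniform_2d Hf (eps := eps / (y - x + 1))) as [h [Hh Hd]].
  { apply Rdiv_lt_0_compat; lra. }
  set (m := Rmin h (Rmin (t - (c - r)) (d + r - t))).
  assert (Hm : 0 < m) by (repeat apply Rmin_pos; lra).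
  assert (Hm1 : m <= h) by apply Rmin_l.
  assert (Hm2 : m <= t - (c - r)) by (eapply Rle_trans; [apply Rmin_r|apply Rmin_l]).
  assert (Hm3 : m <= d + r - t) by (eapply Rle_trans; [apply Rmin_r|apply Rmin_r]).
  exists m. split; [easy|]. intros z Hz.
  assert (Hz' := Hz). apply Rabs_lt_between in Hz'.
  apply Rle_lt_trans with ((y - x) * (eps / (y - x + 1))).
  - apply norm_RInt_diff; [easy|apply ex_RInt_fst; lra|apply ex_RInt_fst; lra|].
    intros u Hu. left. apply Hd; try lra. rewrite Rminus_diag, Rabs_R0. easy.
  - apply Rlt_le_trans with ((y - x + 1) * (eps / (y - x + 1))).
    + apply Rmult_lt_compat_r; [apply Rdiv_lt_0_compat|]; lra.
    + right. field. lra.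
Qed.

(** As functions of the upper limit of the u-integral, both sides have over [x, y] the increment (y
    - x) times the integral of f x, up to an error small compared with y - x. Their difference is
    thus constant by [null_increments], and it vanishes at a. *)
Theorem RInt_swap :
  RInt (fun u => RInt (f u) c d) a b = RInt (fun t => RInt (fun u => f u t) a b) c d.
Proof.
  set (A := fun x => RInt (fun u => RInt (f u) c d) a x).
  set (B := fun x => RInt (fun t => RInt (fun u => f u t) a x) c d).
  assert (exA : forall x y, a <= x <= b -> a <= y <= b ->
    ex_RInt (fun u => RInt (f u) c d) x y).
  { intros x y Hx Hy. apply ex_RInt_continuous. intros u Hu.
    apply RInt_snd_continuous. unfold Rmin, Rmax in Hu; destruct (Rle_dec x y); lra. }
  assert (exB : forall x y, a <= x -> x <= y -> y <= b ->
    ex_RInt (fun t => RInt (fun u => f u t) x y) c d).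
  { intros x y Hx Hxy Hy. apply ex_RInt_continuous. intros t Ht.
    apply RInt_fst_continuous; try easy.
    unfold Rmin, Rmax in Ht; destruct (Rle_dec c d); lra. }
  assert (Hz : minus (A b) (B b) = minus (A a) (B a)).
  { apply (null_increments (D := fun x => minus (A x) (B x)) Hab).
    intros eps Heps.
    set (ep := eps / (2 * (d - c + 1))).
    assert (Hep : 0 < ep) by (apply Rdiv_lt_0_compat; lra).
    destruct (uniform_2d Hf Hep) as [h [Hh Hd]].
    exists h. split; [easy|]. intros x y Hx Hxy Hy Hxyh.
    set (I := scal (y - x) (RInt (f x) c d)).
    assert (e1 : minus (A y) (A x) = RInt (fun u => RInt (f u) c d) x y).
    { unfold A. rewrite <- (RInt_Chasles (fun u => RInt (f u) c d) a x y)
        by (apply exA; lra). module_eq_in V. }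
    assert (e2 : minus (B y) (B x) = RInt (fun t => RInt (fun u => f u t) x y) c d).
    { unfold B.
      assert (g := is_RInt_minus _ _ c d _ _ (RInt_correct _ _ _ (exB a y ltac:(lra) ltac:(lra) Hy))
        (RInt_correct _ _ _ (exB a x ltac:(lra) ltac:(lra) ltac:(lra)))).
      transitivity (RInt (fun t => minus (RInt (fun u => f u t) a y)
        (RInt (fun u => f u t) a x)) c d); [symmetry; apply is_RInt_unique; exact g|].
      apply RInt_ext. intros t Ht.
      rewrite Rmin_left, Rmax_right in Ht by lra.
      rewrite <- (RInt_Chasles (fun u => f u t) a x y) by (apply ex_RInt_fst; lra).
      module_eq_in V. }
    assert (b1 : norm (minus (RInt (fun u => RInt (f u) c d) x y) I) <= (y - x) * ((d - c) * ep)).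
    { unfold I. rewrite <- (RInt_const x y (RInt (f x) c d)).
      apply norm_RInt_diff; [easy|apply exA; lra|apply ex_RInt_const|].
      intros u Hu. apply norm_RInt_diff; [easy|apply ex_RInt_snd; lra|apply ex_RInt_snd; lra|].
      intros t Ht. left. apply Hd; try lra.
      - rewrite Rabs_right; lra.
      - rewrite Rminus_diag, Rabs_R0. easy. }
    assert (b2 : norm (minus (RInt (fun t => RInt (fun u => f u t) x y) c d) I)
        <= (d - c) * ((y - x) * ep)).
    { unfold I. rewrite <- (RInt_scal (f x) c d (y - x)) by (apply ex_RInt_snd; lra).
      apply norm_RInt_diff; [easy|apply exB; lra| |].
      { apply (@ex_RInt_scal V). apply ex_RInt_snd; lra. }
      intros t Ht. rewrite <- (RInt_const x y (f x t)).
      apply norm_RInt_diff; [easy|apply ex_RInt_fst; lra|apply ex_RInt_const|].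
      intros u Hu. left. apply Hd; try lra.
      - rewrite Rabs_right; lra.
      - rewrite Rminus_diag, Rabs_R0. easy. }
    match goal with |- norm ?v <= _ => replace v with
      (minus (minus (minus (A y) (A x)) I) (minus (minus (B y) (B x)) I)) by module_eq_in V end.
    rewrite <- e1 in b1. rewrite <- e2 in b2.
    eapply Rle_trans; [apply (@norm_minus_le V)|].
    eapply Rle_trans; [apply Rplus_le_compat; [exact b1|exact b2]|].
    apply Rle_trans with (2 * (d - c) * ep * (y - x)); [lra|].
    apply Rmult_le_compat_r; [lra|].
    replace eps with (2 * (d - c + 1) * ep) by (unfold ep; field; lra).
    apply Rmult_le_compat_r; lra. }
  assert (Hz0 : minus (A a) (B a) = zero).
  { unfold A, B. rewrite RInt_point.
    replace (RInt (fun t => RInt (fun u => f u t) a a) c d) with (@zero V).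
    - module_eq_in V.
    - symmetry. transitivity (RInt (fun _ : R => @zero V) c d).
      + apply RInt_ext. intros t _. apply RInt_point.
      + rewrite RInt_const. apply (@scal_zero_r R_AbsRing V). }
  rewrite Hz0 in Hz. change (A b = B b).
  transitivity (plus (minus (A b) (B b)) (B b)); [module_eq_in V|].
  rewrite Hz. apply plus_zero_l.
Qed.

End Fubini.

(** * The uniform boundedness principle *)

Definition seq_complete (V : NormedModule R_AbsRing) : Prop :=
  forall u : nat -> V,
  (forall eps, 0 < eps -> exists N, forall n m, (N <= n)%nat -> (N <= m)%nat ->
     norm (minus (u n) (u m)) < eps) ->
  exists l : V, forall eps, 0 < eps -> exists N, forall n, (N <= n)%nat ->
     norm (minus (u n) l) < eps.

Lemma complete_seq (V : CompleteNormedModule R_AbsRing) : seq_complete V.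
Proof.
  intros u H.
  destruct (proj1 (@filterlim_locally_cauchy nat V eventually _ u)) as [l Hl].
  - intros eps. destruct (H eps (cond_pos eps)) as [N HN].
    exists (fun n => (N <= n)%nat). split; [now exists N|].
    intros n m Hn Hm. apply (@norm_compat1 R_AbsRing V). now apply HN.
  - exists l. intros eps Heps.
    destruct (proj1 (@filterlim_norm_eps nat V eventually _ u l) Hl eps Heps) as [N HN].
    exists N. exact HN.
Qed.

(** The last clause, near attainment of the norm on the unit ball, supplies the directions of the
    walk in [uniform_boundedness]. *)
Lemma op_norm {U V : NormedModule R_AbsRing} (L : U -> V) : is_linear L ->
  exists N, 0 <= N /\ (forall x, norm (L x) <= N * norm x) /\
    forall c, c < N -> exists x, norm x <= 1 /\ c < norm (L x).
Proof.
  intros HL. destruct (linear_norm _ HL) as [M [HM HMb]].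
  assert (Hz : L zero = zero) by now apply linear_zero.
  destruct (completeness (fun c => exists x, norm x <= 1 /\ c = norm (L x))) as [N [HN1 HN2]].
  - exists M. intros c [x [hx ->]]. apply Rle_trans with (1 := HMb x). nra.
  - exists 0, zero. rewrite Hz, !norm_zero. lra.
  - assert (HN0 : 0 <= N).
    { apply HN1. exists zero. rewrite Hz, !norm_zero. lra. }
    exists N. split; [easy|]. split.
    + intros x. destruct (Req_dec (norm x) 0) as [h|h].
      { rewrite (norm_eq_zero _ h), Hz, !norm_zero. lra. }
      assert (hp : 0 < norm x) by (generalize (norm_ge_0 x); lra).
      assert (g : norm (L (scal (/ norm x) x)) <= N).
      { apply HN1. eexists. split; [|reflexivity].
        rewrite (norm_scal_R (/ norm x)), Rabs_inv, (Rabs_right (norm x)) by lra.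
        rewrite Rinv_l; lra. }
      rewrite (linear_scal _ HL), (norm_scal_R (/ norm x)), Rabs_inv, (Rabs_right (norm x)) in g by lra.
      apply (Rmult_le_compat_l (norm x)) in g; [|lra].
      rewrite <- Rmult_assoc, Rinv_r in g by lra. lra.
    + intros c Hc. apply NNPP. intros Hn.
      assert (N <= c); [|lra]. apply HN2. intros c' [x [hx ->]].
      destruct (Rle_lt_dec (norm (L x)) c); [easy|]. exfalso. apply Hn. now exists x.
Qed.

Section Uniform_boundedness.

Context {V W : NormedModule R_AbsRing}.
Variables (L : nat -> V -> W) (xi : nat -> V).

Fixpoint glide (k : nat) : V :=
  match k with
  | O => zero
  | S k => if Rle_dec (norm (L k (minus (glide k) (xi k)))) (norm (L k (plus (glide k) (xi k))))
           then plus (glide k) (xi k) else minus (glide k) (xi k)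
  end.

Lemma glide_step k : norm (minus (glide (S k)) (glide k)) <= norm (xi k).
Proof.
  simpl. destruct (Rle_dec _ _).
  - replace (minus (plus (glide k) (xi k)) (glide k)) with (xi k) by module_eq_in V. lra.
  - replace (minus (minus (glide k) (xi k)) (glide k)) with (opp (xi k)) by module_eq_in V.
    rewrite norm_opp. lra.
Qed.

(** The images of g + xi and g - xi differ by 2 L xi, so the larger one, which [glide] selects, has
    at least the norm of L xi. *)
Lemma glide_large k : is_linear (L k) -> norm (L k (xi k)) <= norm (L k (glide (S k))).
Proof.
  intros HL.
  assert (h : 2 * norm (L k (xi k)) <=
    norm (L k (plus (glide k) (xi k))) + norm (L k (minus (glide k) (xi k)))).
  { replace (2 * norm (L k (xi k))) with (norm (scal 2 (L k (xi k)))).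
    2: { rewrite (norm_scal_R 2), Rabs_right by lra. reflexivity. }
    replace (scal 2 (L k (xi k))) with
      (minus (L k (plus (glide k) (xi k))) (L k (minus (glide k) (xi k)))).
    - apply norm_minus_le.
    - rewrite (linear_plus _ HL), (linear_minus _ _ _ HL). module_eq_in W. }
  simpl. destruct (Rle_dec _ _); lra.
Qed.

End Uniform_boundedness.

(* Sokal's proof: the walk [glide] moves by [3^-k] in a direction in which the
   [k]-th operator, of norm at least [4^k], is almost as large as possible. *)
Theorem uniform_boundedness (V W : NormedModule R_AbsRing) (L : nat -> V -> W) :
  seq_complete V ->
  (forall n, is_linear (L n)) ->
  (forall x, exists M, forall n, norm (L n x) <= M) ->
  exists C, forall n x, norm (L n x) <= C * norm x.
Proof.
  intros Hcomp HL Hpt. apply NNPP. intros Hn.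
  assert (Hk : forall k, exists nx : nat * V,
    is_linear (L (fst nx)) /\ norm (snd nx) <= (/ 3) ^ k /\
    exists N, (forall x, norm (L (fst nx) x) <= N * norm x) /\ 4 ^ k <= N /\
      2 / 3 * (/ 3) ^ k * N <= norm (L (fst nx) (snd nx))).
  { intros k.
    assert (Hex : exists n x, 4 ^ k * norm x < norm (L n x)).
    { apply NNPP. intros Hc. apply Hn. exists (4 ^ k). intros n x.
      destruct (Rle_lt_dec (norm (L n x)) (4 ^ k * norm x)); [easy|].
      exfalso. apply Hc. now exists n, x. }
    destruct Hex as [n [x Hx]]. destruct (op_norm (HL n)) as [N [HN0 [HN1 HN2]]].
    assert (H4 : 1 <= 4 ^ k) by (apply pow_R1_Rle; lra).
    assert (H3 : 0 < (/ 3) ^ k) by (apply pow_lt; lra).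
    assert (HN4 : 4 ^ k <= N).
    { destruct (Rle_lt_dec (4 ^ k) N); [easy|]. specialize (HN1 x).
      assert (N * norm x <= 4 ^ k * norm x)
        by (apply Rmult_le_compat_r; [apply norm_ge_0|lra]). lra. }
    destruct (HN2 (2 / 3 * N) ltac:(lra)) as [z [Hz1 Hz2]].
    exists (n, scal ((/ 3) ^ k) z). simpl. split; [apply HL|]. split.
    - rewrite (norm_scal_R (V := V)), Rabs_right by lra.
      rewrite <- (Rmult_1_r ((/ 3) ^ k)) at 2. apply Rmult_le_compat_l; lra.
    - exists N. split; [easy|]. split; [easy|].
      rewrite (linear_scal _ (HL n)), (norm_scal_R (V := W)), Rabs_right by lra.
      rewrite (Rmult_comm (2 / 3)), Rmult_assoc. apply Rmult_le_compat_l; lra. }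
  destruct (functional_choice _ Hk) as [nx Hnx].
  set (LL := fun k => L (fst (nx k))). set (xi := fun k => snd (nx k)).
  set (g := @glide V W LL xi).
  assert (Hd : forall i k, norm (minus (g (k + i)%nat) (g k)) <= 3 / 2 * (/ 3) ^ k).
  { assert (Hd' : forall i k, norm (minus (g (k + i)%nat) (g k))
      <= 3 / 2 * ((/ 3) ^ k - (/ 3) ^ (k + i))).
    { induction i as [|i IH]; intros k.
      - rewrite Nat.add_0_r. replace (minus (g k) (g k)) with (@zero V) by module_eq_in V.
        rewrite (@norm_zero R_AbsRing V). lra.
      - replace (k + S i)%nat with (S (k + i)) by lia.
        assert (h1 := @glide_step V W LL xi (k + i)). fold g in h1.
        destruct (Hnx (k + i)%nat) as [_ [h2 _]]. fold (xi (k + i)%nat) in h2.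
        specialize (IH k).
        replace (minus (g (S (k + i))) (g k)) with
          (plus (minus (g (S (k + i))) (g (k + i)%nat)) (minus (g (k + i)%nat) (g k)))
          by module_eq_in V.
        eapply Rle_trans; [apply (@norm_triangle R_AbsRing V)|].
        replace ((/ 3) ^ S (k + i)) with (/ 3 * (/ 3) ^ (k + i)) by reflexivity.
        eapply Rle_trans; [apply Rplus_le_compat; [exact (Rle_trans _ _ _ h1 h2)|exact IH]|].
        lra. }
    intros i k. apply Rle_trans with (1 := Hd' i k).
    assert (0 < (/ 3) ^ (k + i)) by (apply pow_lt; lra). lra. }
  destruct (Hcomp g) as [x Hx].
  { intros eps Heps. destruct (pow_lt_1_zero (/ 3)) with (y := eps / 3) as [N HN].
    - rewrite Rabs_right; lra.
    - lra.
    - exists N. intros n m h1 h2.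
      specialize (HN N (le_n _)). rewrite Rabs_right in HN by (apply Rle_ge, pow_le; lra).
      assert (d1 := Hd (n - N)%nat N). assert (d2 := Hd (m - N)%nat N).
      replace (N + (n - N))%nat with n in d1 by lia.
      replace (N + (m - N))%nat with m in d2 by lia.
      replace (minus (g n) (g m)) with (minus (minus (g n) (g N)) (minus (g m) (g N)))
        by module_eq_in V.
      eapply Rle_lt_trans; [apply (@norm_minus_le V)|].
      eapply Rle_lt_trans; [apply Rplus_le_compat; [exact d1|exact d2]|]. lra. }
  destruct (Hpt x) as [M HM].
  (* At the limit x the image has norm at least (2/3 - 1/2) 3^-k N, and N >= 4^k makes this at least
     (4/3)^k / 6; k is chosen to exceed the pointwise bound M. *)
  destruct (Pow_x_infinity (4 / 3)) with (b := 6 * M + 1) as [k Hkk].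
  { rewrite Rabs_right; lra. }
  specialize (Hkk k (le_n _)). rewrite Rabs_right in Hkk by (apply Rle_ge, pow_le; lra).
  destruct (Hnx k) as [HLk [_ [N [HN1 [HN2 HN3]]]]].
  specialize (HM (fst (nx k))). fold (LL k) in *. fold (xi k) in HN3.
  assert (Hl := @glide_large V W LL xi k HLk). fold g in Hl.
  assert (Hlim : norm (minus (g (S k)) x) <= / 2 * (/ 3) ^ k).
  { apply le_epsilon. intros eps Heps. destruct (Hx eps Heps) as [n0 Hn0].
    specialize (Hn0 (S k + n0)%nat ltac:(lia)). assert (h := Hd n0 (S k)).
    replace (minus (g (S k)) x) with
      (minus (minus (g (S k + n0)%nat) x) (minus (g (S k + n0)%nat) (g (S k)))) by module_eq_in V.
    eapply Rle_trans; [apply (@norm_minus_le V)|].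
    eapply Rle_trans; [apply Rplus_le_compat; [left; exact Hn0|exact h]|].
    simpl. lra. }
  assert (H3 : 0 < (/ 3) ^ k) by (apply pow_lt; lra).
  assert (HN0 : 0 <= N) by (apply Rle_trans with (2 := HN2), pow_le; lra).
  assert (h1 : norm (LL k (minus (g (S k)) x)) <= N * (/ 2 * (/ 3) ^ k)).
  { apply Rle_trans with (1 := HN1 _). now apply Rmult_le_compat_l. }
  assert (h2 : norm (LL k (g (S k))) <= norm (LL k (minus (g (S k)) x)) + norm (LL k x)).
  { replace (LL k (g (S k))) with (plus (LL k (minus (g (S k)) x)) (LL k x)).
    - apply norm_triangle.
    - rewrite (linear_minus _ _ _ HLk). module_eq_in W. }
  assert (h3 : / 6 * (4 / 3) ^ k <= M).
  { apply Rle_trans with (/ 6 * (/ 3) ^ k * N); [|nra].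
    replace ((4 / 3) ^ k) with ((/ 3) ^ k * 4 ^ k).
    - assert ((/ 3) ^ k * 4 ^ k <= (/ 3) ^ k * N) by (apply Rmult_le_compat_l; lra). lra.
    - rewrite <- Rpow_mult_distr. f_equal. field. }
  lra.
Qed.

(** * Cauchy's estimate *)

Lemma is_derive_eps {V : NormedModule R_AbsRing} (f : R -> V) x l :
  is_derive f x l <-> forall eps, 0 < eps -> exists d, 0 < d /\
    forall h, Rabs h < d -> norm (minus (minus (f (x + h)) (f x)) (scal h l)) <= eps * Rabs h.
Proof.
  split.
  - intros [_ H] eps Heps.
    destruct (H x (fun P HP => HP) (mkposreal eps Heps)) as [d Hd].
    exists d. split; [apply cond_pos|]. intros h Hh.
    assert (g := Hd (x + h)). simpl in g.
    change (minus (x + h) x) with (x + h + - x) in g.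
    replace (x + h + - x) with h in g by ring. apply g.
    change (Rabs (x + h + - x) < d). replace (x + h + - x) with h by ring. exact Hh.
  - intros H. split; [apply is_linear_scal_l|].
    intros y Hy. apply (@is_filter_lim_locally_unique R_AbsRing (AbsRing_NormedModule R_AbsRing) x y) in Hy.
    subst y.
    intros eps. destruct (H eps (cond_pos eps)) as [d [Hd Hf]].
    exists (mkposreal d Hd). intros y Hy. change (Rabs (y + - x) < d) in Hy.
    specialize (Hf (y + - x) Hy). replace (x + (y + - x)) with y in Hf.
    + exact Hf.
    + assert (h : forall a b : R, a = b + (a + - b)) by (intros; ring). exact (h y x).
Qed.

Lemma is_derive_scal_fct {V : NormedModule R_AbsRing} (f : R -> R) (g : R -> V) x f' g' :
  is_derive f x f' -> is_derive g x g' ->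
  is_derive (fun t => scal (f t) (g t)) x (plus (scal f' (g x)) (scal (f x) g')).
Proof.
  intros Hf Hg.
  apply (filterdiff_ext_lin _ _ _ (filterdiff_scal_fct x f g _ _ Rmult_comm Hf Hg)).
  intros y. simpl. change (scal y f') with (y * f').
  module_eq_in V.
Qed.

Lemma is_derive_eq {V : NormedModule R_AbsRing} (f : R -> V) x l l' :
  is_derive f x l -> l = l' -> is_derive f x l'.
Proof. now intros H <-. Qed.

Lemma is_RInt_eq {V : NormedModule R_AbsRing} (f : R -> V) a b l l' :
  is_RInt f a b l -> l = l' -> is_RInt f a b l'.
Proof. now intros H <-. Qed.

Section Curve.
Context {V : NormedModule R_AbsRing}.
Variables (p : R -> R -> V) (c1 c2 : R -> R) (s a1 a2 : R) (d e : V).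
Hypothesis Hp : forall eps, 0 < eps -> exists r, 0 < r /\ forall h k,
  Rabs h < r -> Rabs k < r ->
  norm (minus (minus (p (c1 s + h) (c2 s + k)) (p (c1 s) (c2 s)))
              (plus (scal h d) (scal k e))) <= eps * (Rabs h + Rabs k).
Hypotheses (H1 : is_derive c1 s a1) (H2 : is_derive c2 s a2).

Lemma scalar_increment (c : R -> R) a : is_derive c s a ->
  forall eps, 0 < eps -> exists r, 0 < r /\ forall h, Rabs h < r ->
    Rabs (c (s + h) - c s - h * a) <= eps * Rabs h.
Proof. intros H. exact (proj1 (is_derive_eps (V := R_NormedModule) c s a) H). Qed.

Lemma curve_derive : is_derive (fun t => p (c1 t) (c2 t)) s (plus (scal a1 d) (scal a2 e)).
Proof.
  apply is_derive_eps. intros eps Heps.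
  set (M := Rabs a1 + Rabs a2 + 2).
  set (N := norm d + norm e + 1).
  assert (Ha1 := Rabs_pos a1). assert (Ha2 := Rabs_pos a2).
  assert (Hd := norm_ge_0 d). assert (He := norm_ge_0 e).
  destruct (Hp (eps := eps / (2 * M))) as [r [Hr HP]].
  { apply Rdiv_lt_0_compat; unfold M; lra. }
  set (ep := Rmin 1 (eps / (2 * N))).
  assert (Hep : 0 < ep) by (apply Rmin_pos; [lra|apply Rdiv_lt_0_compat; unfold N; lra]).
  assert (Hep1 : ep <= 1) by apply Rmin_l.
  assert (Hep2 : ep * N <= eps / 2).
  { replace (eps / 2) with (eps / (2 * N) * N) by (field; unfold N; lra).
    apply Rmult_le_compat_r; [unfold N; lra|apply Rmin_r]. }
  destruct (scalar_increment H1 Hep) as [r1 [Hr1 D1]].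
  destruct (scalar_increment H2 Hep) as [r2 [Hr2 D2]].
  set (m := Rmin (r / M) (Rmin r1 r2)).
  assert (Hm : 0 < m).
  { repeat apply Rmin_pos; try lra. apply Rdiv_lt_0_compat; unfold M; lra. }
  exists m. split; [easy|]. intros h Hh.
  assert (g1 := D1 h ltac:(eapply Rlt_le_trans; [exact Hh|]; eapply Rle_trans; [apply Rmin_r|apply Rmin_l])).
  assert (g2 := D2 h ltac:(eapply Rlt_le_trans; [exact Hh|]; eapply Rle_trans; [apply Rmin_r|apply Rmin_r])).
  assert (g3 : Rabs h * M < r).
  { replace r with (r / M * M) by (field; unfold M; lra).
    apply Rmult_lt_compat_r; [unfold M; lra|]. eapply Rlt_le_trans; [exact Hh|apply Rmin_l]. }
  set (h1 := c1 (s + h) - c1 s) in *. set (h2 := c2 (s + h) - c2 s) in *.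
  assert (Hah := Rabs_pos h).
  assert (b : forall x a, Rabs (x - h * a) <= ep * Rabs h -> Rabs x <= (Rabs a + 1) * Rabs h).
  { intros x a hx. replace x with (x - h * a + h * a) by ring.
    eapply Rle_trans; [apply Rabs_triang|]. rewrite Rabs_mult.
    assert (ep * Rabs h <= 1 * Rabs h) by (apply Rmult_le_compat_r; lra). lra. }
  assert (b1 := b _ _ g1). assert (b2 := b _ _ g2).
  assert (k1 : 0 <= Rabs a1 * Rabs h) by now apply Rmult_le_pos.
  assert (k2 : 0 <= Rabs a2 * Rabs h) by now apply Rmult_le_pos.
  assert (q := HP h1 h2 ltac:(unfold M in g3; lra) ltac:(unfold M in g3; lra)).
  replace (c1 s + h1) with (c1 (s + h)) in q by (unfold h1; ring).
  replace (c2 s + h2) with (c2 (s + h)) in q by (unfold h2; ring).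
  set (A := minus (p (c1 (s + h)) (c2 (s + h))) (p (c1 s) (c2 s))) in *.
  replace (minus A (scal h (plus (scal a1 d) (scal a2 e)))) with
    (plus (minus A (plus (scal h1 d) (scal h2 e)))
      (plus (scal (h1 - h * a1) d) (scal (h2 - h * a2) e))) by module_eq_in V.
  eapply Rle_trans; [apply (@norm_triangle R_AbsRing V)|].
  eapply Rle_trans; [apply Rplus_le_compat_l, (@norm_triangle R_AbsRing V)|].
  rewrite !norm_scal_R.
  assert (q1 : eps / (2 * M) * (Rabs h1 + Rabs h2) <= eps / 2 * Rabs h).
  { replace (eps / 2 * Rabs h) with (eps / (2 * M) * (M * Rabs h)) by (field; unfold M; lra).
    apply Rmult_le_compat_l.
    - left. apply Rdiv_lt_0_compat; unfold M; lra.
    - unfold M. lra. }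
  assert (q2 : Rabs (h1 - h * a1) * norm d <= ep * Rabs h * norm d) by now apply Rmult_le_compat_r.
  assert (q3 : Rabs (h2 - h * a2) * norm e <= ep * Rabs h * norm e) by now apply Rmult_le_compat_r.
  assert (q4 : ep * N * Rabs h <= eps / 2 * Rabs h) by now apply Rmult_le_compat_r.
  assert (q5 : 0 <= ep * Rabs h) by (apply Rmult_le_pos; lra).
  unfold N in q4. lra.
Qed.

End Curve.

Section Cauchy_estimate.

Context {V : CompleteNormedModule R_AbsRing}.
Variables (p q d e : R -> R -> V) (R0 R1 M : R).
Hypotheses (HR0 : 0 < R0) (HR1 : R0 < R1).

Definition total_derivative (f : R -> R -> V) (a b : R) (l m : V) : Prop :=
  forall eps, 0 < eps -> exists r, 0 < r /\ forall h k, Rabs h < r -> Rabs k < r ->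
    norm (minus (minus (f (a + h) (b + k)) (f a b)) (plus (scal h l) (scal k m)))
      <= eps * (Rabs h + Rabs k).

(* [p + i q] is holomorphic with derivative [d + i e]. *)
Hypothesis Hp : forall a b, Rabs a < R1 -> Rabs b < R1 ->
  total_derivative p a b (d a b) (opp (e a b)).
Hypothesis Hq : forall a b, Rabs a < R1 -> Rabs b < R1 ->
  total_derivative q a b (e a b) (d a b).
Hypothesis Hd : forall a b, Rabs a < R1 -> Rabs b < R1 ->
  continuous (fun z : R * R => d (fst z) (snd z)) (a, b).
Hypothesis HM : forall a b, Rabs a < R1 -> Rabs b < R1 -> norm (p a b) <= M /\ norm (q a b) <= M.

(** The real part of e^{-i th} (p + i q) at r e^{i th}. Cauchy's formula for the derivative at 0
    says that the mean of g / r over the circle is d 0 0. *)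
Let g (r th : R) : V :=
  plus (scal (cos th) (p (r * cos th) (r * sin th))) (scal (sin th) (q (r * cos th) (r * sin th))).
Let dd (r th : R) : V := d (r * cos th) (r * sin th).

Lemma polar_bound r th : 0 <= r < R1 -> Rabs (r * cos th) < R1 /\ Rabs (r * sin th) < R1.
Proof.
  intros Hr. rewrite !Rabs_mult, (Rabs_right r) by lra.
  assert (Rabs (cos th) <= 1) by (apply Rabs_le; generalize (COS_bound th); lra).
  assert (Rabs (sin th) <= 1) by (apply Rabs_le; generalize (SIN_bound th); lra).
  split; nra.
Qed.

Lemma total_derivative_continuous f a b l m : total_derivative f a b l m ->
  continuous (fun z : R * R => f (fst z) (snd z)) (a, b).
Proof.
  intros Hf. apply (continuous_2d_norm_eps (V := V)). intros eps Heps.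
  destruct (Hf 1 Rlt_0_1) as [r [Hr H]].
  set (N := norm l + norm m + 3).
  assert (Hl := norm_ge_0 l). assert (Hm := norm_ge_0 m).
  assert (HN : 0 < eps / N) by (apply Rdiv_lt_0_compat; unfold N; lra).
  exists (Rmin r (eps / N)). split; [now apply Rmin_pos|].
  intros x y Hx Hy.
  assert (x1 := Rlt_le_trans _ _ _ Hx (Rmin_l _ _)). assert (x2 := Rlt_le_trans _ _ _ Hx (Rmin_r _ _)).
  assert (y1 := Rlt_le_trans _ _ _ Hy (Rmin_l _ _)). assert (y2 := Rlt_le_trans _ _ _ Hy (Rmin_r _ _)).
  specialize (H (x - a) (y - b) x1 y1).
  replace (a + (x - a)) with x in H by ring. replace (b + (y - b)) with y in H by ring.
  set (A := minus (f x y) (f a b)) in *.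
  assert (HA : norm A <= norm (minus A (plus (scal (x - a) l) (scal (y - b) m)))
     + (Rabs (x - a) * norm l + Rabs (y - b) * norm m)).
  { rewrite <- !(norm_scal_R (V := V)).
    replace A with (plus (minus A (plus (scal (x - a) l) (scal (y - b) m)))
      (plus (scal (x - a) l) (scal (y - b) m))) at 1 by module_eq_in V.
    eapply Rle_trans; [apply (@norm_triangle R_AbsRing V)|].
    apply Rplus_le_compat_l, (@norm_triangle R_AbsRing V). }
  assert (k1 : Rabs (x - a) * norm l <= eps / N * norm l) by (apply Rmult_le_compat_r; lra).
  assert (k2 : Rabs (y - b) * norm m <= eps / N * norm m) by (apply Rmult_le_compat_r; lra).
  replace eps with (eps / N * N) by (field; unfold N; lra).
  assert (HNN : eps / N * N = eps / N * norm l + eps / N * norm m + 3 * (eps / N))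
    by (unfold N at 2; ring).
  apply Rle_lt_trans with (1 := HA).
  apply Rle_lt_trans with (1 * (Rabs (x - a) + Rabs (y - b))
    + (Rabs (x - a) * norm l + Rabs (y - b) * norm m)); [apply Rplus_le_compat_r; exact H|].
  lra.
Qed.

Lemma g_derive_r r th : 0 < r < R1 -> is_derive (fun r => g r th) r (dd r th).
Proof.
  intros Hr. destruct (polar_bound th (r := r) ltac:(lra)) as [b1 b2].
  assert (D1 : is_derive (fun r => r * cos th) r (cos th)) by (auto_derive; [easy|ring]).
  assert (D2 : is_derive (fun r => r * sin th) r (sin th)) by (auto_derive; [easy|ring]).
  assert (Dp := curve_derive (Hp b1 b2) D1 D2).
  assert (Dq := curve_derive (Hq b1 b2) D1 D2).
  assert (Dcst : forall c : R, is_derive (fun _ : R => c) r 0) by (intros; auto_derive; easy).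
  assert (Dcp := is_derive_scal_fct (Dcst (cos th)) Dp).
  assert (Dsq := is_derive_scal_fct (Dcst (sin th)) Dq).
  assert (D := is_derive_plus _ _ _ _ _ Dcp Dsq).
  apply (is_derive_eq D). cbv beta.
  - unfold dd. set (x := d (r * cos th) (r * sin th)). set (y := e (r * cos th) (r * sin th)).
    assert (h := sin2_cos2 th). unfold Rsqr in h.
    transitivity (scal (sin th * sin th + cos th * cos th) x).
    + module_eq_in V.
    + rewrite h. module_eq_in V.
Qed.

(** The differentiated function is minus the imaginary part of e^{-i th} (p + i q). Being periodic
    in th, it shows that g - r dd has integral zero over the circle. *)
Lemma m_derive_th r th : 0 < r < R1 ->
  is_derive (fun th => minus (scal (sin th) (p (r * cos th) (r * sin th)))
                             (scal (cos th) (q (r * cos th) (r * sin th))))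
    th (minus (g r th) (scal r (dd r th))).
Proof.
  intros Hr. destruct (polar_bound th (r := r) ltac:(lra)) as [b1 b2].
  assert (D1 : is_derive (fun th => r * cos th) th (- (r * sin th))) by (auto_derive; [easy|ring]).
  assert (D2 : is_derive (fun th => r * sin th) th (r * cos th)) by (auto_derive; [easy|ring]).
  assert (Dc : is_derive cos th (- sin th)) by (auto_derive; [easy|ring]).
  assert (Ds : is_derive sin th (cos th)) by (auto_derive; [easy|ring]).
  assert (Dp := curve_derive (Hp b1 b2) D1 D2).
  assert (Dq := curve_derive (Hq b1 b2) D1 D2).
  assert (Dsp := is_derive_scal_fct Ds Dp).
  assert (Dcq := is_derive_scal_fct Dc Dq).
  assert (D := is_derive_minus _ _ _ _ _ Dsp Dcq).
  apply (is_derive_eq D). cbv beta.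
  - unfold g, dd. set (x := d (r * cos th) (r * sin th)). set (y := e (r * cos th) (r * sin th)).
    set (p0 := p (r * cos th) (r * sin th)). set (q0 := q (r * cos th) (r * sin th)).
    assert (h := sin2_cos2 th). unfold Rsqr in h.
    transitivity (minus (plus (scal (cos th) p0) (scal (sin th) q0))
      (scal (r * (sin th * sin th + cos th * cos th)) x)).
    + module_eq_in V.
    + rewrite h. module_eq_in V.
Qed.

Lemma polar_continuous (f : R -> R -> V) r th :
  continuous (fun z : R * R => f (fst z) (snd z)) (r * cos th, r * sin th) ->
  continuous (fun z : R * R => f (fst z * cos (snd z)) (fst z * sin (snd z))) (r, th).
Proof.
  intros Hf.
  apply (continuous_comp_2 (fun z : R * R => fst z * cos (snd z))
    (fun z : R * R => fst z * sin (snd z)) f).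
  - apply (continuous_mult (fun z : R * R => fst z) (fun z : R * R => cos (snd z))).
    + apply continuous_fst.
    + apply (continuous_comp snd cos); [apply continuous_snd|apply continuous_cos].
  - apply (continuous_mult (fun z : R * R => fst z) (fun z : R * R => sin (snd z))).
    + apply continuous_fst.
    + apply (continuous_comp snd sin); [apply continuous_snd|apply continuous_sin].
  - exact Hf.
Qed.

Lemma g_continuous r th : 0 <= r < R1 ->
  continuous (fun z : R * R => g (fst z) (snd z)) (r, th).
Proof.
  intros Hr. destruct (polar_bound th Hr) as [b1 b2].
  apply (@continuous_plus _ _ V).
  - apply (@continuous_scal _ _ V).
    + apply (continuous_comp snd cos); [apply continuous_snd|apply continuous_cos].
    + apply (polar_continuous (f := p)), (total_derivative_continuous (Hp b1 b2)).
  - apply (@continuous_scal _ _ V).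
    + apply (continuous_comp snd sin); [apply continuous_snd|apply continuous_sin].
    + apply (polar_continuous (f := q)), (total_derivative_continuous (Hq b1 b2)).
Qed.

Lemma dd_continuous r th : 0 <= r < R1 ->
  continuous (fun z : R * R => dd (fst z) (snd z)) (r, th).
Proof.
  intros Hr. destruct (polar_bound th Hr) as [b1 b2].
  apply (polar_continuous (f := d)), (Hd b1 b2).
Qed.

(** The r-derivative of g / r, and at the same time - 1 / r^2 times the th-derivative in
    [m_derive_th]. *)
Let f (r th : R) : V := plus (scal (- (/ (r * r))) (g r th)) (scal (/ r) (dd r th)).

Lemma f_continuous r th : 0 < r < R1 ->
  continuous (fun z : R * R => f (fst z) (snd z)) (r, th).
Proof.
  intros Hr.
  apply (@continuous_plus _ _ V).
  - apply (@continuous_scal _ _ V); [|apply g_continuous; lra].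
    apply (continuous_comp (fst : R * R -> R) (fun x => - (/ (x * x)))); [apply continuous_fst|].
    apply (ex_derive_continuous (V := R_NormedModule)). auto_derive. simpl. apply Rgt_not_eq. nra.
  - apply (@continuous_scal _ _ V); [|apply dd_continuous; lra].
    apply (continuous_comp (fst : R * R -> R) (fun x => / x)); [apply continuous_fst|].
    apply (ex_derive_continuous (V := R_NormedModule)). auto_derive. simpl. lra.
Qed.

Lemma g_over_r_derive r th : 0 < r < R1 ->
  is_derive (fun r => scal (/ r) (g r th)) r (f r th).
Proof.
  intros Hr.
  assert (D : is_derive (fun r => / r) r (- (/ (r * r)))).
  { auto_derive; [lra|]. field. lra. }
  apply (is_derive_eq (is_derive_scal_fct D (g_derive_r th Hr))). reflexivity.
Qed.

Lemma RInt_f_th r : 0 < r < R1 -> is_RInt (f r) 0 (2 * PI) zero.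
Proof.
  intros Hr.
  assert (C : forall th, continuous (fun th => minus (g r th) (scal r (dd r th))) th).
  { intros th. apply (@continuous_minus _ _ V).
    - apply (fun H => proj2 (continuous_slices (V := V) (f := g) (u := r) (t := th) H)).
      apply g_continuous. lra.
    - apply (@continuous_scal_r _ _ V).
      apply (fun H => proj2 (continuous_slices (V := V) (f := dd) (u := r) (t := th) H)).
      apply dd_continuous. lra. }
  assert (I := is_RInt_derive _ _ 0 (2 * PI) (fun th _ => m_derive_th th Hr) (fun th _ => C th)).
  apply (is_RInt_scal _ _ _ (- (/ (r * r)))) in I.
  rewrite sin_2PI, cos_2PI, sin_0, cos_0 in I.
  apply (is_RInt_ext _ (f r)) in I.
  - apply (is_RInt_eq I). module_eq_in V.
  - intros th _. unfold f. module_eq_in V; apply Rgt_not_eq; lra.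
Qed.

(** The integral of [f] over [r, R0] x [0, 2 PI] vanishes in one order of integration and is the
    difference of the two circle integrals in the other. *)
Lemma RInt_g_over_r r : 0 < r -> r <= R0 ->
  RInt (fun th => scal (/ r) (g r th)) 0 (2 * PI)
    = RInt (fun th => scal (/ R0) (g R0 th)) 0 (2 * PI).
Proof.
  intros Hr Hr0. assert (HPI := PI_RGT_0).
  assert (ex : forall x, 0 < x < R1 -> ex_RInt (fun th => scal (/ x) (g x th)) 0 (2 * PI)).
  { intros x Hx. apply ex_RInt_continuous. intros th _.
    apply (@continuous_scal_r _ _ V).
    apply (fun H => proj2 (continuous_slices (V := V) (f := g) (u := x) (t := th) H)).
    apply g_continuous. lra. }
  (* The margin for Fubini, small enough to keep the radii between 0 and R1. *)
  set (w := Rmin (r / 2) ((R1 - R0) / 2)).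
  assert (Hw : 0 < w) by (apply Rmin_pos; lra).
  assert (Hw1 : w <= r / 2) by apply Rmin_l.
  assert (Hw2 : w <= (R1 - R0) / 2) by apply Rmin_r.
  assert (Hs := RInt_swap (f := f) (a := r) (b := R0) (c := 0) (d := 2 * PI) (r := w)
    Hr0 ltac:(lra) Hw (fun u t hu ht => f_continuous (r := u) (th := t) ltac:(lra))).
  assert (L : RInt (fun u => RInt (f u) 0 (2 * PI)) r R0 = zero).
  { transitivity (RInt (fun _ : R => @zero V) r R0).
    - apply RInt_ext. intros u Hu. rewrite Rmin_left, Rmax_right in Hu by lra.
      apply is_RInt_unique, RInt_f_th. lra.
    - rewrite RInt_const. apply (@scal_zero_r R_AbsRing V). }
  rewrite L in Hs.
  assert (Rr : forall th, RInt (fun u => f u th) r R0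
     = minus (scal (/ R0) (g R0 th)) (scal (/ r) (g r th))).
  { intros th. apply is_RInt_unique.
    apply (is_RInt_derive (fun u => scal (/ u) (g u th))).
    - intros x Hx. rewrite Rmin_left, Rmax_right in Hx by lra. apply g_over_r_derive. lra.
    - intros x Hx. rewrite Rmin_left, Rmax_right in Hx by lra.
      apply (fun H => proj1 (continuous_slices (V := V) (f := f) (u := x) (t := th) H)).
      apply f_continuous. lra. }
  assert (Hd' : RInt (fun t => RInt (fun u => f u t) r R0) 0 (2 * PI)
    = minus (RInt (fun th => scal (/ R0) (g R0 th)) 0 (2 * PI))
            (RInt (fun th => scal (/ r) (g r th)) 0 (2 * PI))).
  { transitivity (RInt (fun th => minus (scal (/ R0) (g R0 th)) (scal (/ r) (g r th))) 0 (2 * PI)).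
    - apply RInt_ext. intros th _. apply Rr.
    - apply is_RInt_unique.
      apply (is_RInt_minus (V := V)); apply RInt_correct, ex; lra. }
  rewrite Hd' in Hs. set (A := RInt (fun th => scal (/ r) (g r th)) 0 (2 * PI)) in *.
  transitivity (plus A zero); [module_eq_in V|]. rewrite Hs. module_eq_in V.
Qed.

(** The circle integral of g / r is the same for all r <= R0: at R0 it is bounded through M, and as
    r tends to 0 differentiability at the origin identifies it as 2 PI times d 0 0. The factor 2
    comes from bounding the cosine and sine terms separately. *)
Theorem cauchy_estimate : norm (d 0 0) <= 2 * M / R0.
Proof.
  assert (HPI := PI_RGT_0). set (d0 := d 0 0).
  set (I0 := RInt (fun th => scal (/ R0) (g R0 th)) 0 (2 * PI)).
  assert (ex : forall x, 0 < x < R1 -> ex_RInt (fun th => scal (/ x) (g x th)) 0 (2 * PI)).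
  { intros x Hx. apply ex_RInt_continuous. intros th _.
    apply (@continuous_scal_r _ _ V).
    apply (fun H => proj2 (continuous_slices (V := V) (f := g) (u := x) (t := th) H)).
    apply g_continuous. lra. }
  assert (cs : forall th, Rabs (cos th) <= 1 /\ Rabs (sin th) <= 1).
  { intros th. split; apply Rabs_le; [generalize (COS_bound th)|generalize (SIN_bound th)]; lra. }
  assert (two : forall th (u v : V) c, norm u <= c -> norm v <= c ->
     norm (plus (scal (cos th) u) (scal (sin th) v)) <= 2 * c).
  { intros th u v c hu hv. destruct (cs th) as [c1 c2].
    eapply Rle_trans; [apply (@norm_triangle R_AbsRing V)|].
    rewrite !(norm_scal_R (V := V)).
    assert (nu := @norm_ge_0 R_AbsRing V u). assert (nv := @norm_ge_0 R_AbsRing V v).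
    assert (Rabs (cos th) * norm u <= 1 * norm u) by now apply Rmult_le_compat_r.
    assert (Rabs (sin th) * norm v <= 1 * norm v) by now apply Rmult_le_compat_r.
    lra. }
  assert (HI0 : norm I0 <= 2 * PI * (2 * M / R0)).
  { replace (2 * PI * (2 * M / R0)) with ((2 * PI - 0) * (2 * M / R0)) by ring.
    apply (norm_RInt_le_const (fun th => scal (/ R0) (g R0 th))); [lra| |apply RInt_correct, ex; lra].
    intros th _. destruct (polar_bound th (r := R0) ltac:(lra)) as [b1 b2].
    destruct (HM b1 b2) as [m1 m2].
    rewrite (norm_scal_R (V := V)), Rabs_inv, (Rabs_right R0), (Rmult_comm (/ R0)) by lra.
    apply Rmult_le_compat_r; [left; apply Rinv_0_lt_compat; lra|]. now apply two. }
  assert (R1p : Rabs 0 < R1) by (rewrite Rabs_R0; lra).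
  apply le_epsilon. intros eta Heta.
  destruct (Hp R1p R1p (eps := eta / 4) ltac:(lra)) as [r1 [Hr1 P1]].
  destruct (Hq R1p R1p (eps := eta / 4) ltac:(lra)) as [r2 [Hr2 P2]].
  set (r := Rmin (Rmin r1 r2 / 2) R0).
  assert (Hr12 : 0 < Rmin r1 r2) by now apply Rmin_pos.
  assert (Hrp : 0 < r) by (apply Rmin_pos; lra).
  assert (Hrr : r <= Rmin r1 r2 / 2) by apply Rmin_l.
  assert (Hra : r < r1) by (generalize (Rmin_l r1 r2); lra).
  assert (Hrb : r < r2) by (generalize (Rmin_r r1 r2); lra).
  assert (HrR : r <= R0) by apply Rmin_r.
  (* The contribution of the value at the origin. It is singular as r tends to 0 but consists of
     first harmonics, so its integral is zero. *)
  set (l := fun th => plus (scal (/ r * cos th) (p 0 0)) (scal (/ r * sin th) (q 0 0))).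
  assert (Il : is_RInt l 0 (2 * PI) zero).
  { assert (D : forall th, is_derive (fun th => minus (scal (/ r * sin th) (p 0 0))
      (scal (/ r * cos th) (q 0 0))) th (l th)).
    { intros th.
      assert (D1 : is_derive (fun th => / r * sin th) th (/ r * cos th)) by (auto_derive; [easy|ring]).
      assert (D2 : is_derive (fun th => / r * cos th) th (- (/ r * sin th))) by (auto_derive; [easy|ring]).
      assert (D := is_derive_minus _ _ _ _ _ (is_derive_scal_l _ _ _ (p 0 0) D1)
        (is_derive_scal_l _ _ _ (q 0 0) D2)).
      apply (is_derive_eq D). unfold l. module_eq_in V. }
    assert (C : forall th, continuous l th).
    { intros th. apply (@continuous_plus _ _ V).
      - apply (@continuous_scal_l _ _ V). apply (continuous_scal_r (V := R_NormedModule)), continuous_cos.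
      - apply (@continuous_scal_l _ _ V). apply (continuous_scal_r (V := R_NormedModule)), continuous_sin. }
    assert (I := is_RInt_derive _ _ 0 (2 * PI) (fun th _ => D th) (fun th _ => C th)).
    cbv beta in I. rewrite sin_2PI, cos_2PI, sin_0, cos_0 in I.
    apply (is_RInt_eq I). module_eq_in V. }
  assert (Ic := is_RInt_const 0 (2 * PI) d0).
  assert (Ir := RInt_correct _ _ _ (ex r ltac:(lra))).
  rewrite (RInt_g_over_r Hrp HrR) in Ir. fold I0 in Ir.
  assert (Idiff := is_RInt_minus _ _ _ _ _ _ (is_RInt_minus _ _ _ _ _ _ Ir Il) Ic).
  assert (Hn : forall th, 0 <= th <= 2 * PI ->
    norm (minus (minus (scal (/ r) (g r th)) (l th)) d0) <= eta).
  { intros th _. destruct (cs th) as [c1 c2].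
    assert (sm : Rabs (r * cos th) <= r /\ Rabs (r * sin th) <= r).
    { rewrite !Rabs_mult, (Rabs_right r) by lra. split; nra. }
    destruct sm as [s1 s2].
    assert (A1 := P1 (r * cos th) (r * sin th) ltac:(lra) ltac:(lra)).
    assert (A2 := P2 (r * cos th) (r * sin th) ltac:(lra) ltac:(lra)).
    rewrite !Rplus_0_l in A1, A2. fold d0 in A1, A2.
    match type of A1 with norm ?x <= _ => set (u := x) in * end.
    match type of A2 with norm ?x <= _ => set (v := x) in * end.
    match goal with |- norm ?x <= _ => replace x with
      (scal (/ r) (plus (scal (cos th) u) (scal (sin th) v))) end.
    - rewrite (norm_scal_R (V := V)), Rabs_inv, (Rabs_right r) by lra.
      apply Rmult_le_reg_l with r; [easy|]. rewrite <- Rmult_assoc, Rinv_r, Rmult_1_l by lra.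
      apply Rle_trans with (2 * (eta / 4 * (2 * r))); [|lra].
      assert (e1 : eta / 4 * (Rabs (r * cos th) + Rabs (r * sin th)) <= eta / 4 * (2 * r))
        by (apply Rmult_le_compat_l; lra).
      apply two; lra.
    - unfold u, v, l, g. set (x := e 0 0).
      assert (h := sin2_cos2 th). unfold Rsqr in h.
      set (p1 := p (r * cos th) (r * sin th)). set (q1 := q (r * cos th) (r * sin th)).
      transitivity (minus (minus (scal (/ r) (plus (scal (cos th) p1) (scal (sin th) q1)))
        (plus (scal (/ r * cos th) (p 0 0)) (scal (/ r * sin th) (q 0 0))))
        (scal (sin th * sin th + cos th * cos th) d0)).
      + module_eq_in V; apply Rgt_not_eq; lra.
      + rewrite h. module_eq_in V. }
  assert (Hf := norm_RInt_le_const _ 0 (2 * PI) _ eta ltac:(lra) Hn Idiff).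
  match type of Hf with norm ?x <= _ =>
    assert (hx : x = minus I0 (scal (2 * PI) d0)) by module_eq_in V end.
  rewrite hx in Hf. clear hx.
  assert (Hs : 2 * PI * norm d0 <= norm I0 + 2 * PI * eta).
  { replace (2 * PI * norm d0) with (norm (scal (2 * PI) d0)).
    2: { rewrite (norm_scal_R (V := V)), Rabs_right by lra. reflexivity. }
    replace (scal (2 * PI) d0) with (minus I0 (minus I0 (scal (2 * PI) d0))) by module_eq_in V.
    eapply Rle_trans; [apply (@norm_minus_le V)|]. rewrite Rminus_0_r in Hf.
    apply Rplus_le_compat_l. exact Hf. }
  apply Rmult_le_reg_l with (2 * PI); [lra|]. lra.
Qed.

End Cauchy_estimate.

(** * Analytic semigroups *)

Lemma Cmod_le_abs (a b : R) : Cmod (a, b) <= Rabs a + Rabs b.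
Proof.
  unfold Cmod; simpl fst; simpl snd.
  assert (ha := Rabs_pos a). assert (hb := Rabs_pos b).
  rewrite <- (sqrt_Rsqr (Rabs a + Rabs b)) by lra.
  apply sqrt_le_1_alt. unfold Rsqr.
  rewrite <- (pow2_abs a), <- (pow2_abs b). nra.
Qed.

(* Banach-Steinhaus along a sequence that tends to the vertex of the sector. *)
Lemma bounded_near_0 (V : NormedModule R_AbsRing) (c : R) (A : C -> V -> V) (l : V -> V) :
  seq_complete V ->
  (forall z, sector c z -> is_linear (A z)) ->
  (forall x, filterlim (fun z => A z x) (within (sector c) (locally (RtoC 0))) (locally (l x))) ->
  exists d M, 0 < d /\ forall z x, sector c z -> Rabs (Re z) < d -> Rabs (Im z) < d ->
    norm (A z x) <= M * norm x.
Proof.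
  intros HV Hlin Hlim. apply NNPP. intros Hn.
  assert (Hk : forall n : nat, exists z, sector c z /\ Rabs (Re z) < / INR (S n) /\
     Rabs (Im z) < / INR (S n) /\ exists x, INR n * norm x < norm (A z x)).
  { intros n. apply NNPP. intros Hc. apply Hn.
    exists (/ INR (S n)), (INR n). split.
    { apply Rinv_0_lt_compat, lt_0_INR. lia. }
    intros z x h1 h2 h3. destruct (Rle_lt_dec (norm (A z x)) (INR n * norm x)); [easy|].
    exfalso. apply Hc. exists z. split; [easy|split; [easy|split; [easy|]]]. now exists x. }
  destruct (functional_choice _ Hk) as [z Hz].
  destruct (@uniform_boundedness V V (fun n => A (z n)) HV) as [C HC].
  - intros n. apply Hlin, Hz.
  - intros x.
    destruct (proj1 (filterlim_norm_eps (within (sector c) (locally (RtoC 0)))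
      (fun z => A z x) (l x)) (Hlim x) 1 Rlt_0_1) as [d Hd].
    destruct (INR_unbounded (/ d)) as [N HN].
    assert (Hfin : forall m, exists M, forall n, (n <= m)%nat -> norm (A (z n) x) <= M).
    { induction m as [|m [M IH]].
      - exists (norm (A (z O) x)). intros n h. replace n with O by lia. lra.
      - exists (Rmax M (norm (A (z (S m)) x))). intros n h.
        destruct (Nat.eq_dec n (S m)) as [->|h']; [apply Rmax_r|].
        apply Rle_trans with (2 := Rmax_l _ _). apply IH. lia. }
    destruct (Hfin N) as [M HM]. exists (Rmax M (norm (l x) + 1)). intros n.
    destruct (Nat.le_gt_cases n N) as [h|h].
    { apply Rle_trans with (2 := Rmax_l _ _). now apply HM. }
    apply Rle_trans with (2 := Rmax_r _ _).
    destruct (Hz n) as [z1 [z2 [z3 _]]].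
    assert (hd : / INR (S n) < d).
    { rewrite <- (Rinv_inv d). apply Rinv_lt_contravar.
      - apply Rmult_lt_0_compat; [apply Rinv_0_lt_compat, cond_pos|apply lt_0_INR; lia].
      - apply Rlt_trans with (INR N); [easy|]. apply lt_INR. lia. }
    assert (g : norm (minus (A (z n) x) (l x)) < 1).
    { apply Hd; [|easy]. split.
      - change (Rabs (Re (z n) - 0) < d). rewrite Rminus_0_r. lra.
      - change (Rabs (Im (z n) - 0) < d). rewrite Rminus_0_r. lra. }
    replace (A (z n) x) with (plus (minus (A (z n) x) (l x)) (l x)) by module_eq_in V.
    eapply Rle_trans; [apply norm_triangle|]. lra.
  - destruct (INR_unbounded C) as [N HN]. destruct (Hz N) as [_ [_ [_ [x Hx]]]].
    specialize (HC N x). assert (C * norm x <= INR N * norm x).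
    { apply Rmult_le_compat_r; [apply norm_ge_0|lra]. }
    lra.
Qed.

Lemma sector_open c a b : 0 < c -> sector c (a, b) ->
  exists r, 0 < r /\ forall h k, Rabs h < r -> Rabs k < r -> sector c (a + h, b + k).
Proof.
  intros Hc [H1 H2]. simpl in *.
  set (g := c * a - Rabs b). assert (Hg : 0 < g) by (unfold g; lra).
  exists (Rmin (a / 2) (g / (2 * (1 + c)))).
  split; [apply Rmin_pos; [lra|apply Rdiv_lt_0_compat; lra]|].
  intros h k Hh Hk.
  assert (h1 := Rlt_le_trans _ _ _ Hh (Rmin_l _ _)). assert (h2 := Rlt_le_trans _ _ _ Hh (Rmin_r _ _)).
  assert (k2 := Rlt_le_trans _ _ _ Hk (Rmin_r _ _)).
  apply Rabs_lt_between in h1.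
  assert (h3 : - Rabs h <= h) by (generalize (Rle_abs (- h)); rewrite Rabs_Ropp; lra).
  assert (hc : c * (a - Rabs h) <= c * (a + h)) by (apply Rmult_le_compat_l; lra).
  assert (hg : g / (2 * (1 + c)) * (1 + c) = g / 2) by (field; lra).
  split; simpl; [lra|].
  eapply Rle_lt_trans; [apply Rabs_triang|]. unfold g in *. nra.
Qed.

Section Analytic.

Variables (B : CompleteNormedModule R_AbsRing) (S : R -> B -> B).

Section Holomorphic.
Variables (c : R) (P Q : C -> B -> B).
Hypothesis Hc : 0 < c.
Hypothesis Hder : forall z, sector c z ->
  exists D E : B -> B, is_linear D /\ is_linear E /\
  forall eps : posreal, exists del : posreal, forall w : C,
    sector c w -> Cmod (Cminus w z) < del ->
    let a := Re (Cminus w z) in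
    let b := Im (Cminus w z) in
    op_le (fun x => minus (minus (P w x) (P z x)) (minus (scal a (D x)) (scal b (E x))))
          (eps * Cmod (Cminus w z)) /\
    op_le (fun x => minus (minus (Q w x) (Q z x)) (plus (scal b (D x)) (scal a (E x))))
          (eps * Cmod (Cminus w z)).

Lemma holomorphic_total_derivative a b : sector c (a, b) ->
  exists D E : B -> B, is_linear D /\ is_linear E /\
  forall eps, 0 < eps -> exists r, 0 < r /\ forall h k, Rabs h < r -> Rabs k < r ->
    sector c (a + h, b + k) /\ forall x,
    norm (minus (minus (P (a + h, b + k) x) (P (a, b) x))
            (plus (scal h (D x)) (scal k (opp (E x))))) <= eps * (Rabs h + Rabs k) * norm x /\
    norm (minus (minus (Q (a + h, b + k) x) (Q (a, b) x))
            (plus (scal h (E x)) (scal k (D x)))) <= eps * (Rabs h + Rabs k) * norm x.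
Proof.
  intros Hab. destruct (Hder Hab) as [D [E [HD [HE H]]]].
  exists D, E. split; [easy|]. split; [easy|]. intros eps Heps.
  destruct (H (mkposreal eps Heps)) as [del Hdel].
  destruct (sector_open Hc Hab) as [r [Hr Hs]].
  assert (Hdp := cond_pos del).
  exists (Rmin r (del / 2)). split; [apply Rmin_pos; lra|]. intros h k Hh Hk.
  assert (h1 := Rlt_le_trans _ _ _ Hh (Rmin_l _ _)). assert (h2 := Rlt_le_trans _ _ _ Hh (Rmin_r _ _)).
  assert (k1 := Rlt_le_trans _ _ _ Hk (Rmin_l _ _)). assert (k2 := Rlt_le_trans _ _ _ Hk (Rmin_r _ _)).
  assert (sec := Hs h k h1 k1). split; [exact sec|].
  assert (Hm : Cminus (a + h, b + k) (a, b) = (h, k)).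
  { unfold Cminus, Cplus, Copp; simpl. f_equal; ring. }
  assert (g := Hdel (a + h, b + k) sec). rewrite Hm in g. simpl in g.
  assert (hm := Cmod_le_abs h k). specialize (g ltac:(lra)). destruct g as [g1 g2].
  intros x. assert (Hx := norm_ge_0 x).
  assert (le : eps * Cmod (h, k) * norm x <= eps * (Rabs h + Rabs k) * norm x).
  { apply Rmult_le_compat_r; [easy|]. apply Rmult_le_compat_l; lra. }
  split.
  - apply Rle_trans with (2 := le). eapply Rle_trans; [|exact (g1 x)]. right. f_equal. module_eq_in B.
  - apply Rle_trans with (2 := le). eapply Rle_trans; [|exact (g2 x)]. right. f_equal. module_eq_in B.
Qed.

Lemma holomorphic_continuous (shift : R) a b x : sector c (shift + a, b) ->
  continuous (fun z : R * R => P (shift + fst z, snd z) x) (a, b) /\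
  continuous (fun z : R * R => Q (shift + fst z, snd z) x) (a, b).
Proof.
  intros Hs. destruct (holomorphic_total_derivative Hs) as [D [E [_ [_ H]]]].
  assert (tr : forall (f : R -> R -> B) l m,
    (forall eps, 0 < eps -> exists r, 0 < r /\ forall h k, Rabs h < r -> Rabs k < r ->
      norm (minus (minus (f (a + h) (b + k)) (f a b)) (plus (scal h l) (scal k m)))
        <= eps * (Rabs h + Rabs k) * norm x) -> total_derivative f a b l m).
  { intros f l m Hf eps Heps. assert (Hx := norm_ge_0 x).
    destruct (Hf (eps / (norm x + 1))) as [r [Hr Hb]]; [apply Rdiv_lt_0_compat; lra|].
    exists r. split; [easy|]. intros h k hh hk. apply Rle_trans with (1 := Hb h k hh hk).
    assert (hp : 0 <= Rabs h + Rabs k) by (generalize (Rabs_pos h) (Rabs_pos k); lra).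
    replace (eps * (Rabs h + Rabs k))
      with (eps / (norm x + 1) * (Rabs h + Rabs k) * (norm x + 1)) by (field; lra).
    apply Rmult_le_compat_l; [|lra]. apply Rmult_le_pos; [|easy].
    left. apply Rdiv_lt_0_compat; lra. }
  split.
  - apply (total_derivative_continuous (f := fun a b => P (shift + a, b) x) (l := D x) (m := opp (E x))).
    apply tr. intros eps Heps. destruct (H eps Heps) as [r [Hr Hb]]. exists r. split; [easy|].
    intros h k hh hk. destruct (Hb h k hh hk) as [_ Hx]. rewrite <- Rplus_assoc. apply Hx.
  - apply (total_derivative_continuous (f := fun a b => Q (shift + a, b) x) (l := E x) (m := D x)).
    apply tr. intros eps Heps. destruct (H eps Heps) as [r [Hr Hb]]. exists r. split; [easy|].
    intros h k hh hk. destruct (Hb h k hh hk) as [_ Hx]. rewrite <- Rplus_assoc. apply Hx.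
Qed.

End Holomorphic.

Hypothesis HS : analytic_semigroup S.

(* With [w = t / 2] the holomorphic extension at [z] near [t] is that at [w]
   composed with that at [z - w], so that its derivative is given by the two
   operators that are the derivative at the single point [w]. *)
Lemma analytic_derivative_near_0 : exists d0 C, 0 < d0 /\ 0 < C /\
  forall t, 0 < t -> t < d0 -> exists D : B -> B, is_linear D /\
    (forall x, is_derive (fun s => S s x) t (D x)) /\
    forall x, norm (D x) <= C / t * norm x.
Proof.
  destruct HS as [HC0 [c [P [Q [Hc [Hlin [Hreal [Hmul [Hlim Hder]]]]]]]]].
  destruct (@bounded_near_0 B c P (fun x => x) (complete_seq (V := B))
    (fun z hz => proj1 (Hlin z hz)) (fun x => proj1 (Hlim x))) as [d1 [M1 [Hd1 HM1]]].
  destruct (@bounded_near_0 B c Q (fun _ => zero) (complete_seq (V := B))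
    (fun z hz => proj2 (Hlin z hz)) (fun x => proj2 (Hlim x))) as [d2 [M2 [Hd2 HM2]]].
  set (M := Rmax (Rmax M1 M2) 1).
  assert (HMa : M1 <= M) by (eapply Rle_trans; [apply Rmax_l|apply Rmax_l]).
  assert (HMb : M2 <= M) by (eapply Rle_trans; [apply Rmax_r|apply Rmax_l]).
  assert (HMc : 1 <= M) by apply Rmax_r.
  (* With R1 = 2 kp t one has R1 (1 + c) = c t / 8, so the squares of half-side R1 about t / 2 and
     about t stay in the sector. *)
  set (kp := c / (16 * (1 + c))).
  assert (Hkp : 0 < kp) by (apply Rdiv_lt_0_compat; lra).
  assert (Hkc : kp * (16 * (1 + c)) = c) by (unfold kp; field; lra).
  (* The half leaves room for t + a with |a| < R1 <= t / 8 inside the region where P and Q are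
     bounded; 2 M / (kp t) is Cauchy's bound for the radius R0 = kp t. *)
  exists (Rmin d1 d2 / 2), (2 * M / kp).
  assert (Hdd : 0 < Rmin d1 d2) by now apply Rmin_pos.
  assert (Hda : Rmin d1 d2 <= d1) by apply Rmin_l.
  assert (Hdb : Rmin d1 d2 <= d2) by apply Rmin_r.
  split; [lra|]. split; [apply Rdiv_lt_0_compat; lra|].
  intros t Ht0 Htd.
  set (w := RtoC (t / 2)).
  assert (Hw : sector c w).
  { unfold sector, w, RtoC; simpl. rewrite Rabs_R0. split; [lra|]. nra. }
  destruct (holomorphic_total_derivative Hc Hder (a := t / 2) (b := 0) Hw) as [D [E [HD [HE HDE]]]].
  set (R1 := 2 * kp * t). set (R0 := kp * t).
  assert (HR0 : 0 < R0) by now apply Rmult_lt_0_compat.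
  assert (HR1 : R0 < R1) by (unfold R0, R1 in *; lra).
  assert (HR1t : R1 <= t / 8).
  { unfold R1. assert (kp * 16 <= 1) by nra. nra. }
  assert (Hcone : R1 * (1 + c) = c * t / 8) by (unfold R1; rewrite <- Hkc at 2; field).
  assert (sec : forall a b, Rabs a < R1 -> Rabs b < R1 ->
    sector c (t / 2 + a, b) /\ sector c (t + a, b)).
  { intros a b ha hb. apply Rabs_lt_between in ha. unfold sector; simpl.
    assert (h1 : R1 <= c * (t / 2 - R1)) by nra.
    assert (h2 : c * (t / 2 - R1) <= c * (t / 2 + a)) by (apply Rmult_le_compat_l; lra).
    assert (h3 : c * (t / 2 + a) <= c * (t + a)) by (apply Rmult_le_compat_l; lra).
    repeat split; lra. }
  set (p := fun x a b => P (t + a, b) x). set (q := fun x a b => Q (t + a, b) x).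
  (* Written with fixed operators D and E, the derivative is continuous because P and Q are;
     [cauchy_estimate] requires this continuity. *)
  set (d := fun x a b => minus (D (P (t / 2 + a, b) x)) (E (Q (t / 2 + a, b) x))).
  set (e := fun x a b => plus (E (P (t / 2 + a, b) x)) (D (Q (t / 2 + a, b) x))).
  assert (Htot : forall x a b, Rabs a < R1 -> Rabs b < R1 ->
    total_derivative (p x) a b (d x a b) (opp (e x a b)) /\
    total_derivative (q x) a b (e x a b) (d x a b)).
  { intros x a b ha hb. destruct (sec a b ha hb) as [s1 s2].
    set (y := P (t / 2 + a, b) x) in *. set (y' := Q (t / 2 + a, b) x) in *.
    assert (ny := norm_ge_0 y). assert (ny' := norm_ge_0 y').
    assert (mul : forall h k, sector c (t / 2 + h, 0 + k) ->
      p x (a + h) (b + k) = minus (P (t / 2 + h, 0 + k) y) (Q (t / 2 + h, 0 + k) y') /\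
      q x (a + h) (b + k) = plus (P (t / 2 + h, 0 + k) y') (Q (t / 2 + h, 0 + k) y)).
    { intros h k hs. unfold p, q, y, y'.
      replace (t + (a + h), b + k) with (Cplus (t / 2 + h, 0 + k) (t / 2 + a, b)).
      - exact (Hmul _ _ x hs s1).
      - unfold Cplus; simpl. f_equal; field. }
    assert (mul0 : p x a b = minus (P (t / 2, 0) y) (Q (t / 2, 0) y') /\
      q x a b = plus (P (t / 2, 0) y') (Q (t / 2, 0) y)).
    { assert (m := mul 0 0). rewrite !Rplus_0_r in m. now apply m. }
    destruct mul0 as [m1 m2].
    assert (key : forall eps, 0 < eps -> exists r, 0 < r /\ forall h k, Rabs h < r -> Rabs k < r ->
      norm (minus (minus (p x (a + h) (b + k)) (p x a b)) (plus (scal h (d x a b)) (scal k (opp (e x a b)))))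
        <= eps * (Rabs h + Rabs k) /\
      norm (minus (minus (q x (a + h) (b + k)) (q x a b)) (plus (scal h (e x a b)) (scal k (d x a b))))
        <= eps * (Rabs h + Rabs k)).
    { intros eps Heps. set (N := norm y + norm y' + 1).
      destruct (HDE (eps / N)) as [r [Hr Hb]]; [apply Rdiv_lt_0_compat; unfold N; lra|].
      exists r. split; [easy|]. intros h k hh hk.
      destruct (Hb h k hh hk) as [hs Hbd]. destruct (mul h k hs) as [m3 m4].
      rewrite m1, m2, m3, m4.
      destruct (Hbd y) as [u1 u2]. destruct (Hbd y') as [v1 v2].
      assert (hp : 0 <= Rabs h + Rabs k) by (generalize (Rabs_pos h) (Rabs_pos k); lra).
      assert (heN : 0 < eps / N) by (apply Rdiv_lt_0_compat; unfold N; lra).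
      assert (tot : eps / N * (Rabs h + Rabs k) * norm y + eps / N * (Rabs h + Rabs k) * norm y'
         <= eps * (Rabs h + Rabs k)).
      { replace (eps * (Rabs h + Rabs k)) with (eps / N * (Rabs h + Rabs k) * N)
          by (field; unfold N; lra).
        rewrite <- Rmult_plus_distr_l. apply Rmult_le_compat_l; [apply Rmult_le_pos; lra|].
        unfold N. lra. }
      unfold d, e. fold y y'.
      split; eapply Rle_trans; [|exact tot| |exact tot].
      - match goal with |- norm ?v <= _ => replace v with
          (minus (minus (minus (P (t / 2 + h, 0 + k) y) (P (t / 2, 0) y))
                    (plus (scal h (D y)) (scal k (opp (E y)))))
                 (minus (minus (Q (t / 2 + h, 0 + k) y') (Q (t / 2, 0) y'))
                    (plus (scal h (E y')) (scal k (D y'))))) by module_eq_in B end.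
        eapply Rle_trans; [apply (@norm_minus_le B)|]. now apply Rplus_le_compat.
      - match goal with |- norm ?v <= _ => replace v with
          (plus (minus (minus (Q (t / 2 + h, 0 + k) y) (Q (t / 2, 0) y))
                    (plus (scal h (E y)) (scal k (D y))))
                 (minus (minus (P (t / 2 + h, 0 + k) y') (P (t / 2, 0) y'))
                    (plus (scal h (D y')) (scal k (opp (E y')))))) by module_eq_in B end.
        eapply Rle_trans; [apply (@norm_triangle R_AbsRing B)|]. now apply Rplus_le_compat. }
    split; intros eps Heps; destruct (key eps Heps) as [r [Hr Hb]]; exists r; (split; [easy|]);
      intros h k hh hk; apply (Hb h k hh hk). }
  assert (Hreal2 : forall x, P (t / 2 + 0, 0) x = S (t / 2) x /\ Q (t / 2 + 0, 0) x = zero).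
  { intros x. rewrite Rplus_0_r. apply (Hreal (t / 2) x). lra. }
  assert (Hd0 : forall x, d x 0 0 = D (S (t / 2) x)).
  { intros x. unfold d. destruct (Hreal2 x) as [-> ->]. rewrite (linear_zero _ HE).
    module_eq_in B. }
  destruct HC0 as [HSl _].
  exists (fun x => D (S (t / 2) x)). split; [|split].
  - apply (is_linear_comp (S (t / 2)) D); [apply HSl; lra|exact HD].
  - intros x. rewrite <- Hd0. apply is_derive_eps. intros eps Heps.
    assert (H0 : Rabs 0 < R1) by (rewrite Rabs_R0; lra).
    destruct (proj1 (Htot x 0 0 H0 H0) eps Heps) as [r [Hr Hb]].
    exists (Rmin r t). split; [now apply Rmin_pos|]. intros h hh.
    assert (h1 := Rlt_le_trans _ _ _ hh (Rmin_l _ _)). assert (h2 := Rlt_le_trans _ _ _ hh (Rmin_r _ _)).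
    apply Rabs_lt_between in h2.
    assert (g := Hb h 0 h1 ltac:(rewrite Rabs_R0; lra)). rewrite !Rplus_0_l, Rabs_R0, Rplus_0_r in g.
    unfold p in g. rewrite Rplus_0_r in g.
    replace (S (t + h) x) with (P (t + h, 0) x) by (apply (Hreal (t + h) x); lra).
    replace (S t x) with (P (t, 0) x) by (apply (Hreal t x); lra).
    eapply Rle_trans; [|exact g]. right. f_equal. module_eq_in B.
  - intros x. rewrite <- Hd0.
    replace (2 * M / kp / t * norm x) with (2 * (M * norm x) / R0) by (unfold R0; field; lra).
    apply (cauchy_estimate (p := p x) (q := q x) (d := d x) (e := e x) (R1 := R1)); try easy.
    + intros a b ha hb. apply (Htot x a b ha hb).
    + intros a b ha hb. apply (Htot x a b ha hb).
    + intros a b ha hb. destruct (sec a b ha hb) as [s1 s2].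
      destruct (holomorphic_continuous Hc Hder x s1) as [c1 c2].
      apply (@continuous_minus _ _ B).
      * apply (continuous_comp (fun z : R * R => P (t / 2 + fst z, snd z) x) D); [exact c1|].
        now apply (@linear_cont R_AbsRing B B).
      * apply (continuous_comp (fun z : R * R => Q (t / 2 + fst z, snd z) x) E); [exact c2|].
        now apply (@linear_cont R_AbsRing B B).
    + intros a b ha hb. destruct (sec a b ha hb) as [s1 s2].
      assert (ha' := ha). apply Rabs_lt_between in ha'.
      assert (hre : Rabs (t + a) < Rmin d1 d2) by (apply Rabs_lt_between; lra).
      assert (Hx := norm_ge_0 x).
      split; unfold p, q.
      * apply Rle_trans with (M1 * norm x); [apply HM1; simpl; try easy; lra|].
        apply Rmult_le_compat_r; lra.
      * apply Rle_trans with (M2 * norm x); [apply HM2; simpl; try easy; lra|].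
        apply Rmult_le_compat_r; lra.
Qed.

End Analytic.

(** * Fractional powers and smoothing *)

Section Improper.

Context {V : CompleteNormedModule R_AbsRing}.

(* [int_0^oo f = l]. *)
Definition IG (f : R -> V) (l : V) : Prop :=
  forall eps, 0 < eps -> exists d N, 0 < d <= 1 /\ 1 <= N /\
    forall a c, 0 < a < d -> N < c -> norm (minus (RInt f a c) l) <= eps.

Definition cont_pos (f : R -> V) : Prop := forall t, 0 < t -> continuous f t.

Lemma cont_pos_ex_RInt f a c : cont_pos f -> 0 < a -> 0 < c -> ex_RInt f a c.
Proof.
  intros Hf Ha Hc. apply ex_RInt_continuous. intros t [h _]. apply Hf.
  unfold Rmin in h. destruct (Rle_dec a c); lra.
Qed.

Lemma IG_is_RInt_gen f l : cont_pos f ->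
  (is_RInt_gen f (at_right 0) (Rbar_locally p_infty) l <-> IG f l).
Proof.
  intros Hf. split.
  - intros H eps Heps.
    assert (Hb : locally l (fun v => norm (minus v l) < eps))
      by exact (@locally_ball_norm R_AbsRing V l (mkposreal eps Heps)).
    destruct (H _ Hb) as [Q R HQ HR HQR].
    destruct HQ as [d Hd]. destruct HR as [N HN].
    exists (Rmin d 1), (Rmax N 1).
    assert (Hdp := cond_pos d).
    split; [split; [apply Rmin_pos; lra|apply Rmin_r]|]. split; [apply Rmax_r|].
    intros a c [Ha1 Ha2] Hc.
    assert (h1 := Rlt_le_trans _ _ _ Ha2 (Rmin_l _ _)).
    assert (h2 := Rle_lt_trans _ _ _ (Rmax_l _ _) Hc).
    destruct (HQR a c) as [v [Hv1 Hv2]].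
    + apply Hd; [|easy]. change (Rabs (a - 0) < d). rewrite Rabs_right; lra.
    + now apply HN.
    + simpl in Hv1. rewrite (is_RInt_unique _ _ _ _ Hv1). left. exact Hv2.
  - intros H P HP.
    assert (Hb : exists eps : posreal, forall v, norm (minus v l) < eps -> P v).
    { destruct (@locally_norm_le_locally R_AbsRing V l P HP) as [eps He]. now exists eps. }
    destruct Hb as [eps He].
    destruct (H (eps / 2)) as [d [N [Hd [HN HdN]]]]; [generalize (cond_pos eps); lra|].
    apply (Filter_prod _ _ _ (fun a => 0 < a < d) (fun c => N < c)).
    + exists (mkposreal d (proj1 Hd)). intros a Ha Ha0. split; [easy|].
      change (Rabs (a - 0) < d) in Ha. rewrite Rabs_right in Ha; lra.
    + now exists N.
    + intros a c Ha Hc. exists (RInt f a c). simpl. split.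
      * apply RInt_correct, cont_pos_ex_RInt; [easy|lra|lra].
      * apply He. apply Rle_lt_trans with (1 := HdN a c Ha Hc).
        generalize (cond_pos eps); lra.
Qed.

Lemma IG_unique f l m : IG f l -> IG f m -> l = m.
Proof.
  intros Hl Hm.
  assert (h : norm (minus l m) <= 0).
  { apply le_epsilon. intros eps Heps.
    destruct (Hl (eps / 2)) as [d1 [N1 [D1 [E1 F1]]]]; [lra|].
    destruct (Hm (eps / 2)) as [d2 [N2 [D2 [E2 F2]]]]; [lra|].
    set (a := Rmin d1 d2 / 2). set (c := Rmax N1 N2 + 1).
    assert (ha : 0 < Rmin d1 d2) by (apply Rmin_pos; lra).
    assert (ha1 := Rmin_l d1 d2). assert (ha2 := Rmin_r d1 d2).
    assert (hc1 := Rmax_l N1 N2). assert (hc2 := Rmax_r N1 N2).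
    specialize (F1 a c ltac:(unfold a; lra) ltac:(unfold c; lra)).
    specialize (F2 a c ltac:(unfold a; lra) ltac:(unfold c; lra)).
    match goal with |- norm ?v <= _ => replace v with
      (minus (minus (RInt f a c) m) (minus (RInt f a c) l)) by module_eq_in V end.
    eapply Rle_trans; [apply (@norm_minus_le V)|].
    apply Rle_trans with (eps / 2 + eps / 2); [now apply Rplus_le_compat|lra]. }
  assert (h0 : minus l m = zero).
  { apply (@norm_eq_zero R_AbsRing V). apply Rle_antisym; [easy|apply (@norm_ge_0 R_AbsRing V)]. }
  transitivity (plus (minus l m) m); [module_eq_in V|]. rewrite h0. apply plus_zero_l.
Qed.

Lemma IG_ext f g l : (forall t, 0 < t -> f t = g t) -> IG f l -> IG g l.
Proof.
  intros H Hf eps Heps. destruct (Hf eps Heps) as [d [N [D [E1 F1]]]].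
  exists d, N. split; [easy|]. split; [easy|]. intros a c Ha Hc.
  rewrite <- (RInt_ext f g a c); [now apply F1|].
  intros t [ht _]. apply H. rewrite Rmin_left in ht; lra.
Qed.

Lemma IG_plus f g l m : cont_pos f -> cont_pos g -> IG f l -> IG g m ->
  IG (fun t => plus (f t) (g t)) (plus l m).
Proof.
  intros Cf Cg Hl Hm eps Heps.
  destruct (Hl (eps / 2)) as [d1 [N1 [D1 [E1 F1]]]]; [lra|].
  destruct (Hm (eps / 2)) as [d2 [N2 [D2 [E2 F2]]]]; [lra|].
  exists (Rmin d1 d2), (Rmax N1 N2).
  assert (ha1 := Rmin_l d1 d2). assert (ha2 := Rmin_r d1 d2).
  assert (hc1 := Rmax_l N1 N2). assert (hc2 := Rmax_r N1 N2).
  split; [split; [apply Rmin_pos; lra|lra]|]. split; [lra|].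
  intros a c Ha Hc.
  specialize (F1 a c ltac:(lra) ltac:(lra)). specialize (F2 a c ltac:(lra) ltac:(lra)).
  match goal with |- norm (minus ?v _) <= _ =>
    replace v with (plus (RInt f a c) (RInt g a c))
      by (symmetry; apply (RInt_plus f g); apply cont_pos_ex_RInt; (easy || lra)) end.
  match goal with |- norm ?v <= _ => replace v with
    (plus (minus (RInt f a c) l) (minus (RInt g a c) m)) by module_eq_in V end.
  eapply Rle_trans; [apply (@norm_triangle R_AbsRing V)|].
  apply Rle_trans with (eps / 2 + eps / 2); [now apply Rplus_le_compat|lra].
Qed.

Lemma norm_RInt_le_sym (f : R -> V) (x y E : R) :
  ex_RInt f x y ->
  (x <= y -> norm (RInt f x y) <= E) -> (y <= x -> norm (RInt f y x) <= E) ->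
  norm (RInt f x y) <= E.
Proof.
  intros Hex H1 H2. destruct (Rle_lt_dec x y) as [h|h]; [now apply H1|].
  replace (RInt f x y) with (opp (RInt f y x)) by (apply opp_RInt_swap; now apply ex_RInt_swap).
  rewrite (@norm_opp R_AbsRing V). apply H2. lra.
Qed.

Section Decay.

Variables (b lam : R).
Hypotheses (Hb : 0 < b) (Hlam : 0 < lam).

Lemma Rpower_derive x : 0 < x -> is_derive (fun t => Rpower t b) x (b * Rpower x (b - 1)).
Proof.
  intros Hx. unfold Rpower. auto_derive; [easy|].
  replace ((b - 1) * ln x) with (b * ln x + - ln x) by ring.
  rewrite exp_plus, exp_Ropp, exp_ln by easy. field. lra.
Qed.

Lemma Rpower_continuous (m x : R) : 0 < x -> continuous (fun t => Rpower t m) x.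
Proof.
  intros Hx. apply (ex_derive_continuous (V := R_NormedModule)).
  unfold Rpower. auto_derive. easy.
Qed.

(** With m such that (|b - 1| + 1) m = lam / 2, the inequality ln (m t) <= m t - 1 lets half of the
    exponential decay absorb the power of t; this is the constant left over. *)
Definition decay_cst : R :=
  let m := lam / (2 * (Rabs (b - 1) + 1)) in exp ((Rabs (b - 1) + 1) * (- 1 - ln m)).

Lemma Rpower_decay t : 1 <= t ->
  Rpower t (b - 1) * exp (- lam * t) <= decay_cst * exp (- (lam / 2) * t).
Proof.
  intros Ht. unfold decay_cst. set (be := Rabs (b - 1) + 1). set (m := lam / (2 * be)).
  assert (Hbe : 0 < be) by (unfold be; generalize (Rabs_pos (b - 1)); lra).
  assert (Hm : 0 < m) by (apply Rdiv_lt_0_compat; lra).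
  assert (Hl : 0 <= ln t) by (rewrite <- ln_1; apply ln_le; lra).
  assert (Hlm : ln m + ln t <= m * t - 1).
  { rewrite <- ln_mult by lra. assert (hp : 0 < m * t) by nra.
    assert (h := exp_ineq1_le (ln (m * t))). rewrite exp_ln in h by easy. lra. }
  unfold Rpower. rewrite <- !exp_plus.
  assert (h1 : (b - 1) * ln t <= be * ln t).
  { apply Rmult_le_compat_r; [easy|]. unfold be. generalize (Rle_abs (b - 1)); lra. }
  assert (h2 : be * ln t <= be * (m * t - 1 - ln m)) by (apply Rmult_le_compat_l; lra).
  assert (h3 : be * m = lam / 2) by (unfold m; field; lra).
  assert (h4 : (b - 1) * ln t + - lam * t <= be * (-1 - ln m) + - (lam / 2) * t).
  { replace (be * (m * t - 1 - ln m)) with (be * m * t + be * (-1 - ln m)) in h2 by ring.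
    rewrite h3 in h2. lra. }
  destruct h4 as [h4|h4]; [left; now apply exp_increasing|rewrite h4; lra].
Qed.

Variables (phi : R -> V) (K : R).
Hypotheses (Hphi : cont_pos phi) (HK : 0 <= K).
Hypothesis Hdecay : forall t, 0 < t -> norm (phi t) <= K * exp (- lam * t).

Let f (t : R) : V := scal (Rpower t (b - 1)) (phi t).

Lemma weighted_continuous : cont_pos f.
Proof.
  intros t Ht. apply (@continuous_scal _ _ V); [now apply Rpower_continuous|now apply Hphi].
Qed.

Lemma norm_small x y d : 0 < x <= d -> 0 < y <= d -> d <= 1 ->
  norm (RInt f x y) <= K * (Rpower d b / b).
Proof.
  assert (main : forall x y, 0 < x -> x <= y -> y <= d -> d <= 1 ->
    norm (RInt f x y) <= K * (Rpower d b / b)).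
  { clear x y. intros x y Hx Hxy Hy Hd.
    assert (g : norm (RInt f x y) <= K * (Rpower y b / b) - K * (Rpower x b / b)).
    { apply (norm_RInt_le f (fun t => K * Rpower t (b - 1)) x y); [easy| | |].
      - intros t Ht. unfold f. rewrite (norm_scal_R (V := V)), Rabs_right by (left; apply exp_pos).
        rewrite Rmult_comm. apply Rmult_le_compat_r; [left; apply exp_pos|].
        apply Rle_trans with (1 := Hdecay (t := t) ltac:(lra)).
        rewrite <- (Rmult_1_r K) at 2. apply Rmult_le_compat_l; [easy|].
        rewrite <- exp_0. destruct (Rle_lt_or_eq_dec (- lam * t) 0) as [h|h]; [nra| |rewrite h; lra].
        left. now apply exp_increasing.
      - apply RInt_correct, cont_pos_ex_RInt; [exact weighted_continuous|lra|lra].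
      - apply (is_RInt_derive (V := R_CompleteNormedModule) (fun t => K * (Rpower t b / b))).
        + intros t Ht. rewrite Rmin_left, Rmax_right in Ht by lra.
          assert (D := is_derive_scal (fun t => Rpower t b) t (K / b) _ (Rpower_derive (x := t) ltac:(lra))).
          apply (is_derive_ext (fun t => K / b * Rpower t b)).
          { intros s. change (K / b * Rpower s b = K * (Rpower s b / b)). field. lra. }
          apply (is_derive_eq D).
          change (K / b * (b * Rpower t (b - 1)) = K * Rpower t (b - 1)). field. lra.
        + intros t Ht. rewrite Rmin_left, Rmax_right in Ht by lra.
          apply (continuous_scal_r (V := R_NormedModule)), Rpower_continuous. lra. }
    assert (h1 : 0 <= K * (Rpower x b / b)).
    { apply Rmult_le_pos; [easy|]. left. apply Rdiv_lt_0_compat; [apply exp_pos|easy]. }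
    assert (h2 : K * (Rpower y b / b) <= K * (Rpower d b / b)).
    { apply Rmult_le_compat_l; [easy|]. apply Rmult_le_compat_r; [left; now apply Rinv_0_lt_compat|].
      apply Rle_Rpower_l; lra. }
    lra. }
  intros Hx Hy Hd. apply norm_RInt_le_sym.
  - apply cont_pos_ex_RInt; [exact weighted_continuous|lra|lra].
  - intros h. apply main; lra.
  - intros h. apply main; lra.
Qed.

Definition tail_cst : R := decay_cst * (2 / lam).

Lemma tail_cst_pos : 0 < tail_cst.
Proof. apply Rmult_lt_0_compat; [apply exp_pos|apply Rdiv_lt_0_compat; lra]. Qed.

Lemma norm_large N x y : 1 <= N -> N <= x -> N <= y ->
  norm (RInt f x y) <= K * (tail_cst * exp (- (lam / 2) * N)).
Proof.
  assert (main : forall x y, 1 <= N -> N <= x -> x <= y ->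
    norm (RInt f x y) <= K * (tail_cst * exp (- (lam / 2) * N))).
  { clear x y. intros x y HN Hx Hxy.
    set (G := fun t => - (K * (tail_cst * exp (- (lam / 2) * t)))).
    assert (g : norm (RInt f x y) <= G y - G x).
    { apply (norm_RInt_le f (fun t => K * (decay_cst * exp (- (lam / 2) * t))) x y); [easy| | |].
      - intros t Ht. unfold f. rewrite (norm_scal_R (V := V)), Rabs_right by (left; apply exp_pos).
        apply Rle_trans with (Rpower t (b - 1) * (K * exp (- lam * t))).
        + apply Rmult_le_compat_l; [left; apply exp_pos|]. apply Hdecay. lra.
        + replace (Rpower t (b - 1) * (K * exp (- lam * t)))
            with (K * (Rpower t (b - 1) * exp (- lam * t))) by ring.
          apply Rmult_le_compat_l; [easy|]. apply Rpower_decay. lra.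
      - apply RInt_correct, cont_pos_ex_RInt; [exact weighted_continuous|lra|lra].
      - apply (is_RInt_derive (V := R_CompleteNormedModule) G).
        + intros t _. unfold G, tail_cst. auto_derive; [easy|]. field. lra.
        + intros t _. apply (ex_derive_continuous (V := R_NormedModule)). auto_derive. easy. }
    assert (h1 : G y <= 0).
    { unfold G. assert (0 <= K * (tail_cst * exp (- (lam / 2) * y))); [|lra].
      apply Rmult_le_pos; [easy|]. left. apply Rmult_lt_0_compat; [apply tail_cst_pos|apply exp_pos]. }
    assert (h2 : - G x <= - G N).
    { unfold G. rewrite !Ropp_involutive. apply Rmult_le_compat_l; [easy|].
      apply Rmult_le_compat_l; [left; apply tail_cst_pos|].
      destruct (Rle_lt_or_eq_dec (- (lam / 2) * x) (- (lam / 2) * N)) as [h|h];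
        [nra|left; now apply exp_increasing|rewrite h; lra]. }
    unfold G in *. lra. }
  intros HN Hx Hy. apply norm_RInt_le_sym.
  - apply cont_pos_ex_RInt; [exact weighted_continuous|lra|lra].
  - intros h. now apply main.
  - intros h. now apply main.
Qed.

(** The integrals over [1 / (n + 1), n + 1] form a Cauchy sequence by [norm_small] and [norm_large].
    In the final bound / b accounts for (0, 1] and [tail_cst] for the rest. *)
Lemma IG_exists : exists l, IG f l /\ norm l <= K * (/ b + tail_cst).
Proof.
  assert (Hex : forall x y, 0 < x -> 0 < y -> ex_RInt f x y)
    by (intros; now apply (cont_pos_ex_RInt weighted_continuous)).
  assert (Htc := tail_cst_pos).
  assert (diff : forall d N a c a' c', d <= 1 -> 1 <= N -> 0 < a <= d -> 0 < a' <= d ->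
    N <= c -> N <= c' -> norm (minus (RInt f a c) (RInt f a' c'))
      <= K * (Rpower d b / b) + K * (tail_cst * exp (- (lam / 2) * N))).
  { intros d N a c a' c' h1 h2 h3 h4 h5 h6.
    match goal with |- norm ?v <= _ => replace v with (minus (RInt f a a') (RInt f c c')) end.
    - eapply Rle_trans; [apply (@norm_minus_le V)|]. apply Rplus_le_compat.
      + now apply norm_small.
      + now apply norm_large.
    - replace (RInt f a c) with (plus (RInt f a a') (RInt f a' c))
        by (apply (RInt_Chasles f); apply Hex; lra).
      replace (RInt f a' c') with (plus (RInt f a' c) (RInt f c c'))
        by (apply (RInt_Chasles f); apply Hex; lra). module_eq_in V. }
  assert (small : forall eps, 0 < eps -> exists d N, 0 < d <= 1 /\ 1 <= N /\
    K * (Rpower d b / b) + K * (tail_cst * exp (- (lam / 2) * N)) <= eps).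
  { intros eps Heps.
    destruct (rpow_small b (eps * b / (2 * (K + 1))) Hb) as [d [Hd Hds]].
    { apply Rdiv_lt_0_compat; nra. }
    set (N := Rmax 1 (2 / lam * (2 * (K + 1) * tail_cst / eps))).
    exists (Rmin d 1), N.
    assert (Hm : 0 < Rmin d 1) by (apply Rmin_pos; lra).
    split; [split; [easy|apply Rmin_r]|]. split; [apply Rmax_l|].
    assert (s1 : K * (Rpower (Rmin d 1) b / b) <= eps / 2).
    { assert (g := Hds (Rmin d 1) (Rmin_l _ _)). rewrite rpow_Rpower in g by easy.
      apply Rle_trans with ((K + 1) * (eps * b / (2 * (K + 1)) / b)).
      - apply Rmult_le_compat; [easy| |lra|].
        + left. apply Rdiv_lt_0_compat; [apply exp_pos|easy].
        + apply Rmult_le_compat_r; [left; now apply Rinv_0_lt_compat|easy].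
      - right. field. split; lra. }
    assert (s2 : K * (tail_cst * exp (- (lam / 2) * N)) <= eps / 2).
    { assert (hN : 2 * (K + 1) * tail_cst / eps <= lam / 2 * N).
      { apply Rle_trans with (lam / 2 * (2 / lam * (2 * (K + 1) * tail_cst / eps))).
        - right. field. lra.
        - apply Rmult_le_compat_l; [lra|apply Rmax_r]. }
      assert (he : exp (- (lam / 2) * N) <= / (lam / 2 * N)).
      { assert (hp : 0 < lam / 2 * N).
        { apply Rmult_lt_0_compat; [lra|]. apply Rlt_le_trans with 1; [lra|apply Rmax_l]. }
        replace (- (lam / 2) * N) with (- (lam / 2 * N)) by ring. rewrite exp_Ropp.
        apply Rinv_le_contravar; [easy|]. generalize (exp_ineq1_le (lam / 2 * N)). lra. }
      assert (hq : 0 < 2 * (K + 1) * tail_cst / eps).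
      { apply Rdiv_lt_0_compat; [|easy]. apply Rmult_lt_0_compat; lra. }
      assert (hi : / (lam / 2 * N) <= eps / (2 * (K + 1) * tail_cst)).
      { replace (eps / (2 * (K + 1) * tail_cst)) with (/ (2 * (K + 1) * tail_cst / eps))
          by (field; repeat split; lra).
        now apply Rinv_le_contravar. }
      apply Rle_trans with ((K + 1) * (tail_cst * (eps / (2 * (K + 1) * tail_cst)))).
      - apply Rmult_le_compat; [easy| |lra|].
        + apply Rmult_le_pos; [lra|left; apply exp_pos].
        + apply Rmult_le_compat_l; lra.
      - right. field. split; lra. }
    lra. }
  set (u := fun n => RInt f (/ INR (S n)) (INR (S n))).
  assert (HS : forall n, 0 < INR (S n)) by (intros; apply lt_0_INR; lia).
  assert (near : forall eps, 0 < eps -> exists d N n0, 0 < d <= 1 /\ 1 <= N /\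
    forall n a c, (n0 <= n)%nat -> 0 < a <= d -> N <= c -> norm (minus (RInt f a c) (u n)) <= eps).
  { intros eps Heps. destruct (small eps Heps) as [d [N [Hd [HN Hs]]]].
    destruct (INR_unbounded (Rmax (/ d) N)) as [n0 Hn0].
    exists d, N, n0. split; [easy|]. split; [easy|]. intros n a c Hn Ha Hc.
    apply Rle_trans with (2 := Hs).
    assert (hn : Rmax (/ d) N < INR (S n)).
    { apply Rlt_trans with (1 := Hn0). apply lt_INR. lia. }
    assert (hn1 := Rle_lt_trans _ _ _ (Rmax_l _ _) hn).
    assert (hn2 := Rle_lt_trans _ _ _ (Rmax_r _ _) hn).
    apply diff; try lra.
    split; [now apply Rinv_0_lt_compat|]. rewrite <- (Rinv_inv d).
    apply Rinv_le_contravar; [apply Rinv_0_lt_compat; lra|lra]. }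
  destruct (@complete_seq V u) as [l Hl].
  { intros eps Heps. destruct (near (eps / 2) ltac:(lra)) as [d [N [n0 [Hd [HN H]]]]].
    destruct (INR_unbounded (Rmax (/ d) N)) as [n1 Hn1].
    exists (max n0 n1). intros n m Hn Hm.
    assert (hn : Rmax (/ d) N < INR (S n)).
    { apply Rlt_trans with (1 := Hn1). apply lt_INR. lia. }
    assert (hn1 := Rle_lt_trans _ _ _ (Rmax_l _ _) hn).
    assert (hn2 := Rle_lt_trans _ _ _ (Rmax_r _ _) hn).
    apply Rle_lt_trans with (eps / 2); [|lra].
    unfold u at 1. apply H; [lia| |lra].
    split; [now apply Rinv_0_lt_compat|]. rewrite <- (Rinv_inv d).
    apply Rinv_le_contravar; [apply Rinv_0_lt_compat; lra|lra]. }
  exists l. assert (HIG : IG f l).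
  { intros eps Heps. destruct (near (eps / 2) ltac:(lra)) as [d [N [n0 [Hd [HN H]]]]].
    exists d, N. split; [easy|]. split; [easy|]. intros a c Ha Hc.
    destruct (Hl (eps / 2) ltac:(lra)) as [n1 Hn1].
    specialize (Hn1 (max n0 n1) ltac:(lia)).
    specialize (H (max n0 n1) a c ltac:(lia) ltac:(lra) ltac:(lra)).
    match goal with |- norm ?v <= _ => replace v with
      (plus (minus (RInt f a c) (u (max n0 n1))) (minus (u (max n0 n1)) l)) by module_eq_in V end.
    eapply Rle_trans; [apply (@norm_triangle R_AbsRing V)|].
    apply Rle_trans with (eps / 2 + eps / 2); [|lra].
    apply Rplus_le_compat; [exact H|left; exact Hn1]. }
  split; [exact HIG|].
  apply le_epsilon. intros eps Heps. destruct (HIG eps Heps) as [d [N [Hd [HN H]]]].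
  specialize (H (d / 2) (N + 1) ltac:(lra) ltac:(lra)).
  assert (h1 := norm_small (x := d / 2) (y := 1) (d := 1) ltac:(lra) ltac:(lra) ltac:(lra)).
  assert (h2 := norm_large (N := 1) (x := 1) (y := N + 1) ltac:(lra) ltac:(lra) ltac:(lra)).
  assert (h3 : Rpower 1 b = 1) by (unfold Rpower; rewrite ln_1, Rmult_0_r; apply exp_0).
  rewrite h3 in h1.
  assert (h4 : exp (- (lam / 2) * 1) <= 1).
  { apply Rle_trans with (exp 0); [left; apply exp_increasing; lra|rewrite exp_0; lra]. }
  assert (h5 : K * (tail_cst * exp (- (lam / 2) * 1)) <= K * (tail_cst * 1)).
  { apply Rmult_le_compat_l; [easy|]. apply Rmult_le_compat_l; lra. }
  replace l with (minus (RInt f (d / 2) (N + 1)) (minus (RInt f (d / 2) (N + 1)) l)) by module_eq_in V.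
  eapply Rle_trans; [apply (@norm_minus_le V)|].
  assert (h6 : norm (RInt f (d / 2) (N + 1)) <= K * (1 / b) + K * (tail_cst * exp (- (lam / 2) * 1))).
  { replace (RInt f (d / 2) (N + 1)) with (plus (RInt f (d / 2) 1) (RInt f 1 (N + 1)))
      by (apply (RInt_Chasles f); apply Hex; lra).
    eapply Rle_trans; [apply (@norm_triangle R_AbsRing V)|]. now apply Rplus_le_compat. }
  replace (1 / b) with (/ b) in h6 by (field; lra).
  apply Rplus_le_compat; [|exact H].
  apply Rle_trans with (1 := h6). rewrite Rmult_plus_distr_l. apply Rplus_le_compat_l.
  apply Rle_trans with (1 := h5). rewrite Rmult_1_r. lra.
Qed.

End Decay.

End Improper.

(** * Integrals under linear maps, primitives, and the Gamma function *)

Lemma Riemann_sum_linear {V W : NormedModule R_AbsRing} (L : V -> W) (f : R -> V) ptd :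
  is_linear L -> Riemann_sum (fun t => L (f t)) ptd = L (Riemann_sum f ptd).
Proof.
  intros HL. apply SF_cons_ind with (s := ptd).
  - intros x. change (@zero W = L zero). symmetry. now apply linear_zero.
  - intros h s IH. rewrite !Riemann_sum_cons, IH.
    rewrite (linear_plus _ HL), (linear_scal _ HL). reflexivity.
Qed.

Lemma is_RInt_linear {V W : NormedModule R_AbsRing} (L : V -> W) (f : R -> V) a b l :
  is_linear L -> is_RInt f a b l -> is_RInt (fun t => L (f t)) a b (L l).
Proof.
  intros HL H. unfold is_RInt in *.
  apply (filterlim_ext (fun ptd => L (scal (sign (b - a)) (Riemann_sum f ptd)))).
  - intros ptd. rewrite (Riemann_sum_linear f ptd HL). exact (linear_scal L HL _ _).
  - apply (filterlim_comp _ _ _ _ _ _ _ _ H). apply (linear_cont (K := R_AbsRing) _ _ HL).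
Qed.

Lemma is_derive_linear {V W : NormedModule R_AbsRing} (L : V -> W) (f : R -> V) x l :
  is_linear L -> is_derive f x l -> is_derive (fun t => L (f t)) x (L l).
Proof.
  intros HL Hf.
  apply (filterdiff_ext_lin _ _ _ (filterdiff_comp' f L x _ L Hf (filterdiff_linear L HL))).
  intros y. now apply linear_scal.
Qed.

Lemma is_derive_unique_vec {V : NormedModule R_AbsRing} (f : R -> V) x l m :
  is_derive f x l -> is_derive f x m -> l = m.
Proof.
  intros Hl Hm.
  assert (h : norm (minus l m) <= 0).
  { apply le_epsilon. intros eps Heps.
    destruct (proj1 (is_derive_eps f x l) Hl (eps / 2)) as [d1 [D1 H1]]; [lra|].
    destruct (proj1 (is_derive_eps f x m) Hm (eps / 2)) as [d2 [D2 H2]]; [lra|].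
    set (h := Rmin d1 d2 / 2).
    assert (hp : 0 < Rmin d1 d2) by (apply Rmin_pos; lra).
    assert (m1 := Rmin_l d1 d2). assert (m2 := Rmin_r d1 d2).
    assert (ha : Rabs h = h) by (apply Rabs_right; unfold h; lra).
    specialize (H1 h ltac:(rewrite ha; unfold h; lra)).
    specialize (H2 h ltac:(rewrite ha; unfold h; lra)).
    assert (h0 : 0 < h) by (unfold h; lra). clearbody h.
    replace (minus l m) with (scal (/ h) (minus (minus (minus (f (x + h)) (f x)) (scal h m))
      (minus (minus (f (x + h)) (f x)) (scal h l)))) by (module_eq_in V; lra).
    rewrite norm_scal_R, Rabs_right by (left; now apply Rinv_0_lt_compat).
    apply Rle_trans with (/ h * (eps / 2 * Rabs h + eps / 2 * Rabs h)).
    - apply Rmult_le_compat_l; [left; now apply Rinv_0_lt_compat|].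
      eapply Rle_trans; [apply norm_minus_le|]. now apply Rplus_le_compat.
    - rewrite ha. right. field. lra. }
  assert (h0 : minus l m = zero).
  { apply (@norm_eq_zero R_AbsRing V). apply Rle_antisym; [easy|apply (@norm_ge_0 R_AbsRing V)]. }
  replace l with (plus (minus l m) m) by module_eq_in V. rewrite h0. apply plus_zero_l.
Qed.

Section Improper.

Context {V : CompleteNormedModule R_AbsRing}.

Lemma cont_pos_is_RInt (f : R -> V) a c : cont_pos f -> 0 < a -> 0 < c -> is_RInt f a c (RInt f a c).
Proof. intros Hf Ha Hc. now apply RInt_correct, cont_pos_ex_RInt. Qed.

Lemma IG_linear {W : CompleteNormedModule R_AbsRing} (L : V -> W) f l :
  is_linear L -> cont_pos f -> IG f l -> IG (fun t => L (f t)) (L l).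
Proof.
  intros HL Hf H eps Heps. destruct (linear_norm _ HL) as [C [HC HLC]].
  destruct (H (eps / C)) as [d [N [Hd [HN HdN]]]]; [now apply Rdiv_lt_0_compat|].
  exists d, N. split; [easy|]. split; [easy|]. intros a c Ha Hc.
  rewrite (is_RInt_unique _ a c (L (RInt f a c))).
  - match goal with |- norm ?v <= _ => replace v with (L (minus (RInt f a c) l)) end.
    + eapply Rle_trans; [apply HLC|].
      apply Rle_trans with (C * (eps / C)); [|right; field; lra].
      apply Rmult_le_compat_l; [lra|]. now apply HdN.
    + exact (linear_minus _ _ _ HL).
  - apply (is_RInt_linear HL). apply cont_pos_is_RInt; [easy|lra|lra].
Qed.

Lemma IG_scal k (f : R -> V) l : cont_pos f -> IG f l -> IG (fun t => scal k (f t)) (scal k l).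
Proof.
  intros Hf H. apply (IG_linear (L := fun x => scal k x)); [|easy|easy].
  exact (is_linear_scal_r (V := V) k Rmult_comm).
Qed.

Lemma IG_derive (G h : R -> V) l0 :
  (forall t, 0 < t -> is_derive G t (h t)) -> cont_pos h ->
  (forall eps, 0 < eps -> exists d, 0 < d /\ forall t, 0 < t < d -> norm (minus (G t) l0) <= eps) ->
  (forall eps, 0 < eps -> exists N, forall t, N < t -> norm (G t) <= eps) ->
  IG h (opp l0).
Proof.
  intros HG Hh H0 Hi eps Heps.
  destruct (H0 (eps / 2)) as [d [Hd H0d]]; [lra|].
  destruct (Hi (eps / 2)) as [N HN]; [lra|].
  exists (Rmin d 1), (Rmax N 1).
  assert (m1 := Rmin_l d 1). assert (m2 := Rmin_r d 1).
  assert (m3 := Rmax_l N 1). assert (m4 := Rmax_r N 1).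
  split; [split; [apply Rmin_pos; lra|lra]|]. split; [lra|]. intros a c Ha Hc.
  rewrite (is_RInt_unique _ a c (minus (G c) (G a))).
  - match goal with |- norm ?v <= _ => replace v with
      (minus (G c) (minus (G a) l0)) by module_eq_in V end.
    eapply Rle_trans; [apply (@norm_minus_le V)|].
    apply Rle_trans with (eps / 2 + eps / 2); [|lra].
    apply Rplus_le_compat; [apply HN; lra|apply H0d; lra].
  - apply (is_RInt_derive (V := V)); intros t; rewrite Rmin_left by lra; intros Ht.
    + apply HG. lra.
    + apply Hh. lra.
Qed.

Lemma norm_RInt_antiderivative (f : R -> V) (m G : R -> R) x y : x <= y ->
  (forall t, x <= t <= y -> continuous f t) ->
  (forall t, x <= t <= y -> continuous m t) ->
  (forall t, x <= t <= y -> norm (f t) <= m t) ->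
  (forall t, x <= t <= y -> is_derive G t (m t)) ->
  norm (RInt f x y) <= G y - G x.
Proof.
  intros Hxy Cf Cm Hm HG.
  apply (norm_RInt_le f m x y); [easy|easy| |].
  - apply RInt_correct, ex_RInt_continuous. intros t. rewrite Rmin_left, Rmax_right by lra. apply Cf.
  - apply (is_RInt_derive (V := R_CompleteNormedModule)); intros t;
      rewrite Rmin_left, Rmax_right by lra; [apply HG|apply Cm].
Qed.

Lemma IG_norm_le (f : R -> V) (m G : R -> R) l C :
  cont_pos f -> (forall t, 0 < t -> continuous m t) ->
  (forall t, 0 < t -> norm (f t) <= m t) ->
  (forall t, 0 < t -> is_derive G t (m t)) ->
  (forall x y, 0 < x <= y -> G y - G x <= C) ->
  IG f l -> norm l <= C.
Proof.
  intros Cf Cm Hm HG HC H. apply le_epsilon. intros eps Heps.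
  destruct (H eps Heps) as [d [N [Hd [HN HdN]]]].
  specialize (HdN (d / 2) (N + 1) ltac:(lra) ltac:(lra)).
  replace l with (minus (RInt f (d / 2) (N + 1)) (minus (RInt f (d / 2) (N + 1)) l)) by module_eq_in V.
  eapply Rle_trans; [apply (@norm_minus_le V)|]. apply Rplus_le_compat; [|exact HdN].
  apply Rle_trans with (G (N + 1) - G (d / 2)); [|apply HC; lra].
  apply (norm_RInt_antiderivative (m := m)); [lra| | | |]; intros t Ht;
    [apply Cf|apply Cm|apply Hm|apply HG]; lra.
Qed.

(** For an integrand continuous across 0 the lower limit may be 0 itself: near 0 it is bounded by
    norm (f 0) + 1, so the added piece is as small as wanted. *)
Lemma IG_proper (f : R -> V) l : (forall t, continuous f t) -> IG f l ->
  forall eps, 0 < eps -> exists N, 1 <= N /\ forall c, N < c -> norm (minus (RInt f 0 c) l) <= eps.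
Proof.
  intros Cf H eps Heps. destruct (H (eps / 2)) as [d [N [Hd [HN HdN]]]]; [lra|].
  exists N. split; [easy|]. intros c Hc.
  destruct (proj1 (continuous_norm_eps f 0) (Cf 0) 1 Rlt_0_1) as [r [Hr Hf]].
  set (m := norm (f 0) + 1).
  assert (hm : 0 < m) by (unfold m; generalize (@norm_ge_0 R_AbsRing V (f 0)); lra).
  set (a := Rmin (Rmin (d / 2) (r / 2)) (eps / (2 * m))).
  assert (ha1 : a <= d / 2) by (eapply Rle_trans; [apply Rmin_l|apply Rmin_l]).
  assert (ha2 : a <= r / 2) by (eapply Rle_trans; [apply Rmin_l|apply Rmin_r]).
  assert (ha3 : a <= eps / (2 * m)) by apply Rmin_r.
  assert (ha : 0 < a).
  { apply Rmin_pos; [apply Rmin_pos; lra|]. apply Rdiv_lt_0_compat; lra. }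
  assert (Hex : forall x y, ex_RInt f x y) by (intros; apply ex_RInt_continuous; intros; apply Cf).
  replace (RInt f 0 c) with (plus (RInt f 0 a) (RInt f a c)) by (apply (RInt_Chasles f); apply Hex).
  match goal with |- norm ?v <= _ => replace v with
    (plus (RInt f 0 a) (minus (RInt f a c) l)) by module_eq_in V end.
  eapply Rle_trans; [apply (@norm_triangle R_AbsRing V)|].
  apply Rle_trans with (eps / 2 + eps / 2); [|lra].
  apply Rplus_le_compat; [|apply HdN; lra].
  apply Rle_trans with (m * a - m * 0).
  - apply (norm_RInt_antiderivative (m := fun _ => m) (G := fun t => m * t)); [lra| | | |].
    + intros; apply Cf.
    + intros. apply continuous_const.
    + intros t Ht. unfold m.
      replace (f t) with (plus (f 0) (minus (f t) (f 0))) by module_eq_in V.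
      eapply Rle_trans; [apply (@norm_triangle R_AbsRing V)|]. apply Rplus_le_compat_l.
      left. apply Hf. rewrite Rminus_0_r, Rabs_right; lra.
    + intros t _. auto_derive; [easy|]. ring.
  - rewrite Rmult_0_r, Rminus_0_r. apply Rle_trans with (m * (eps / (2 * m))).
    + apply Rmult_le_compat_l; lra.
    + right. field. lra.
Qed.

End Improper.

Lemma Gamma_IG a : 0 < a ->
  IG (V := R_CompleteNormedModule) (fun t => Rpower t (a - 1) * exp (- t)) (Euler_Gamma a) /\
  0 < Euler_Gamma a.
Proof.
  intros Ha.
  assert (Cexp : cont_pos (V := R_CompleteNormedModule) (fun t => exp (- t))).
  { intros t _. apply (ex_derive_continuous (V := R_NormedModule)). auto_derive. easy. }
  assert (Cf : cont_pos (V := R_CompleteNormedModule) (fun t => Rpower t (a - 1) * exp (- t))).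
  { intros t Ht. apply (continuous_mult (K := R_AbsRing)); [now apply Rpower_continuous|now apply Cexp]. }
  destruct (IG_exists (V := R_CompleteNormedModule) Ha Rlt_0_1 (phi := fun t => exp (- t)) (K := 1) Cexp Rle_0_1)
    as [l [Hl _]].
  { intros t Ht. change (Rabs (exp (- t)) <= 1 * exp (- (1) * t)).
    rewrite Rabs_right by (left; apply exp_pos). replace (- (1) * t) with (- t) by ring. lra. }
  assert (e : Euler_Gamma a = l).
  { unfold Euler_Gamma. apply is_RInt_gen_unique.
    now apply (IG_is_RInt_gen (V := R_CompleteNormedModule) l Cf). }
  rewrite e. split; [exact Hl|].
  set (f := fun t => Rpower t (a - 1) * exp (- t)).
  assert (fpos : forall t, 0 < f t) by (intros; apply Rmult_lt_0_compat; apply exp_pos).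
  assert (h1 : 0 < RInt f 1 2).
  { apply RInt_gt_0; [lra|easy|]. intros x Hx. apply Cf. lra. }
  destruct (Hl (RInt f 1 2 / 2)) as [d [N [Hd [HN HdN]]]]; [lra|].
  specialize (HdN (d / 2) (N + 2) ltac:(lra) ltac:(lra)).
  assert (Hex : forall x y, 0 < x -> 0 < y -> ex_RInt f x y)
    by (intros; now apply (cont_pos_ex_RInt (V := R_CompleteNormedModule) Cf)).
  assert (h2 : RInt f 1 2 <= RInt f (d / 2) (N + 2)).
  { rewrite <- (RInt_Chasles f (d / 2) 1 (N + 2)) by (apply Hex; lra).
    rewrite <- (RInt_Chasles f 1 2 (N + 2)) by (apply Hex; lra).
    assert (g1 : 0 <= RInt f (d / 2) 1).
    { apply RInt_ge_0; [lra|apply Hex; lra|intros; left; apply fpos]. }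
    assert (g2 : 0 <= RInt f 2 (N + 2)).
    { apply RInt_ge_0; [lra|apply Hex; lra|intros; left; apply fpos]. }
    change (RInt f 1 2 <= RInt f (d / 2) 1 + (RInt f 1 2 + RInt f 2 (N + 2))). lra. }
  change (Rabs (RInt f (d / 2) (N + 2) - l) <= RInt f 1 2 / 2) in HdN.
  apply Rabs_le_between in HdN. lra.
Qed.

Lemma rpow_continuous m (x : R) : 0 < m -> continuous (fun t => rpow t m) x.
Proof.
  intros Hm. destruct (Rtotal_order x 0) as [h|[h|h]].
  - apply (continuous_ext_loc _ (fun _ => 0)); [|apply continuous_const].
    exists (mkposreal (- x) ltac:(lra)). intros y Hy. change (Rabs (y - x) < - x) in Hy.
    symmetry. apply rpow_nonpos. apply Rabs_lt_between in Hy. lra.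
  - subst x. apply (continuous_norm_eps (V := R_NormedModule)). intros eps Heps.
    destruct (rpow_small m (eps / 2) Hm) as [d [Hd H]]; [lra|].
    exists d. split; [easy|]. intros y Hy. rewrite Rminus_0_r in Hy.
    change (Rabs (rpow y m - rpow 0 m) < eps).
    rewrite (rpow_nonpos 0) by lra. rewrite Rminus_0_r, Rabs_right.
    + apply Rle_lt_trans with (eps / 2); [|lra]. apply H. apply Rabs_lt_between in Hy. lra.
    + apply Rle_ge, rpow_nonneg.
  - apply (continuous_ext_loc _ (fun t => Rpower t m)); [|now apply Rpower_continuous].
    exists (mkposreal x h). intros y Hy. change (Rabs (y - x) < x) in Hy.
    symmetry. apply rpow_Rpower. apply Rabs_lt_between in Hy. lra.
Qed.

(** * The derivative of the semigroup and the integrals of its fractional powers *)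

Section Semigroup.

Context {B : CompleteNormedModule R_AbsRing}.
Variables (S : R -> B -> B) (M lam : R).
Hypotheses (HC0 : C0_semigroup S) (HM : 0 < M) (Hlam : 0 < lam).
Hypothesis Hdecay : forall t, 0 <= t -> op_le (S t) (M * exp (- lam * t)).

Lemma S_linear t : 0 <= t -> is_linear (S t).
Proof. apply HC0. Qed.

Lemma S_0 x : S 0 x = x.
Proof. apply HC0. Qed.

Lemma S_plus t s x : 0 <= t -> 0 <= s -> S (t + s) x = S t (S s x).
Proof. apply HC0. Qed.

Lemma S_comm t s x : 0 <= t -> 0 <= s -> S t (S s x) = S s (S t x).
Proof. intros. rewrite <- !S_plus by easy. now rewrite Rplus_comm. Qed.

Lemma exp_le_1 t : 0 <= t -> exp (- lam * t) <= 1.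
Proof.
  intros Ht. rewrite <- exp_0. destruct (Rle_lt_or_eq_dec (- lam * t) 0) as [h|h]; [nra| |].
  - left. now apply exp_increasing.
  - rewrite h. apply Rle_refl.
Qed.

Lemma S_bound t x : 0 <= t -> norm (S t x) <= M * norm x.
Proof.
  intros Ht. apply Rle_trans with (1 := Hdecay Ht x).
  apply Rmult_le_compat_r; [apply (@norm_ge_0 R_AbsRing B)|].
  rewrite <- (Rmult_1_r M) at 2. apply Rmult_le_compat_l; [lra|]. now apply exp_le_1.
Qed.

Lemma inv_exp_bound u : 0 < u -> exp (- lam * u) <= / (lam * u).
Proof.
  intros Hu. assert (hp : 0 < lam * u) by now apply Rmult_lt_0_compat.
  replace (- lam * u) with (- (lam * u)) by ring. rewrite exp_Ropp.
  apply Rinv_le_contravar; [easy|]. generalize (exp_ineq1_le (lam * u)). lra.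
Qed.

Definition semigroup_derivative (D : R -> B -> B) (C : R) : Prop :=
  0 < C /\ forall t, 0 < t -> is_linear (D t) /\
    (forall x, is_derive (fun s => S s x) t (D t x)) /\
    forall x, norm (D t x) <= C / t * norm x.

(** For t >= d0 write S_t = S_u S_s with s = d0 / 2. Then u >= t / 2, and exp (- lam u) <= 1 / (lam
    u) restores the factor 1 / t that the fixed derivative at s does not provide. *)
Lemma semigroup_derivative_exists :
  (exists d0 C, 0 < d0 /\ 0 < C /\ forall t, 0 < t -> t < d0 -> exists D : B -> B,
     is_linear D /\ (forall x, is_derive (fun s => S s x) t (D x)) /\
     forall x, norm (D x) <= C / t * norm x) ->
  exists D C, semigroup_derivative D C.
Proof.
  intros [d0 [C [Hd0 [HC H]]]].
  set (s := d0 / 2). set (C2 := M * (C / s) * (2 / lam)).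
  assert (Hs : 0 < s) by (unfold s; lra).
  assert (Hcs : 0 < C / s) by now apply Rdiv_lt_0_compat.
  assert (HC2 : 0 < C2).
  { unfold C2. apply Rmult_lt_0_compat; [now apply Rmult_lt_0_compat|apply Rdiv_lt_0_compat; lra]. }
  assert (main : forall t, exists D : B -> B, 0 < t -> is_linear D /\
     (forall x, is_derive (fun s => S s x) t (D x)) /\
     forall x, norm (D x) <= (C + C2) / t * norm x).
  { intros t. destruct (Rle_lt_dec t 0) as [Ht|Ht]; [exists (S 0); lra|].
    destruct (Rlt_le_dec t d0) as [h|h].
    - destruct (H t Ht h) as [D [H1 [H2 H3]]]. exists D. intros _. split; [easy|]. split; [easy|].
      intros x. apply Rle_trans with (1 := H3 x).
      apply Rmult_le_compat_r; [apply (@norm_ge_0 R_AbsRing B)|].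
      apply Rmult_le_compat_r; [left; now apply Rinv_0_lt_compat|lra].
    - destruct (H s Hs ltac:(unfold s; lra)) as [D [H1 [H2 H3]]].
      set (u := t - s). assert (Hu : 0 < u) by (unfold u, s; lra).
      exists (fun x => S u (D x)). intros _.
      split; [exact (is_linear_comp D (S u) H1 (S_linear (Rlt_le _ _ Hu)))|]. split.
      + intros x. apply (is_derive_ext_loc (fun r => S u (S (r - u) x))).
        * exists (mkposreal s Hs). intros y Hy. change (Rabs (y - t) < s) in Hy.
          apply Rabs_lt_between in Hy.
          rewrite <- S_plus by (unfold u in *; lra). f_equal. ring.
        * apply (is_derive_linear (S_linear (Rlt_le _ _ Hu))).
          assert (e : t - u = s) by (unfold u; ring).
          apply (is_derive_eq (l := scal 1 (D x))); [|apply (@scal_one R_AbsRing B)].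
          apply (is_derive_comp (fun r => S r x) (fun r => r - u)).
          { rewrite e. apply H2. }
          { auto_derive; [easy|ring]. }
      + intros x. apply Rle_trans with (1 := Hdecay (Rlt_le _ _ Hu) (D x)).
        apply Rle_trans with (M * (/ (lam * u)) * (C / s * norm x)).
        * apply Rmult_le_compat; [|apply (@norm_ge_0 R_AbsRing B)| |apply H3].
          { apply Rmult_le_pos; [lra|left; apply exp_pos]. }
          { apply Rmult_le_compat_l; [lra|]. now apply inv_exp_bound. }
        * rewrite <- Rmult_assoc. apply Rmult_le_compat_r; [apply (@norm_ge_0 R_AbsRing B)|].
          apply Rle_trans with (C2 / t).
          { unfold C2. replace (M * / (lam * u) * (C / s)) with (M * (C / s) / lam * / u) by (field; lra).
            replace (M * (C / s) * (2 / lam) / t) with (M * (C / s) / lam * (2 / t)) by (field; lra).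
            apply Rmult_le_compat_l.
            - left. apply Rdiv_lt_0_compat; [now apply Rmult_lt_0_compat|easy].
            - replace (2 / t) with (/ (t / 2)) by (field; lra).
              apply Rinv_le_contravar; unfold u, s in *; lra. }
          { apply Rmult_le_compat_r; [left; now apply Rinv_0_lt_compat|lra]. } }
  destruct (functional_choice _ main) as [D HD]. exists D, (C + C2). split; [lra|exact HD].
Qed.

Variables (D : R -> B -> B) (CD : R).
Hypothesis HD : semigroup_derivative D CD.

Lemma D_linear t : 0 < t -> is_linear (D t).
Proof. apply HD. Qed.

Lemma D_derive t x : 0 < t -> is_derive (fun s => S s x) t (D t x).
Proof. intros. now apply HD. Qed.

Lemma D_bound t x : 0 < t -> norm (D t x) <= CD / t * norm x.
Proof. intros. now apply HD. Qed.

Lemma S_cont_pos x : cont_pos (fun t => S t x).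
Proof.
  intros t Ht. apply (ex_derive_continuous (V := B)). exists (D t x). now apply D_derive.
Qed.

Lemma is_derive_shift {V : NormedModule R_AbsRing} (f : R -> V) r t l :
  is_derive f (r + t) l -> is_derive (fun s => f (r + s)) t l.
Proof.
  intros H. apply (is_derive_eq (l := scal 1 l)); [|apply (@scal_one R_AbsRing V)].
  apply (is_derive_comp f (fun s => r + s)); [exact H|]. auto_derive; [easy|ring].
Qed.

Lemma D_S r t x : 0 <= r -> 0 < t -> D (r + t) x = S r (D t x).
Proof.
  intros Hr Ht. apply (@is_derive_unique_vec B (fun s => S (r + s) x) t).
  - apply (is_derive_shift (f := fun s => S s x)). apply D_derive. lra.
  - apply (is_derive_ext_loc (fun s => S r (S s x))).
    + exists (mkposreal t Ht). intros y Hy. change (Rabs (y - t) < t) in Hy.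
      apply Rabs_lt_between in Hy. rewrite S_plus; [easy|lra|lra].
    + apply (is_derive_linear (S_linear Hr)). now apply D_derive.
Qed.

Lemma S_D r t x : 0 <= r -> 0 < t -> S r (D t x) = D t (S r x).
Proof.
  intros Hr Ht. apply (@is_derive_unique_vec B (fun s => S r (S s x)) t).
  - apply (is_derive_linear (S_linear Hr)). now apply D_derive.
  - apply (is_derive_ext_loc (fun s => S s (S r x))); [|now apply D_derive].
    exists (mkposreal t Ht). intros y Hy. change (Rabs (y - t) < t) in Hy.
    apply Rabs_lt_between in Hy. apply S_comm; lra.
Qed.

(* x = Gamma(b) A_o^{-b} z *)
Definition Ipow (b : R) (z x : B) : Prop := IG (fun t => scal (Rpower t (b - 1)) (S t z)) x.

Definition Icst (b : R) : R := M * (/ b + tail_cst b lam).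

Lemma weighted_cont_pos b (f : R -> B) : cont_pos f -> cont_pos (fun t => scal (Rpower t b) (f t)).
Proof.
  intros Hf t Ht. apply (@continuous_scal _ _ B); [now apply Rpower_continuous|now apply Hf].
Qed.

Lemma Ipow_exists b z : 0 < b -> exists x, Ipow b z x /\ norm x <= Icst b * norm z.
Proof.
  intros Hb.
  destruct (IG_exists Hb Hlam (phi := fun t => S t z) (K := M * norm z)) as [x [H1 H2]].
  - apply S_cont_pos.
  - apply Rmult_le_pos; [lra|apply (@norm_ge_0 R_AbsRing B)].
  - intros t Ht. eapply Rle_trans; [apply Hdecay; lra|]. right. ring.
  - exists x. split; [exact H1|]. apply Rle_trans with (1 := H2). unfold Icst. right. ring.
Qed.

Lemma Ipow_unique b z x y : Ipow b z x -> Ipow b z y -> x = y.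
Proof. apply IG_unique. Qed.

Lemma Ipow_bound b z x : 0 < b -> Ipow b z x -> norm x <= Icst b * norm z.
Proof.
  intros Hb H. destruct (Ipow_exists z Hb) as [y [Hy Hn]]. now rewrite (Ipow_unique H Hy).
Qed.

Lemma Ipow_commute (L : B -> B) b z x : is_linear L ->
  (forall t, 0 < t -> L (S t z) = S t (L z)) -> Ipow b z x -> Ipow b (L z) (L x).
Proof.
  intros HL Hc H. assert (g := IG_linear HL (weighted_cont_pos (b := b - 1) (S_cont_pos (x := z))) H).
  revert g. apply IG_ext. intros t Ht. rewrite <- Hc by easy. apply (linear_scal L HL).
Qed.

Lemma Ipow_S b z x r : 0 <= r -> Ipow b z x -> Ipow b (S r z) (S r x).
Proof. intros Hr. apply Ipow_commute; [now apply S_linear|]. intros. apply S_comm; lra. Qed.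

Lemma Ipow_D b z x r : 0 < r -> Ipow b z x -> Ipow b (D r z) (D r x).
Proof. intros Hr. apply Ipow_commute; [now apply D_linear|]. intros. rewrite S_D; [easy|lra|lra]. Qed.

Lemma Ipow_plus b z w x y : Ipow b z x -> Ipow b w y -> Ipow b (plus z w) (plus x y).
Proof.
  intros Hx Hy. assert (g := IG_plus (weighted_cont_pos (b := b - 1) (S_cont_pos (x := z)))
    (weighted_cont_pos (b := b - 1) (S_cont_pos (x := w))) Hx Hy).
  revert g. apply IG_ext. intros t Ht.
  assert (e := linear_plus _ (S_linear (Rlt_le _ _ Ht)) z w).
  transitivity (scal (Rpower t (b - 1)) (plus (S t z) (S t w))); [|now f_equal].
  symmetry. apply (@scal_distr_l R_AbsRing B).
Qed.

Lemma Ipow_scal b k z x : Ipow b z x -> Ipow b (scal k z) (scal k x).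
Proof.
  apply (Ipow_commute (L := fun y => scal k y)).
  - exact (is_linear_scal_r (V := B) k Rmult_comm).
  - intros t Ht. symmetry. exact (linear_scal (S t) (S_linear (Rlt_le _ _ Ht)) k z).
Qed.

Lemma weight_small b K eps : 0 < b -> 0 <= K -> 0 < eps ->
  exists d, 0 < d /\ forall t, 0 < t < d -> K * Rpower t b <= eps.
Proof.
  intros Hb HK Heps.
  destruct (rpow_small b (eps / (K + 1)) Hb) as [d [Hd H]]; [apply Rdiv_lt_0_compat; lra|].
  exists d. split; [easy|]. intros t Ht. specialize (H t ltac:(lra)). rewrite rpow_Rpower in H by lra.
  apply Rle_trans with ((K + 1) * (eps / (K + 1))); [|right; field; lra].
  apply Rmult_le_compat; [easy|left; apply exp_pos|lra|easy].
Qed.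

Lemma weight_decay b l0 K eps : 0 < l0 -> 0 <= K -> 0 < eps ->
  exists N, 1 <= N /\ forall t, N < t -> K * (Rpower t b * exp (- l0 * t)) <= eps.
Proof.
  intros Hl HK Heps. set (c := decay_cst (b + 1) l0).
  assert (Hc : 0 < c) by apply exp_pos.
  exists (Rmax 1 (2 / l0 * ((K + 1) * c / eps))). split; [apply Rmax_l|]. intros t Ht.
  assert (h1 := Rle_lt_trans _ _ _ (Rmax_l _ _) Ht).
  assert (h2 := Rle_lt_trans _ _ _ (Rmax_r _ _) Ht).
  assert (g := Rpower_decay (b + 1) Hl (t := t) ltac:(lra)).
  replace (b + 1 - 1) with b in g by ring. fold c in g.
  assert (hp : 0 < l0 / 2 * t) by nra.
  assert (he : exp (- (l0 / 2) * t) <= / (l0 / 2 * t)).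
  { replace (- (l0 / 2) * t) with (- (l0 / 2 * t)) by ring. rewrite exp_Ropp.
    apply Rinv_le_contravar; [easy|]. generalize (exp_ineq1_le (l0 / 2 * t)). lra. }
  assert (hq : 0 < (K + 1) * c / eps) by (apply Rdiv_lt_0_compat; [nra|easy]).
  assert (hN : (K + 1) * c / eps <= l0 / 2 * t).
  { apply Rle_trans with (l0 / 2 * (2 / l0 * ((K + 1) * c / eps))); [right; field; lra|].
    apply Rmult_le_compat_l; lra. }
  assert (hi : / (l0 / 2 * t) <= eps / ((K + 1) * c)).
  { replace (eps / ((K + 1) * c)) with (/ ((K + 1) * c / eps)) by (field; repeat split; lra).
    now apply Rinv_le_contravar. }
  apply Rle_trans with ((K + 1) * (c * (eps / ((K + 1) * c)))).
  - apply Rmult_le_compat; [easy| |lra|].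
    + apply Rmult_le_pos; left; apply exp_pos.
    + apply Rle_trans with (1 := g). apply Rmult_le_compat_l; lra.
  - right. field. split; lra.
Qed.

Lemma scal_linear_value (L : B -> B) k x : is_linear L -> L (scal k x) = scal k (L x).
Proof. intros HL. exact (linear_scal L HL k x). Qed.

(* Integration by parts in Gamma(b+1) A_o^{-(b+1)}: apply d/dr S_r under the integral sign and
   use D_r S_t = d/dt S_{r+t}. *)
Lemma Ipow_by_parts b r z x y : 0 < b -> 0 < r -> Ipow b z x -> Ipow (b + 1) z y ->
  D r y = scal (- b) (S r x).
Proof.
  intros Hb Hr Hx Hy.
  assert (HDy := Ipow_D Hr Hy). assert (HSx := Ipow_scal b (Ipow_S (Rlt_le _ _ Hr) Hx)).
  assert (g := IG_plus (weighted_cont_pos (b := b + 1 - 1) (S_cont_pos (x := D r z)))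
     (weighted_cont_pos (b := b - 1) (S_cont_pos (x := scal b (S r z)))) HDy HSx).
  assert (g0 : IG (fun t => plus (scal (Rpower t (b + 1 - 1)) (S t (D r z)))
      (scal (Rpower t (b - 1)) (S t (scal b (S r z))))) (opp zero)).
  { apply (IG_derive (G := fun t => scal (Rpower t b) (S (r + t) z))).
    - intros t Ht. refine (is_derive_eq (is_derive_scal_fct (Rpower_derive b Ht) (is_derive_shift
        (f := fun s => S s z) (D_derive (t := r + t) z _))) _); [lra|].
      replace (b + 1 - 1) with b by ring.
      replace (D (r + t) z) with (S t (D r z)) by (rewrite (Rplus_comm r t), D_S; [easy|lra|easy]).
      replace (S (r + t) z) with (S t (S r z)) by (rewrite S_comm, S_plus; [easy|lra..]).
      rewrite (scal_linear_value b _ (S_linear (Rlt_le _ _ Ht))).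
      change (scal (b * Rpower t (b - 1)) (S t (S r z))) with
        (scal (mult b (Rpower t (b - 1))) (S t (S r z))).
      module_eq_in B. change (mult b (Rpower t (b - 1))) with (b * Rpower t (b - 1)). ring.
    - intros t Ht. apply (continuous_plus (V := B)).
      + exact (weighted_cont_pos (b := b + 1 - 1) (S_cont_pos (x := D r z)) Ht).
      + exact (weighted_cont_pos (b := b - 1) (S_cont_pos (x := scal b (S r z))) Ht).
    - intros eps Heps. destruct (@weight_small b (M * norm z) eps) as [d [Hd H]]; [easy| |easy|].
      { apply Rmult_le_pos; [lra|apply (@norm_ge_0 R_AbsRing B)]. }
      exists d. split; [easy|]. intros t Ht. apply Rle_trans with (2 := H t Ht).
      match goal with |- norm ?v <= _ => replace v with (scal (Rpower t b) (S (r + t) z)) by module_eq_in B end.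
      rewrite (norm_scal_R (V := B)), Rabs_right by (left; apply exp_pos). rewrite Rmult_comm.
      apply Rmult_le_compat_r; [left; apply exp_pos|]. apply S_bound. lra.
    - intros eps Heps. destruct (@weight_decay b lam (M * norm z) eps) as [N [HN H]]; [easy| |easy|].
      { apply Rmult_le_pos; [lra|apply (@norm_ge_0 R_AbsRing B)]. }
      exists N. intros t Ht. apply Rle_trans with (2 := H t Ht).
      rewrite (norm_scal_R (V := B)), Rabs_right by (left; apply exp_pos).
      replace (M * norm z * (Rpower t b * exp (- lam * t))) with
        (Rpower t b * (M * exp (- lam * t) * norm z)) by ring.
      apply Rmult_le_compat_l; [left; apply exp_pos|].
      apply Rle_trans with (1 := Hdecay (t := r + t) ltac:(lra) z).
      apply Rmult_le_compat_r; [apply (@norm_ge_0 R_AbsRing B)|].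
      apply Rmult_le_compat_l; [lra|]. left. apply exp_increasing. nra. }
  assert (h : plus (D r y) (scal b (S r x)) = opp zero) by exact (IG_unique g g0).
  transitivity (minus (plus (D r y) (scal b (S r x))) (scal b (S r x))); [module_eq_in B|].
  transitivity (minus (opp zero) (scal b (S r x))); [now f_equal|module_eq_in B].
Qed.

Lemma S_continuous_0 z eps : 0 < eps ->
  exists d, 0 < d /\ forall t, 0 < t < d -> norm (minus (S t z) z) <= eps.
Proof.
  intros Heps. destruct HC0 as [_ [_ [_ H]]].
  destruct (H z (fun v => norm (minus v z) < eps)) as [d Hd].
  { exact (@locally_ball_norm R_AbsRing B z (mkposreal eps Heps)). }
  exists d. split; [apply cond_pos|]. intros t Ht. left. apply Hd; [|lra].
  change (Rabs (t - 0) < d). rewrite Rminus_0_r, Rabs_right; lra.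
Qed.

(** The limiting case b = 0 of [Ipow_by_parts]: the integrand is the exact derivative of S_{r+t} z,
    and the boundary term at t = 0 takes the place of the missing I_0. *)
Lemma Ipow_1_derivative r z y : 0 < r -> Ipow 1 z y -> D r y = opp (S r z).
Proof.
  intros Hr Hy.
  apply (IG_unique (Ipow_D Hr Hy)).
  apply (IG_derive (G := fun t => S (r + t) z)).
  - intros t Ht. refine (is_derive_eq (is_derive_shift (f := fun s => S s z) (D_derive (t := r + t) z _)) _);
      [lra|].
    rewrite (Rplus_comm r t), D_S by lra. replace (1 - 1) with 0 by ring.
    rewrite Rpower_O by easy. symmetry. apply (@scal_one R_AbsRing B).
  - apply weighted_cont_pos. apply S_cont_pos.
  - intros eps Heps. destruct (S_continuous_0 (S r z) Heps) as [d [Hd H]].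
    exists d. split; [easy|]. intros t Ht. rewrite (Rplus_comm r t), S_plus by lra. now apply H.
  - intros eps Heps. destruct (@weight_decay 0 lam (M * norm z) eps) as [N [HN H]]; [easy| |easy|].
    { apply Rmult_le_pos; [lra|apply (@norm_ge_0 R_AbsRing B)]. }
    exists N. intros t Ht. apply Rle_trans with (2 := H t Ht).
    rewrite Rpower_O by lra. rewrite Rmult_1_l.
    apply Rle_trans with (1 := Hdecay (t := r + t) ltac:(lra) z).
    replace (M * norm z * exp (- lam * t)) with (M * exp (- lam * t) * norm z) by ring.
    apply Rmult_le_compat_r; [apply (@norm_ge_0 R_AbsRing B)|].
    apply Rmult_le_compat_l; [lra|]. left. apply exp_increasing. nra.
Qed.

(** With A the generator, D_r = A S_r, so this is A^k S_{kr}. *)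
Definition iterD (r : R) (k : nat) (x : B) : B := Nat.iter k (D r) x.

Lemma iterD_linear r k : 0 < r -> is_linear (iterD r k).
Proof.
  intros Hr. induction k as [|k IH].
  - apply (is_linear_ext (fun x : B => x)); [easy|apply is_linear_id].
  - exact (is_linear_comp (iterD r k) (D r) IH (D_linear Hr)).
Qed.

Lemma iterD_S r k t x : 0 < r -> 0 <= t -> iterD r k (S t x) = S t (iterD r k x).
Proof.
  intros Hr Ht. induction k as [|k IH]; [easy|].
  change (D r (iterD r k (S t x)) = S t (D r (iterD r k x))). rewrite IH. symmetry. now apply S_D.
Qed.

Lemma iterD_succ r k x : iterD r (Datatypes.S k) x = iterD r k (D r x).
Proof. apply Nat.iter_succ_r. Qed.

Lemma Ipow_iterD b z x r k : 0 < r -> Ipow b z x -> Ipow b (iterD r k z) (iterD r k x).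
Proof. intros Hr H. induction k as [|k IH]; [easy|]. now apply Ipow_D. Qed.

(** Each D_r lowers the exponent by one through [Ipow_by_parts] and leaves a factor S_r; the last
    one is removed by [Ipow_1_derivative]. The constant is (-1)^(k+1) k!. *)
Lemma iterD_Ipow_nat k : exists c, c <> 0 /\ forall r z y, 0 < r ->
  Ipow (INR (Datatypes.S k)) z y -> iterD r (Datatypes.S k) y = scal c (S (INR (Datatypes.S k) * r) z).
Proof.
  induction k as [|k [c [Hc IH]]].
  - exists (-1). split; [lra|]. intros r z y Hr Hy. change (INR 1) with 1 in *.
    change (D r y = scal (-1) (S (1 * r) z)). rewrite (Ipow_1_derivative Hr Hy), Rmult_1_l.
    module_eq_in B.
  - exists (- INR (Datatypes.S k) * c). assert (hk : 0 < INR (Datatypes.S k)) by (apply lt_0_INR; lia).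
    split; [apply Rmult_integral_contrapositive; split; lra|]. intros r z y Hr Hy.
    rewrite iterD_succ. rewrite (S_INR (Datatypes.S k)) in Hy |- *.
    destruct (Ipow_exists z hk) as [x [Hx _]].
    rewrite (Ipow_by_parts hk Hr Hx Hy).
    rewrite (scal_linear_value _ _ (iterD_linear _ Hr)), iterD_S by lra.
    rewrite (IH r z x Hr Hx).
    rewrite (scal_linear_value _ _ (S_linear (Rlt_le _ _ Hr))).
    rewrite <- S_plus by (try apply Rmult_le_pos; lra).
    replace (r + INR (Datatypes.S k) * r) with ((INR (Datatypes.S k) + 1) * r) by ring.
    apply (@scal_assoc R_AbsRing B).
Qed.

End Semigroup.

(** * The Beta function and the composition of fractional integrals *)

Definition beta_weight (p q v : R) : R := rpow v (p - 1) * rpow (1 - v) (q - 1).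

Definition Beta (p q : R) : R := RInt (beta_weight p q) 0 1.

Lemma rpow_sub_continuous m c x : 0 < m -> continuous (fun t => rpow (c - t) m) x.
Proof.
  intros Hm. apply (continuous_comp (fun t => c - t) (fun t => rpow t m)).
  - apply (ex_derive_continuous (V := R_NormedModule)). auto_derive. easy.
  - now apply rpow_continuous.
Qed.

(** For exponents above 1 the extension of the powers by zero is continuous on the whole line, so
    the integrals of this part are proper; hence the conditions p, q > 1 throughout. *)
Lemma beta_weight_continuous p q v : 1 < p -> 1 < q -> continuous (beta_weight p q) v.
Proof.
  intros Hp Hq. apply (continuous_mult (K := R_AbsRing)).
  - apply rpow_continuous. lra.
  - apply rpow_sub_continuous. lra.
Qed.

Lemma Beta_pos p q : 1 < p -> 1 < q -> 0 < Beta p q.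
Proof.
  intros Hp Hq. apply RInt_gt_0; [lra| |].
  - intros v Hv. apply Rmult_lt_0_compat; apply rpow_pos; lra.
  - intros v _. now apply beta_weight_continuous.
Qed.

Lemma Beta_scaled p q s : 1 < p -> 1 < q -> 0 < s ->
  is_RInt (fun u => rpow u (p - 1) * rpow (s - u) (q - 1)) 0 s (Beta p q * rpow s (p + q - 1)).
Proof.
  intros Hp Hq Hs.
  assert (h : is_RInt (beta_weight p q) 0 1 (Beta p q)).
  { apply (RInt_correct (V := R_CompleteNormedModule)), ex_RInt_continuous. intros.
    now apply beta_weight_continuous. }
  assert (h2 : is_RInt (fun y => scal (/ s) (beta_weight p q (/ s * y + 0))) 0 s (Beta p q)).
  { apply (is_RInt_comp_lin (V := R_NormedModule)).
    replace (/ s * 0 + 0) with 0 by ring. replace (/ s * s + 0) with 1 by (field; lra). exact h. }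
  apply (is_RInt_scal (V := R_NormedModule) _ _ _ (rpow s (p + q - 1))) in h2.
  rewrite Rmult_comm. revert h2. apply is_RInt_ext. intros u _.
  change (rpow s (p + q - 1) * (/ s * (rpow (/ s * u + 0) (p - 1) * rpow (1 - (/ s * u + 0)) (q - 1)))
    = rpow u (p - 1) * rpow (s - u) (q - 1)).
  assert (hi : 0 < / s) by now apply Rinv_0_lt_compat.
  replace (/ s * u + 0) with (/ s * u) by ring.
  replace (1 - / s * u) with (/ s * (s - u)) by (field; lra).
  rewrite !rpow_mult by easy.
  assert (e : rpow s (p + q - 1) * / s * rpow (/ s) (p - 1) * rpow (/ s) (q - 1) = 1).
  { assert (g : forall m, rpow s m * rpow (/ s) m = 1).
    { intros m. rewrite <- rpow_mult, Rinv_r, rpow_Rpower by lra.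
      unfold Rpower. rewrite ln_1, Rmult_0_r. apply exp_0. }
    replace (p + q - 1) with (1 + (p - 1) + (q - 1)) by ring. rewrite !rpow_plus, rpow_1 by lra.
    transitivity ((s * / s) * (rpow s (p - 1) * rpow (/ s) (p - 1))
      * (rpow s (q - 1) * rpow (/ s) (q - 1))); [ring|]. rewrite !g, Rinv_r by lra. ring. }
  transitivity (rpow s (p + q - 1) * / s * rpow (/ s) (p - 1) * rpow (/ s) (q - 1)
    * (rpow u (p - 1) * rpow (s - u) (q - 1))); [ring|rewrite e; ring].
Qed.

Section Convolution.

Context {B : CompleteNormedModule R_AbsRing}.
Variables (S : R -> B -> B) (M lam : R).
Hypotheses (HC0 : C0_semigroup S) (HM : 0 < M) (Hlam : 0 < lam).
Hypothesis Hdecay : forall t, 0 <= t -> op_le (S t) (M * exp (- lam * t)).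
Hypothesis Hcont : forall x, cont_pos (fun t => S t x).

(** Constant for negative times, hence continuous on R, which allows Fubini on a rectangle enlarged
    past 0. *)
Definition S_ext (z : B) (s : R) : B := S (Rmax s 0) z.

Lemma S_ext_eq z s : 0 <= s -> S_ext z s = S s z.
Proof. intros Hs. unfold S_ext. now rewrite Rmax_left. Qed.

Lemma S_ext_continuous z s : continuous (S_ext z) s.
Proof.
  destruct (Rtotal_order s 0) as [h|[h|h]].
  - apply (continuous_ext_loc _ (fun _ => S 0 z)); [|apply continuous_const].
    exists (mkposreal (- s) ltac:(lra)). intros y Hy. change (Rabs (y - s) < - s) in Hy.
    unfold S_ext. rewrite Rmax_right; [easy|]. apply Rabs_lt_between in Hy. lra.
  - subst s. apply (continuous_norm_eps (V := B)). intros eps Heps.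
    destruct (S_continuous_0 HC0 z (eps := eps / 2)) as [d [Hd H]]; [lra|].
    exists d. split; [easy|]. intros y Hy. rewrite Rminus_0_r in Hy. apply Rabs_lt_between in Hy.
    unfold S_ext. rewrite (Rmax_left 0 0), (S_0 HC0) by lra.
    destruct (Rle_lt_dec y 0) as [hy|hy].
    + rewrite Rmax_right, (S_0 HC0) by easy.
      apply Rle_lt_trans with (@norm R_AbsRing B zero).
      { right. f_equal. module_eq_in B. }
      rewrite (@norm_zero R_AbsRing B). lra.
    + rewrite Rmax_left by lra. apply Rle_lt_trans with (eps / 2); [apply H; lra|lra].
  - apply (continuous_ext_loc _ (fun t => S t z)); [|now apply Hcont].
    exists (mkposreal s h). intros y Hy. change (Rabs (y - s) < s) in Hy.
    unfold S_ext. rewrite Rmax_left; [easy|]. apply Rabs_lt_between in Hy. lra.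
Qed.

Definition wS (q : R) (z : B) (t : R) : B := scal (rpow t (q - 1)) (S_ext z t).

Lemma wS_continuous q z t : 1 < q -> continuous (wS q z) t.
Proof.
  intros Hq. apply (@continuous_scal _ _ B); [apply rpow_continuous; lra|apply S_ext_continuous].
Qed.

Lemma wS_is_RInt q z a b : 1 < q -> is_RInt (wS q z) a b (RInt (wS q z) a b).
Proof. intros Hq. apply RInt_correct, ex_RInt_continuous. intros. now apply wS_continuous. Qed.

Lemma Ipow_wS q z x : Ipow S q z x -> IG (wS q z) x.
Proof.
  apply IG_ext. intros t Ht. unfold wS. now rewrite S_ext_eq, rpow_Rpower by lra.
Qed.

Definition wcst (q : R) : R := M * (1 + decay_cst q lam).

Lemma wcst_pos q : 0 < wcst q.
Proof. apply Rmult_lt_0_compat; [easy|]. assert (0 < decay_cst q lam) by apply exp_pos. lra. Qed.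

Lemma wS_bound q z t : 1 < q -> 0 <= t -> norm (wS q z t) <= wcst q * norm z * exp (- (lam / 2) * t).
Proof.
  intros Hq Ht. unfold wS. rewrite (norm_scal_R (V := B)), Rabs_right by (apply Rle_ge, rpow_nonneg).
  rewrite S_ext_eq by easy.
  assert (hd : 0 < decay_cst q lam) by apply exp_pos.
  assert (he : 0 < exp (- (lam / 2) * t)) by apply exp_pos.
  assert (key : rpow t (q - 1) * exp (- lam * t) <= (1 + decay_cst q lam) * exp (- (lam / 2) * t)).
  { destruct (Rle_lt_dec t 1) as [h|h].
    - apply Rle_trans with (1 * exp (- (lam / 2) * t)); [|apply Rmult_le_compat_r; lra].
      apply Rmult_le_compat; [apply rpow_nonneg|left; apply exp_pos|apply rpow_le_1; lra|].
      destruct (Rle_lt_or_eq_dec (- lam * t) (- (lam / 2) * t)) as [g|g]; [nra| |rewrite g; lra].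
      left. now apply exp_increasing.
    - rewrite rpow_Rpower by lra.
      apply Rle_trans with (1 := Rpower_decay q Hlam (t := t) ltac:(lra)).
      apply Rmult_le_compat_r; lra. }
  apply Rle_trans with (rpow t (q - 1) * (M * exp (- lam * t) * norm z)).
  - apply Rmult_le_compat_l; [apply rpow_nonneg|]. now apply Hdecay.
  - apply Rle_trans with (M * norm z * (rpow t (q - 1) * exp (- lam * t))); [right; ring|].
    apply Rle_trans with (M * norm z * ((1 + decay_cst q lam) * exp (- (lam / 2) * t)));
      [|right; unfold wcst; ring].
    apply Rmult_le_compat_l; [|exact key].
    apply Rmult_le_pos; [lra|apply (@norm_ge_0 R_AbsRing B)].
Qed.

Lemma wS_tail q z x c : 1 < q -> 0 <= c -> Ipow S q z x ->
  norm (minus x (RInt (wS q z) 0 c)) <= wcst q * (2 / lam) * norm z * exp (- (lam / 2) * c).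
Proof.
  intros Hq Hc Hx. apply le_epsilon. intros eps Heps.
  destruct (IG_proper (fun t => wS_continuous (z := z) (t := t) Hq) (Ipow_wS Hx) Heps) as [N [HN H]].
  set (c' := Rmax N c + 1). assert (m1 := Rmax_l N c). assert (m2 := Rmax_r N c).
  specialize (H c' ltac:(unfold c'; lra)).
  match goal with |- norm ?v <= _ => replace v with
    (minus (RInt (wS q z) c c') (minus (RInt (wS q z) 0 c') x)) end.
  - eapply Rle_trans; [apply (@norm_minus_le B)|]. apply Rplus_le_compat; [|exact H].
    set (G := fun t => - (wcst q * (2 / lam) * norm z * exp (- (lam / 2) * t))).
    apply Rle_trans with (G c' - G c).
    + apply (norm_RInt_antiderivative (m := fun t => wcst q * norm z * exp (- (lam / 2) * t))).
      * unfold c'; lra.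
      * intros t _. now apply wS_continuous.
      * intros t _. apply (ex_derive_continuous (V := R_NormedModule)). auto_derive. easy.
      * intros t Ht. apply wS_bound; lra.
      * intros t _. unfold G. auto_derive; [easy|]. field. lra.
    + unfold G. assert (0 <= wcst q * (2 / lam) * norm z * exp (- (lam / 2) * c')); [|lra].
      apply Rmult_le_pos; [|left; apply exp_pos].
      apply Rmult_le_pos; [|apply (@norm_ge_0 R_AbsRing B)].
      left. apply Rmult_lt_0_compat; [apply wcst_pos|apply Rdiv_lt_0_compat; lra].
  - replace (RInt (wS q z) 0 c') with (plus (RInt (wS q z) 0 c) (RInt (wS q z) c c')).
    + module_eq_in B.
    + apply (RInt_Chasles (wS q z)); eexists; now apply wS_is_RInt.
Qed.

Variables (p q : R).
Hypotheses (Hp : 1 < p) (Hq : 1 < q).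

(** The integrand of I_p I_q z in the variables u and s = u + t. [rpow (s - u)] vanishes for s <= u,
    so the triangle u <= s is integrated as a square. *)
Definition kernel (z : B) (u s : R) : B :=
  scal (rpow u (p - 1) * rpow (s - u) (q - 1)) (S_ext z s).

Lemma kernel_continuous z u s : continuous (fun x => kernel z (fst x) (snd x)) (u, s).
Proof.
  apply (@continuous_scal _ _ B).
  - apply (continuous_mult (K := R_AbsRing)).
    + apply (continuous_comp fst (fun t => rpow t (p - 1))); [apply continuous_fst|].
      apply rpow_continuous. lra.
    + apply (continuous_comp (fun x : R * R => snd x - fst x) (fun t => rpow t (q - 1))).
      * apply (continuous_minus (V := R_NormedModule)); [apply continuous_snd|apply continuous_fst].
      * apply rpow_continuous. lra.
  - apply (continuous_comp snd (S_ext z)); [apply continuous_snd|apply S_ext_continuous].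
Qed.

Lemma is_RInt_zero_ext {V : NormedModule R_AbsRing} (f : R -> V) a b : a <= b ->
  (forall t, a < t < b -> f t = zero) -> is_RInt f a b zero.
Proof.
  intros Hab H. apply (is_RInt_ext (fun _ => zero)).
  - intros t. rewrite Rmin_left, Rmax_right by easy. intros Ht. now rewrite H.
  - apply (is_RInt_eq (is_RInt_const a b (@zero V))). module_eq_in V.
Qed.

Lemma kernel_snd z u N : 0 <= u <= N ->
  is_RInt (kernel z u) 0 N (scal (rpow u (p - 1)) (S u (RInt (wS q z) 0 (N - u)))).
Proof.
  intros Hu.
  set (l := scal (rpow u (p - 1)) (S u (RInt (wS q z) 0 (N - u)))).
  apply (is_RInt_eq (l := plus zero l)); [|apply (@plus_zero_l B)].
  apply (is_RInt_Chasles (V := B) _ 0 u N).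
  - apply (is_RInt_zero_ext (V := B)); [easy|]. intros t Ht. unfold kernel.
    rewrite (rpow_nonpos (t - u)), Rmult_0_r by lra. apply (@scal_zero_l R_AbsRing B).
  - set (g := fun t => scal (rpow u (p - 1)) (S u (wS q z t))).
    assert (h : is_RInt g 0 (N - u) l).
    { apply (is_RInt_scal (V := B)). apply is_RInt_linear; [now apply (S_linear HC0)|].
      now apply wS_is_RInt. }
    assert (h2 : is_RInt (fun y => scal 1 (g (1 * y + - u))) u N l).
    { apply (is_RInt_comp_lin (V := B)). replace (1 * u + - u) with 0 by ring.
      now replace (1 * N + - u) with (N - u) by ring. }
    revert h2. apply is_RInt_ext. intros s. rewrite Rmin_left, Rmax_right by easy. intros Hs.
    replace (1 * s + - u) with (s - u) by ring. unfold g, wS, kernel.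
    rewrite (scal_linear_value _ _ (S_linear HC0 (proj1 Hu))), !S_ext_eq by lra.
    rewrite <- (S_plus HC0) by lra. replace (u + (s - u)) with s by ring.
    module_eq_in B.
Qed.

Lemma kernel_fst z s N : 0 < s <= N ->
  is_RInt (fun u => kernel z u s) 0 N (scal (Beta p q) (wS (p + q) z s)).
Proof.
  intros Hs. set (l := scal (Beta p q) (wS (p + q) z s)).
  apply (is_RInt_eq (l := plus l zero)); [|apply (@plus_zero_r B)].
  apply (is_RInt_Chasles (V := B) _ 0 s N).
  - apply (is_RInt_eq (l := scal (Beta p q * rpow s (p + q - 1)) (S_ext z s))).
    + apply (is_RInt_linear (V := R_NormedModule) (W := B) (L := fun k => scal k (S_ext z s))
        (f := fun u => rpow u (p - 1) * rpow (s - u) (q - 1))); [apply (is_linear_scal_l (V := B))|].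
      now apply Beta_scaled.
    + symmetry. apply (@scal_assoc R_AbsRing B).
  - apply (is_RInt_zero_ext (V := B)); [easy|]. intros t Ht. unfold kernel.
    rewrite (rpow_nonpos (s - t)), Rmult_0_r by lra. apply (@scal_zero_l R_AbsRing B).
Qed.

(** The semigroup law and Fubini on the triangle u + t <= N: for fixed s = u + t the scalar weights
    integrate to Beta s^(p+q-1). The identity is exact at every truncation N. *)
Lemma kernel_swap z N : 0 < N ->
  is_RInt (fun u => scal (rpow u (p - 1)) (S u (RInt (wS q z) 0 (N - u)))) 0 N
    (scal (Beta p q) (RInt (wS (p + q) z) 0 N)).
Proof.
  intros HN.
  assert (Hk : forall a b u s, a - 1 <= u <= b + 1 -> a - 1 <= s <= b + 1 ->
    continuous (fun x => kernel z (fst x) (snd x)) (u, s)) by (intros; apply kernel_continuous).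
  apply (is_RInt_ext (fun u => RInt (kernel z u) 0 N)).
  { intros u. rewrite Rmin_left, Rmax_right by lra. intros Hu. apply is_RInt_unique, kernel_snd. lra. }
  apply (is_RInt_eq (l := RInt (fun u => RInt (kernel z u) 0 N) 0 N)).
  { apply RInt_correct, ex_RInt_continuous. rewrite Rmin_left, Rmax_right by lra. intros u Hu.
    apply (RInt_snd_continuous (f := kernel z) (a := 0) (b := N) (c := 0) (d := N) (r := 1));
      try lra. exact (Hk 0 N). }
  transitivity (RInt (fun s => RInt (fun u => kernel z u s) 0 N) 0 N).
  { apply (RInt_swap (r := 1)); [lra|lra|lra|]. exact (Hk 0 N). }
  transitivity (RInt (fun s => scal (Beta p q) (wS (p + q) z s)) 0 N).
  { apply RInt_ext. intros s. rewrite Rmin_left, Rmax_right by lra. intros Hs.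
    apply is_RInt_unique, kernel_fst. lra. }
  apply is_RInt_unique, (is_RInt_scal (V := B)), wS_is_RInt. lra.
Qed.

(** [kernel_swap] truncates to a triangle, whereas I_p I_q truncates to u <= N with the full inner
    integral; the difference tends to 0 with N. *)
Lemma Ipow_compose z w v u : Ipow S q z w -> Ipow S p w v -> Ipow S (p + q) z u ->
  v = scal (Beta p q) u.
Proof.
  intros Hw Hv Hu. assert (HB := Beta_pos Hp Hq).
  set (b := Beta p q) in *.
  assert (h : norm (minus v (scal b u)) <= 0).
  { apply le_epsilon. intros eps Heps.
    destruct (IG_proper (fun t => wS_continuous (z := w) (t := t) Hp) (Ipow_wS Hv) (eps := eps / 3)) as [N1 [HN1 H1]];
      [lra|].
    destruct (IG_proper (fun t => wS_continuous (q := p + q) (z := z) (t := t) ltac:(lra)) (Ipow_wS Hu)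
      (eps := eps / 3 / b)) as [N2 [HN2 H2]]; [apply Rdiv_lt_0_compat; lra|].
    set (K := M * (wcst q * (2 / lam) * norm z)).
    assert (HK : 0 <= K).
    { apply Rmult_le_pos; [lra|]. apply Rmult_le_pos; [|apply (@norm_ge_0 R_AbsRing B)].
      left. apply Rmult_lt_0_compat; [apply wcst_pos|apply Rdiv_lt_0_compat; lra]. }
    destruct (@weight_decay p (lam / 2) K (eps / 3)) as [N3 [HN3 H3]]; [lra|easy|lra|].
    set (N := Rmax N1 (Rmax N2 N3) + 1).
    assert (m1 := Rmax_l N1 (Rmax N2 N3)). assert (m2 := Rmax_r N1 (Rmax N2 N3)).
    assert (m3 := Rmax_l N2 N3). assert (m4 := Rmax_r N2 N3).
    assert (HN : 1 < N) by (unfold N; lra).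
    specialize (H1 N ltac:(unfold N; lra)). specialize (H2 N ltac:(unfold N; lra)).
    specialize (H3 N ltac:(unfold N; lra)). clearbody N.
    set (g := fun u => scal (rpow u (p - 1)) (S u (RInt (wS q z) 0 (N - u)))).
    assert (Hg : is_RInt g 0 N (scal b (RInt (wS (p + q) z) 0 N))).
    { apply kernel_swap. lra. }
    (* The inner integral misses a tail of size exp (- (lam / 2) (N - u)). Together with the decay
       of S_u this is at most exp (- (lam / 2) N) for every u, and integrating the weight costs only
       N^p. *)
    assert (H4 : norm (minus (RInt (wS p w) 0 N) (scal b (RInt (wS (p + q) z) 0 N))) <= eps / 3).
    { apply Rle_trans with (2 := H3).
      assert (d : is_RInt (fun u => minus (wS p w u) (g u)) 0 N
        (minus (RInt (wS p w) 0 N) (scal b (RInt (wS (p + q) z) 0 N)))).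
      { apply (is_RInt_minus (V := B)); [now apply wS_is_RInt|exact Hg]. }
      set (k := rpow N (p - 1) * (K * exp (- (lam / 2) * N))).
      apply Rle_trans with ((N - 0) * k).
      - apply (norm_RInt_le_const (V := B)) with (3 := d); [lra|]. intros u0 Hu0.
        unfold wS, g. rewrite S_ext_eq by lra.
        match goal with |- norm ?x <= _ => replace x
          with (scal (rpow u0 (p - 1)) (S u0 (minus w (RInt (wS q z) 0 (N - u0))))) end.
        + rewrite (norm_scal_R (V := B)), Rabs_right by (apply Rle_ge, rpow_nonneg).
          unfold k. apply Rmult_le_compat; [apply rpow_nonneg|apply (@norm_ge_0 R_AbsRing B)| |].
          * apply rpow_le; lra.
          * apply Rle_trans with (1 := Hdecay (proj1 Hu0) _).
            apply Rle_trans with (M * exp (- lam * u0) *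
              (wcst q * (2 / lam) * norm z * exp (- (lam / 2) * (N - u0)))).
            { apply Rmult_le_compat_l; [|apply wS_tail; (lra || easy)].
              apply Rmult_le_pos; [lra|left; apply exp_pos]. }
            apply Rle_trans with (K * (exp (- lam * u0) * exp (- (lam / 2) * (N - u0))));
              [right; unfold K; ring|].
            apply Rmult_le_compat_l; [easy|]. rewrite <- exp_plus.
            destruct (Rle_lt_or_eq_dec (- lam * u0 + - (lam / 2) * (N - u0)) (- (lam / 2) * N)) as [e|e];
              [nra|left; now apply exp_increasing|rewrite e; lra].
        + assert (HL := S_linear HC0 (proj1 Hu0)).
          transitivity (scal (rpow u0 (p - 1)) (minus (S u0 w) (S u0 (RInt (wS q z) 0 (N - u0))))).
          { f_equal. exact (linear_minus _ _ _ HL). }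
          module_eq_in B.
      - unfold k. rewrite Rminus_0_r. right.
        replace (Rpower N p) with (N * rpow N (p - 1)); [ring|].
        rewrite rpow_Rpower by lra. rewrite <- (Rpower_1 N) at 1 by lra.
        rewrite <- Rpower_plus. f_equal. ring. }
    match goal with |- norm ?x <= _ => replace x with
      (plus (minus (minus (RInt (wS p w) 0 N) (scal b (RInt (wS (p + q) z) 0 N)))
                   (minus (RInt (wS p w) 0 N) v))
            (scal b (minus (RInt (wS (p + q) z) 0 N) u))) by module_eq_in B end.
    eapply Rle_trans; [apply (@norm_triangle R_AbsRing B)|].
    apply Rle_trans with (eps / 3 + eps / 3 + b * (eps / 3 / b)); [|right; field; lra].
    apply Rplus_le_compat.
    - eapply Rle_trans; [apply (@norm_minus_le B)|]. now apply Rplus_le_compat.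
    - rewrite (norm_scal_R (V := B)), Rabs_right by lra. apply Rmult_le_compat_l; [lra|easy]. }
  assert (h0 : minus v (scal b u) = zero).
  { apply (@norm_eq_zero R_AbsRing B). apply Rle_antisym; [easy|apply (@norm_ge_0 R_AbsRing B)]. }
  transitivity (plus (minus v (scal b u)) (scal b u)); [module_eq_in B|].
  rewrite h0. apply plus_zero_l.
Qed.

End Convolution.

(** * The smoothing estimate for one fractional power *)

Section Gain.

Context {B : CompleteNormedModule R_AbsRing}.
Variables (S : R -> B -> B) (M lam : R).
Hypotheses (HC0 : C0_semigroup S) (HM : 0 < M) (Hlam : 0 < lam).
Hypothesis Hdecay : forall t, 0 <= t -> op_le (S t) (M * exp (- lam * t)).
Variables (D : R -> B -> B) (CD : R).
Hypothesis HD : semigroup_derivative S D CD.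

(** The total time m s is shared equally among the m derivatives, each S_s D_r being D_{r+s}. *)
Lemma S_iterD_bound r s m x : 0 < r -> 0 <= s ->
  norm (S (INR m * s) (iterD D r m x)) <= (CD / (r + s)) ^ m * norm x.
Proof.
  intros Hr Hs. assert (HCD : 0 < CD) by apply HD.
  induction m as [|m IH].
  - change (norm (S (0 * s) x) <= 1 * norm x). rewrite Rmult_0_l, (S_0 HC0). lra.
  - replace (S (INR (Datatypes.S m) * s) (iterD D r (Datatypes.S m) x))
      with (D (s + r) (S (INR m * s) (iterD D r m x))).
    + eapply Rle_trans; [apply (D_bound HD); lra|].
      simpl. rewrite Rmult_assoc, (Rplus_comm s r). apply Rmult_le_compat_l; [|exact IH].
      left. apply Rdiv_lt_0_compat; lra.
    + assert (hm := pos_INR m). assert (hms : 0 <= INR m * s) by now apply Rmult_le_pos.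
      rewrite (D_S HC0 HD) by lra. rewrite <- (S_D HC0 HD) by lra.
      rewrite <- (S_plus HC0) by lra. f_equal. rewrite S_INR. ring.
Qed.

(** [S_iterD_bound] with s = t / m, together with r + t / m >= (r + t) / m. *)
Lemma S_iterD_decay r t m x : 0 < r -> 0 <= t -> (0 < m)%nat ->
  norm (S t (iterD D r m x)) <= (CD * INR m) ^ m * Rpower (r + t) (- INR m) * norm x.
Proof.
  intros Hr Ht Hm. assert (HCD : 0 < CD) by apply HD.
  assert (hm : 1 <= INR m) by (change 1 with (INR 1); apply le_INR; lia).
  assert (hs : 0 <= t / INR m) by (apply Rdiv_le_0_compat; lra).
  assert (g := S_iterD_bound m x Hr hs).
  replace (INR m * (t / INR m)) with t in g by (field; lra).
  apply Rle_trans with (1 := g). apply Rmult_le_compat_r; [apply (@norm_ge_0 R_AbsRing B)|].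
  rewrite Rpower_Ropp, Rpower_pow, <- pow_inv, <- Rpow_mult_distr by lra.
  apply pow_incr. split; [left; apply Rdiv_lt_0_compat; lra|].
  rewrite Rmult_assoc. apply Rmult_le_compat_l; [lra|].
  replace (INR m * / (r + t)) with (/ ((r + t) / INR m)) by (field; lra).
  apply Rinv_le_contravar; [apply Rdiv_lt_0_compat; lra|].
  unfold Rdiv. rewrite Rmult_plus_distr_r. apply Rplus_le_compat_r.
  rewrite <- (Rmult_1_r r) at 2. apply Rmult_le_compat_l; [lra|].
  rewrite <- Rinv_1. apply Rinv_le_contravar; lra.
Qed.

(* With n > b + 2 and p = n - b - 1, the n-th derivative of Beta I_n z = I_p I_{b+1} z is a
   multiple of S_{nr} z on the left, and on the right it is the integral I_p of
   D_r^{n-1} S_r I_b z, which converges with the bound r^{-b}. *)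
Theorem fractional_gain b : 0 < b -> exists C, 0 < C /\ forall r z x, 0 < r ->
  Ipow S b z x -> Rpower r b * norm (S r z) <= C * norm x.
Proof.
  intros Hb. assert (HCD : 0 < CD) by apply HD.
  destruct (INR_unbounded (b + 2)) as [m Hm].
  set (n := INR (Datatypes.S m)). assert (hn : n = INR m + 1) by (unfold n; apply S_INR).
  assert (hm : (0 < m)%nat) by (apply INR_lt; simpl; lra).
  set (p := n - b - 1). assert (Hp : 1 < p) by (unfold p; lra). assert (Hq : 1 < b + 1) by lra.
  assert (hB := Beta_pos Hp Hq).
  destruct (iterD_Ipow_nat HC0 HM Hlam Hdecay HD m) as [c [Hc Hiter]].
  assert (hc := Rabs_pos_lt c Hc).
  set (K := M * (CD * INR m) ^ m).
  assert (hK : 0 < K).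
  { apply Rmult_lt_0_compat; [easy|]. apply pow_lt. apply Rmult_lt_0_compat; lra. }
  set (C := K * Rpower n b / (Beta p (b + 1) * Rabs c)).
  assert (hBc : 0 < Beta p (b + 1) * Rabs c) by now apply Rmult_lt_0_compat.
  assert (hC : 0 < C).
  { apply Rdiv_lt_0_compat; [|easy]. apply Rmult_lt_0_compat; [easy|apply exp_pos]. }
  exists C. split; [easy|]. intros r0 z x Hr0 Hx.
  set (r := r0 / n). assert (Hr : 0 < r) by (apply Rdiv_lt_0_compat; lra).
  assert (er : n * r = r0) by (unfold r; field; lra).
  destruct (Ipow_exists HM Hlam Hdecay HD z (b := b + 1) ltac:(lra)) as [x1 [Hx1 _]].
  destruct (Ipow_exists HM Hlam Hdecay HD z (b := n) ltac:(lra)) as [w [Hw _]].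
  destruct (Ipow_exists HM Hlam Hdecay HD x1 (b := p) ltac:(lra)) as [v [Hv _]].
  assert (ev : v = scal (Beta p (b + 1)) w).
  { apply (Ipow_compose HC0 HM Hlam Hdecay (S_cont_pos HD) Hp Hq Hx1 Hv).
    now replace (p + (b + 1)) with n by (unfold p; ring). }
  assert (HL := iterD_linear HD (Datatypes.S m) Hr).
  assert (e1 : iterD D r (Datatypes.S m) v = scal (Beta p (b + 1)) (scal c (S r0 z))).
  { rewrite ev, (scal_linear_value _ _ HL), (Hiter r z w Hr Hw). fold n. now rewrite er. }
  assert (Hv2 := Ipow_iterD HC0 HD (Datatypes.S m) Hr Hv). rewrite e1, iterD_succ in Hv2.
  rewrite (Ipow_by_parts HC0 HM Hlam Hdecay HD Hb Hr Hx Hx1) in Hv2.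
  rewrite (scal_linear_value _ _ (iterD_linear HD m Hr)), (iterD_S HC0 HD) in Hv2 by lra.
  (* The powers p - 1 of t and - m of r + t combine to at most (r + t)^(-b-1), since p = m - b; its
     primitive gives r^(-b). *)
  assert (bound : norm (scal (Beta p (b + 1)) (scal c (S r0 z))) <= K * norm x * Rpower r (- b)).
  { apply (IG_norm_le (m := fun t => b * (K * norm x) * Rpower (r + t) (- b - 1))
      (G := fun t => - (K * norm x * Rpower (r + t) (- b)))) with (6 := Hv2).
    - apply weighted_cont_pos, (S_cont_pos HD).
    - intros t Ht. apply (ex_derive_continuous (V := R_NormedModule)). unfold Rpower.
      auto_derive. lra.
    - intros t Ht. rewrite (norm_scal_R (V := B)), Rabs_right by (left; apply exp_pos).
      rewrite (scal_linear_value _ _ (S_linear HC0 (Rlt_le _ _ Ht))), (S_comm HC0) by lra.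
      rewrite (norm_scal_R (V := B)), Rabs_left by lra.
      apply Rle_trans with (Rpower (r + t) (p - 1) * (b * (M *
        ((CD * INR m) ^ m * Rpower (r + t) (- INR m) * norm x)))).
      + apply Rmult_le_compat; [left; apply exp_pos| | |].
        * apply Rmult_le_pos; [lra|apply (@norm_ge_0 R_AbsRing B)].
        * apply Rle_Rpower_l; lra.
        * rewrite Ropp_involutive. apply Rmult_le_compat_l; [lra|].
          eapply Rle_trans; [apply (S_bound HM Hlam Hdecay); lra|].
          apply Rmult_le_compat_l; [lra|]. apply S_iterD_decay; (lra || easy).
      + right. replace (- b - 1) with (p - 1 + - INR m) by (unfold p; lra).
        rewrite Rpower_plus. unfold K. ring.
    - intros t Ht. assert (g := @Rpower_derive (- b) (r + t) ltac:(lra)).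
      apply (is_derive_shift (f := fun s => Rpower s (- b)) (V := R_NormedModule)) in g.
      apply (is_derive_scal _ _ (- (K * norm x))) in g.
      apply (is_derive_ext (fun s => - (K * norm x) * Rpower (r + s) (- b))).
      + intros s. change (- (K * norm x) * Rpower (r + s) (- b) = - (K * norm x * Rpower (r + s) (- b))).
        ring.
      + apply (is_derive_eq g).
        change (- (K * norm x) * (- b * Rpower (r + t) (- b - 1)) = b * (K * norm x) * Rpower (r + t) (- b - 1)).
        ring.
    - intros t1 t2 Ht.
      assert (hx : 0 <= K * norm x) by (apply Rmult_le_pos; [lra|apply (@norm_ge_0 R_AbsRing B)]).
      assert (g1 : 0 <= K * norm x * Rpower (r + t2) (- b)).
      { apply Rmult_le_pos; [easy|left; apply exp_pos]. }
      assert (g2 : K * norm x * Rpower (r + t1) (- b) <= K * norm x * Rpower r (- b)).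
      { apply Rmult_le_compat_l; [easy|]. rewrite !Rpower_Ropp.
        apply Rinv_le_contravar; [apply exp_pos|]. apply Rle_Rpower_l; lra. }
      lra. }
  rewrite (norm_scal_R (V := B)), (norm_scal_R (V := B)), (Rabs_right (Beta _ _)) in bound by lra.
  assert (hr : Rpower r0 b * Rpower r (- b) = Rpower n b).
  { rewrite <- er, <- Rpower_mult_distr by lra. rewrite Rpower_Ropp. field.
    apply Rgt_not_eq, exp_pos. }
  apply Rmult_le_reg_l with (1 := hBc).
  apply Rle_trans with (Rpower r0 b * (K * norm x * Rpower r (- b))).
  - apply Rle_trans with (Rpower r0 b * (Beta p (b + 1) * (Rabs c * norm (S r0 z)))); [right; ring|].
    apply Rmult_le_compat_l; [left; apply exp_pos|exact bound].
  - right. unfold C. rewrite <- hr. field. split; lra.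
Qed.

End Gain.

(** * Smoothing from B_{-rho} to B_eta *)

Section Fractional.

Context {B : CompleteNormedModule R_AbsRing}.
Variables (S : R -> B -> B) (M lam : R).
Hypotheses (HC0 : C0_semigroup S) (HM : 0 < M) (Hlam : 0 < lam).
Hypothesis Hdecay : forall t, 0 <= t -> op_le (S t) (M * exp (- lam * t)).
Variables (D : R -> B -> B) (CD : R).
Hypothesis HD : semigroup_derivative S D CD.

Lemma is_Aneg_Ipow a x z : 0 < a -> is_Aneg S a x z <-> Ipow S a x (scal (Euler_Gamma a) z).
Proof.
  intros Ha. destruct (Gamma_IG Ha) as [_ HG]. set (G := Euler_Gamma a) in *.
  set (f := fun t => scal (Rpower t (a - 1)) (S t x)).
  set (g := fun t => scal (Rpower t (a - 1) / G) (S t x)).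
  assert (Cf : cont_pos f) by (apply weighted_cont_pos, (S_cont_pos HD)).
  assert (e1 : forall t, g t = scal (/ G) (f t)).
  { intros t. unfold f, g. module_eq_in B; try lra. }
  assert (e2 : forall t, f t = scal G (g t)).
  { intros t. unfold f, g. module_eq_in B; try lra. }
  assert (Cg : cont_pos g).
  { intros t Ht. apply (continuous_ext (fun t => scal (/ G) (f t))); [intros; now rewrite e1|].
    apply (@continuous_scal_r _ _ B). now apply Cf. }
  split.
  - intros H. apply (IG_is_RInt_gen z Cg) in H. apply (IG_scal G Cg) in H.
    revert H. apply IG_ext. intros t _. symmetry. exact (e2 t).
  - intros H. apply (IG_is_RInt_gen z Cg). apply (IG_scal (/ G) Cf) in H.
    replace z with (scal (/ G) (scal G z)) by (module_eq_in B; try lra).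
    revert H. apply IG_ext. intros t _. symmetry. exact (e1 t).
Qed.

Lemma S_injective z : (forall r, 0 < r -> S r z = zero) -> z = zero.
Proof.
  intros H. apply (@norm_eq_zero R_AbsRing B). apply Rle_antisym; [|apply (@norm_ge_0 R_AbsRing B)].
  apply le_epsilon. intros eps Heps.
  destruct (S_continuous_0 HC0 z Heps) as [d [Hd Hc]]. specialize (Hc (d / 2) ltac:(lra)).
  rewrite H in Hc by lra. rewrite Rplus_0_l.
  apply Rle_trans with (2 := Hc). right.
  match goal with |- _ = norm ?v => transitivity (@norm R_AbsRing B (opp z)) end.
  - symmetry. apply (@norm_opp R_AbsRing B).
  - f_equal. module_eq_in B.
Qed.

Lemma Ipow_minus b z w x y : Ipow S b z x -> Ipow S b w y -> Ipow S b (minus z w) (minus x y).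
Proof.
  intros Hx Hy. assert (g := Ipow_plus HC0 HD Hx (Ipow_scal HC0 HD (-1) Hy)).
  replace (minus z w) with (plus z (scal (-1) w)) by module_eq_in B.
  replace (minus x y) with (plus x (scal (-1) y)) by module_eq_in B. exact g.
Qed.

(** The gain applied to z - w, whose integral is 0, gives S_r (z - w) = 0 for all r > 0.
    Consequently the vector z in [dom_in_norm] is unique, and norms in E can be computed from any
    such z. *)
Lemma Ipow_injective b z w x : 0 < b -> Ipow S b z x -> Ipow S b w x -> z = w.
Proof.
  intros Hb Hz Hw. destruct (fractional_gain HC0 HM Hlam Hdecay HD Hb) as [C [HC H]].
  assert (h : minus z w = zero).
  { apply S_injective. intros r Hr.
    assert (g := H r (minus z w) (minus x x) Hr (Ipow_minus Hz Hw)).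
    apply (@norm_eq_zero R_AbsRing B). apply Rle_antisym; [|apply (@norm_ge_0 R_AbsRing B)].
    apply Rmult_le_reg_l with (Rpower r b); [apply exp_pos|]. rewrite Rmult_0_r.
    apply Rle_trans with (1 := g). right.
    replace (norm (minus x x)) with (@norm R_AbsRing B zero) by (f_equal; module_eq_in B).
    rewrite (@norm_zero R_AbsRing B). ring. }
  transitivity (plus (minus z w) w); [module_eq_in B|]. rewrite h. apply plus_zero_l.
Qed.

Variables (eta rho : R).
Hypotheses (Heta : 0 < eta) (Hrho : 0 <= rho).
Variables (E : dom_space S eta) (F : cpl_space S (- rho)).

(* z = A_o^eta v *)
Definition power_of (v : E) (z : B) : Prop := Ipow S eta z (scal (Euler_Gamma eta) (dom_in v)).

Lemma power_of_norm v : exists z, power_of v z /\ norm v = norm z.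
Proof.
  destruct (dom_in_norm v) as [z [[H|[H|[_ H]]] Hn]]; [lra|lra|].
  exists z. split; [|exact Hn]. unfold power_of.
  exact (proj1 (is_Aneg_Ipow _ _ Heta) H).
Qed.

Lemma norm_power v z : power_of v z -> norm v = norm z.
Proof.
  intros H. destruct (power_of_norm v) as [z' [H' ->]]. f_equal. exact (Ipow_injective Heta H' H).
Qed.

Lemma power_of_S t v z : 0 <= t -> power_of v z -> power_of (dom_S E t v) (S t z).
Proof.
  intros Ht H. unfold power_of. rewrite dom_SE by easy.
  rewrite <- (scal_linear_value _ _ (S_linear HC0 Ht)). now apply (Ipow_S HC0 HD).
Qed.

Lemma dom_in_minus (v w : E) : dom_in (minus v w) = minus (dom_in v) (dom_in w).
Proof.
  replace (minus v w) with (plus v (scal (-1) w)) by module_eq_in E.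
  transitivity (plus (dom_in v) (dom_in (scal (-1) w))); [apply dom_in_plus|].
  transitivity (plus (dom_in v) (scal (-1) (dom_in w))); [f_equal; apply dom_in_scal|].
  module_eq_in B.
Qed.

Lemma power_of_minus v w y z : power_of v y -> power_of w z -> power_of (minus v w) (minus y z).
Proof.
  intros Hy Hz. unfold power_of. rewrite dom_in_minus.
  replace (scal (Euler_Gamma eta) (minus (dom_in v) (dom_in w))) with
    (minus (scal (Euler_Gamma eta) (dom_in v)) (scal (Euler_Gamma eta) (dom_in w))) by module_eq_in B.
  now apply Ipow_minus.
Qed.

Lemma dom_in_bound : exists C, 0 < C /\ forall v : E, norm (dom_in v) <= C * norm v.
Proof.
  destruct (Gamma_IG Heta) as [_ HG].
  assert (hI : 0 < Icst M lam eta).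
  { apply Rmult_lt_0_compat; [easy|]. assert (0 < / eta) by now apply Rinv_0_lt_compat.
    assert (0 < tail_cst eta lam) by now apply tail_cst_pos. lra. }
  exists (Icst M lam eta / Euler_Gamma eta). split; [now apply Rdiv_lt_0_compat|].
  intros v. destruct (power_of_norm v) as [z [Hz ->]].
  assert (g := Ipow_bound HM Hlam Hdecay HD Heta Hz).
  rewrite (norm_scal_R (V := B)), Rabs_right in g by lra.
  apply Rmult_le_reg_l with (1 := HG). apply Rle_trans with (1 := g). right. field. lra.
Qed.

Lemma cpl_in_bound : exists C, 0 < C /\ forall x : B, norm (cpl_in F x) <= C * norm x.
Proof.
  destruct (Rle_lt_or_eq_dec 0 rho Hrho) as [h|h].
  - destruct (Gamma_IG h) as [_ HG].
    assert (hI : 0 < Icst M lam rho).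
    { apply Rmult_lt_0_compat; [easy|]. assert (0 < / rho) by now apply Rinv_0_lt_compat.
      assert (0 < tail_cst rho lam) by now apply tail_cst_pos. lra. }
    exists (Icst M lam rho / Euler_Gamma rho). split; [now apply Rdiv_lt_0_compat|].
    intros x. destruct (cpl_in_norm F x) as [z [[[_ H]|[H|H]] ->]]; [|lra|lra].
    rewrite Ropp_involutive in H. apply (proj1 (is_Aneg_Ipow _ _ h)) in H.
    assert (g := Ipow_bound HM Hlam Hdecay HD h H).
    rewrite (norm_scal_R (V := B)), Rabs_right in g by lra.
    apply Rmult_le_reg_l with (1 := HG). apply Rle_trans with (1 := g). right. field. lra.
  - exists 1. split; [lra|]. intros x. rewrite Rmult_1_l.
    destruct (cpl_in_norm F x) as [z [[H|[[_ ->]|H]] ->]]; lra.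
Qed.

Lemma cpl_in_S t x : 0 <= t -> norm (cpl_in F (S t x)) <= M * norm (cpl_in F x).
Proof.
  intros Ht. destruct (cpl_in_norm F x) as [z [Hz ->]].
  destruct (cpl_in_norm F (S t x)) as [w [Hw ->]].
  replace w with (S t z); [now apply (S_bound HM Hlam Hdecay)|].
  destruct Hz as [[h Hz]|[[h ->]|[h _]]]; destruct Hw as [[h' Hw]|[[h' ->]|[h' _]]]; try lra; [|easy].
  assert (hr : 0 < rho) by lra. destruct (Gamma_IG hr) as [_ HG].
  rewrite Ropp_involutive in Hz, Hw.
  apply (proj1 (is_Aneg_Ipow _ _ hr)) in Hz. apply (proj1 (is_Aneg_Ipow _ _ hr)) in Hw.
  apply (Ipow_S HC0 HD Ht) in Hz. rewrite (scal_linear_value _ _ (S_linear HC0 Ht)) in Hz.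
  assert (e := Ipow_unique Hz Hw).
  transitivity (scal (/ Euler_Gamma rho) (scal (Euler_Gamma rho) (S t z)));
    [module_eq_in B; lra|].
  transitivity (scal (/ Euler_Gamma rho) (scal (Euler_Gamma rho) w)); [|module_eq_in B; lra].
  exact (f_equal (fun y : B => scal (/ Euler_Gamma rho) y) e).
Qed.

Lemma cpl_gain : exists C, 0 < C /\ forall r x, 0 < r ->
  rpow r rho * norm (S r x) <= C * norm (cpl_in F x).
Proof.
  destruct (Rle_lt_or_eq_dec 0 rho Hrho) as [h|h].
  - destruct (Gamma_IG h) as [_ HG].
    destruct (fractional_gain HC0 HM Hlam Hdecay HD h) as [C [HC H]].
    exists (C * Euler_Gamma rho). split; [now apply Rmult_lt_0_compat|]. intros r x Hr.
    destruct (cpl_in_norm F x) as [z [[[_ Hz]|[Hz|Hz]] ->]]; [|lra|lra].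
    rewrite Ropp_involutive in Hz. apply (proj1 (is_Aneg_Ipow _ _ h)) in Hz.
    rewrite rpow_Rpower by easy. apply Rle_trans with (1 := H r _ _ Hr Hz).
    rewrite (norm_scal_R (V := B)), Rabs_right by lra. right. ring.
  - exists M. split; [easy|]. intros r x Hr.
    destruct (cpl_in_norm F x) as [z [[Hz|[[_ ->]|Hz]] ->]]; [lra| |lra].
    rewrite rpow_Rpower, <- h, Rpower_O, Rmult_1_l by easy. apply (S_bound HM Hlam Hdecay). lra.
Qed.

Lemma emb_bound : exists C, 0 < C /\ forall v : E, norm (emb F v) <= C * norm v.
Proof.
  destruct dom_in_bound as [C1 [HC1 H1]]. destruct cpl_in_bound as [C2 [HC2 H2]].
  exists (C2 * C1). split; [now apply Rmult_lt_0_compat|]. intros v.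
  apply Rle_trans with (1 := H2 (dom_in v)). rewrite Rmult_assoc.
  apply Rmult_le_compat_l; [lra|easy].
Qed.

Lemma emb_linear : is_linear (emb F (E := E)).
Proof.
  split.
  - intros v w. unfold emb. transitivity (cpl_in F (plus (dom_in v) (dom_in w))); [|apply cpl_in_plus].
    f_equal. apply dom_in_plus.
  - intros k v. unfold emb. transitivity (cpl_in F (scal k (dom_in v))); [|apply cpl_in_scal].
    f_equal. apply dom_in_scal.
  - exact emb_bound.
Qed.

Lemma dom_S_bound t (v : E) : 0 <= t -> norm (dom_S E t v) <= M * norm v.
Proof.
  intros Ht. destruct (power_of_norm v) as [z [Hz ->]].
  rewrite (norm_power (power_of_S Ht Hz)). now apply (S_bound HM Hlam Hdecay).
Qed.

Lemma dom_S_linear t : 0 <= t -> is_linear (dom_S E t).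
Proof.
  intros Ht. split.
  - intros v w. apply dom_in_inj.
    transitivity (S t (plus (dom_in v) (dom_in w))).
    { rewrite dom_SE by easy. f_equal. apply dom_in_plus. }
    transitivity (plus (S t (dom_in v)) (S t (dom_in w))).
    { exact (linear_plus _ (S_linear HC0 Ht) _ _). }
    rewrite <- !dom_SE by easy. symmetry. apply dom_in_plus.
  - intros k v. apply dom_in_inj.
    transitivity (S t (scal k (dom_in v))).
    { rewrite dom_SE by easy. f_equal. apply dom_in_scal. }
    rewrite (scal_linear_value _ _ (S_linear HC0 Ht)), <- dom_SE by easy. symmetry. apply dom_in_scal.
  - exists M. split; [easy|]. intros v. now apply dom_S_bound.
Qed.

Lemma dom_S_continuous (v : E) : filterlim (fun t => dom_S E t v) (at_right 0) (locally v).
Proof.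
  apply (filterlim_norm_eps _ _ v). intros eps Heps. destruct (power_of_norm v) as [z [Hz _]].
  destruct (S_continuous_0 HC0 z (eps := eps / 2)) as [d [Hd H]]; [lra|].
  exists (mkposreal d Hd). intros t Ht Ht0. change (Rabs (t - 0) < d) in Ht.
  rewrite Rminus_0_r, Rabs_right in Ht by lra.
  eapply Rle_lt_trans; [right; exact (norm_power (power_of_minus (power_of_S (Rlt_le _ _ Ht0) Hz) Hz))|].
  apply Rle_lt_trans with (eps / 2); [apply H; lra|]. lra.
Qed.

(** For the gain S_t is split into two halves: one gains the power eta, passing from B to B_eta, the
    other the power rho, passing from B_{-rho} to B. The factor 2^(eta+rho) is the cost of halving
    the time. *)
Lemma dom_cpl_smoothing : exists CS CJ, smoothing (emb F (E := E)) (dom_S E) (eta + rho) CS CJ.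
Proof.
  destruct emb_bound as [CJ [HCJ HJ]].
  destruct (fractional_gain HC0 HM Hlam Hdecay HD Heta) as [C1 [HC1 H1]].
  destruct cpl_gain as [C2 [HC2 H2]].
  destruct (Gamma_IG Heta) as [_ HG]. set (G := Euler_Gamma eta) in *.
  set (C3 := rpow 2 (eta + rho) * (C1 * G * C2)).
  exists (1 + M + C3), CJ.
  assert (HC3 : 0 < C3).
  { apply Rmult_lt_0_compat; [apply rpow_pos; lra|]. apply Rmult_lt_0_compat; [nra|easy]. }
  split; try lra.
  - exact emb_linear.
  - exact HJ.
  - exact dom_S_linear.
  - intros v. apply dom_in_inj. rewrite dom_SE by lra. apply (S_0 HC0).
  - intros t s v Ht Hs. apply dom_in_inj. rewrite !dom_SE by lra. now apply (S_plus HC0).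
  - intros f t v Ht. apply Rle_trans with (M * graded_norm (emb F (E := E)) f v).
    + destruct f; simpl; [|now apply dom_S_bound].
      unfold emb. rewrite dom_SE by easy. now apply cpl_in_S.
    + apply Rmult_le_compat_r; [|lra]. destruct f; simpl; apply norm_ge_0.
  - intros t v Ht. destruct (power_of_norm v) as [z [Hz _]].
    set (r := t / 2). assert (Hr : 0 < r) by (unfold r; lra).
    rewrite (norm_power (power_of_S (Rlt_le _ _ Ht) Hz)).
    replace (S t z) with (S r (S r z)) by (rewrite <- (S_plus HC0) by lra; f_equal; unfold r; field).
    assert (g1 := H1 r _ _ Hr (Ipow_S HC0 HD (Rlt_le _ _ Hr) Hz)).
    rewrite (scal_linear_value _ _ (S_linear HC0 (Rlt_le _ _ Hr))) in g1.
    rewrite (norm_scal_R (V := B)), Rabs_right in g1 by (apply Rle_ge, Rlt_le, HG).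
    assert (g2 := H2 r (dom_in v) Hr). fold (emb F v) in g2.
    assert (e : rpow t (eta + rho) = rpow 2 (eta + rho) * (Rpower r eta * rpow r rho)).
    { replace t with (2 * r) at 1 by (unfold r; field).
      rewrite rpow_mult, <- (rpow_Rpower r), <- rpow_plus by lra. easy. }
    rewrite e.
    assert (p2 : 0 <= rpow r rho) by apply rpow_nonneg.
    apply Rle_trans with (rpow 2 (eta + rho) * (rpow r rho * (Rpower r eta * norm (S r (S r z)))));
      [right; ring|].
    apply Rle_trans with (C3 * norm (emb F v)).
    + unfold C3. rewrite Rmult_assoc. apply Rmult_le_compat_l; [apply rpow_nonneg|].
      apply Rle_trans with (C1 * G * (rpow r rho * norm (S r (dom_in v)))).
      * apply Rle_trans with (rpow r rho * (C1 * (G * norm (S r (dom_in v))))); [|right; ring].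
        apply Rmult_le_compat_l; [easy|exact g1].
      * rewrite Rmult_assoc, (Rmult_assoc (C1 * G)), (Rmult_assoc C1).
        apply Rmult_le_compat_l; [lra|]. apply Rmult_le_compat_l; [lra|exact g2].
    + apply Rmult_le_compat_r; [apply (@norm_ge_0 R_AbsRing F)|lra].
  - exact dom_S_continuous.
Qed.

Lemma cpl_S_emb r (v : E) : 0 <= r -> cpl_S F r (emb F v) = emb F (dom_S E r v).
Proof. intros Hr. unfold emb. now rewrite cpl_SE, dom_SE. Qed.

End Fractional.

(** * The equation in the fractional spaces *)

Lemma C2L_bound (U V : NormedModule R_AbsRing) a b mu (Y : R -> R -> U -> V) : C2L a b mu Y ->
  exists K, 0 <= K /\ forall t s v, S2 a b (t, s) -> norm (Y t s v) <= K * rpow (t - s) mu * norm v.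
Proof.
  intros [_ [_ [K HK]]]. exists (Rabs K). split; [apply Rabs_pos|]. intros t s v H.
  apply Rle_trans with (1 := HK t s H v). apply Rmult_le_compat_r; [apply norm_ge_0|].
  apply Rmult_le_compat_r; [apply rpow_nonneg|apply Rle_abs].
Qed.

Lemma scale_bound (x K K' r n : R) : x <= K * r * n -> K <= K' -> 0 <= r -> 0 <= n -> x <= K' * r * n.
Proof.
  intros H HK Hr Hn. apply Rle_trans with (1 := H).
  apply Rmult_le_compat_r; [easy|]. now apply Rmult_le_compat_r.
Qed.

Lemma rem_hdelta1 (E : NormedModule R_AbsRing) (SE : R -> E -> E) X y t s :
  remainder SE X y t s = minus (hdelta1 SE y t s) (Xs X t s (y s)).
Proof. unfold remainder, remainder, one_step, hdelta1. module_eq_in E. Qed.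

Lemma hdelta1_rem (E : NormedModule R_AbsRing) (SE : R -> E -> E) X y t s :
  hdelta1 SE y t s = plus (Xs X t s (y s)) (remainder SE X y t s).
Proof. rewrite rem_hdelta1. module_eq_in E. Qed.

Section Equation.

Variables (B : CompleteNormedModule R_AbsRing) (S : R -> B -> B) (eta rho : R).
Variables (E : dom_space S eta) (F : cpl_space S (- rho)).
Variables (e CS CJ T gam kap0 kap : R).
Hypothesis sm : smoothing (emb F (E := E)) (dom_S E) e CS CJ.
Hypothesis HSF : forall r (v : E), 0 <= r -> cpl_S F r (emb F v) = emb F (dom_S E r v).
Hypotheses (Hgam : gam = kap0 + e) (Hkap : 0 < kap) (Hkap0 : kap < kap0).
Hypothesis Hek : 1 < e + (kap0 + 3 * kap).

Let j := emb F (E := E).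

Lemma admissible_rough_ok (X : rough E) : admissible F T gam kap0 X ->
  exists K, 0 <= K /\ rough_bounds j e T kap0 K X.
Proof.
  intros [[H1 G1] [[H2 G2] [[H3 G3] _]]].
  destruct (C2L_bound H1) as [K1 [p1 B1]]. destruct (C2L_bound G1) as [L1 [q1 D1]].
  destruct (C2L_bound H2) as [K2 [p2 B2]]. destruct (C2L_bound G2) as [L2 [q2 D2]].
  destruct (C2L_bound H3) as [K3 [p3 B3]]. destruct (C2L_bound G3) as [L3 [q3 D3]].
  exists (K1 + L1 + (K2 + L2) + (K3 + L3)). split; [lra|]. split.
  - intros t s H. split; [apply G1, H|]. split; [apply G2, H|apply G3, H].
  - intros f t s v H. destruct f; simpl.
    + apply (scale_bound (K := K1)); [|lra|apply rpow_nonneg|apply norm_ge_0].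
      replace (e + kap0) with (gam + (1 - 1) * kap0) by (rewrite Hgam; ring). exact (B1 t s v H).
    + apply (scale_bound (K := L1)); [|lra|apply rpow_nonneg|apply norm_ge_0].
      replace (0 + kap0) with (1 * kap0) by ring. exact (D1 t s v H).
  - intros f t s v H. destruct f; simpl.
    + apply (scale_bound (K := K2)); [|lra|apply rpow_nonneg|apply norm_ge_0].
      replace (e + 2 * kap0) with (gam + (2 - 1) * kap0) by (rewrite Hgam; ring). exact (B2 t s v H).
    + apply (scale_bound (K := L2)); [|lra|apply rpow_nonneg|apply norm_ge_0].
      rewrite Rplus_0_l. exact (D2 t s v H).
  - intros f t s v H. destruct f; simpl.
    + apply (scale_bound (K := K3)); [|lra|apply rpow_nonneg|apply norm_ge_0].
      replace (e + 3 * kap0) with (gam + (3 - 1) * kap0) by (rewrite Hgam; ring). exact (B3 t s v H).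
    + apply (scale_bound (K := L3)); [|lra|apply rpow_nonneg|apply norm_ge_0].
      rewrite Rplus_0_l. exact (D3 t s v H).
Qed.

Lemma admissible_chen (X : rough E) : admissible F T gam kap0 X -> chen_relations (dom_S E) T X.
Proof. intros [_ [_ [_ H]]]. exact H. Qed.

Lemma rough_ok_le K K' (X : rough E) : K <= K' -> rough_bounds j e T kap0 K X -> rough_bounds j e T kap0 K' X.
Proof.
  intros HK HX. split; [apply HX| | |]; intros f t s v H.
  - apply (scale_bound (K := K)); [now apply HX|easy|apply rpow_nonneg|apply norm_ge_0].
  - apply (scale_bound (K := K)); [now apply HX|easy|apply rpow_nonneg|apply norm_ge_0].
  - apply (scale_bound (K := K)); [now apply HX|easy|apply rpow_nonneg|apply norm_ge_0].
Qed.

Variables (X : rough E) (K : R).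
Hypotheses (Hadm : admissible F T gam kap0 X) (HK : 0 <= K) (HX : rough_bounds j e T kap0 K X).

(** At a fixed point y^1 = y^2 = y, so the remainder is y^r - X^3 y and its image in F is M. This
    gives the orders 3 kap in E and mu in F, which [remainder_bound] raises to the ones required. *)
Lemma solution_asol a b psi p : 0 <= a -> a <= b -> b <= T -> is_solution F X kap a b psi p ->
  asol j (dom_S E) e (kap0 + 3 * kap) X a b psi (cy p).
Proof.
  intros Ha Hab Hb [[H0 [HC1 [_ [_ [HCr [_ [Hd _]]]]]]] [M [HL [_ [_ [H12 Hr]]]]]].
  destruct HL as [mu [Hmu [_ [[_ [KM HM]] _]]]].
  destruct HC1 as [_ [_ [Ky Hy]]]. destruct HCr as [_ [Kr Hyr]].
  set (y := cy p) in *.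
  assert (Hrem : forall t s, S2 a b (t, s) ->
    remainder (dom_S E) X y t s = minus (cyr p t s) (X3 X t s (y s)) /\ j (remainder (dom_S E) X y t s) = M t s).
  { intros t s H. assert (Hs : S1 a b s) by (unfold S1, S2 in *; simpl in *; lra).
    destruct (H12 s Hs) as [e1 e2']. assert (e2 := eq_trans e2' e1).
    assert (d : hdelta1 (dom_S E) y t s
        = plus (plus (X1 X t s (y s)) (X2 X t s (y s))) (cyr p t s))
      by exact (eq_trans (Hd t s H) (f_equal2
        (fun u v : E => plus (plus (X1 X t s u) (X2 X t s v)) (cyr p t s)) e1 e2)).
    assert (r2 : j (cyr p t s) = plus (j (X3 X t s (y s))) (M t s))
      by exact (eq_trans (proj2 (Hr t s H)) (f_equal (fun u : E => plus (j (X3 X t s u)) (M t s)) e2)).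
    assert (q : remainder (dom_S E) X y t s = minus (cyr p t s) (X3 X t s (y s))).
    { etransitivity; [apply rem_hdelta1|].
      transitivity (minus (plus (plus (X1 X t s (y s)) (X2 X t s (y s))) (cyr p t s))
        (plus (plus (X1 X t s (y s)) (X2 X t s (y s))) (X3 X t s (y s)))).
      { exact (f_equal (fun v : E => minus v (Xs X t s (y s))) d). }
      module_eq_in E. }
    split; [exact q|]. rewrite q.
    transitivity (minus (j (cyr p t s)) (j (X3 X t s (y s)))); [exact (linear_minus _ _ _ (sm_j sm))|].
    transitivity (minus (plus (j (X3 X t s (y s))) (M t s)) (j (X3 X t s (y s))));
      [|module_eq_in F].
    f_equal. exact r2. }
  assert (HCS := sm_CS sm).
  set (Ly := Rabs Ky * rpow (1 + T) kap + CS * norm psi).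
  assert (HLy : 0 <= Ly).
  { apply Rplus_le_le_0_compat; apply Rmult_le_pos;
      [apply Rabs_pos|apply rpow_nonneg|lra|apply norm_ge_0]. }
  assert (Hyb : forall t, a <= t <= b -> norm (y t) <= Ly).
  { intros t Ht. assert (h : S2 a b (t, a)) by (unfold S2; simpl; lra).
    match goal with |- norm ?v <= _ =>
      replace v with (plus (hdelta1 (dom_S E) y t a) (dom_S E (t - a) (y a))) end.
    2: { unfold hdelta1. module_eq_in E. }
    eapply Rle_trans; [apply (@norm_triangle R_AbsRing E)|]. apply Rplus_le_compat.
    - apply Rle_trans with (1 := Hy t a h). apply Rle_trans with (Rabs Ky * rpow (t - a) kap).
      + apply Rmult_le_compat_r; [apply rpow_nonneg|apply Rle_abs].
      + apply Rmult_le_compat_l; [apply Rabs_pos|]. apply rpow_le; lra.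
    - assert (H0' : psi = y a) by (symmetry; exact H0). rewrite H0'. apply (sm_bd sm false). lra. }
  set (L := Ly + Rabs KM + (Rabs Kr + K * Ly * rpow (1 + T) (3 * kap0 - 3 * kap))).
  assert (HLK : 0 <= K * Ly * rpow (1 + T) (3 * kap0 - 3 * kap)).
  { apply Rmult_le_pos; [now apply Rmult_le_pos|apply rpow_nonneg]. }
  assert (HM0 := Rabs_pos KM). assert (HR0 := Rabs_pos Kr).
  destruct (remainder_bound sm (k0 := kap0) ltac:(lra) HK HX (admissible_chen Hadm)
    (k2 := kap0 + 3 * kap) (q := 3 * kap) (mu := mu) ltac:(lra) ltac:(lra) Hek ltac:(lra) ltac:(lra)
    Hmu (a := a) (b := b) (y := y) (L := L) Ha Hb) as [L' HL'].
  - intros t Ht. apply Rle_trans with (1 := Hyb t Ht). unfold L. lra.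
  - intros t s h1 h2 h3. assert (h : S2 a b (t, s)) by (unfold S2; simpl; lra).
    rewrite (proj1 (Hrem t s h)).
    eapply Rle_trans; [apply (@norm_minus_le E)|].
    apply Rle_trans with (Rabs Kr * rpow (t - s) (3 * kap)
      + K * Ly * rpow (1 + T) (3 * kap0 - 3 * kap) * rpow (t - s) (3 * kap)).
    + apply Rplus_le_compat.
      * apply Rle_trans with (1 := Hyr t s h).
        apply Rmult_le_compat_r; [apply rpow_nonneg|apply Rle_abs].
      * assert (hT : S2 0 T (t, s)) by (unfold S2; simpl; lra).
        apply Rle_trans with (1 := ro_3 HX false (y s) hT). simpl. rewrite Rplus_0_l.
        apply Rle_trans with (K * (rpow (1 + T) (3 * kap0 - 3 * kap) * rpow (t - s) (3 * kap)) * Ly);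
          [|right; ring].
        apply Rmult_le_compat; [apply Rmult_le_pos; [easy|apply rpow_nonneg]|apply norm_ge_0| |].
        { apply Rmult_le_compat_l; [easy|]. apply rpow_trade; lra. }
        { apply Hyb. lra. }
    + rewrite <- Rmult_plus_distr_r. apply Rmult_le_compat_r; [apply rpow_nonneg|].
      unfold L. lra.
  - intros t s h1 h2 h3. assert (h : S2 a b (t, s)) by (unfold S2; simpl; lra).
    fold j. rewrite (proj2 (Hrem t s h)).
    apply Rle_trans with (1 := HM t s h). apply Rmult_le_compat_r; [apply rpow_nonneg|].
    generalize (Rle_abs KM). unfold L. lra.
  - split; [exact H0|]. exists (Rmax Ly L'). split.
    + intros t Ht. apply Rle_trans with (1 := Hyb t Ht). apply Rmax_l.
    + intros f t s h1 h2 h3. apply Rle_trans with (1 := HL' f t s h1 h2 h3).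
      apply Rmult_le_compat_r; [apply rpow_nonneg|apply Rmax_r].
Qed.

Lemma asol_solution a b psi y : 0 <= a -> b <= T ->
  asol j (dom_S E) e (kap0 + 3 * kap) X a b psi y ->
  is_solution F X kap a b psi (solution_path (dom_S E) X y).
Proof.
  intros Ha Hb Hy.
  assert (HC := admissible_chen Hadm).
  destruct Hadm as [[_ [_ [G1 _]]] [[_ [_ [G2 _]]] [[_ [_ [G3 _]]] _]]].
  split.
  - exact (asol_in_Q sm Hkap Hkap0 HK HX Ha Hb Hy G1 G2).
  - exists (fun t s => j (remainder (dom_S E) X y t s)). split.
    { exact (asol_is_Lambda sm HSF Hkap Hkap0 Hek HK HX HC Ha Hb Hy G1 G2 G3). }
    split; [apply Hy|]. split; [|split; [easy|]].
    + intros t s H. unfold rough_int.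
      etransitivity; [|apply (linear_plus _ (sm_j sm))].
      f_equal. exact (hdelta1_rem (dom_S E) X y t s).
    + intros t s H. split; [easy|]. etransitivity; [|apply (linear_plus _ (sm_j sm))].
      f_equal. exact (path_r_rem (dom_S E) X y t s).
Qed.

Lemma apriori_exponent : exists k1, kap <= k1 /\ 0 < k1 /\ k1 < kap0 + 3 * kap /\ 1 < e + k1.
Proof.
  (* The midpoint of 1 - e and kap0 + 3 kap; the maximum with 3 kap also keeps the exponent above
     kap, as the Hoelder estimate needs. *)
  set (x := (kap0 + 3 * kap + 1 - e) / 2). exists (Rmax (3 * kap) x).
  assert (m1 := Rmax_l (3 * kap) x). assert (m2 := Rmax_r (3 * kap) x).
  split; [lra|]. split; [lra|]. split; [apply Rmax_lub_lt; unfold x; lra|unfold x in *; lra].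
Qed.

(** Uniqueness of y fixes the other components: y^1 and y^2 equal y, y^r is read off in E from the
    decomposition of hdelta y, and y^{1,r} from its formula in Gamma. *)
Lemma solution_agree a b psi p q : 0 <= a -> a <= b -> b <= T ->
  is_solution F X kap a b psi p -> is_solution F X kap a b psi q -> agree a b p q.
Proof.
  intros Ha Hab Hb Hp Hq.
  destruct apriori_exponent as [k1 [_ [Hk1 [Hk12 Hek1]]]].
  destruct (apriori_global sm T (k0 := kap0) ltac:(lra) Hk1 ltac:(lra) Hek1 HK)
    as [tau [C [Htau [HC Hap]]]].
  assert (Hy : forall t, S1 a b t -> cy p t = cy q t).
  { intros t Ht. exact (asol_unique sm Hk1 Hk12 Htau HC Hap HX (admissible_chen Hadm) Ha Hb
      (solution_asol Ha Hab Hb Hp) (solution_asol Ha Hab Hb Hq) Ht). }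
  destruct Hp as [[_ [_ [_ [_ [_ [_ [Hd _]]]]]]] [M [_ [_ [_ [H12 Hr]]]]]].
  destruct Hq as [[_ [_ [_ [_ [_ [_ [Hd' _]]]]]]] [M' [_ [_ [_ [H12' Hr']]]]]].
  assert (E12 : forall t, S1 a b t -> cy1 p t = cy1 q t /\ cy2 p t = cy2 q t).
  { intros t Ht. destruct (H12 t Ht) as [e1 e2]. destruct (H12' t Ht) as [e1' e2'].
    assert (f : cy1 p t = cy1 q t) by (rewrite e1, e1'; now apply Hy).
    split; [exact f|]. now rewrite e2, e2'. }
  split.
  - intros t Ht. split; [now apply Hy|now apply E12].
  - intros t s H. assert (Ht : S1 a b t) by (unfold S1, S2 in *; simpl in *; lra).
    assert (Hs : S1 a b s) by (unfold S1, S2 in *; simpl in *; lra).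
    destruct (E12 s Hs) as [f1 f2].
    assert (d : hdelta1 (dom_S E) (cy p) t s = hdelta1 (dom_S E) (cy q) t s).
    { unfold hdelta1. now rewrite (Hy t Ht), (Hy s Hs). }
    assert (er : cyr p t s = cyr q t s).
    { transitivity (minus (hdelta1 (dom_S E) (cy p) t s)
        (plus (X1 X t s (cy1 p s)) (X2 X t s (cy2 p s)))).
      { assert (g := Hd t s H).
        transitivity (minus (plus (plus (X1 X t s (cy1 p s)) (X2 X t s (cy2 p s))) (cyr p t s))
          (plus (X1 X t s (cy1 p s)) (X2 X t s (cy2 p s)))); [module_eq_in E|].
        symmetry. exact (f_equal (fun v : E =>
          minus v (plus (X1 X t s (cy1 p s)) (X2 X t s (cy2 p s)))) g). }
      rewrite d, f1, f2.
      transitivity (minus (plus (plus (X1 X t s (cy1 q s)) (X2 X t s (cy2 q s))) (cyr q t s))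
          (plus (X1 X t s (cy1 q s)) (X2 X t s (cy2 q s)))); [|module_eq_in E].
      exact (f_equal (fun v : E =>
          minus v (plus (X1 X t s (cy1 q s)) (X2 X t s (cy2 q s)))) (Hd' t s H)). }
    split; [exact er|].
    rewrite (proj1 (Hr t s H)), (proj1 (Hr' t s H)). now rewrite f2, er.
Qed.

Lemma unique_solution_exists a b psi : 0 <= a -> a <= b -> b <= T ->
  exists p, is_unique_solution F X kap a b psi p.
Proof.
  intros Ha Hab Hb.
  destruct apriori_exponent as [k1 [_ [Hk1 [Hk12 Hek1]]]].
  destruct (apriori_global sm T (k0 := kap0) ltac:(lra) Hk1 ltac:(lra) Hek1 HK)
    as [tau1 [C1 [Htau1 [HC1 Hap1]]]].
  destruct (apriori_global sm T (k0 := kap0) (k := kap0 + 3 * kap) ltac:(lra) ltac:(lra) ltac:(lra)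
    Hek HK) as [tau2 [C2 [Htau2 [HC2 Hap2]]]].
  destruct (asol_exists sm (complete_seq (V := E)) (k0 := kap0) ltac:(lra) Hk1 Hk12 ltac:(lra) HK
    Htau1 HC1 Htau2 HC2 Hap1 Hap2 HX (admissible_chen Hadm) psi Ha Hab Hb) as [y Hy].
  assert (Hs := asol_solution Ha Hb Hy).
  exists (solution_path (dom_S E) X y). split; [exact Hs|].
  intros q Hq. now apply (solution_agree Ha Hab Hb Hs).
Qed.

(** One choice function fixes a solution for every starting time and value. A restriction of a
    solution, or a linear combination of two, is again a solution, so uniqueness identifies it with
    the chosen one; this gives the cocycle property and linearity. *)
Lemma flow_exists : 0 < T -> exists Phi : R -> R -> E -> E,
  (forall s psi, 0 <= s <= T ->
     exists p : cpath E, is_unique_solution F X kap s T psi p /\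
       forall t, s <= t <= T -> Phi t s psi = cy p t) /\
  (forall t s, S2 0 T (t, s) -> is_linear (Phi t s)) /\
  (forall t u s psi, S3 0 T (t, u, s) -> Phi t u (Phi u s psi) = Phi t s psi).
Proof.
  intros HT.
  (* The condition on the starting time is a premise of the relation, so the choice is total;
     constant dummy paths fill in outside [0, T]. *)
  destruct (functional_choice (fun (x : R * E) (p : cpath E) =>
    0 <= fst x <= T -> is_unique_solution F X kap (fst x) T (snd x) p)) as [sol Hsol].
  { intros [s psi]. simpl. destruct (Rle_lt_dec 0 s) as [h1|h1].
    - destruct (Rle_lt_dec s T) as [h2|h2].
      + destruct (@unique_solution_exists s T psi h1 h2 (Rle_refl T)) as [p Hp]. now exists p.
      + exists (CPath (fun _ => psi) (fun _ => psi) (fun _ => psi) (fun _ _ => psi) (fun _ _ => psi)). lra.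
    - exists (CPath (fun _ => psi) (fun _ => psi) (fun _ => psi) (fun _ _ => psi) (fun _ _ => psi)). lra. }
  destruct apriori_exponent as [k1 [_ [Hk1 [Hk12 Hek1]]]].
  destruct (apriori_global sm T (k0 := kap0) ltac:(lra) Hk1 ltac:(lra) Hek1 HK)
    as [tau [C [Htau [HC Hap]]]].
  assert (Hch := admissible_chen Hadm).
  set (Phi := fun t s psi => cy (sol (s, psi)) t).
  assert (Ha : forall s psi, 0 <= s <= T ->
    asol j (dom_S E) e (kap0 + 3 * kap) X s T psi (fun t => Phi t s psi)).
  { intros s psi Hs. apply (solution_asol (proj1 Hs) (proj2 Hs) (Rle_refl T)).
    exact (proj1 (Hsol (s, psi) Hs)). }
  assert (HU : forall s psi y, 0 <= s <= T ->
    asol j (dom_S E) e (kap0 + 3 * kap) X s T psi y -> forall t, s <= t <= T -> Phi t s psi = y t).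
  { intros s psi y Hs Hy t Ht.
    exact (asol_unique sm Hk1 Hk12 Htau HC Hap HX Hch (proj1 Hs) (Rle_refl T) (Ha s psi Hs) Hy Ht). }
  exists Phi. split; [|split].
  - intros s psi Hs. exists (sol (s, psi)). split; [now apply (Hsol (s, psi))|easy].
  - intros t s H. assert (Hs : 0 <= s <= T) by (unfold S2 in H; simpl in H; lra).
    assert (Ht : s <= t <= T) by (unfold S2 in H; simpl in H; lra).
    assert (comb : forall al be v w, Phi t s (plus (scal al v) (scal be w))
      = plus (scal al (Phi t s v)) (scal be (Phi t s w))).
    { intros al be v w.
      exact (HU s _ _ Hs (asol_lin sm HX al be (proj1 Hs) (Rle_refl T) (Ha s v Hs) (Ha s w Hs)) t Ht). }
    split.
    + intros v w. transitivity (Phi t s (plus (scal 1 v) (scal 1 w))).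
      { f_equal. module_eq_in E. }
      etransitivity; [apply comb|]. module_eq_in E.
    + intros k v. transitivity (Phi t s (plus (scal k v) (scal 0 v))).
      { f_equal. module_eq_in E. }
      etransitivity; [apply comb|]. module_eq_in E.
    + exists C. split; [lra|]. intros v.
      exact (proj1 (asol_bound sm Hk1 Hk12 Htau HC Hap HX Hch (proj1 Hs) (Rle_refl T) (Ha s v Hs)) t Ht).
  - intros t u s psi H. assert (Hs : 0 <= s <= T) by (unfold S3 in H; simpl in H; lra).
    assert (Hu : 0 <= u <= T) by (unfold S3 in H; simpl in H; lra).
    assert (Hsu : s <= u) by (unfold S3 in H; simpl in H; lra).
    assert (Ht : u <= t <= T) by (unfold S3 in H; simpl in H; lra).
    exact (HU u _ _ Hu (asol_restrict Hsu (Ha s psi Hs)) t Ht).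
Qed.

Lemma rough_dist_close del (X' : rough E) : rough_dist_le F T gam kap0 X X' del ->
  rough_close j e T kap0 del X X'.
Proof.
  intros [H1 [H2 H3]] f t s v H.
  destruct (H1 t s H) as [a1 b1]. destruct (H2 t s H) as [a2 b2]. destruct (H3 t s H) as [a3 b3].
  destruct f; simpl.
  - split; [|split].
    + replace (e + kap0) with (gam + (1 - 1) * kap0) by (rewrite Hgam; ring).
      eapply Rle_trans; [right; exact (f_equal (@norm R_AbsRing F) (linear_minus _ _ _ (sm_j sm)))|exact (a1 v)].
    + replace (e + 2 * kap0) with (gam + (2 - 1) * kap0) by (rewrite Hgam; ring).
      eapply Rle_trans; [right; exact (f_equal (@norm R_AbsRing F) (linear_minus _ _ _ (sm_j sm)))|exact (a2 v)].
    + replace (e + 3 * kap0) with (gam + (3 - 1) * kap0) by (rewrite Hgam; ring).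
      eapply Rle_trans; [right; exact (f_equal (@norm R_AbsRing F) (linear_minus _ _ _ (sm_j sm)))|exact (a3 v)].
  - rewrite !Rplus_0_l. split; [|split].
    + replace kap0 with (1 * kap0) by ring. exact (b1 v).
    + exact (b2 v).
    + exact (b3 v).
Qed.

(** Data within distance 1 of X share the constant K + 1, which makes tau and C uniform on a
    neighbourhood of X. *)
Lemma rough_close_ok del (X' : rough E) : del <= 1 -> admissible F T gam kap0 X' ->
  rough_close j e T kap0 del X X' -> rough_bounds j e T kap0 (K + 1) X'.
Proof.
  intros Hdel Hadm' Hc.
  assert (step : forall f (x x' : E) r n, 0 <= r -> 0 <= n -> graded_norm j f x <= K * r * n ->
    graded_norm j f (minus x' x) <= del * r * n -> graded_norm j f x' <= (K + 1) * r * n).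
  { intros f x x' r n Hr Hn h1 h2.
    replace x' with (plus x (minus x' x)) by module_eq_in E.
    eapply Rle_trans; [apply (nrm_plus sm)|].
    assert (h3 : del * r * n <= 1 * r * n) by (apply Rmult_le_compat_r; [easy|now apply Rmult_le_compat_r]).
    rewrite !Rmult_plus_distr_r. now apply Rplus_le_compat; [|apply Rle_trans with (1 := h2)]. }
  split.
  - destruct Hadm' as [[_ [G1 _]] [[_ [G2 _]] [[_ [G3 _]] _]]]. intros t s H.
    split; [apply G1, H|]. split; [apply G2, H|apply G3, H].
  - intros f t s v H. apply (step f (X1 X t s v)); [apply rpow_nonneg|apply norm_ge_0| |].
    + now apply HX.
    + exact (proj1 (Hc f t s v H)).
  - intros f t s v H. apply (step f (X2 X t s v)); [apply rpow_nonneg|apply norm_ge_0| |].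
    + now apply HX.
    + exact (proj1 (proj2 (Hc f t s v H))).
  - intros f t s v H. apply (step f (X3 X t s v)); [apply rpow_nonneg|apply norm_ge_0| |].
    + now apply HX.
    + exact (proj2 (proj2 (Hc f t s v H))).
Qed.

End Equation.

(** * Continuity of the solution in the data *)

Lemma solution_continuous (B : CompleteNormedModule R_AbsRing) (S : R -> B -> B) (eta rho : R)
  (E : dom_space S eta) (F : cpl_space S (- rho)) (e CS CJ T gam kap0 kap : R)
  (sm : smoothing (emb F (E := E)) (dom_S E) e CS CJ)
  (Hgam : gam = kap0 + e) (Hkap : 0 < kap) (Hkap0 : kap < kap0)
  (Hek : 1 < e + (kap0 + 3 * kap)) (X : rough E) (HT : 0 < T) :
  admissible F T gam kap0 X ->
  forall (psi : E) (eps : posreal), exists del : posreal,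
     forall (psi' : E) (X' : rough E),
       admissible F T gam kap0 X' ->
       norm (minus psi' psi) <= del ->
       rough_dist_le F T gam kap0 X X' del ->
       forall p p' : cpath E,
         is_solution F X kap 0 T psi p ->
         is_solution F X' kap 0 T psi' p' ->
         C1_dist_le (dom_S E) 0 T kap (cy p) (cy p') eps.
Proof.
  intros Hadm psi eps.
  destruct (admissible_rough_ok Hgam Hadm) as [K0 [HK0 HX0]].
  (* A constant valid for X and for every X' within distance 1, chosen before tau and C. *)
  set (K := K0 + 1). assert (HK : 0 <= K) by (unfold K; lra).
  assert (HX : rough_bounds (emb F (E := E)) e T kap0 K X)
    by exact (rough_ok_le (K := K0) (K' := K) ltac:(unfold K; lra) HX0).
  destruct (apriori_exponent Hkap Hkap0 Hek) as [k1 [Hk1k [Hk1 [Hk12 Hek1]]]].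
  destruct (apriori_global sm T (k0 := kap0) ltac:(lra) Hk1 ltac:(lra) Hek1 HK)
    as [tau [C [Htau [HC Hap]]]].
  assert (HCS := sm_CS sm).
  assert (Hn := @norm_ge_0 R_AbsRing E psi).
  set (W := (12 * K + 3) * C * (norm psi + 1)).
  assert (HW : 0 <= W) by (unfold W; repeat apply Rmult_le_pos; lra).
  set (Q := C * (1 + W)). assert (HQ : 0 <= Q) by (apply Rmult_le_pos; lra).
  assert (Ht0 := rpow_pos tau kap (proj1 Htau)).
  (* Z dominates the coefficients of del in the three estimates to come: Q for the supremum norm, W
     + (3 K + 1) Q for increments up to tau, and (1 + CS) Q / tau^kap for longer ones, which are
     controlled by the supremum norm alone. W and Q use norm psi' <= norm psi + 1. *)
  set (Z := W + (3 * K + 1) * Q + (Q + (1 + CS) * Q / rpow tau kap) + 1).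
  assert (Z1 : 0 <= (3 * K + 1) * Q) by (apply Rmult_le_pos; lra).
  assert (Z2 : 0 <= (1 + CS) * Q / rpow tau kap).
  { apply Rdiv_le_0_compat; [apply Rmult_le_pos; lra|easy]. }
  assert (HZ : 0 < Z) by (unfold Z; lra).
  assert (Hdel : 0 < Rmin 1 (eps / Z)).
  { apply Rmin_pos; [lra|]. apply Rdiv_lt_0_compat; [apply cond_pos|easy]. }
  exists (mkposreal _ Hdel). simpl. set (del := Rmin 1 (eps / Z)) in *.
  assert (d1 : del <= 1) by apply Rmin_l. assert (d2 : del * Z <= eps).
  { apply Rle_trans with (eps / Z * Z); [|right; field; lra].
    apply Rmult_le_compat_r; [lra|apply Rmin_r]. }
  intros psi' X' Hadm' Hpsi Hdist p p' Hp Hp'.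
  assert (Hcl : rough_close (emb F (E := E)) e T kap0 del X X') by exact (rough_dist_close sm Hgam Hdist).
  assert (HX' : rough_bounds (emb F (E := E)) e T kap0 K X') by exact (rough_close_ok sm HX0 d1 Hadm' Hcl).
  assert (Hy := solution_asol sm Hkap Hkap0 Hek Hadm HK HX (Rle_refl 0) (Rlt_le _ _ HT) (Rle_refl T) Hp).
  assert (Hy' := solution_asol sm Hkap Hkap0 Hek Hadm' HK HX' (Rle_refl 0) (Rlt_le _ _ HT) (Rle_refl T) Hp').
  destruct (asol_stable sm (k0 := kap0) (D := del) (kap := kap) ltac:(lra) Hk1 Hk12 ltac:(lra) HK Htau HC Hap HX HX'
    (admissible_chen Hadm) (admissible_chen Hadm') (Rlt_le _ _ Hdel) Hcl (Rle_refl 0) (Rle_refl T) Hy Hy'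
    ltac:(lra) Hk1k) as [g1 g2].
  set (e1 := (12 * K + 3) * del * C * norm psi') in *.
  set (A := C * (norm (minus psi' psi) + e1)) in *.
  assert (Hpsi' : norm psi' <= norm psi + 1).
  { replace psi' with (plus psi (minus psi' psi)) by module_eq_in E.
    eapply Rle_trans; [apply (@norm_triangle R_AbsRing E)|]. apply Rplus_le_compat_l. lra. }
  assert (He1 : e1 <= del * W).
  { unfold e1, W. replace (del * ((12 * K + 3) * C * (norm psi + 1)))
      with ((12 * K + 3) * del * C * (norm psi + 1)) by ring.
    apply Rmult_le_compat_l; [|easy]. repeat apply Rmult_le_pos; lra. }
  assert (HA : A <= del * Q).
  { unfold A, Q. replace (del * (C * (1 + W))) with (C * (del + del * W)) by ring.
    apply Rmult_le_compat_l; [lra|]. now apply Rplus_le_compat. }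
  assert (HdZ : forall z, z <= Z -> del * z <= eps).
  { intros z Hz. apply Rle_trans with (2 := d2). apply Rmult_le_compat_l; lra. }
  split.
  - intros t Ht. apply Rle_trans with (1 := g1 t Ht). apply Rle_trans with (1 := HA).
    apply HdZ. unfold Z. lra.
  - intros t s [[h1 h2] h3]. simpl in h1, h2, h3.
    destruct (Rle_lt_dec (t - s) tau) as [h|h].
    + apply Rle_trans with (1 := g2 t s h1 h2 h3 h). apply Rmult_le_compat_r; [apply rpow_nonneg|].
      apply Rle_trans with (del * (W + (3 * K + 1) * Q)); [|apply HdZ; unfold Z; lra].
      replace (del * (W + (3 * K + 1) * Q)) with (del * W + (3 * K + 1) * (del * Q)) by ring.
      apply Rplus_le_compat; [exact He1|]. apply Rmult_le_compat_l; [lra|exact HA].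
    + assert (b1 : norm (minus (cy p' t) (cy p t)) <= del * Q).
      { apply Rle_trans with (2 := HA). apply g1. lra. }
      assert (b2 : norm (dom_S E (t - s) (minus (cy p' s) (cy p s))) <= CS * (del * Q)).
      { apply Rle_trans with (1 := sm_bd sm false (t := t - s) (minus (cy p' s) (cy p s)) ltac:(lra)).
        apply Rmult_le_compat_l; [lra|]. apply Rle_trans with (2 := HA). apply g1. lra. }
      apply Rle_trans with (del * ((1 + CS) * Q / rpow tau kap) * rpow (t - s) kap).
      * apply Rle_trans with (del * ((1 + CS) * Q / rpow tau kap) * rpow tau kap).
        { apply Rle_trans with (del * Q + CS * (del * Q)); [|right; field; lra].
          eapply Rle_trans; [|exact (Rplus_le_compat _ _ _ _ b1 b2)].
          eapply Rle_trans; [|apply (@norm_minus_le E)]. right. f_equal.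
          transitivity (minus (minus (cy p' t) (cy p t))
            (minus (dom_S E (t - s) (cy p' s)) (dom_S E (t - s) (cy p s)))).
          - unfold hdelta1. module_eq_in E.
          - f_equal. symmetry. apply (linear_minus _ _ _ (sm_lin sm (t := t - s) ltac:(lra))). }
        apply Rmult_le_compat_l; [apply Rmult_le_pos; lra|]. apply rpow_le; lra.
      * apply Rmult_le_compat_r; [apply rpow_nonneg|]. apply HdZ. unfold Z. lra.
Qed.

Unset Implicit Arguments.
Set Strict Implicit.

Theorem theorem5p6
  (T : R) (hT : 0 < T)
  (B : CompleteNormedModule R_AbsRing) (hB : separable B)
  (A : B -> B -> Prop) (S : R -> B -> B)
  (hS : analytic_semigroup S) (hA : generates A S)
  (M lam : R) (hM : 0 < M) (hlam : 0 < lam)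
  (hdecay : forall t, 0 <= t -> op_le (S t) (M * exp (- lam * t)))
  (eta rho gam kap0 kap : R)
  (heta : 0 <= eta) (hrho : 0 <= rho)
  (hgam : gam = kap0 + eta + rho) (hgam0 : gam + 3 * kap0 > 1)
  (hkap : 0 < kap < Rmin kap0 eta) (hgamkap : gam + 3 * kap > 1)
  (E : dom_space S eta) (F : cpl_space S (- rho))
  (X : rough E) (hX : admissible F T gam kap0 X) :
  (forall psi : E, exists p : cpath E, is_unique_solution F X kap 0 T psi p)
  /\
  (forall (psi : E) (eps : posreal), exists del : posreal,
     forall (psi' : E) (X' : rough E),
       admissible F T gam kap0 X' ->
       norm (minus psi' psi) <= del ->
       rough_dist_le F T gam kap0 X X' del ->
       forall p p' : cpath E,
         is_solution F X kap 0 T psi p ->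
         is_solution F X' kap 0 T psi' p' ->
         C1_dist_le (dom_S E) 0 T kap (cy p) (cy p') eps)
  /\
  (exists Phi : R -> R -> E -> E,
     (forall s psi, 0 <= s <= T ->
        exists p : cpath E, is_unique_solution F X kap s T psi p /\
          forall t, s <= t <= T -> Phi t s psi = cy p t) /\
     (forall t s, S2 0 T (t, s) -> is_linear (Phi t s)) /\
     (forall t u s psi, S3 0 T (t, u, s) ->
        Phi t u (Phi u s psi) = Phi t s psi)).

Proof.
  assert (hC0 : C0_semigroup S) by apply hS.
  destruct (semigroup_derivative_exists hC0 hM hlam hdecay (analytic_derivative_near_0 hS)) as [D [CD HD]].
  assert (m1 := Rmin_l kap0 eta). assert (m2 := Rmin_r kap0 eta).
  (* eta is positive because 0 < kap < eta; the integral formula for A_o^{-eta} is therefore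
     available. *)
  assert (heta' : 0 < eta) by lra.
  destruct (dom_cpl_smoothing hC0 hM hlam hdecay HD heta' hrho E F) as [CS [CJ sm]].
  assert (Hgam : gam = kap0 + (eta + rho)) by lra.
  assert (hk0 : 0 < kap) by lra. assert (hk1 : kap < kap0) by lra.
  assert (Hek : 1 < eta + rho + (kap0 + 3 * kap)) by lra.
  assert (HSF := cpl_S_emb F (E := E)).
  destruct (admissible_rough_ok Hgam hX) as [K [HK HX]].
  split; [|split].
  - intros psi. exact (unique_solution_exists sm HSF hk0 hk1 Hek hX HK HX psi
      (Rle_refl 0) (Rlt_le _ _ hT) (Rle_refl T)).
  - exact (solution_continuous sm Hgam hk0 hk1 Hek hT hX).
  - exact (flow_exists sm HSF hk0 hk1 Hek hX HK HX hT).
Qed.
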